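(* Suppose assumptions (H1)-(H3) listed in the context hold. Let $u^*=\{u_k^*:k=0,\ldots,N-1\}\in\mathcal{U}$ be optimal and $\{X_k^*:k=0,\ldots,N\}$ be the corresponding state process. Then there exists a $P^*\in\mathcal{P}^*$ such that $$H_u(k,X_k^*,u_k^*,P_k,Q_k)(u-u_k^* )\ge0,\quad P^*\text{-a.s.},\quad\forall u\in U_k,\ k=0,\ldots,N-1,$$ where $\{(P_k,Q_k):k=0,\ldots,N-1\}$ is the solution of the adjoint equation under $P^*$ (given in the context).
   Context: Noise. Let $\Omega$ be a sample space, $N$ a positive integer, $W_k=(W_k^1,\ldots,W_k^d)^T:\Omega\to\mathbb{R}^d$, $k=1,\ldots,N$, given functions, $W=(W_1,\ldots,W_N)$, $\mathcal{F}_k=\sigma\{W_1,\ldots,W_k\}$, $\mathcal{F}_0=\{\emptyset,\Omega\}$. $C_{b,Lip}$ denotes bounded Lipschitz functions and $Lip(\mathcal{F}_k)=\{\phi(W_1,\ldots,W_k):\phi\in C_{b,Lip}(\mathbb{R}^{d\times k})\}$. Let $\{F_\theta:\theta\in\Theta\}$ be a family of probability measures on $\mathbb{R}^d$. Define $\hat{\mathbb{E}}[\varphi(W_k)]=\sup_{\theta\in\Theta}\int\varphi\,dF_\theta$ for $\varphi\in C_{b,Lip}(\mathbb{R}^d)$, and for $\phi\in C_{b,Lip}(\mathbb{R}^{d\times N})$ set $\phi_N=\phi$, $\phi_k(x_1,\ldots,x_k)=\hat{\mathbb{E}}[\phi_{k+1}(x_1,\ldots,x_k,W_{k+1})]$ for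 $k=N-1,\ldots,1$, and $\hat{\mathbb{E}}[\phi(W_1,\ldots,W_N)]=\hat{\mathbb{E}}[\phi_1(W_1)]$. Standing assumptions: (A1) $W(\Omega)=A_1\times\cdots\times A_N$ with $A_k=W_k(\Omega)$ and $F_\theta(\bar A_k)=1$ for all $\theta,k$ ($\bar A_k$ the closure of $A_k$); (A2) $\sup_\theta\int|x|F_\theta(dx)<\infty$; (A3) for each $Q\in\mathcal{A}$ there is a probability measure $P$ on $(\Omega,\mathcal{F}_N)$ with $Q=P\circ W^{-1}$, where $\mathcal{A}$ is the set of probability measures $Q$ on $\mathbb{R}^{d\times N}$ with $E_Q[\phi]\le\hat{\mathbb{E}}[\phi(W)]$ for all $\phi\in C_{b,Lip}(\mathbb{R}^{d\times N})$. Let $\mathcal{P}$ be the set of probability measures $P$ on $(\Omega,\mathcal{F}_N)$ with $E_P[\phi(W)]\le\hat{\mathbb{E}}[\phi(W)]$ for all $\phi\in C_{b,Lip}(\mathbb{R}^{d\times N})$. A set $B\in\mathcal{F}_N$ is polar if $\sup_{P\in\mathcal{P}}P(B)=0$; random variables equal outside a polar set are identified. $\hat{\mathbb{E}}$ is extended by $\hat{\mathbb{E}}[X]=\sup_{P\in\mathcal{P}}E_P[X]$ to all $\mathcal{F}_N$-measurable $X$ with $\sup_{P\in\mathcal{P}}E_P[|X|]<\infty$. $L_c^p(\mathcal{F}_k)$ is the completion of $Lip(\mathcal{F}_k)$ under $\|X\|_p=(\hat{\mathbb{E}}[|X|^p])^{1/p}$ (a closed subspace of the $\mathcal{F}_k$-measurable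 $X$ with $\hat{\mathbb{E}}[|X|^p]<\infty$), and $L_c^p(\mathcal{F}_0)=\mathbb{R}$. For vector-valued $Z$, ''$|Z|\in L_c^2(\mathcal{F}_k)$'' means that all components of $Z$ lie in $L_c^2(\mathcal{F}_k)$. Standing assumption: $|W_k|\in L_c^2(\mathcal{F}_k)$ for $k=1,\ldots,N$. Control problem. $U_k\subset\mathbb{R}^m$, $k=0,\ldots,N-1$, are nonempty convex sets; $\mathcal{U}$ is the set of admissible controls $u=\{u_k\}_{k=0}^{N-1}$ with $u_k:\Omega\to U_k$ and $|u_k|\in L_c^2(\mathcal{F}_k)$. The coefficients are $b(k,\cdot),\sigma^l(k,\cdot):\mathbb{R}^n\times U_k\times\Omega\to\mathbb{R}^n$, $f(k,\cdot):\mathbb{R}^n\times U_k\times\Omega\to\mathbb{R}$, $\varphi:\mathbb{R}^n\times\Omega\to\mathbb{R}$ ($l=1,\ldots,d$, $k=0,\ldots,N-1$), with $b,\sigma^l,f$ differentiable in $(x,u)$ and $\varphi$ differentiable in $x$; the argument $\omega$ is suppressed. The state process of $u\in\mathcal{U}$ is the solution of $X_{k+1}=b(k,X_k,u_k)+\sum_{l=1}^d\sigma^l(k,X_k,u_k)W_{k+1}^l$, $X_0=x_0\in\mathbb{R}^n$, $k=0,\ldots,N-1$, and the cost is $J(u)=\hat{\mathbb{E}}[\sum_{k=0}^{N-1}f(k,X_k,u_k)+\varphi(X_N)]$. A control $u^*\in\mathcal{U}$ is optimal if it minimizes $J$ over $\mathcal{U}$. (H1) $|b(k,x,u)|,|\sigma^l(k,x,u)|\in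 L_c^2(\mathcal{F}_k)$, $f(k,x,u)\in L_c^1(\mathcal{F}_k)$, $\varphi(x)\in L_c^1(\mathcal{F}_N)$ for all $x\in\mathbb{R}^n$, $u\in U_k$, $l$, $k$. (H2) There is $L>0$ with $|b_x(k,x,u)|+|b_u(k,x,u)|+|\sigma^l_x(k,x,u)|+|\sigma^l_u(k,x,u)|\le L$ and $|f_x(k,x,u)|+|f_u(k,x,u)|+|\varphi_x(x)|\le L(1+|x|+|u|)$ for all $x\in\mathbb{R}^n$, $u\in U_k$, $l$, $k$. (H3) For each $\alpha>0$ there is a modulus of continuity $\omega_\alpha:[0,\infty)\to[0,\infty)$ (nondecreasing, $\omega_\alpha(r)\to\omega_\alpha(0)=0$ as $r\downarrow0$) such that for all $x,x'\in\mathbb{R}^n$ with $|x|,|x'|\le\alpha$ and $u,u'\in U_k$ with $|u|,|u'|\le\alpha$, $|\phi(k,x,u)-\phi(k,x',u')|+|\varphi_x(x)-\varphi_x(x')|\le\omega_\alpha(|x-x'|+|u-u'|)$, where $\phi(k,\cdot,\cdot)$ is the derivative in $(x,u)$ of any of $b(k,\cdot,\cdot)$, $\sigma^l(k,\cdot,\cdot)$, $f(k,\cdot,\cdot)$. Notation. $b_x$ is the Jacobian matrix $(\partial b_i/\partial x_j)$, similarly $b_u,\sigma_x^l,\sigma_u^l$; $f_x,f_u,\varphi_x$ are row vectors. Write $b_x(k)=b_x(k,X_k^*,u_k^* )$ and similarly $\sigma_x^l(k),f_x(k)$. $\mathcal{P}^*=\{P\in\mathcal{P}:E_P[\sum_{k=0}^{N-1}f(k,X_k^*,u_k^*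 )+\varphi(X_N^* )]=\hat{\mathbb{E}}[\sum_{k=0}^{N-1}f(k,X_k^*,u_k^* )+\varphi(X_N^* )]\}$. Adjoint equation under $P^*$, with unknowns $P_k:\Omega\to\mathbb{R}^n$ and $Q_k=[Q_k^1,\ldots,Q_k^d]:\Omega\to\mathbb{R}^{n\times d}$ (equalities $P^*$-a.s.): $$P_{N-1}=E_{P^*}[\varphi_x^T(X_N^* )|\mathcal{F}_{N-1}],\qquad Q_{N-1}=E_{P^*}[\varphi_x^T(X_N^* )W_N^T|\mathcal{F}_{N-1}],$$ and for $k=N-2,\ldots,0$, $$P_k=E_{P^*}\Big[b_x^T(k+1)P_{k+1}+\sum_{l=1}^d(\sigma_x^l(k+1))^TQ_{k+1}^l+f_x^T(k+1)\Big|\mathcal{F}_k\Big],$$ $$Q_k=E_{P^*}\Big[\Big(b_x^T(k+1)P_{k+1}+\sum_{l=1}^d(\sigma_x^l(k+1))^TQ_{k+1}^l+f_x^T(k+1)\Big)W_{k+1}^T\Big|\mathcal{F}_k\Big].$$ Hamiltonian. For $k=0,\ldots,N-1$, $x\in\mathbb{R}^n$, $u\in U_k$, $p\in\mathbb{R}^n$, $q=[q^1,\ldots,q^d]\in\mathbb{R}^{n\times d}$: $H(k,x,u,p,q)=p^Tb(k,x,u)+\sum_{l=1}^d(q^l)^T\sigma^l(k,x,u)+f(k,x,u)$, so that $H_u(k,x,u,p,q)=p^Tb_u(k,x,u)+\sum_{l=1}^d(q^l)^T\sigma_u^l(k,x,u)+f_u(k,x,u)$ (a row vector). *)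

(* Defs.v *)
From HB Require Import structures.
From mathcomp Require Import all_boot all_order all_algebra.
From mathcomp Require Import all_classical all_reals all_analysis.

Set Implicit Arguments.
Unset Strict Implicit.
Unset Printing Implicit Defensive.

Import Order.TTheory GRing.Theory Num.Theory.
Import numFieldNormedType.Exports.

Local Open Scope classical_set_scope.
Local Open Scope ring_scope.

(* Euclidean (Frobenius) norm; the library norm on matrices is the sup norm. *)
Definition enorm (R : realType) (p q : nat) (A : 'M[R]_(p, q)) : R :=
  Num.sqrt (\sum_i \sum_j A i j ^+ 2).

Definition borel (T : ptopologicalType) := g_sigma_algebraType (@open T).

Definition bLip (R : realType) (p q : nat) (g : 'M[R]_(p, q) -> R) : Prop :=
  (exists C : R, forall x, `|g x| <= C) /\
  (exists C : R, forall x y, `|g x - g y| <= C * enorm (x - y)).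

(* (x_1, ..., x_k), y |-> (x_1, ..., x_k, y) *)
Definition rcons_mx (R : realType) (d k : nat)
    (x : 'M[R]_(d, k)) (y : 'cV[R]_d) : 'M[R]_(d, k.+1) :=
  \matrix_(i, j) (if unlift ord_max j is Some j' then x i j' else y i 0).

Section noise.
Context {R : realType} {d : nat}.
Context {Theta : Type} (F : Theta -> probability (borel 'cV[R]_d) R).

Definition sup_int (psi : 'cV[R]_d -> R) : R :=
  sup [set \int[F theta]_y psi y | theta in [set: Theta]].

(* sublin k phi is the sublinear expectation of phi (W_1, ..., W_k): the step
   from k.+1 to k is phi_k (x_1, ..., x_k) := E[phi_{k+1} (x_1, ..., x_k, .)],
   and the unique point of R^(d x 0) ends the recursion. *)
Fixpoint sublin (k : nat) : ('M[R]_(d, k) -> R) -> R :=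
  if k is k'.+1 then
    fun phi => sublin (fun x : 'M[R]_(d, k') => sup_int (phi \o rcons_mx x))
  else fun phi => phi 0.

(* W k is W_k for 1 <= k <= N; the other values of W are never used. *)
Context {Omega : pointedType} (W : nat -> Omega -> 'cV[R]_d).

Definition Wmat (k : nat) (w : Omega) : 'M[R]_(d, k) :=
  \matrix_(i, j) W j.+1 w i 0.

(* The measurable space (Omega, F_k), F_k = sigma (W_1, ..., W_k). *)
Definition Fspace (k : nat) := g_sigma_algebraType
  (\big[setU/set0]_(j < k) preimage_set_system setT
     (W j.+1 : Omega -> borel 'cV[R]_d) measurable).

Definition LipF (k : nat) : set (Omega -> R) :=
  [set g \o Wmat k | g in @bLip R d k].

Variable N : nat.

Definition calA : set (probability (borel 'M[R]_(d, N)) R) :=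
  fun Q => forall g : 'M[R]_(d, N) -> R, bLip g -> \int[Q]_x g x <= sublin g.

Definition calP : set (probability (Fspace N) R) :=
  fun P => forall g : 'M[R]_(d, N) -> R, bLip g ->
    \int[P]_w g (Wmat N w) <= sublin g.

Definition polar (B : set (Fspace N)) : Prop :=
  measurable B /\ ereal_sup [set P B | P in calP] = 0%E.

Definition qs_eq (X Y : Omega -> R) : Prop :=
  exists2 B, polar B & forall w, ~ B w -> X w = Y w.

Definition Ehat (X : Omega -> R) : \bar R :=
  ereal_sup [set (\int[P]_w (X w)%:E)%E | P in calP].

Definition cnorm (p : nat) (X : Omega -> R) : \bar R :=
  (Ehat (fun w => `|X w| ^+ p)%R `^ p%:R^-1)%E.

(* L_c^p(F_k): closure of Lip(F_k) in the F_k-measurable X with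
   Ehat |X|^p < oo, random variables (i.e. F_N-measurable functions) being
   identified when they agree outside a polar set.  For k = 0 these are the
   random variables that are constant outside a polar set. *)
Definition Lc (p k : nat) : set (Omega -> R) :=
  [set X | measurable_fun setT (X : Fspace N -> R) /\
    exists X', [/\ qs_eq X X',
      measurable_fun setT (X' : Fspace k -> R),
      (Ehat (fun w => `|X' w| ^+ p)%R < +oo)%E &
      forall e : R, 0 < e ->
        exists2 Y, LipF k Y & (cnorm p (fun w => X' w - Y w)%R < e%:E)%E]].

Definition mxLc (p k : nat) (a c : nat) : set (Omega -> 'M[R]_(a, c)) :=
  [set Z | forall i j, Lc p k (fun w => Z w i j)].

(* Y is a version of the conditional expectation of X given F_k under P. *)
Definition cond_exp (P : probability (Fspace N) R) (k : nat)
    (X Y : Omega -> R) : Prop :=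
  [/\ P.-integrable setT (EFin \o X),
      measurable_fun setT (Y : Fspace k -> R),
      P.-integrable setT (EFin \o Y) &
      forall A : set Omega, measurable (A : set (Fspace k)) ->
        \int[P]_(w in A) X w = \int[P]_(w in A) Y w].

Definition mxcond_exp (P : probability (Fspace N) R) (k : nat) (a c : nat)
    (X Y : Omega -> 'M[R]_(a, c)) : Prop :=
  forall i j, cond_exp P k (fun w => X w i j) (fun w => Y w i j).

End noise.

(* J is a derivative at z of g restricted to A.  As U_k need not be open,
   differentiability in (x, u) is relative to the domain R^n x U_k. *)
Definition is_derivative_within (R : realType) (p q : nat) (A : set 'cV[R]_q)
    (g : 'cV[R]_q -> 'cV[R]_p) (z : 'cV[R]_q) (J : 'M[R]_(p, q)) : Prop :=
  forall e : R, 0 < e -> exists2 r : R, 0 < r &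
    forall z', A z' -> enorm (z' - z) < r ->
      enorm (g z' - g z - J *m (z' - z)) <= e * enorm (z' - z).

Definition modulus (R : realType) (rho : R -> R) : Prop :=
  [/\ forall r, 0 <= r -> 0 <= rho r,
      forall r s, 0 <= r -> r <= s -> rho r <= rho s,
      rho 0 = 0 & rho @ 0^'+ --> 0].

Record coefficients (R : realType) (Omega : Type) (n m d : nat) := Coefficients {
  c_b : nat -> 'cV[R]_n -> 'cV[R]_m -> Omega -> 'cV[R]_n;
  c_sigma : 'I_d -> nat -> 'cV[R]_n -> 'cV[R]_m -> Omega -> 'cV[R]_n;
  c_f : nat -> 'cV[R]_n -> 'cV[R]_m -> Omega -> R;
  c_phi : 'cV[R]_n -> Omega -> R }.

(* Jacobians in (x, u): the first n columns are the x-derivative, the last m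
   columns the u-derivative. *)
Record derivatives (R : realType) (Omega : Type) (n m d : nat) := Derivatives {
  Db : nat -> 'cV[R]_n -> 'cV[R]_m -> Omega -> 'M[R]_(n, n + m);
  Dsigma : 'I_d -> nat -> 'cV[R]_n -> 'cV[R]_m -> Omega -> 'M[R]_(n, n + m);
  Df : nat -> 'cV[R]_n -> 'cV[R]_m -> Omega -> 'rV[R]_(n + m);
  phi_x : 'cV[R]_n -> Omega -> 'rV[R]_n }.

Section control.
Context {R : realType} {Omega : pointedType} {n m d : nat}.

Section partials.
Variable D : derivatives R Omega n m d.
Definition b_x k x u w := lsubmx (Db D k x u w).
Definition b_u k x u w := rsubmx (Db D k x u w).
Definition sigma_x l k x u w := lsubmx (Dsigma D l k x u w).
Definition sigma_u l k x u w := rsubmx (Dsigma D l k x u w).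
Definition f_x k x u w := lsubmx (Df D k x u w).
Definition f_u k x u w := rsubmx (Df D k x u w).

(* The derivative in u of the Hamiltonian
   H(k, x, u, p, q) = p^T b(k, x, u) + \sum_l (q^l)^T sigma^l(k, x, u)
                      + f(k, x, u). *)
Definition H_u (k : nat) (x : 'cV[R]_n) (u : 'cV[R]_m) (p : 'cV[R]_n)
    (q : 'M[R]_(n, d)) (w : Omega) : 'rV[R]_m :=
  p^T *m b_u k x u w + \sum_l (col l q)^T *m sigma_u l k x u w + f_u k x u w.
End partials.

Context {Theta : Type} (F : Theta -> probability (borel 'cV[R]_d) R).
Context (W : nat -> Omega -> 'cV[R]_d) (N : nat).
Context (U : nat -> set 'cV[R]_m).
Context (c : coefficients R Omega n m d) (D : derivatives R Omega n m d).

Definition differentiable_coefficients : Prop :=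
  (forall k, (k < N)%N -> forall w x u, U k u ->
    let A : set 'cV[R]_(n + m) := [set z | U k (dsubmx z)] in
    let on_pairs T (h : 'cV[R]_n -> 'cV[R]_m -> Omega -> T) z :=
      h (usubmx z) (dsubmx z) w in
    [/\ is_derivative_within A (on_pairs _ (c_b c k)) (col_mx x u)
          (Db D k x u w),
        forall l, is_derivative_within A (on_pairs _ (c_sigma c l k))
          (col_mx x u) (Dsigma D l k x u w) &
        is_derivative_within A (fun z => (on_pairs _ (c_f c k) z)%:M)
          (col_mx x u) (Df D k x u w)]) /\
  (forall w x, is_derivative_within setT (fun x' => (c_phi c x' w)%:M) x
    (phi_x D x w)).

Definition H1 : Prop :=
  (forall k, (k < N)%N -> forall x u, U k u ->
    [/\ mxLc F W N 2 k (c_b c k x u),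
        forall l, mxLc F W N 2 k (c_sigma c l k x u) &
        Lc F W N 1 k (c_f c k x u)]) /\
  (forall x, Lc F W N 1 N (c_phi c x)).

Definition H2 : Prop :=
  exists2 L : R, 0 < L & forall k, (k < N)%N -> forall w x u, U k u ->
    (forall l, enorm (b_x D k x u w) + enorm (b_u D k x u w) +
       enorm (sigma_x D l k x u w) + enorm (sigma_u D l k x u w) <= L) /\
    enorm (f_x D k x u w) + enorm (f_u D k x u w) + enorm (phi_x D x w)
      <= L * (1 + enorm x + enorm u).

Definition H3 : Prop :=
  forall alpha : R, 0 < alpha -> exists2 rho : R -> R, modulus rho &
    forall k, (k < N)%N -> forall w x x' u u', U k u -> U k u' ->
      enorm x <= alpha -> enorm x' <= alpha ->
      enorm u <= alpha -> enorm u' <= alpha ->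
      let dphi := enorm (phi_x D x w - phi_x D x' w) in
      let bound := rho (enorm (x - x') + enorm (u - u')) in
      [/\ enorm (Db D k x u w - Db D k x' u' w) + dphi <= bound,
          forall l, enorm (Dsigma D l k x u w - Dsigma D l k x' u' w) + dphi
            <= bound &
          enorm (Df D k x u w - Df D k x' u' w) + dphi <= bound].

Definition admissible (u : nat -> Omega -> 'cV[R]_m) : Prop :=
  forall k, (k < N)%N -> (forall w, U k (u k w)) /\ mxLc F W N 2 k (u k).

Context (x0 : 'cV[R]_n).

Fixpoint state (u : nat -> Omega -> 'cV[R]_m) (k : nat) (w : Omega) : 'cV[R]_n :=
  if k is j.+1 then
    c_b c j (state u j w) (u j w) w +
    \sum_l W j.+1 w l 0 *: c_sigma c l j (state u j w) (u j w) w
  else x0.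

Definition total_cost (u : nat -> Omega -> 'cV[R]_m) (w : Omega) : R :=
  \sum_(k < N) c_f c k (state u k w) (u k w) w + c_phi c (state u N w) w.

Definition cost (u : nat -> Omega -> 'cV[R]_m) : \bar R :=
  Ehat F W N (total_cost u).

Definition optimal (u : nat -> Omega -> 'cV[R]_m) : Prop :=
  admissible u /\ forall v, admissible v -> (cost u <= cost v)%E.

Definition calPstar (u : nat -> Omega -> 'cV[R]_m) :
    set (probability (Fspace W N) R) :=
  fun P => calP F P /\ (\int[P]_w (total_cost u w)%:E)%E = cost u.

(* (p, q) solves the adjoint equation along the control u under P. *)
Definition adjoint_solution (u : nat -> Omega -> 'cV[R]_m)
    (P : probability (Fspace W N) R)
    (p : nat -> Omega -> 'cV[R]_n) (q : nat -> Omega -> 'M[R]_(n, d)) : Prop :=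
  let X := state u in
  let terminal w := (phi_x D (X N w) w)^T in
  let driver k w :=
    (b_x D k (X k w) (u k w) w)^T *m p k w +
    \sum_l (sigma_x D l k (X k w) (u k w) w)^T *m col l (q k w) +
    (f_x D k (X k w) (u k w) w)^T in
  [/\ mxcond_exp P N.-1 terminal (p N.-1),
      mxcond_exp P N.-1 (fun w => terminal w *m (W N w)^T) (q N.-1) &
      forall k, (k.+1 < N)%N ->
        mxcond_exp P k (driver k.+1) (p k) /\
        mxcond_exp P k (fun w => driver k.+1 w *m (W k.+1 w)^T) (q k)].

End control.

(* Main.v *)
Require Import Defs.
From HB Require Import structures.
From mathcomp Require Import all_boot all_order all_algebra.
From mathcomp Require Import all_classical all_reals all_analysis.
From mathcomp Require Import measurable_realfun ring lra.
Set Implicit Arguments.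
Unset Strict Implicit.
Unset Printing Implicit Defensive.
Import Order.TTheory GRing.Theory Num.Theory.
Import numFieldNormedType.Exports.
Local Open Scope classical_set_scope.
Local Open Scope ring_scope.

(* Let Z be the cost of the optimal control u, and p(X) the supremum of E_P[X]
   over P in calP.  Along directions xi = psi(W) - phi(W) u with u + xi in U,
   the difference quotients of the cost converge to some Y_xi, linear in xi, in
   L^1 uniformly over P in calP.  Optimality makes p nonnegative on the convex
   cone generated by Z - p(Z) and all the Y_xi, so the Mazur-Orlicz form of the
   Hahn-Banach theorem yields one linear l <= p with l(Z) = p(Z) and
   l(Y_xi) >= 0 for all xi: a minimax theorem without compactness.  As W is
   uniformly tight, l is continuous along decreasing sequences of bounded
   Lipschitz functions of W, hence is represented by a measure (Daniell), which
   (A3) lifts to some P* in calP; l and E_P* agree on the closure of the bounded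
   Lipschitz functions of W, which contains the costs.

   Under P* the adjoint processes turn E[Y_xi] into the sum of the E[H_u xi_k].
   Taking xi_k = h(W_1, ..., W_k) (v - u_k) with an arbitrary bounded Lipschitz
   h in [0, 1], and xi_j = 0 for the other j, gives H_u (v - u_k) >= 0 a.s. *)

(** * Bounded Lipschitz functions on matrices *)

(** Two obstacles shape the proof. First, no regularity in omega is assumed of the Jacobians, and
    since the sets U_k need not be open, the coefficients need not determine them. Only their
    products with admissible directions are under control: these are limits of difference quotients,
    and the deterministic modulus in (H3) makes the limits uniform over calP. Measurability and
    quasi-continuity are therefore proved for a Jacobian applied to a direction, never for H_u
    alone. Second, a product of two square-integrable variables is merely integrable, whereas the
    state equation multiplies by W_{k+1} at each step. What preserves square integrability is a
    bound, uniform over calP, on the second moment of W_{k+1} given F_k. It comes from the order of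
    integration in the sublinear expectation, and it also bounds the adjoint process Q. As f and phi
    may grow quadratically, the costs are only uniformly integrable. The expansion of the cost is
    therefore made on the set where all processes involved are bounded by a constant, and the rest
    is handled by a uniformly integrable majorant. *)

Section l1_norm.
Context {R : realType}.
Implicit Types p q : nat.

(** The entrywise l^1 norm replaces [enorm] in all estimates: it is additive over blocks,
    submultiplicative, and bounded by summing bounds on entries. *)
Definition n1 p q (A : 'M[R]_(p, q)) : R := \sum_i \sum_j `|A i j|.

Lemma n1_ge0 p q (A : 'M[R]_(p, q)) : 0 <= n1 A.
Proof. by apply: sumr_ge0 => i _; apply: sumr_ge0. Qed.

Lemma le_n1D p q (A B : 'M[R]_(p, q)) : n1 (A + B) <= n1 A + n1 B.
Proof.
rewrite /n1 -big_split/=; apply: ler_sum => i _.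
rewrite -big_split/=; apply: ler_sum => j _.
by rewrite mxE ler_normD.
Qed.

Lemma le_n1_tri p q (B A C : 'M[R]_(p, q)) : n1 (A - C) <= n1 (A - B) + n1 (B - C).
Proof. by have := le_n1D (A - B) (B - C); rewrite addrA subrK. Qed.

Lemma n1N p q (A : 'M[R]_(p, q)) : n1 (- A) = n1 A.
Proof.
by apply: eq_bigr => i _; apply: eq_bigr => j _; rewrite mxE normrN.
Qed.

Lemma n1Z p q (a : R) (A : 'M[R]_(p, q)) : n1 (a *: A) = `|a| * n1 A.
Proof.
rewrite /n1 mulr_sumr; apply: eq_bigr => i _; rewrite mulr_sumr.
by apply: eq_bigr => j _; rewrite mxE normrM.
Qed.

Lemma n1C p q (A B : 'M[R]_(p, q)) : n1 (A - B) = n1 (B - A).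
Proof. by rewrite -n1N opprB. Qed.

Lemma n1_0 p q : n1 (0 : 'M[R]_(p, q)) = 0.
Proof. by rewrite /n1 big1// => i _; rewrite big1// => j _; rewrite mxE normr0. Qed.

Lemma le_entry_n1 p q (A : 'M[R]_(p, q)) i j : `|A i j| <= n1 A.
Proof.
rewrite /n1 (bigD1 i)//= (bigD1 j)//= -addrA lerDl addr_ge0//.
  by apply: sumr_ge0.
by apply: sumr_ge0 => k _; apply: sumr_ge0.
Qed.

Lemma le_entry_enorm p q (A : 'M[R]_(p, q)) i j : `|A i j| <= enorm A.
Proof.
rewrite /enorm -sqrtr_sqr ler_wsqrtr//.
rewrite (bigD1 i)//= (bigD1 j)//= -addrA lerDl addr_ge0//.
  by apply: sumr_ge0 => k _; exact: sqr_ge0.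
by apply: sumr_ge0 => k _; apply: sumr_ge0 => l _; exact: sqr_ge0.
Qed.

Lemma enorm_ge0 p q (A : 'M[R]_(p, q)) : 0 <= enorm A.
Proof. exact: sqrtr_ge0. Qed.

Lemma sum_sqr_le (I : finType) (a : I -> R) : (forall i, 0 <= a i) ->
  \sum_i a i ^+ 2 <= (\sum_i a i) ^+ 2.
Proof.
move=> a0; rewrite expr2 mulr_suml; apply: ler_sum => i _.
rewrite expr2 ler_wpM2l// (bigD1 i)//= lerDl; exact: sumr_ge0.
Qed.

Lemma enorm_le_n1 p q (A : 'M[R]_(p, q)) : enorm A <= n1 A.
Proof.
rewrite -(ger0_norm (n1_ge0 A)) -sqrtr_sqr ler_wsqrtr//.
apply: le_trans (sum_sqr_le _); last by move=> i; exact: sumr_ge0.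
apply: ler_sum => i _; apply: le_trans (sum_sqr_le _) => //.
by apply: ler_sum => j _; rewrite real_normK// num_real.
Qed.

Lemma n1_le_enorm p q (A : 'M[R]_(p, q)) : n1 A <= (p * q)%:R * enorm A.
Proof.
rewrite /n1 (le_trans (y := \sum_(i < p) \sum_(j < q) enorm A))//.
  by apply: ler_sum => i _; apply: ler_sum => j _; exact: le_entry_enorm.
by rewrite !sumr_const !card_ord -mulrnA mulnC mulr_natl.
Qed.

(** Neighbourhoods of a matrix are given entry by entry. The least of finitely many radii yields an
    [n1]-ball; conversely, entrywise errors below r / (pq + 1) sum to less than r, also when pq =
    0. *)
Lemma mx_openP p q (A : set 'M[R]_(p, q)) :
  open A <-> forall x, A x -> exists2 r, 0 < r & forall y, n1 (y - x) < r -> A y.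
Proof.
rewrite openE; split=> [oA x Ax|h x Ax].
  have [P nP PA] := oA _ Ax.
  have /choice[f fP] : forall ij : 'I_p * 'I_q, exists e : R, 0 < e /\
      (forall y, `|y - x ij.1 ij.2| < e -> P ij.1 ij.2 y).
    move=> -[i j]/=; have /nbhs_ballP[e/= e0 eP] := nP i j.
    by exists e; split => // y; rewrite distrC => ye; apply: eP.
  exists (\big[Order.min/1]_ij f ij).
    by elim/big_ind: _ => // [a b a0 b0|ij _]; [rewrite lt_min a0|have [] := fP ij].
  move=> y yx; apply: PA => i j; have [_] := fP (i, j); apply => /=.
  have := le_entry_n1 (y - x) i j; rewrite !mxE => /le_lt_trans; apply.
  by apply: lt_le_trans yx _; exact: bigmin_le_cond.
have [r r0 rA] := h _ Ax.
exists (fun i j => ball (x i j) (r / (p * q).+1%:R)).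
  by move=> i j; apply: nbhsx_ballx; rewrite divr_gt0.
move=> y yP; apply: rA.
apply: (@le_lt_trans _ _ (\sum_(i < p) \sum_(j < q) (r / (p * q).+1%:R))).
  apply: ler_sum => i _; apply: ler_sum => j _; rewrite !mxE.
  by have := yP i j; rewrite /ball/= distrC => /ltW.
rewrite !sumr_const !card_ord -mulrnA mulnC -[X in X < _]mulr_natl mulrA mulrAC.
by rewrite gtr_pMl// ltr_pdivrMr// mul1r ltr_nat.
Qed.

Lemma measurable_lip p q (g : 'M[R]_(p, q) -> R) (C : R) :
  (forall x y, `|g x - g y| <= C * n1 (x - y)) ->
  measurable_fun setT (g : borel 'M[R]_(p, q) -> R).
Proof.
move=> gC; apply: (measurability _ (RGenOInfty.measurableE R)) => _ [_ [x ->] <-].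
rewrite setTI; apply: sub_sigma_algebra => /=.
apply/mx_openP => y /=; rewrite in_itv/= andbT => xy.
have C1 : 0 < `|C| + 1 by rewrite ltr_wpDl.
exists ((g y - x) / (`|C| + 1)); first by rewrite divr_gt0// subr_gt0.
move=> z; rewrite ltr_pdivlMr// => zy; rewrite in_itv/= andbT.
have : `|g z - g y| < g y - x.
  apply: le_lt_trans (gC _ _) (le_lt_trans _ zy); rewrite mulrC ler_wpM2l ?n1_ge0//.
  by rewrite (le_trans (ler_norm _))// lerDl.
by rewrite ltr_norml => /andP[+ _]; lra.
Qed.

End l1_norm.

Section blip.
Context {R : realType}.

(** Merging the two constants into one nonnegative C, with [n1] in place of [enorm], lets each
    closure property below exhibit a single witness. *)
Lemma bLipP p q (g : 'M[R]_(p, q) -> R) : bLip g <->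
  exists2 C : R, 0 <= C & (forall x, `|g x| <= C) /\
                      (forall x y, `|g x - g y| <= C * n1 (x - y)).
Proof.
split=> [[[C gC] [L gL]]|[C C0 [gC gL]]].
  exists (Num.max `|C| `|L|); first by rewrite le_max normr_ge0.
  split=> [x|x y]; first by rewrite le_max (le_trans (gC _))// ler_norm.
  apply: le_trans (gL _ _) _; apply: (@le_trans _ _ (`|L| * enorm (x - y))).
    by rewrite ler_wpM2r ?enorm_ge0// ler_norm.
  by rewrite ler_pM ?enorm_ge0 ?enorm_le_n1// le_max lexx orbT.
split; first by exists C.
exists (C * (p * q)%:R) => x y; apply: le_trans (gL _ _) _.
by rewrite -mulrA ler_wpM2l// n1_le_enorm.
Qed.

Lemma bLip_measurable p q (g : 'M[R]_(p, q) -> R) : bLip g ->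
  measurable_fun setT (g : borel 'M[R]_(p, q) -> R).
Proof. by move=> /bLipP[C _ [_]]; exact: measurable_lip. Qed.

Lemma bLip_cst p q (a : R) : bLip (fun _ : 'M[R]_(p, q) => a).
Proof.
apply/bLipP; exists `|a| => //; split => // x y.
by rewrite subrr normr0 mulr_ge0// n1_ge0.
Qed.

Lemma bLipD p q (f g : 'M[R]_(p, q) -> R) : bLip f -> bLip g ->
  bLip (fun x => f x + g x).
Proof.
move=> /bLipP[C C0 [fC fL]] /bLipP[D D0 [gD gL]]; apply/bLipP.
exists (C + D); first exact: addr_ge0.
split=> [x|x y]; first by rewrite (le_trans (ler_normD _ _))// lerD.
by rewrite mulrDl opprD addrACA (le_trans (ler_normD _ _))// lerD.
Qed.

Lemma bLipM p q (f g : 'M[R]_(p, q) -> R) : bLip f -> bLip g ->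
  bLip (fun x => f x * g x).
Proof.
move=> /bLipP[C C0 [fC fL]] /bLipP[D D0 [gD gL]]; apply/bLipP.
exists (C * D + C * D); first by rewrite addr_ge0// mulr_ge0.
split=> [x|x y].
  by rewrite normrM (@le_trans _ _ (C * D))// ?ler_pM// lerDl mulr_ge0.
have -> : f x * g x - f y * g y = f x * (g x - g y) + (f x - f y) * g y by ring.
apply: le_trans (ler_normD _ _) _; rewrite [leRHS]mulrDl !normrM; apply: lerD.
  by rewrite -mulrA ler_pM.
by rewrite mulrAC ler_pM.
Qed.

Lemma bLipZ p q (a : R) (f : 'M[R]_(p, q) -> R) : bLip f ->
  bLip (fun x => a * f x).
Proof. by move=> fL; apply: bLipM => //; exact: bLip_cst. Qed.

Lemma bLipN p q (f : 'M[R]_(p, q) -> R) : bLip f -> bLip (fun x => - f x).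
Proof.
move=> /(bLipZ (-1)); congr bLip; apply/funext => x; exact: mulN1r.
Qed.

Lemma bLipB p q (f g : 'M[R]_(p, q) -> R) : bLip f -> bLip g ->
  bLip (fun x => f x - g x).
Proof. by move=> fL /bLipN; exact: bLipD. Qed.

Lemma bLip_sum p q (I : Type) (s : seq I) (f : I -> 'M[R]_(p, q) -> R) :
  (forall i, bLip (f i)) -> bLip (fun x => \sum_(i <- s) f i x).
Proof.
move=> fL; elim: s => [|a s ih].
  by under eq_fun do rewrite big_nil; exact: bLip_cst.
by under eq_fun do rewrite big_cons; apply: bLipD.
Qed.

Lemma le_dist_max (a b c d : R) :
  `|Num.max a b - Num.max c d| <= `|a - c| + `|b - d|.
Proof.
have := ler_norm (a - c); have := ler_norm (b - d).
have := ler_norm (- (a - c)); have := ler_norm (- (b - d)); rewrite !normrN.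
move=> h1 h2 h3 h4; rewrite ler_norml.
by apply/andP; split; case: (lerP a b); case: (lerP c d) => *; lra.
Qed.

Lemma le_dist_min (a b c d : R) :
  `|Num.min a b - Num.min c d| <= `|a - c| + `|b - d|.
Proof.
have := ler_norm (a - c); have := ler_norm (b - d).
have := ler_norm (- (a - c)); have := ler_norm (- (b - d)); rewrite !normrN.
move=> h1 h2 h3 h4; rewrite ler_norml.
by apply/andP; split; case: (lerP a b); case: (lerP c d) => *; lra.
Qed.

Lemma bLip_max p q (f g : 'M[R]_(p, q) -> R) : bLip f -> bLip g ->
  bLip (fun x => Num.max (f x) (g x)).
Proof.
move=> /bLipP[C C0 [fC fL]] /bLipP[D D0 [gD gL]]; apply/bLipP.
exists (C + D); first exact: addr_ge0.
split=> [x|x y]; last by rewrite (le_trans (le_dist_max _ _ _ _))// mulrDl lerD.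
have := fC x; have := gD x.
by case: (lerP (f x) (g x)) => _ h1 h2; apply: le_trans; eauto; rewrite ?lerDl ?lerDr.
Qed.

Lemma bLip_min p q (f g : 'M[R]_(p, q) -> R) : bLip f -> bLip g ->
  bLip (fun x => Num.min (f x) (g x)).
Proof.
move=> /bLipP[C C0 [fC fL]] /bLipP[D D0 [gD gL]]; apply/bLipP.
exists (C + D); first exact: addr_ge0.
split=> [x|x y]; last by rewrite (le_trans (le_dist_min _ _ _ _))// mulrDl lerD.
have := fC x; have := gD x.
by case: (lerP (f x) (g x)) => _ h1 h2; apply: le_trans; eauto; rewrite ?lerDl ?lerDr.
Qed.

End blip.

Section distC.
Context {R : realType} {p q : nat}.
Implicit Types G : set 'M[R]_(p, q).

(** The value 1 keeps the infimum meaningful when the complement of G is empty, and makes the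
    distance bounded. *)
Definition distC G (x : 'M[R]_(p, q)) : R :=
  inf ([set 1] `|` [set n1 (x - y) | y in ~` G]).

Let lb0 G x : lbound ([set 1] `|` [set n1 (x - y) | y in ~` G]) 0.
Proof. by move=> _ [->//|[y _ <-]]; exact: n1_ge0. Qed.

Let hinf G x : has_inf ([set 1] `|` [set n1 (x - y) | y in ~` G]).
Proof. by split; [exists 1; left|exists 0; exact: lb0]. Qed.

Lemma distC_ge0 G x : 0 <= distC G x.
Proof. by apply: lb_le_inf; [exists 1; left|exact: lb0]. Qed.

Lemma distC_le1 G x : distC G x <= 1.
Proof. by apply: ge_inf; [exists 0; exact: lb0|left]. Qed.

Lemma distC_eq0 G x : ~ G x -> distC G x = 0.
Proof.
move=> Gx; apply/eqP; rewrite eq_le distC_ge0 andbT.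
apply: ge_inf; first by exists 0; exact: lb0.
by right; exists x => //; rewrite subrr n1_0.
Qed.

Lemma distC_gt0 G x : open G -> G x -> 0 < distC G x.
Proof.
move=> /mx_openP/(_ x) h /h[r r0 rG].
apply: (@lt_le_trans _ _ (Num.min 1 r)); first by rewrite lt_min ltr01.
apply: lb_le_inf; first by exists 1; left.
move=> _ [->|[y Gy <-]]; first by rewrite ge_min lexx.
rewrite ge_min; apply/orP; right; rewrite leNgt; apply/negP => xy.
by apply: Gy; apply: rG; rewrite n1C.
Qed.

Lemma bLip_distC G : bLip (distC G).
Proof.
apply/bLipP; exists 1 => //; split=> [x|x y].
  by rewrite ger0_norm ?distC_ge0 ?distC_le1.
have key a b : distC G a <= distC G b + n1 (a - b).
  rewrite -lerBlDr; apply: lb_le_inf; first by exists 1; left.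
  move=> _ [->|[z Gz <-]].
    by rewrite lerBlDr (le_trans (distC_le1 _ _))// lerDl n1_ge0.
  rewrite lerBlDr (@le_trans _ _ (n1 (a - z)))//.
    by apply: ge_inf; [exists 0; exact: lb0|right; exists z].
  by rewrite [leRHS]addrC; exact: le_n1_tri.
rewrite mul1r ler_norml; have := key x y; have := key y x.
by rewrite (n1C y); lra.
Qed.

(* bounded Lipschitz functions increasing to the indicator of an open set *)
Definition obump G (j : nat) (x : 'M[R]_(p, q)) : R :=
  Num.min 1 (j%:R * distC G x).

Lemma obump_ge0 G j x : 0 <= obump G j x.
Proof. by rewrite le_min ler01 mulr_ge0 ?ler0n ?distC_ge0. Qed.

Lemma obump_le1 G j x : obump G j x <= 1.
Proof. by rewrite ge_min lexx. Qed.

Lemma obump_eq0 G j x : ~ G x -> obump G j x = 0.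
Proof. by move=> Gx; rewrite /obump distC_eq0// mulr0; case: ltP; lra. Qed.

Lemma obump_eq1 G x : open G -> G x ->
  exists j0, forall j, (j0 <= j)%N -> obump G j x = 1.
Proof.
move=> oG Gx; have d0 := distC_gt0 oG Gx.
exists (Num.trunc (distC G x)^-1).+1 => j j0; apply/eqP.
rewrite eq_le obump_le1 le_min lexx/= -ler_pdivrMr// mul1r.
rewrite (le_trans (ltW (truncnS_gt _)))// ler_nat//.
Qed.

Lemma obump_mono G x : {homo (fun j => obump G j x) : i j / (i <= j)%N >-> i <= j}.
Proof.
move=> i j ij; rewrite /obump le_min ge_min lexx/= ge_min; apply/orP; right.
by rewrite ler_wpM2r ?distC_ge0// ler_nat.
Qed.

Lemma bLip_obump G j : bLip (obump G j).
Proof.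
by apply: bLip_min; [exact: bLip_cst|apply: bLipZ; exact: bLip_distC].
Qed.

End distC.

(** * The Daniell representation theorem *)

Section daniell.
Local Open Scope ereal_scope.
Context {R : realType} {p q : nat}.
Local Notation T := 'M[R]_(p, q).
Variable l : (T -> R) -> R.
Hypothesis lD : forall f g, bLip f -> bLip g ->
  l (fun x => f x + g x)%R = (l f + l g)%R.
Hypothesis lZ : forall a f, bLip f -> l (fun x => a * f x)%R = (a * l f)%R.
Hypothesis l_ge0 : forall f, bLip f -> (forall x, 0 <= f x)%R -> (0 <= l f)%R.
Hypothesis l1 : l (fun=> 1%R) = 1%R.
Hypothesis lcont : forall f : nat -> T -> R, (forall i, bLip (f i)) ->
  (forall i x, 0 <= f i x)%R ->
  (forall x, {homo f^~ x : i j / (i <= j)%N >-> (j <= i)%R}) ->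
  (forall x (e : R), 0 < e -> exists i, f i x <= e)%R ->
  forall e : R, (0 < e -> exists i, l (f i) <= e)%R.

Let lB f g : bLip f -> bLip g -> l (fun x => f x - g x)%R = (l f - l g)%R.
Proof.
move=> fL gL; rewrite -mulN1r -lZ// -lD//; last exact: bLipZ.
by congr l; apply/funext => x; rewrite mulN1r.
Qed.

Let l_le f g : bLip f -> bLip g -> (forall x, f x <= g x)%R -> (l f <= l g)%R.
Proof.
move=> fL gL fg; rewrite -subr_ge0 -lB// l_ge0//; first exact: bLipB.
by move=> x; rewrite subr_ge0.
Qed.

Let l_sum (f : nat -> T -> R) n : (forall i, bLip (f i)) ->
  l (fun x => \sum_(i < n) f i x)%R = (\sum_(i < n) l (f i))%R.
Proof.
move=> fL; elim: n => [|n ih].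
  rewrite big_ord0; under eq_fun do rewrite big_ord0.
  rewrite -[RHS](mul0r (l (fun=> 1%R))) -lZ; last exact: bLip_cst.
  by congr l; apply/funext => x; rewrite mul0r.
rewrite [RHS]big_ord_recr/= -ih -lD//; last exact: bLip_sum.
by congr l; apply/funext => x; rewrite big_ord_recr.
Qed.

Let below (G : set T) (f : T -> R) :=
  [/\ bLip f, forall x, (0 <= f x <= 1)%R & forall x, ~ G x -> f x = 0%R].

(** Riesz's construction: open sets are measured from inside by functions, all sets from outside by
    open sets. *)
Let lam (G : set T) : \bar R := ereal_sup [set (l f)%:E | f in below G].

Let dan (A : set T) : \bar R :=
  ereal_inf [set lam G | G in [set G | open G /\ A `<=` G]].

Let le_lam f G : below G f -> (l f)%:E <= lam G.
Proof. by move=> fG; apply: ereal_sup_ubound; exists f. Qed.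

Let below0 G : below G (fun=> 0%R).
Proof. by split => //; [exact: bLip_cst|move=> _; rewrite lexx ler01]. Qed.

Let lam_ge0 G : 0 <= lam G.
Proof.
apply: le_trans (le_lam (below0 G)); rewrite lee_fin.
by apply: l_ge0 => //; exact: bLip_cst.
Qed.

Let lam_mono G H : G `<=` H -> lam G <= lam H.
Proof.
move=> GH; apply: ge_ereal_sup => _ [f [fL f01 f0] <-]; apply: le_lam.
by split => // x Hx; apply: f0 => /GH.
Qed.

Let lam_le1 G : lam G <= 1.
Proof.
apply: ge_ereal_sup => _ [f [fL f01 f0] <-]; rewrite lee_fin -l1.
by apply: l_le => //; [exact: bLip_cst|move=> x; have /andP[] := f01 x].
Qed.

Let dan_open G : open G -> dan G = lam G.
Proof.
move=> oG; apply/eqP; rewrite eq_le; apply/andP; split.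
  by apply: ereal_inf_lbound; exists G => //; split.
by apply: le_ereal_inf_tmp => _ [H [oH GH] <-]; exact: lam_mono.
Qed.

Let dan_le A G : open G -> A `<=` G -> dan A <= lam G.
Proof. by move=> oG AG; apply: ereal_inf_lbound; exists G. Qed.

Let dan_ge0 A : 0 <= dan A.
Proof. by apply: le_ereal_inf_tmp => _ [H [oH GH] <-]. Qed.

Let dan_le1 A : dan A <= 1.
Proof. by apply: le_trans (lam_le1 setT); apply: dan_le => //; exact: openT. Qed.

Let dan_fin A : dan A \is a fin_num.
Proof. by rewrite ge0_fin_numE// (le_lt_trans (dan_le1 A))// ltry. Qed.

Let dan_mono : {homo dan : A B / A `<=` B >-> A <= B}.
Proof.
move=> A B AB; apply: ereal_inf_le_tmp => _ [G [oG BG] <-]; exists G => //.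
by split => //; exact: subset_trans BG.
Qed.

Let dan0 : dan set0 = 0.
Proof.
rewrite dan_open; last exact: open0.
apply/eqP; rewrite eq_le lam_ge0 andbT.
apply: ge_ereal_sup => _ [f [fL f01 f0] <-].
have -> : f = (fun=> 0 * 1)%R by apply/funext => x; rewrite mul0r f0.
by rewrite lZ ?mul0r//; exact: bLip_cst.
Qed.

(** Serves to split a function below a union into functions below the single sets. *)
Let min_sum (a : R) (b : nat -> R) n : (0 <= a)%R -> (forall i, 0 <= b i)%R ->
  (Num.min a (\sum_(i < n) b i) <= \sum_(i < n) Num.min a (b i))%R.
Proof.
move=> a0 b0; elim: n => [|n ih]; first by rewrite !big_ord0 ge_min lexx orbT.
rewrite !big_ord_recr/=.
have : (0 <= \sum_(i < n) b i)%R by apply: sumr_ge0.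
have := b0 n; move: ih.
set s := (\sum_(i < n) b i)%R; set t := (\sum_(i < n) Num.min a (b i))%R.
by case: (lerP a s); case: (lerP a (b n)); case: (lerP a (s + b n)) => *; lra.
Qed.

(** This is where [lcont] enters: for f below the union, f minus its minimum with the partial sums
    of bumps decreases to 0. Hence l f is almost reached by a function below a finite sum of bumps,
    which splits over the sets. *)
Let lam_bigcup (G : nat -> set T) : (forall i, open (G i)) ->
  lam (\bigcup_i G i) <= \sum_(i <oo) lam (G i).
Proof.
move=> oG; apply: ge_ereal_sup => _ [f [fL f01 f0] <-].
have fge0 x : (0 <= f x)%R by have /andP[] := f01 x.
have fle1 x : (f x <= 1)%R by have /andP[] := f01 x.
(* The index n is both the number of sets and the height of the bumps, so [s n] increases and
   eventually exceeds 1, up to equality, on the union. *)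
pose s n (x : T) := (\sum_(i < n) obump (G i) n x)%R.
have sL n : bLip (s n).
  by rewrite /s; apply: bLip_sum => i; exact: bLip_obump.
pose h n x := Num.min (f x) (s n x).
have hL n : bLip (h n) by exact: bLip_min.
have s_mono x i j : (i <= j)%N -> (s i x <= s j x)%R.
  move=> ij; rewrite /s -(subnKC ij) big_split_ord/=.
  rewrite (@le_trans _ _ (\sum_(k < i) obump (G k) (i + (j - i)) x))%R//.
    by apply: ler_sum => k _; apply: obump_mono; rewrite leq_addr.
  by rewrite lerDl; apply: sumr_ge0 => k _; exact: obump_ge0.
apply/lee_addgt0Pr => e e0.
have [//| | | |n ln] := @lcont (fun n x => f x - h n x)%R _ _ _ _ e e0.
- by move=> n; exact: bLipB.
- by move=> n x; rewrite subr_ge0 ge_min lexx.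
- move=> x i j ij; rewrite lerD2l lerN2 le_min ge_min lexx/= ge_min.
  by rewrite s_mono// orbT.
- move=> x e' e'0; have [[i _ Gx]|Gx] := pselect ((\bigcup_i G i) x); last first.
    exists 0%N; rewrite f0// sub0r /h /s big_ord0 f0//.
    by rewrite min_l// oppr0 ltW.
  have [j0 hj0] := obump_eq1 (oG i) Gx.
  exists (maxn i.+1 j0); rewrite /h min_l ?subrr ?(ltW e'0)//.
  rewrite (le_trans (fle1 x))// /s (bigD1 (Ordinal (leq_maxl i.+1 j0)))//=.
  rewrite hj0 ?leq_maxr// lerDl; apply: sumr_ge0 => k _; exact: obump_ge0.
rewrite lB// in ln; have {}ln : (l f <= l (h n) + e)%R by lra.
apply: (@le_trans _ _ (l (h n) + e)%:E); first by rewrite lee_fin.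
rewrite EFinD leeD2r//.
pose g i x := Num.min (f x) (obump (G i) n x).
have gL i : bLip (g i) by apply: bLip_min => //; exact: bLip_obump.
apply: (@le_trans _ _ (\sum_(i < n) (l (g i))%:E)).
  rewrite sumEFin lee_fin -l_sum//; apply: l_le => //.
    exact: bLip_sum.
  move=> x; apply: (min_sum (b := fun i => obump (G i) n x)) => // i.
  exact: obump_ge0.
apply: (@le_trans _ _ (\sum_(i < n) lam (G i))).
  apply: lee_sum => i _; apply: le_lam; split => // x.
    by rewrite le_min fge0 obump_ge0/= ge_min fle1.
  by move=> /obump_eq0 b0; rewrite /g b0 min_r.
rewrite -(big_mkord xpredT (fun i => lam (G i))).
by apply: nneseries_lim_ge => k _.
Qed.

Let dan_sigma_subadditive : sigma_subadditive dan.
Proof.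
move=> A; apply/lee_addgt0Pr => e e0.
have /choice[G GP] : forall i, exists G, [/\ open G, A i `<=` G &
    lam G <= dan (A i) + (e / (2 ^ i.+1)%:R)%:E].
  move=> i; have e'0 : (0 < e / (2 ^ i.+1)%:R :> R)%R.
    by rewrite divr_gt0// ltr0n expn_gt0.
  have [_ [G [oG AG] <-] /ltW] := lb_ereal_inf_adherent e'0 (dan_fin (A i)).
  by exists G.
apply: le_trans (epsilon_trick _ _ (ltW e0)) => //.
apply: (@le_trans _ _ (\sum_(i <oo) lam (G i))).
  apply: le_trans (lam_bigcup _); last by move=> i; have [] := GP i.
  apply: dan_le; first by apply: bigcup_open => i _; have [] := GP i.
  by apply: subset_bigcup => i _; have [] := GP i.
by apply: lee_nneseries => // i _; have [] := GP i.
Qed.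

HB.instance Definition _ := isOuterMeasure.Build R T dan
  dan0 dan_ge0 dan_mono dan_sigma_subadditive.

(** For f below the intersection of H and G, the truncation (f - e)^+ vanishes on [K], the part of H
    where f < e. This open set contains A outside G, and a function below [K] can be added to the
    truncation while staying below H. So the two masses add up to at most the mass of H, up to e. *)
Let dan_open_measurable G : open G -> dan.-caratheodory G.
Proof.
move=> oG; apply: le_caratheodory_measurable => A.
apply: le_ereal_inf_tmp => _ [H [oH AH] <-].
apply: (@le_trans _ _ (lam (H `&` G) + dan (A `&` ~` G))).
  by apply: leeD => //; apply: dan_le; [exact: openI|exact: setSI].
have lamf B : lam B \is a fin_num.
  by rewrite ge0_fin_numE// (le_lt_trans (lam_le1 _))// ltry.
rewrite -leeBrDr// ?dan_fin//; apply: ge_ereal_sup => _ [f [fL f01 f0] <-].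
rewrite leeBrDr ?dan_fin//; apply/lee_addgt0Pr => e e0.
have fge0 x : (0 <= f x)%R by have /andP[] := f01 x.
have fle1 x : (f x <= 1)%R by have /andP[] := f01 x.
pose fe x := Num.max 0%R (f x - e)%R.
have feL : bLip fe by apply: bLip_max; [exact: bLip_cst|apply: bLipB => //; exact: bLip_cst].
pose K := H `&` [set x | f x < e]%R.
have oK : open K.
  apply: openI => //; apply/mx_openP => x /= fx.
  have /bLipP[C C0 [_ fC]] := fL.
  exists ((e - f x) / (C + 1))%R; first by rewrite divr_gt0 ?subr_gt0// ltr_wpDl.
  move=> y; rewrite ltr_pdivlMr; last (by rewrite ltr_wpDl); move=> yx.
  have : (`|f y - f x| < e - f x)%R.
    by apply: le_lt_trans (fC _ _) (le_lt_trans _ yx); rewrite mulrC ler_wpM2l ?n1_ge0// lerDl.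
  by rewrite ltr_norml => /andP[_]; lra.
have hK : dan (A `&` ~` G) <= lam K.
  by apply: dan_le => // x [Ax Gx]; split; [exact: AH|rewrite /= f0// => -[]].
have hfe : (l f)%:E <= (l fe)%:E + e%:E.
  have := @lZ e _ (bLip_cst p q 1%R); rewrite l1 => le1.
  rewrite -EFinD lee_fin -[X in (_ + X)%R]mulr1 -le1 -lD//; last by apply: bLipZ; exact: bLip_cst.
  apply: l_le => //; first by apply: bLipD => //; apply: bLipZ; exact: bLip_cst.
  by move=> x; rewrite mulr1 -lerBlDr le_max lexx orbT.
apply: (@le_trans _ _ ((l fe)%:E + e%:E + lam K)); first exact: leeD.
rewrite addeAC leeD2r// addeC -leeBrDr//.
apply: ge_ereal_sup => _ [g [gL g01 g0] <-]; rewrite leeBrDr// -EFinD -lD//.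
apply: le_lam; split; first exact: bLipD.
  move=> x; have /andP[g0x g1x] := g01 x; rewrite /fe.
  have [fx|fx] := ltP (f x) e.
    by rewrite max_l ?addr0 ?g0x// subr_le0 ltW.
  rewrite g0 ?add0r; last by move=> -[_ /=]; rewrite ltNge fx.
  by rewrite le_max lexx/= ge_max ler01/=; have := fle1 x; lra.
move=> x Hx; rewrite g0 ?add0r; last by move=> -[].
by rewrite /fe f0 ?sub0r ?max_l//; [rewrite oppr_le0 ltW|move=> -[]].
Qed.

Let dan_borel (A : set (borel T)) : measurable A -> dan.-caratheodory A.
Proof.
apply: smallest_sub; last exact: dan_open_measurable.
split; first exact: caratheodory_measurable_set0.
  by move=> B mB; rewrite setTD; exact: caratheodory_measurable_setC.
by move=> B mB; exact: caratheodory_measurable_bigcup.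
Qed.

Let dan_additive : semi_sigma_additive (dan : set (borel T) -> \bar R).
Proof.
move=> A mA tA mUA.
apply: (@caratheodory_measure_sigma_additive R T dan) => //.
  by move=> i; apply: dan_borel.
exact: dan_borel.
Qed.

Let danb : set (borel T) -> \bar R := dan.

HB.instance Definition _ := isMeasure.Build _ (borel T) R danb
  dan0 dan_ge0 dan_additive.

Let dan1 : danb setT = 1.
Proof.
rewrite /danb dan_open; last exact: openT.
apply/eqP; rewrite eq_le lam_le1 -l1; apply: le_lam; split => //.
- exact: bLip_cst.
- by move=> x; rewrite ler01 lexx.
- by move=> x /(_ I).
Qed.

HB.instance Definition _ := Measure_isProbability.Build _ _ _ danb dan1.

(** The layer-cake decomposition of t into layers of height one. *)
Let clamp_sum (t : R) n : (0 <= t)%R ->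
  (\sum_(i < n) Num.min 1 (Num.max 0 (t - i%:R)) = Num.min t n%:R)%R.
Proof.
move=> t0; elim: n => [|n ih]; first by rewrite big_ord0 min_r.
rewrite big_ord_recr ih/= -natr1.
have [h|h] := lerP t n%:R.
  rewrite (@max_l _ _ 0%R) ?subr_le0// min_r// addr0 min_l//.
  by rewrite (le_trans h)// lerDl.
rewrite max_r ?subr_ge0 ?(ltW h)//.
by case: (lerP 1 (t - n%:R)%R); case: (lerP t (n%:R + 1)%R) => *; lra.
Qed.

Let count_sum (t : R) n : (0 <= t)%R ->
  (\sum_(i < n) (i%:R < t)%R%:R <= t + 1)%R.
Proof.
move=> t0; elim: n => [|n ih]; first by rewrite big_ord0 addr_ge0.
rewrite big_ord_recr/=; have [nt|nt] := ltP n%:R t; last by rewrite addr0.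
rewrite lerD2r (le_trans _ (ltW nt))//.
rewrite (@le_trans _ _ (\sum_(i < n) 1)%R)//; last by rewrite sumr_const card_ord.
by apply: ler_sum => i _; case: (_ < _)%R.
Qed.

Let int01 f : bLip f -> (forall x, 0 <= f x <= 1)%R ->
  danb.-integrable setT (EFin \o f).
Proof.
move=> fL f01; apply: (@le_integrable _ _ _ _ _ measurableT _ (cst 1)).
- by apply/measurable_EFinP; exact: bLip_measurable.
- move=> x _ /=; rewrite lee_fin normr1; have /andP[h0 h1] := f01 x.
  by rewrite ger0_norm.
- by apply: finite_measure_integrable_cst.
Qed.

(** Cut (n + 1) f into layers of height one. The i-th layer lies below the open set where (n + 1) f
    > i, and at every point the number of these sets exceeds (n + 1) f by at most 1, an error that
    vanishes after division by n + 1. *)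
Let l_le_int f : bLip f -> (forall x, 0 <= f x <= 1)%R ->
  (l f)%:E <= \int[danb]_x (f x)%:E.
Proof.
move=> fL f01.
have fge0 x : (0 <= f x)%R by have /andP[] := f01 x.
have fle1 x : (f x <= 1)%R by have /andP[] := f01 x.
have mf : measurable_fun setT (f : borel T -> R) by exact: bLip_measurable.
suff h n : (n.+1%:R * l f)%:E <= n.+1%:R%:E * \int[danb]_x (f x)%:E + 1.
  apply/lee_addgt0Pr => e e0; pose n := (Num.trunc e^-1).
  have ne : (1 <= n.+1%:R * e)%R.
    by rewrite -ler_pdivrMr// mul1r ltW// truncnS_gt.
  have [r rE] : exists r, \int[danb]_x (f x)%:E = r%:E.
    exists (fine (\int[danb]_x (f x)%:E)); rewrite fineK//.
    exact: integrable_fin_num (int01 fL f01).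
  have := h n; rewrite rE -EFinM -!EFinD !lee_fin => hn.
  rewrite -(@ler_pM2l _ n.+1%:R)// ?ltr0n// mulrDr.
  by apply: le_trans hn _; rewrite lerD2l.
pose A i := [set x | i%:R < n.+1%:R * f x]%R.
have mA i : measurable (A i : set (borel T)).
  rewrite -[A i]setTI -[A i]/((fun x => i%:R < n.+1%:R * f x)%R @^-1` [set true]).
  apply: measurable_fun_ltr => //.
  by apply: measurable_funM => //; exact: measurable_cst.
pose g i x := Num.min 1%R (Num.max 0 (n.+1%:R * f x - i%:R))%R.
have gL i : bLip (g i).
  apply: bLip_min; first exact: bLip_cst.
  apply: bLip_max; first exact: bLip_cst.
  by apply: bLipB; [exact: bLipZ|exact: bLip_cst].
have -> : (n.+1%:R * l f = \sum_(i < n.+1) l (g i))%R.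
  rewrite -lZ// -l_sum//; congr l; apply/funext => x.
  by rewrite clamp_sum ?mulr_ge0// min_l// ger_pMr.
apply: (@le_trans _ _ (\sum_(i < n.+1) danb (A i))).
  rewrite -sumEFin; apply: lee_sum => i _; rewrite /danb dan_open.
    apply: le_lam; split => // x.
      by rewrite /g le_min ler01 le_max lexx/= ge_min lexx.
    rewrite /A/= => /negP; rewrite -leNgt => h.
    by rewrite /g max_l ?min_r// subr_le0.
  apply/mx_openP => x /= Ax.
  have /bLipP[C C0 [_ gC]] : bLip (fun x => n.+1%:R * f x)%R by exact: bLipZ.
  exists ((n.+1%:R * f x - i%:R) / (C + 1))%R; first by rewrite divr_gt0 ?subr_gt0// ltr_wpDl.
  move=> y; rewrite ltr_pdivlMr; last (by rewrite ltr_wpDl); move=> yx.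
  have : (`|n.+1%:R * f y - n.+1%:R * f x| < n.+1%:R * f x - i%:R)%R.
    by apply: le_lt_trans (gC _ _) (le_lt_trans _ yx); rewrite mulrC ler_wpM2l ?n1_ge0// lerDl.
  by rewrite ltr_norml opprB => /andP[+ _]; rewrite ltrD2r.
have -> : \sum_(i < n.+1) danb (A i) =
    \int[danb]_x (\sum_(i < n.+1) (\1_(A i) x)%:E).
  rewrite ge0_integral_sum//; last first.
    by move=> i; apply/measurable_EFinP; exact: measurable_indic.
  by apply: eq_bigr => i _; rewrite integral_indic// setIT.
rewrite -(probability_setT danb) -[X in _ + X]mul1e -(integral_cst danb measurableT 1).
rewrite -ge0_integralZl//; last by move=> x _; rewrite lee_fin.
rewrite -ge0_integralD//; last 2 first.
- by move=> x _; rewrite mule_ge0// lee_fin.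
- by apply/measurable_EFinP; exact: measurable_funM.
apply: ge0_le_integral => //.
- by move=> x _; apply: sume_ge0 => i _; rewrite lee_fin.
- by apply: emeasurable_sum => i; apply/measurable_EFinP; exact: measurable_indic.
- apply: emeasurable_funD => //; apply/measurable_EFinP; exact: measurable_funM.
move=> x _; rewrite sumEFin -EFinM -EFinD lee_fin.
apply: le_trans (count_sum n.+1 (mulr_ge0 (ler0n _ _) (fge0 x))).
apply: ler_sum => i _; by rewrite indicE/= mem_setE.
exact/measurable_EFinP.
Qed.

(** The inequality [l_le_int] suffices: applied to 1 - g it gives the reverse one, since l and the
    measure are both normalized. Affine rescaling reduces a bounded function to values in [0, 1]. *)
Theorem daniell : exists Q : probability (borel T) R,
  forall f, bLip f -> (\int[Q]_x f x)%R = l f.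
Proof.
exists danb => f fL.
have int_cst (a : R) : (\int[danb]_x a = a)%R.
  by rewrite Rintegral_cst// -[RHS]mulr1; congr (_ * _)%R; exact: (congr1 fine dan1).
have key g : bLip g -> (forall x, 0 <= g x <= 1)%R -> (\int[danb]_x g x)%R = l g.
  move=> gL g01.
  have hle h : bLip h -> (forall x, 0 <= h x <= 1)%R -> (l h <= \int[danb]_x h x)%R.
    move=> hL h01; rewrite -lee_fin fineK ?l_le_int//.
    by apply: integrable_fin_num => //; exact: int01.
  apply/eqP; rewrite eq_le hle// andbT.
  have g'L : bLip (fun x => 1 - g x)%R by apply: bLipB => //; exact: bLip_cst.
  have g'01 x : (0 <= 1 - g x <= 1)%R by have := g01 x; lra.
  have := hle _ g'L g'01.
  rewrite lB ?l1//; last exact: bLip_cst.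
  rewrite RintegralB//; [|exact: finite_measure_integrable_cst|exact: int01].
  rewrite int_cst; lra.
have /bLipP[C C0 [fC _]] := fL.
(* The denominator is 2 C + 1 rather than 2 C because C may be 0. *)
pose g x := ((f x + C) * (2 * C + 1)^-1)%R.
have C1 : (0 < 2 * C + 1)%R by lra.
have gL : bLip g.
  rewrite /g; under eq_fun do rewrite mulrC.
  by apply: bLipZ; apply: bLipD => //; exact: bLip_cst.
have g01 x : (0 <= g x <= 1)%R.
  have := fC x; rewrite ler_norml => /andP[h1 h2].
  rewrite divr_ge0 ?(ltW C1)//=; last lra.
  by rewrite ler_pdivrMr// mul1r; lra.
have fE : f = (fun x => (2 * C + 1) * g x - C)%R.
  by apply/funext => x; rewrite /g mulrCA divff ?mulr1 ?addrK// gt_eqF.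
have ig := int01 gL g01.
have lC : l (fun=> C) = C.
  have := @lZ C _ (bLip_cst p q 1%R); rewrite l1 mulr1 => {2}<-.
  by congr l; apply/funext => x; rewrite mulr1.
rewrite fE RintegralB//; last 2 first.
- exact: (integrableZl measurableT (2 * C + 1)%R ig).
- exact: finite_measure_integrable_cst.
rewrite RintegralZl// key// int_cst lB ?lZ// ?lC//.
  exact: bLipZ.
exact: bLip_cst.
Qed.

End daniell.

(** * Dini's theorem and tightness *)

Section dini.
Context {R : realType}.

(** Points x_i of the box with f_i (x_i) > e would cluster at some y. If f_i y <= e / 2, the
    Lipschitz bound keeps f_i below e near y, and monotonicity contradicts the choice of a later x_j
    close to y. Rows come first because their boxes are products of segments; [mxvec] transfers the
    result to matrices. *)
Lemma dini_row (n : nat) (f : nat -> 'rV[R]_n -> R) (r e : R) : 0 < e ->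
  (forall i, bLip (f i)) ->
  (forall x, {homo f^~ x : i j / (i <= j)%N >-> j <= i}) ->
  (forall x (e : R), 0 < e -> exists i, f i x <= e) ->
  exists i, forall x, n1 x <= r -> f i x <= e.
Proof.
move=> e0 fL f_mono f0; apply/not_existsP => hf.
have /choice[x xP] : forall i, exists x, n1 x <= r /\ e < f i x.
  move=> i; have /existsNP[x /not_implyP[xr /negP]] := hf i.
  by rewrite -ltNge => xe; exists x.
pose K := [set v : 'rV[R]_n | forall j, `[- r, r]%classic (v ord0 j)].
have cK : compact K by apply: (@rV_compact R n (fun=> `[- r, r]%classic)) => j; exact: segment_compact.
have xK : (x @ \oo) K.
  exists 0%N => // i _ j /=; rewrite in_itv/= -ler_norml.
  by apply: le_trans (xP i).1; exact: le_entry_n1.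
have [y [_ clu]] := cK (x @ \oo) _ xK.
have [i fi] : exists i, f i y <= e / 2 by apply: f0; rewrite divr_gt0.
have /bLipP[C C0 [_ fC]] := fL i.
have e2C : 0 < e / 2 / (C + 1) by rewrite !divr_gt0// ltr_wpDl.
have /clu : (x @ \oo) [set z | exists2 j, (i <= j)%N & z = x j].
  by exists i => // j/= ij; exists j.
have ny : nbhs y [set z | n1 (z - y) < e / 2 / (C + 1)].
  apply: open_nbhs_nbhs; split; last by rewrite /= subrr n1_0.
  apply/mx_openP => z/= zy; exists (e / 2 / (C + 1) - n1 (z - y)).
    by rewrite subr_gt0.
  move=> w wz; apply: le_lt_trans (le_n1_tri z _ _) _; lra.
move=> /(_ _ ny)[z [[j ij ->{z}] xy]].
have := fC (x j) y => /(le_trans (ler_norm _)).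
have : C * n1 (x j - y) <= e / 2.
  move: xy => /=; rewrite ltr_pdivlMr ?ltr_wpDl// => /ltW; apply: le_trans.
  by rewrite mulrC ler_wpM2l ?n1_ge0// lerDl.
by have := (xP j).2; have := f_mono (x j) _ _ ij => /=; lra.
Qed.

Lemma le_n1_vec_mx p q (v : 'rV[R]_(p * q)) : n1 (vec_mx v) <= (p * q)%:R * n1 v.
Proof.
rewrite {1}/n1 (le_trans (y := \sum_(i < p) \sum_(j < q) n1 v))//.
  by apply: ler_sum => i _; apply: ler_sum => j _; rewrite mxE le_entry_n1.
by rewrite !sumr_const !card_ord -mulrnA -[leLHS]mulr_natl [(q * p)%N]mulnC.
Qed.

Lemma le_n1_mxvec p q (A : 'M[R]_(p, q)) : n1 (mxvec A) <= (p * q)%:R * n1 A.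
Proof.
rewrite {1}/n1 big_ord1 (le_trans (y := \sum_(k < p * q) n1 A))//.
  by apply: ler_sum => k _; case/mxvec_indexP: k => i j; rewrite mxvecE le_entry_n1.
by rewrite sumr_const card_ord mulr_natl.
Qed.

Lemma dini p q (f : nat -> 'M[R]_(p, q) -> R) (r e : R) : 0 < e ->
  (forall i, bLip (f i)) ->
  (forall x, {homo f^~ x : i j / (i <= j)%N >-> j <= i}) ->
  (forall x (e : R), 0 < e -> exists i, f i x <= e) ->
  exists i, forall x, n1 x <= r -> f i x <= e.
Proof.
move=> e0 fL f_mono f0.
have [|||i fi] := @dini_row _ (fun i => f i \o vec_mx) ((p * q)%:R * r) e e0.
- move=> i; have /bLipP[C C0 [fb fC]] := fL i; apply/bLipP.
  exists (C * (p * q).+1%:R); first by rewrite mulr_ge0.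
  split=> [x|x y] /=; first by rewrite (le_trans (fb _))// ler_peMr// ler1n.
  rewrite (le_trans (fC _ _))// -mulrA ler_wpM2l// -linearB.
  rewrite (le_trans (le_n1_vec_mx _))// ler_wpM2r ?n1_ge0// ler_nat.
  exact: leqnSn.
- by move=> x i j ij /=; exact: f_mono.
- by move=> x e' e'0; exact: f0.
exists i => x xr; rewrite -(mxvecK x); apply: fi.
by rewrite (le_trans (le_n1_mxvec _))// ler_wpM2l.
Qed.

(* [l] need only be monotone on bounded Lipschitz functions: tightness turns
   monotone pointwise convergence into uniform convergence on a large ball. *)
Lemma dini_tight p q (l : ('M[R]_(p, q) -> R) -> R) :
  (forall f, bLip f -> forall a b : R, 0 <= a -> 0 <= b ->
     (forall r, 0 < r -> (forall x, f x <= a + b * Num.min 1 (r^-1 * n1 x)) ->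
        l f <= a + b * l (fun x => Num.min 1 (r^-1 * n1 x)))) ->
  (forall e, 0 < e -> exists2 r, 0 < r & l (fun x => Num.min 1 (r^-1 * n1 x)) <= e) ->
  forall f : nat -> 'M[R]_(p, q) -> R, (forall i, bLip (f i)) ->
  (forall i x, 0 <= f i x) ->
  (forall x, {homo f^~ x : i j / (i <= j)%N >-> j <= i}) ->
  (forall x (e : R), 0 < e -> exists i, f i x <= e) ->
  forall e : R, 0 < e -> exists i, l (f i) <= e.
Proof.
move=> lle tight f fL f_ge0 f_mono f0 e e0.
have /bLipP[C C0 [fC _]] := fL 0%N.
have C1 : 0 < C + 1 by rewrite ltr_wpDl.
have [r r0 lr] : exists2 r, 0 < r &
    l (fun x => Num.min 1 (r^-1 * n1 x)) <= e / 2 / (C + 1).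
  by apply: tight; rewrite !divr_gt0.
have e2 : 0 < e / 2 by rewrite divr_gt0.
have [i fi] := dini r e2 fL f_mono f0.
(* Inside the ball [f i] is at most e / 2; outside, it is at most C while the truncated norm equals
   1. *)
exists i; apply: (@le_trans _ _ (e / 2 + (C + 1) * l (fun x => Num.min 1 (r^-1 * n1 x)))).
  apply: lle => // [||x]; [exact: ltW|exact: ltW|].
  have [xr|xr] := leP (n1 x) r.
    rewrite (le_trans (fi x xr))// lerDl mulr_ge0 ?(ltW C1)// le_min ler01/=.
    by rewrite mulr_ge0 ?n1_ge0// invr_ge0 ltW.
  rewrite min_l; last by rewrite mulrC ler_pdivlMr// mul1r ltW.
  rewrite (le_trans (f_mono x 0%N i _))// (le_trans (ler_norm _))// (le_trans (fC _))//.
  by rewrite mulr1; lra.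
rewrite [leRHS](splitr e) lerD2l mulrC -ler_pdivlMr//.
Qed.

Lemma bLip_n1 p q (r : R) : 0 < r ->
  bLip (fun x : 'M[R]_(p, q) => Num.min 1 (r^-1 * n1 x)).
Proof.
move=> r0; apply/bLipP; exists (1 + r^-1); first by rewrite addr_ge0// invr_ge0 ltW.
have ri : 0 <= r^-1 by rewrite invr_ge0 ltW.
split=> [x|x y].
  rewrite ger0_norm ?ge_min ?lerDl ?ri// le_min ler01/=.
  by rewrite mulr_ge0 ?n1_ge0.
rewrite (le_trans (le_dist_min _ _ _ _))// subrr normr0 add0r -mulrBr normrM.
rewrite (ger0_norm ri) ler_pM ?normr_ge0 ?lerDr//.
have := le_n1_tri y x 0; have := le_n1_tri x y 0; rewrite !subr0 ler_norml.
by rewrite (n1C y); lra.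
Qed.

End dini.

(** * The Hahn-Banach and Mazur-Orlicz theorems *)

Section hahn_banach.
Context {R : realType} {E : lmodType R}.
Variable V : set E.
Hypothesis V0 : V 0.
Hypothesis VD : forall x y, V x -> V y -> V (x + y).
Hypothesis VZ : forall (a : R) x, V x -> V (a *: x).

(** Everything is relative to a subspace V because the functional to be dominated, a supremum of
    expectations, is used only on variables whose absolute expectations are uniformly bounded. *)
Definition sublinear_on (p : E -> R) :=
  (forall x y, V x -> V y -> p (x + y) <= p x + p y) /\
  (forall (a : R) x, 0 <= a -> V x -> p (a *: x) = a * p x).

Definition linear_on (l : E -> R) :=
  (forall x y, V x -> V y -> l (x + y) = l x + l y) /\
  (forall (a : R) x, V x -> l (a *: x) = a * l x).

Let VN x : V x -> V (- x).
Proof. by rewrite -scaleN1r; exact: VZ. Qed.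

Let sub0 p : sublinear_on p -> p 0 = 0.
Proof. by move=> [_ /(_ 0 0 (lexx _) V0)]; rewrite scale0r mul0r. Qed.

Let subN p x : sublinear_on p -> V x -> - p (- x) <= p x.
Proof.
move=> ps Vx; have := ps.1 _ _ Vx (VN Vx); rewrite subrr sub0//; lra.
Qed.

(** Directedness gives subadditivity: near-minimizers at x and at y are replaced by one functional
    below both. *)
Let inf_sublinear (A : set (E -> R)) (b : E -> R) : A !=set0 ->
  (forall q, A q -> sublinear_on q) ->
  (forall q1 q2, A q1 -> A q2 -> exists2 q, A q &
    forall x, V x -> q x <= q1 x /\ q x <= q2 x) ->
  (forall q x, A q -> V x -> b x <= q x) ->
  sublinear_on (fun x => inf [set q x | q in A]).
Proof.
move=> [q0 Aq0] As Adir Ab.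
have hlb x : V x -> has_lbound [set q x | q in A].
  by move=> Vx; exists (b x) => _ [q Aq <-]; exact: Ab.
have ne x : [set q x | q in A] !=set0 by exists (q0 x); exists q0.
split=> [x y Vx Vy|a x a0 Vx].
  rewrite -lerBlDr; apply: lb_le_inf => // _ [q1 Aq1 <-].
  rewrite lerBlDl -lerBlDr; apply: lb_le_inf => // _ [q2 Aq2 <-].
  have [q Aq hq] := Adir _ _ Aq1 Aq2.
  rewrite lerBlDr; apply: (@le_trans _ _ (q (x + y))).
    by apply: ge_inf; [apply: hlb; exact: VD|exists q].
  rewrite (le_trans ((As _ Aq).1 _ _ Vx Vy))// addrC lerD//.
    by have [] := hq _ Vy.
  by have [] := hq _ Vx.
move: a0; rewrite le_eqVlt => /predU1P[<-|a0].
  rewrite mul0r scale0r (_ : [set _ | _ in A] = [set 0]) ?inf1//.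
  apply/seteqP; split=> [_ [q Aq <-]|_ ->]; first by rewrite (sub0 (As _ Aq)).
  by exists q0 => //; rewrite (sub0 (As _ Aq0)).
apply/eqP; rewrite eq_le; apply/andP; split.
  rewrite -ler_pdivrMl//; apply: lb_le_inf => // _ [q Aq <-].
  rewrite ler_pdivrMl// -(As _ Aq).2 ?(ltW a0)//.
  by apply: ge_inf; [apply: hlb; exact: VZ|exists q].
apply: lb_le_inf => // _ [q Aq <-]; rewrite (As _ Aq).2 ?(ltW a0)//.
by rewrite ler_pM2l//; apply: ge_inf; [exact: hlb|exists q].
Qed.

Let minimal (q : E -> R) := forall q', sublinear_on q' ->
  (forall x, V x -> q' x <= q x) -> forall x, V x -> q x <= q' x.

(** Zorn's lemma for the pointwise order on V, which is only a preorder because values outside V are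
    free. A chain is bounded below by its pointwise infimum, kept finite by - p (- x) <= q x. *)
Let ex_minimal p : sublinear_on p -> exists q,
  [/\ sublinear_on q, forall x, V x -> q x <= p x & minimal q].
Proof.
move=> ps.
pose T := {q : E -> R | sublinear_on q /\ forall x, V x -> q x <= p x}.
pose Rl : rel T := fun q q' => `[< forall x, V x -> sval q' x <= sval q x >].
have [||A Atot|] := @ZL_preorder T (exist _ p (conj ps (fun x _ => lexx (p x)))) Rl.
- by move=> q; apply/asboolP.
- move=> q1 q2 q3 /asboolP h1 /asboolP h2; apply/asboolP => x Vx.
  by rewrite (le_trans (h2 x Vx))// h1.
- have [[q0 Aq0]|A0] := pselect (A !=set0); last first.
    by exists (exist _ p (conj ps (fun x _ => lexx (p x)))) => s As; case: A0; exists s.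
  pose B := [set sval q | q in A].
  pose qi x := inf [set q x | q in B].
  have Bb q x : B q -> V x -> - p (- x) <= q x.
    move=> [[{}q [qs qp]] Aq <-]/= Vx; rewrite (le_trans _ (subN qs Vx))//.
    by rewrite lerN2 qp//; exact: VN.
  have qis : sublinear_on qi.
    apply: (@inf_sublinear B (fun x => - p (- x))) => //.
    + by exists (sval q0); exists q0.
    + by move=> _ [[q [qs qp]] Aq <-].
    move=> _ _ [q1 Aq1 <-] [q2 Aq2 <-]; have [/asboolP h|/asboolP h] := Atot _ _ Aq1 Aq2.
      by exists (sval q2); [exists q2|move=> x Vx; split=> //; exact: h].
    by exists (sval q1); [exists q1|move=> x Vx; split=> //; exact: h].
  have qiB q x : A q -> V x -> qi x <= sval q x.
    move=> Aq Vx; apply: ge_inf; last by exists (sval q) => //; exists q.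
    by exists (- p (- x)) => _ [q' Bq' <-]; exact: Bb.
  have qip x : V x -> qi x <= p x.
    by move=> Vx; rewrite (le_trans (qiB _ _ Aq0 Vx))// (proj2 (svalP q0)).
  exists (exist _ qi (conj qis qip)) => s As; apply/asboolP => x Vx /=.
  exact: qiB.
move=> [q [qs qp]] qmin; exists q; split => // q' q's q'q x Vx.
have q'p y : V y -> q' y <= p y by move=> Vy; rewrite (le_trans (q'q _ Vy))// qp.
by have /asboolP := qmin (exist _ q' (conj q's q'p)) (asboolT q'q); exact.
Qed.

(** Given y, the functional z -> inf over t >= 0 of q (z + t y) - t q y is sublinear and below q,
    hence above q by minimality. Its value at x is at most q (x + y) - q y, which is the missing
    half of additivity; additivity then handles negative scalars. *)
Let minimal_linear q : sublinear_on q -> minimal q -> linear_on q.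
Proof.
move=> qs qmin.
have qD x y : V x -> V y -> q (x + y) = q x + q y.
  move=> Vx Vy; apply/eqP; rewrite eq_le (qs.1 _ _ Vx Vy)/=.
  pose F (t : R) z := q (z + t *: y) - t * q y.
  have Fb t z : 0 <= t -> V z -> - q (- z) <= F t z.
    move=> t0 Vz; have := qs.1 (z + t *: y) (- z).
    rewrite addrAC subrr add0r qs.2// => /(_ (VD Vz (VZ t Vy)) (VN Vz)).
    by rewrite /F; lra.
  pose qy z := inf [set F t z | t in [set t | 0 <= t]].
  have hlb z : V z -> has_lbound [set F t z | t in [set t | 0 <= t]].
    by move=> Vz; exists (- q (- z)) => _ [t t0 <-]; exact: Fb.
  have ne z : [set F t z | t in [set t | 0 <= t]] !=set0.
    by exists (F 0 z); exists 0 => /=.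
  have qys : sublinear_on qy.
    split=> [z w Vz Vw|a z a0 Vz].
      rewrite -lerBlDr; apply: lb_le_inf => // _ [t t0 <-].
      rewrite lerBlDl -lerBlDr; apply: lb_le_inf => // _ [s s0 <-].
      rewrite lerBlDr; apply: (@le_trans _ _ (F (t + s) (z + w))).
        by apply: ge_inf; [apply: hlb; exact: VD|exists (t + s) => //=; exact: addr_ge0].
      have := qs.1 _ _ (VD Vz (VZ t Vy)) (VD Vw (VZ s Vy)).
      by rewrite addrACA -scalerDl /F; lra.
    move: a0; rewrite le_eqVlt => /predU1P[<-|a0].
      rewrite mul0r scale0r /qy (_ : [set _ | _ in _] = [set 0]) ?inf1//.
      have F0 t : 0 <= t -> F t 0 = 0 by move=> t0; rewrite /F add0r qs.2// subrr.
      apply/seteqP; split=> [_ [t t0 <-]|_ ->]; first by rewrite F0.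
      by exists 0; rewrite /= ?F0.
    have Fa t : F (a * t) (a *: z) = a * F t z.
      rewrite /F -scalerA -scalerDr qs.2 ?(ltW a0)//; last exact: VD (VZ t Vy).
      by rewrite mulrBr mulrA.
    apply/eqP; rewrite eq_le; apply/andP; split.
      rewrite -ler_pdivrMl//; apply: lb_le_inf => // _ [t t0 <-].
      rewrite ler_pdivrMl// -Fa.
      apply: ge_inf; first by apply: hlb; exact: VZ.
      by exists (a * t) => //=; rewrite mulr_ge0// ltW.
    apply: lb_le_inf => // _ [t t0 <-].
    rewrite -(mulVKf (lt0r_neq0 a0) t) Fa ler_pM2l//.
    apply: ge_inf; first exact: hlb.
    by exists (a^-1 * t) => //=; rewrite mulr_ge0// invr_ge0 ltW.
  have qyq z : V z -> qy z <= q z.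
    move=> Vz; apply: ge_inf; first exact: hlb.
    by exists 0 => //=; rewrite /F scale0r addr0 mul0r subr0.
  have := qmin _ qys qyq x Vx; rewrite -lerBrDr => /le_trans; apply.
  apply: ge_inf; first exact: hlb.
  by exists 1 => //=; rewrite /F scale1r mul1r.
have qN x : V x -> q (- x) = - q x.
  move=> Vx; apply/eqP; rewrite -addr_eq0 addrC -qD//; last exact: VN.
  by rewrite subrr sub0.
split=> // a x Vx; have [a0|a0] := leP 0 a; first exact: qs.2.
rewrite -[a]opprK scaleNr qN; last exact: VZ.
by rewrite qs.2 ?mulNr// oppr_ge0 ltW.
Qed.

Lemma hahn_banach p : sublinear_on p ->
  exists2 l, linear_on l & forall x, V x -> l x <= p x.
Proof.
move=> /ex_minimal[q [qs qp qmin]]; exists q => //.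
exact: minimal_linear.
Qed.

(** Dominate by p1 x, the infimum of p (x + c) over c in K. It is finite because p is nonnegative on
    K, lies below p, and satisfies p1 (- x) <= p 0 = 0 for x in K, so a linear functional below it
    is nonnegative on K. *)
Theorem mazur_orlicz p (K : set E) : sublinear_on p -> K `<=` V -> K 0 ->
  (forall x y, K x -> K y -> K (x + y)) ->
  (forall (a : R) x, 0 <= a -> K x -> K (a *: x)) ->
  (forall x, K x -> 0 <= p x) ->
  exists l, [/\ linear_on l, forall x, V x -> l x <= p x & forall x, K x -> 0 <= l x].
Proof.
move=> ps KV K0 KD KZ Kp.
pose p1 x := inf [set p (x + c) | c in K].
have p1b x c : V x -> K c -> - p (- x) <= p (x + c).
  move=> Vx Kc; have := ps.1 (x + c) (- x) (VD Vx (KV _ Kc)) (VN Vx).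
  by rewrite addrAC subrr add0r; have := Kp _ Kc; lra.
have hlb x : V x -> has_lbound [set p (x + c) | c in K].
  by move=> Vx; exists (- p (- x)) => _ [c Kc <-]; exact: p1b.
have ne x : [set p (x + c) | c in K] !=set0 by exists (p (x + 0)); exists 0.
have p1s : sublinear_on p1.
  split=> [z w Vz Vw|a z a0 Vz].
    rewrite -lerBlDr; apply: lb_le_inf => // _ [t t0 <-].
    rewrite lerBlDl -lerBlDr; apply: lb_le_inf => // _ [s s0 <-].
    rewrite lerBlDr; apply: (@le_trans _ _ (p (z + w + (t + s)))).
      by apply: ge_inf; [apply: hlb; exact: VD|exists (t + s) => //; exact: KD].
    by rewrite addrACA [leRHS]addrC ps.1//; apply: VD => //; exact: KV.
  move: a0; rewrite le_eqVlt => /predU1P[<-|a0].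
    rewrite mul0r scale0r; apply/eqP; rewrite eq_le; apply/andP; split.
      by apply: ge_inf; [exact: hlb|exists 0 => //; rewrite addr0 sub0].
    by apply: lb_le_inf => // _ [c Kc <-]; rewrite add0r Kp.
  apply/eqP; rewrite eq_le; apply/andP; split.
    rewrite -ler_pdivrMl//; apply: lb_le_inf => // _ [t t0 <-].
    rewrite ler_pdivrMl// -ps.2 ?(ltW a0)//; last by apply: VD => //; exact: KV.
    apply: ge_inf; first by apply: hlb; exact: VZ.
    by exists (a *: t); [apply: KZ => //; exact: ltW|rewrite scalerDr].
  apply: lb_le_inf => // _ [t t0 <-].
  have Kt : K (a^-1 *: t) by apply: KZ => //; rewrite invr_ge0 ltW.
  rewrite -[t](scalerKV (lt0r_neq0 a0)) -scalerDr ps.2 ?(ltW a0)//; last by apply: VD => //; exact: KV.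
  by rewrite ler_pM2l//; apply: ge_inf; [exact: hlb|exists (a^-1 *: t)].
have [l ll lp1] := hahn_banach p1s; exists l; split=> // x.
  move=> Vx; rewrite (le_trans (lp1 _ Vx))//.
  by apply: ge_inf; [exact: hlb|exists 0 => //; rewrite addr0].
move=> Kx; have Vx := KV _ Kx.
have lN : l (- x) = - l x by rewrite -scaleN1r ll.2// mulN1r.
rewrite -oppr_le0 -lN (le_trans (lp1 _ (VN Vx)))//.
apply: ge_inf; first exact: hlb (VN Vx).
by exists x => //; rewrite addrC subrr sub0.
Qed.

End hahn_banach.

(** * Measurability of compositions *)

Section nets.
Context {R : realType}.

Lemma trunc_dist (a b : R) : 0 <= a -> 0 <= b ->
  Num.trunc a = Num.trunc b -> `|a - b| <= 1.
Proof.
move=> a0 b0 ab; have /andP[h1 h2] := truncn_itv a0; have /andP[h3 h4] := truncn_itv b0.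
by rewrite ab in h1 h2; rewrite -natr1 in h2 h4; rewrite ler_norml; lra.
Qed.

(** Each cell of a cubic grid that contains a point of A in the ball contributes one such point. The
    net is taken inside A because the functions to be approximated are controlled only there. *)
Lemma finite_net p q (A : set 'M[R]_(p, q)) (al de : R) : 0 < de ->
  exists s : seq 'M[R]_(p, q), (forall z, z \in s -> A z /\ n1 z <= al) /\
    forall z, A z -> n1 z <= al -> exists2 z', z' \in s & n1 (z - z') <= de.
Proof.
move=> de0; pose eta := de / (p * q).+1%:R.
have eta0 : 0 < eta by rewrite divr_gt0.
pose K := (Num.trunc (2 * al / eta)).+1.
pose cell (z : 'M[R]_(p, q)) i j := Num.trunc ((z i j + al) / eta).
pose incell (c : {ffun 'I_p * 'I_q -> 'I_K}) (z : 'M[R]_(p, q)) :=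
  [/\ A z, n1 z <= al & forall i j, cell z i j = c (i, j)].
pose s := [seq xget 0 (incell c) | c <- enum {: {ffun 'I_p * 'I_q -> 'I_K}} & `[< incell c !=set0 >]].
exists s; split=> [_ /mapP[c + ->]|z Az zal].
  by rewrite mem_filter => /andP[/asboolP h _]; have [] := xgetPex 0 h.
have zb i j : 0 <= z i j + al <= 2 * al.
  by have := le_trans (le_entry_n1 z i j) zal; rewrite ler_norml; lra.
have cK i j : (cell z i j < K)%N.
  rewrite /K ltnS; apply: le_truncn.
  by rewrite ler_pM2r ?invr_gt0//; have /andP[] := zb i j.
pose c : {ffun 'I_p * 'I_q -> 'I_K} := [ffun ij => Ordinal (cK ij.1 ij.2)].
have cz : incell c z by split=> // i j; rewrite ffunE.
have [Az' z'al z'c] : incell c (xget 0 (incell c)) by apply: xgetPex; exists z.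
exists (xget 0 (incell c)).
  apply/mapP; exists c => //; rewrite mem_filter mem_enum andbT.
  by apply/asboolP; exists z.
set z' := xget 0 (incell c) in Az' z'al z'c *.
apply: (@le_trans _ _ (\sum_(i < p) \sum_(j < q) eta)).
  apply: ler_sum => i _; apply: ler_sum => j _; rewrite !mxE.
  have zb' : 0 <= z' i j + al.
    by have := le_trans (le_entry_n1 z' i j) z'al; rewrite ler_norml; lra.
  have : cell z i j = cell z' i j by rewrite z'c ffunE.
  have /andP[zb0 _] := zb i j.
  move=> /trunc_dist; rewrite -mulrBl normrM (gtr0_norm (_ : 0 < eta^-1)) ?invr_gt0//.
  rewrite ler_pdivrMr// mul1r opprD addrACA subrr addr0; apply.
    by rewrite divr_ge0// ltW.
  by rewrite divr_ge0// ltW.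
rewrite !sumr_const !card_ord -mulrnA -[leLHS]mulr_natl [(q * p)%N]mulnC /eta.
by rewrite mulrC mulrAC -mulrA ler_piMr ?(ltW de0)// ler_pdivrMr// mul1r ler_nat.
Qed.

(* McShane's formula: an L-Lipschitz G is the infimum of z |-> G z + L |. - z|. *)
Definition mcshane p q (G : 'M[R]_(p, q) -> R) (L : R) (z0 : 'M[R]_(p, q)) s x :=
  foldr (fun z a => Num.min (G z + L * n1 (x - z)) a) (G z0 + L * n1 (x - z0)) s.

(** Each term of the minimum is at least G x by the Lipschitz bound, and the term of a net point
    within de of x exceeds G x by at most 2 L de. *)
Lemma mcshane_approx p q (G : 'M[R]_(p, q) -> R) (L de : R) z0 s x :
  (forall z, z \in z0 :: s -> `|G x - G z| <= L * n1 (x - z)) ->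
  (exists2 z, z \in s & n1 (x - z) <= de) -> 0 <= L ->
  `|mcshane G L z0 s x - G x| <= 2 * L * de.
Proof.
move=> GL [z zs zde] L0.
have lo : G x <= mcshane G L z0 s x.
  have : forall z, z \in z0 :: s -> G x <= G z + L * n1 (x - z).
    by move=> y /GL; rewrite ler_norml; lra.
  move: s {zs GL} => s; elim: s => [|y s ih] h /=; first by apply: h; rewrite inE.
  rewrite le_min h ?inE ?eqxx ?orbT//=; apply: ih => t.
  by rewrite inE => /orP[|] ht; apply: h; rewrite !inE ht ?orbT.
have hi : mcshane G L z0 s x <= G z + L * n1 (x - z).
  move: zs {GL lo}; elim: s => //= y s ih; rewrite inE ge_min => /orP[/eqP->|/ih ->].
    by rewrite lexx.
  by rewrite orbT.
have /GL : z \in z0 :: s by rewrite inE zs orbT.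
have : L * n1 (x - z) <= L * de by rewrite ler_wpM2l.
rewrite !ler_norml; lra.
Qed.

(** The net and the constant do not depend on w. A composition G (Z w) w is thus approximated by a
    finite minimum of expressions in the variables G z, with z fixed, and Z; measurability and
    quasi-continuity pass through such a minimum. *)
Lemma locally_lip_approx (p q : nat) (T : Type) (A : set 'M[R]_(p, q))
    (G : 'M[R]_(p, q) -> T -> R) (al e : R) (z0 : 'M[R]_(p, q)) :
  (exists2 L : R, 0 <= L & forall w x z, A x -> A z -> n1 x <= al -> n1 z <= al ->
    `|G x w - G z w| <= L * n1 (x - z)) ->
  A z0 -> n1 z0 <= al -> 0 < e ->
  exists L s, (forall z, z \in z0 :: s -> A z) /\
    forall w x, A x -> n1 x <= al -> `|mcshane (G^~ w) L z0 s x - G x w| <= e.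
Proof.
move=> [L L0 GL] Az0 z0al e0.
have de0 : 0 < e / (2 * (L + 1)) by rewrite divr_gt0// mulr_gt0// ltr_wpDl.
have [s [sA snet]] := finite_net A al de0.
have s'A z : z \in z0 :: s -> A z /\ n1 z <= al.
  by rewrite inE => /orP[/eqP->//|/sA].
exists L, s; split=> [z /s'A[]//|w x Ax xal].
apply: le_trans (mcshane_approx _ (snet _ Ax xal) L0) _.
  by move=> z /s'A[Az zal]; exact: GL.
rewrite mulrA ler_pdivrMr ?mulr_gt0// ?ltr_wpDl//.
by rewrite [leRHS]mulrC ler_wpM2r ?(ltW e0)//; lra.
Qed.

Lemma measurable_fun_sum_seq dd (T : measurableType dd) (I : Type) (s : seq I)
    (f : I -> T -> R) : (forall i, measurable_fun setT (f i)) ->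
  measurable_fun setT (fun x => \sum_(i <- s) f i x).
Proof.
move=> mf; elim: s => [|i s ih].
  by under eq_fun do rewrite big_nil; exact: measurable_cst.
by under eq_fun do rewrite big_cons; apply: measurable_funD.
Qed.

Lemma measurable_mcshane dd (T : measurableType dd) p q (A : set 'M[R]_(p, q))
    (G : 'M[R]_(p, q) -> T -> R) L z0 s (Z : T -> 'M[R]_(p, q)) :
  (forall z, z \in z0 :: s -> measurable_fun setT (G z)) ->
  (forall i j, measurable_fun setT (fun w => Z w i j)) ->
  measurable_fun setT (fun w => mcshane (G^~ w) L z0 s (Z w)).
Proof.
move=> mG mZ.
have mn z : measurable_fun setT (fun w => L * n1 (Z w - z)).
  apply: measurable_funM; first exact: measurable_cst.
  rewrite /n1; apply: measurable_fun_sum_seq => i; apply: measurable_fun_sum_seq => j.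
  apply: measurableT_comp; first exact: normr_measurable.
  under eq_fun do rewrite !mxE.
  by apply: measurable_funB => //; exact: measurable_cst.
elim: s mG => [|z s ih] mG.
  by apply: measurable_funD => //; apply: mG; rewrite inE.
apply: measurable_minr; first by apply: measurable_funD => //; apply: mG; rewrite !inE eqxx orbT.
by apply: ih => y; rewrite inE => /orP[|] hy; apply: mG; rewrite !inE hy ?orbT.
Qed.

Lemma measurable_comp_locally_lip dd (T : measurableType dd) p q (A : set 'M[R]_(p, q))
    (G : 'M[R]_(p, q) -> T -> R) (Z : T -> 'M[R]_(p, q)) :
  (forall al, exists2 L : R, 0 <= L & forall w x z, A x -> A z ->
    n1 x <= al -> n1 z <= al -> `|G x w - G z w| <= L * n1 (x - z)) ->
  (forall z, A z -> measurable_fun setT (G z)) ->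
  (forall w, A (Z w)) -> (forall i j, measurable_fun setT (fun w => Z w i j)) ->
  measurable_fun setT (fun w => G (Z w) w).
Proof.
move=> GL mG ZA mZ; pose z0 := Z point.
(* [h M] is accurate to 1 / (M + 1) on a ball whose radius grows with M, so it converges at every w;
   the summand [n1 z0] keeps the base point in the ball. *)
have /choice[h hP] : forall M : nat, exists h : T -> R, measurable_fun setT h /\
    forall w, n1 (Z w) <= n1 z0 + M%:R -> `|h w - G (Z w) w| <= M.+1%:R^-1.
  move=> M; have M0 : 0 < M.+1%:R^-1 :> R by rewrite invr_gt0.
  have z0M : n1 z0 <= n1 z0 + M%:R by rewrite lerDl.
  have [L [s [sA hs]]] := locally_lip_approx (GL _) (ZA point) z0M M0.
  exists (fun w => mcshane (G^~ w) L z0 s (Z w)); split.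
    by apply: (measurable_mcshane A) => // z /sA; exact: mG.
  by move=> w wM; exact: hs.
apply: (measurable_fun_cvg (h := h)) => [M|w _]; first by have [] := hP M.
apply/cvgrPdist_le => e e0.
have [m mP] : exists m : nat, forall M, (m <= M)%N ->
    n1 (Z w) <= n1 z0 + M%:R /\ M.+1%:R^-1 <= e.
  exists (maxn (Num.trunc (n1 (Z w))).+1 (Num.trunc e^-1).+1) => M.
  rewrite geq_max => /andP[h1 h2]; split.
    rewrite (le_trans (ltW (truncnS_gt _)))// (le_trans (y := M%:R)) ?ler_nat//.
    by rewrite lerDr n1_ge0.
  rewrite invf_ple// ?posrE// (le_trans (ltW (truncnS_gt _)))// ler_nat.
  exact: leqW.
exists m => // M /= /mP[h1 h2]; rewrite distrC.
by apply: le_trans h2; have [_] := hP M; apply.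
Qed.

End nets.

(** * The noise path and its filtration *)

Section paths.
Context {R : realType} {d : nat} {Omega : pointedType} (W : nat -> Omega -> 'cV[R]_d).

Lemma Fspace_genE k : \big[setU/set0]_(j < k) preimage_set_system setT
    (W j.+1 : Omega -> borel 'cV[R]_d) measurable =
  \bigcup_(j < k) preimage_set_system setT
    (W j.+1 : Omega -> borel 'cV[R]_d) measurable.
Proof. by rewrite (bigcup_mkord k (fun j => preimage_set_system _ (W j.+1) _)). Qed.

Lemma measurable_Fspace_le k k' (A : set Omega) : (k <= k')%N ->
  measurable (A : set (Fspace W k)) -> measurable (A : set (Fspace W k')).
Proof.
move=> kk'; apply: smallest_sub; first exact: smallest_sigma_algebra.
move=> B hB; apply: sub_sigma_algebra.
move: hB; rewrite !Fspace_genE => -[j jk hj]; exists j => //.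
exact: leq_trans jk kk'.
Qed.

Lemma measurable_fun_Fspace_le k k' dd (T : measurableType dd) (X : Omega -> T) :
  (k <= k')%N -> measurable_fun setT (X : Fspace W k -> T) ->
  measurable_fun setT (X : Fspace W k' -> T).
Proof.
move=> kk' mX _ B mB; rewrite setTI; apply: (measurable_Fspace_le kk').
by rewrite -[X in measurable X]setTI; exact: mX.
Qed.

Lemma measurable_W j k : (j < k)%N ->
  measurable_fun setT (W j.+1 : Fspace W k -> borel 'cV[R]_d).
Proof.
move=> jk _ B mB; apply: sub_sigma_algebra.
by rewrite Fspace_genE; exists j => //; exists B.
Qed.

Lemma measurable_Wentry j k i : (0 < j <= k)%N ->
  measurable_fun setT ((fun w => W j w i 0) : Fspace W k -> R).
Proof.
case: j => // j /= jk.
apply: (measurableT_comp (f := (fun y : borel 'cV[R]_d => y i 0))).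
  apply: (@measurable_lip _ _ _ _ 1) => x y; rewrite mul1r.
  by have := le_entry_n1 (x - y) i 0; rewrite !mxE.
exact: measurable_W.
Qed.

Lemma measurable_lip_Wmat k (g : 'M[R]_(d, k) -> R) (C : R) :
  (forall x y, `|g x - g y| <= C * n1 (x - y)) ->
  measurable_fun setT ((g \o Wmat W k) : Fspace W k -> R).
Proof.
move=> gC; apply: (@measurable_comp_locally_lip _ _ _ _ _ setT (fun z _ => g z)) => //.
- move=> al; exists `|C| => // w x z _ _ _ _; rewrite (le_trans (gC _ _))//.
  by rewrite ler_wpM2r ?n1_ge0// ler_norm.
- move=> i j; rewrite (_ : (fun w => _) = (fun w => W j.+1 w i 0)).
    by apply: measurable_Wentry; rewrite /= ltn_ord.
  by apply/funext => w; rewrite mxE.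
Qed.

Lemma measurable_bLip_Wmat k (g : 'M[R]_(d, k) -> R) : bLip g ->
  measurable_fun setT ((g \o Wmat W k) : Fspace W k -> R).
Proof. by move=> /bLipP[C _ [_]]; exact: measurable_lip_Wmat. Qed.

(** The preimage of an open set G is the set where the Lipschitz function [distC G] of the path is
    positive. *)
Lemma measurable_Wmat k :
  measurable_fun setT (Wmat W k : Fspace W k -> borel 'M[R]_(d, k)).
Proof.
apply: (measurability _ (erefl : @measurable _ (borel 'M[R]_(d, k)) = <<s open >>)).
move=> _ [G oG <-]; rewrite setTI.
have := measurable_bLip_Wmat (bLip_distC G) measurableT (measurable_itv `]0, +oo[).
rewrite setTI; congr measurable; apply/seteqP; split=> w /=; rewrite in_itv/= andbT.
  by move=> h; apply: contrapT => /distC_eq0; lra.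
exact: distC_gt0.
Qed.

Definition first_cols k k' (kk' : (k <= k')%N) (x : 'M[R]_(d, k')) : 'M[R]_(d, k) :=
  colsub (widen_ord kk') x.

Lemma le_n1_first_cols k k' (kk' : (k <= k')%N) x :
  n1 (first_cols kk' x) <= (d * k)%:R * n1 x.
Proof.
rewrite {1}/n1 (le_trans (y := \sum_(i < d) \sum_(j < k) n1 x))//.
  by apply: ler_sum => i _; apply: ler_sum => j _; rewrite mxE le_entry_n1.
by rewrite !sumr_const !card_ord -mulrnA -[leLHS]mulr_natl [(d * k)%N]mulnC.
Qed.

Lemma Wmat_first_cols k k' (kk' : (k <= k')%N) w :
  first_cols kk' (Wmat W k' w) = Wmat W k w.
Proof. by apply/matrixP => i j; rewrite !mxE. Qed.

Lemma bLip_first_cols k k' (kk' : (k <= k')%N) g : bLip g ->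
  bLip (g \o first_cols kk').
Proof.
move=> /bLipP[C C0 [gb gC]]; apply/bLipP; exists (C * (d * k).+1%:R).
  by rewrite mulr_ge0.
split=> [x|x y] /=; first by rewrite (le_trans (gb _))// ler_peMr// ler1n.
rewrite (le_trans (gC _ _))// -mulrA ler_wpM2l//.
have -> : first_cols kk' x - first_cols kk' y = first_cols kk' (x - y).
  by apply/matrixP => i j; rewrite !mxE.
by rewrite (le_trans (le_n1_first_cols _ _))// ler_wpM2r ?n1_ge0// ler_nat.
Qed.

Lemma LipF_le k k' X : (k <= k')%N -> LipF W k X -> LipF W k' X.
Proof.
move=> kk' [g gL <-]; exists (g \o first_cols kk'); first exact: bLip_first_cols.
by apply/funext => w /=; rewrite Wmat_first_cols.
Qed.

End paths.

(** * The sublinear expectation and its representing measures *)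

Section prob_integrals.
Context {R : realType} {dd : measure_display} {T : measurableType dd}.
Variable P : probability T R.

Lemma Rint_cst (a : R) : \int[P]_x a = a.
Proof.
rewrite Rintegral_cst// -[RHS]mulr1; congr (_ * _).
exact: (congr1 fine (probability_setT P)).
Qed.

Lemma bounded_integrable (f : T -> R) (C : R) : measurable_fun setT f ->
  (forall x, `|f x| <= C) -> P.-integrable setT (EFin \o f).
Proof.
move=> mf fC; apply: (@le_integrable _ _ _ _ _ measurableT _ (cst C%:E)).
- exact/measurable_EFinP.
- by move=> x _ /=; rewrite lee_fin (le_trans (fC x))// ler_norm.
- exact: finite_measure_integrable_cst.
Qed.

Lemma Rint_decr0 (f : nat -> T -> R) (C : R) :
  (forall i, measurable_fun setT (f i)) -> (forall i x, 0 <= f i x <= C) ->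
  (forall x, {homo f^~ x : i j / (i <= j)%N >-> j <= i}) ->
  (forall x (e : R), 0 < e -> exists i, f i x <= e) ->
  forall e : R, 0 < e -> exists i, \int[P]_x f i x <= e.
Proof.
move=> mf fC fmono f0 e e0.
have h1 i : measurable_fun setT (EFin \o f i) by exact/measurable_EFinP.
have h2 (x : T) : setT x -> (EFin \o f i) x @[i --> \oo] --> cst 0%E x.
  move=> _; apply: cvg_EFin; first exact: nearW.
  apply/cvgrPdist_le => e' e'0 /=; have [i fi] := f0 x e' e'0.
  exists i => // j /= ij; rewrite sub0r normrN ger0_norm; last by have /andP[] := fC j x.
  by rewrite (le_trans (fmono x _ _ ij)).
have h4 : P.-integrable setT (cst C%:E) by exact: finite_measure_integrable_cst.
have h5 i (x : T) : setT x -> (`|(EFin \o f i) x| <= cst C%:E x)%E.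
  by move=> _; rewrite /= lee_fin ger0_norm; have /andP[] := fC i x.
have h3 (x : T) : setT x -> cst C%:E x \is a fin_num by [].
have := dominated_cvg measurableT h1 h2 h3 h4 h5.
rewrite integral0 => /fine_cvgP[_ /cvgrPdist_le /(_ e e0)[i _ /(_ i (leqnn i))]].
by rewrite sub0r normrN => h; exists i; rewrite (le_trans (ler_norm _)).
Qed.

End prob_integrals.

Section sublin.
Context {R : realType} {d : nat}.

Lemma rcons_mxB k (x x' : 'M[R]_(d, k)) (y y' : 'cV[R]_d) :
  rcons_mx x y - rcons_mx x' y' = rcons_mx (x - x') (y - y').
Proof. by apply/matrixP => i j; rewrite !mxE; case: unlift => [j'|]; rewrite ?mxE. Qed.

Lemma le_n1_rcons_mx k (x : 'M[R]_(d, k)) (y : 'cV[R]_d) :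
  n1 (rcons_mx x y) <= (d * k.+1)%:R * (n1 x + n1 y).
Proof.
rewrite {1}/n1 (le_trans (y := \sum_(i < d) \sum_(j < k.+1) (n1 x + n1 y)))//.
  apply: ler_sum => i _; apply: ler_sum => j _; rewrite mxE; case: unlift => [j'|].
    by rewrite (le_trans (le_entry_n1 _ _ _))// lerDl n1_ge0.
  by rewrite (le_trans (le_entry_n1 _ _ _))// lerDr n1_ge0.
by rewrite !sumr_const !card_ord -mulrnA -[leLHS]mulr_natl [(d * k.+1)%N]mulnC.
Qed.

Lemma lip_rcons_mx k (phi : 'M[R]_(d, k.+1) -> R) : bLip phi ->
  exists2 C : R, 0 <= C & (forall x, `|phi x| <= C) /\
    forall x x' y y', `|phi (rcons_mx x y) - phi (rcons_mx x' y')| <=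
      C * (n1 (x - x') + n1 (y - y')).
Proof.
move=> /bLipP[C C0 [pb pC]]; exists (C * (d * k.+1).+1%:R); first by rewrite mulr_ge0.
split=> [x|x x' y y']; first by rewrite (le_trans (pb _))// ler_peMr// ler1n.
rewrite (le_trans (pC _ _))// -mulrA ler_wpM2l// rcons_mxB.
rewrite (le_trans (le_n1_rcons_mx _ _))// ler_wpM2r ?ler_nat//.
by rewrite addr_ge0 ?n1_ge0.
Qed.

Lemma bLip_rcons_mx k (phi : 'M[R]_(d, k.+1) -> R) x : bLip phi ->
  bLip (phi \o rcons_mx x).
Proof.
move=> /lip_rcons_mx[C C0 [pb pC]]; apply/bLipP; exists C => //.
by split=> [y|y y'] //=; have := pC x x y y'; rewrite subrr n1_0 add0r.
Qed.

Section sup_int.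
Context {Theta : Type} (theta0 : Theta) (F : Theta -> probability (borel 'cV[R]_d) R).

Lemma bLip_integrable (P : probability (borel 'cV[R]_d) R) (psi : 'cV[R]_d -> R) :
  bLip psi -> P.-integrable setT (EFin \o psi).
Proof.
move=> psiL; have /bLipP[C _ [psiC _]] := psiL.
by apply: (@bounded_integrable _ _ _ P _ C) => //; exact: bLip_measurable.
Qed.

Lemma le_int_sup_int psi th : bLip psi -> \int[F th]_y psi y <= sup_int F psi.
Proof.
move=> psiL; apply: ub_le_sup; last by exists th.
have /bLipP[C _ [psiC _]] := psiL.
exists C => _ [t _ <-]; rewrite -[leRHS](Rint_cst (F t)).
apply: le_Rintegral => //; [exact: bLip_integrable|exact: finite_measure_integrable_cst|].
by move=> y _; exact: le_trans (ler_norm _) (psiC y).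
Qed.

Lemma sup_int_le psi (a : R) : (forall th, \int[F th]_y psi y <= a) ->
  sup_int F psi <= a.
Proof.
move=> h; apply: ge_sup; last by move=> _ [t _ <-].
by exists (\int[F theta0]_y psi y); exists theta0.
Qed.

Lemma sup_int_leD psi psi' (a : R) : bLip psi -> bLip psi' ->
  (forall y, psi y <= psi' y + a) -> sup_int F psi <= sup_int F psi' + a.
Proof.
move=> h h' psia; apply: sup_int_le => th.
apply: (@le_trans _ _ (\int[F th]_y (psi' y + a))).
  apply: le_Rintegral => //; first exact: bLip_integrable.
  by apply: bLip_integrable; apply: bLipD => //; exact: bLip_cst.
rewrite RintegralD//; [|exact: bLip_integrable|exact: finite_measure_integrable_cst].
by rewrite Rint_cst lerD2r le_int_sup_int.
Qed.

Lemma sup_int_cst (a : R) : sup_int F (fun=> a) = a.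
Proof.
apply/eqP; rewrite eq_le sup_int_le/=; last by move=> th; rewrite Rint_cst.
by have := le_int_sup_int theta0 (bLip_cst d 1 a); rewrite Rint_cst.
Qed.

Lemma bLip_sup_int k (phi : 'M[R]_(d, k.+1) -> R) : bLip phi ->
  bLip (fun x => sup_int F (phi \o rcons_mx x)).
Proof.
move=> phiL; have [C C0 [pb pC]] := lip_rcons_mx phiL.
have h x : bLip (phi \o rcons_mx x) by exact: bLip_rcons_mx.
have key x x' : sup_int F (phi \o rcons_mx x) <=
    sup_int F (phi \o rcons_mx x') + C * n1 (x - x').
  apply: sup_int_leD => // y /=; have := pC x x' y y.
  by rewrite subrr n1_0 addr0 ler_norml => /andP[_]; lra.
apply/bLipP; exists C => //; split=> [x|x x'].
  rewrite ler_norml; apply/andP; split.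
    rewrite -(sup_int_cst (- C)) -[leRHS]addr0; apply: sup_int_leD => //.
      exact: bLip_cst.
    by move=> y /=; rewrite addr0; have := pb (rcons_mx x y); rewrite ler_norml => /andP[].
  by apply: sup_int_le => th; rewrite (le_trans (le_int_sup_int _ _))// 
     -(sup_int_cst C) -[leRHS]addr0; apply: sup_int_leD => //; [exact: bLip_cst|
     move=> y /=; rewrite addr0 (le_trans (ler_norm _))].
by have := key x x'; have := key x' x; rewrite (n1C x') ler_norml; lra.
Qed.

Lemma sublin_le k (phi phi' : 'M[R]_(d, k) -> R) : bLip phi -> bLip phi' ->
  (forall x, phi x <= phi' x) -> sublin F phi <= sublin F phi'.
Proof.
elim: k phi phi' => //= k ih phi phi' h h' pp'; apply: ih; try exact: bLip_sup_int.
move=> x; rewrite -[leRHS]addr0; apply: sup_int_leD; try exact: bLip_rcons_mx.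
by move=> y /=; rewrite addr0.
Qed.

Lemma sublin_cst k (a : R) : sublin F (fun _ : 'M[R]_(d, k) => a) = a.
Proof.
elim: k => //= k ih; rewrite -[RHS]ih; congr sublin; apply/funext => x.
exact: sup_int_cst.
Qed.

(** The later variables disappear one at a time because [sup_int] preserves constants. *)
Lemma sublin_first_cols k k' (kk' : (k <= k')%N) (phi : 'M[R]_(d, k) -> R) :
  sublin F (phi \o first_cols kk') = sublin F phi.
Proof.
elim: k' kk' => [|k' ih] kk'.
  have k0 : k = 0%N by case: k kk' phi.
  subst k; rewrite /= /comp; congr phi; apply/matrixP => i [].
  by [].
have [kk|kk] := leqP k k'; last first.
  have ek : k = k'.+1 by apply/eqP; rewrite eqn_leq kk' kk.
  subst k; congr sublin; apply/funext => x /=; congr phi; apply/matrixP => i j.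
  by rewrite mxE; congr (x i _); exact/val_inj.
rewrite /= -(ih kk); congr sublin; apply/funext => x.
rewrite -[RHS]sup_int_cst; congr sup_int; apply/funext => y /=; congr phi.
apply/matrixP => i j; rewrite !mxE.
have -> : widen_ord kk' j = lift ord_max (widen_ord kk j).
  by apply: val_inj; rewrite /= /bump leqNgt (leq_trans (ltn_ord j) kk).
by rewrite liftK.
Qed.

(** Once the first k columns are frozen, h is a nonnegative factor and psi - [sup_int F psi] has
    nonpositive integral under each F th. *)
Lemma sublin_cond_le0 k (h : 'M[R]_(d, k) -> R) (psi : 'cV[R]_d -> R) N (kN : (k < N)%N) :
  bLip h -> (forall x, 0 <= h x) -> bLip psi ->
  sublin F (fun x : 'M[R]_(d, N) => h (first_cols (ltnW kN) x) *
     (psi (col (Ordinal kN) x) - sup_int F psi)) <= 0.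
Proof.
move=> hL h0 psiL; set c := sup_int F psi.
pose g (x : 'M[R]_(d, k.+1)) := h (first_cols (leqnSn k) x) * (psi (col ord_max x) - c).
have -> : (fun x => h (first_cols (ltnW kN) x) * (psi (col (Ordinal kN) x) - c)) =
    g \o first_cols kN.
  apply/funext => x; rewrite /g /=; congr (h _ * (psi _ - c)).
    by apply/matrixP => i j; rewrite !mxE; congr (x i _); exact/val_inj.
  by apply/matrixP => i j; rewrite !mxE; congr (x i _); exact/val_inj.
rewrite sublin_first_cols /= -[leRHS](sublin_cst k 0).
have gE x : g \o rcons_mx x = fun y => h x * (psi y - c).
  apply/funext => y; rewrite /g /=; congr (h _ * (psi _ - c)).
    apply/matrixP => i j; rewrite !mxE.
    have -> : widen_ord (leqnSn k) j = lift ord_max j.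
      by apply: val_inj; rewrite /= /bump leqNgt ltn_ord.
    by rewrite liftK.
  by apply/matrixP => i j; rewrite !mxE unlift_none ord1.
have psicL : bLip (fun y => psi y - c) by apply: bLipB => //; exact: bLip_cst.
apply: sublin_le => [||x].
- apply: bLip_sup_int; apply: bLipM.
    exact: bLip_first_cols.
  apply: bLipB; last exact: bLip_cst.
  have /bLipP[C C0 [pb pC]] := psiL; apply/bLipP; exists C => //; split=> [//|x y].
  rewrite (le_trans (pC _ _))// ler_wpM2l// -linearB {1}/n1.
  rewrite /n1 ler_sum// => i _; rewrite big_ord1 mxE (bigD1 ord_max)//= lerDl.
  exact: sumr_ge0.
- exact: bLip_cst.
rewrite gE; apply: sup_int_le => th; rewrite RintegralZl//; last exact: bLip_integrable.
rewrite mulr_ge0_le0// RintegralB//; [|exact: bLip_integrable|exact: finite_measure_integrable_cst].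
by rewrite Rint_cst subr_le0 le_int_sup_int.
Qed.

End sup_int.
End sublin.

(** * The law of independent copies of one distribution *)

Section product_law.
Context {R : realType} {d : nat} (P : probability (borel 'cV[R]_d) R).

(** For a one-point family the suprema are integrals, so [sublin] becomes the linear functional of
    iterated integration against P. *)
Let F1 (_ : unit) := P.

Lemma sup_int_unit psi : sup_int F1 psi = \int[P]_y psi y.
Proof.
rewrite /sup_int (_ : [set _ | _ in _] = [set \int[P]_y psi y]) ?sup1//.
by apply/seteqP; split=> [_ [t _ <-]|_ ->]; last exists tt.
Qed.

Let int_rcons k (phi : 'M[R]_(d, k.+1) -> R) x := \int[P]_y phi (rcons_mx x y).

Let sublinS k (phi : 'M[R]_(d, k.+1) -> R) :
  sublin F1 phi = sublin F1 (int_rcons phi).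
Proof.
by rewrite /=; congr (sublin F1 _); apply/funext => x; rewrite sup_int_unit.
Qed.

Let bLip_int_rcons k (phi : 'M[R]_(d, k.+1) -> R) : bLip phi -> bLip (int_rcons phi).
Proof.
move=> /(bLip_sup_int tt F1); congr bLip; apply/funext => x.
exact: sup_int_unit.
Qed.

Lemma sublin_unitD k (f g : 'M[R]_(d, k) -> R) : bLip f -> bLip g ->
  sublin F1 (fun x => f x + g x) = sublin F1 f + sublin F1 g.
Proof.
elim: k f g => [//|k ih] f g fL gL; rewrite !sublinS -ih; try exact: bLip_int_rcons.
congr sublin; apply/funext => x; rewrite /int_rcons RintegralD//;
  by apply: bLip_integrable; exact: bLip_rcons_mx.
Qed.

Lemma sublin_unitZ k (a : R) (f : 'M[R]_(d, k) -> R) : bLip f ->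
  sublin F1 (fun x => a * f x) = a * sublin F1 f.
Proof.
elim: k f => [//|k ih] f fL; rewrite !sublinS -ih; last exact: bLip_int_rcons.
congr sublin; apply/funext => x; rewrite /int_rcons RintegralZl//.
by apply: bLip_integrable; exact: bLip_rcons_mx.
Qed.

(** Dominated convergence in the last variable gives the pointwise hypothesis for the function of
    the remaining ones, so the induction proceeds without a product measure. *)
Lemma sublin_unit_cont k (f : nat -> 'M[R]_(d, k) -> R) : (forall i, bLip (f i)) ->
  (forall i x, 0 <= f i x) ->
  (forall x, {homo f^~ x : i j / (i <= j)%N >-> j <= i}) ->
  (forall x (e : R), 0 < e -> exists i, f i x <= e) ->
  forall e : R, 0 < e -> exists i, sublin F1 (f i) <= e.
Proof.
elim: k f => [|k ih] f fL f_ge0 fmono f0 e e0; first by have [i] := f0 0 e e0; exists i.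
have [| | |x e' e'0|i fi] := ih (fun i => int_rcons (f i)) _ _ _ _ e e0.
- by move=> i; exact: bLip_int_rcons.
- by move=> i x; apply: Rintegral_ge0.
- move=> x i j ij; apply: le_Rintegral => //;
    by [apply: bLip_integrable; exact: bLip_rcons_mx|move=> y _; exact: fmono].
- have /bLipP[C C0 [fC _]] := fL 0%N.
  apply: (@Rint_decr0 _ _ _ P (fun i y => f i (rcons_mx x y)) C) => //.
  + by move=> i; apply: bLip_measurable; exact: bLip_rcons_mx.
  + move=> i y; rewrite f_ge0/= (le_trans (fmono _ 0%N i _))//.
    by rewrite (le_trans (ler_norm _)).
  + by move=> y; exact: f0.
by exists i; rewrite sublinS.
Qed.

End product_law.

Section laws.
Context {R : realType} {d : nat} {Theta : Type}.
Context (F : Theta -> probability (borel 'cV[R]_d) R).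
Context {Omega : pointedType} (W : nat -> Omega -> 'cV[R]_d) (N : nat).
Hypothesis A3 : forall Q : probability (borel 'M[R]_(d, N)) R, calA F Q ->
  exists P : probability (Fspace W N) R,
    forall B : set (borel 'M[R]_(d, N)), measurable B ->
      Q B = P (Wmat W N @^-1` B).

(** The passage from functionals to calP; it is used for the product laws and for the functional
    given by Hahn-Banach. *)
Lemma calP_of_functional (l : ('M[R]_(d, N) -> R) -> R) :
  (forall f g, bLip f -> bLip g -> l (fun x => f x + g x) = l f + l g) ->
  (forall a f, bLip f -> l (fun x => a * f x) = a * l f) ->
  (forall f, bLip f -> (forall x, 0 <= f x) -> 0 <= l f) ->
  l (fun=> 1) = 1 ->
  (forall f : nat -> 'M[R]_(d, N) -> R, (forall i, bLip (f i)) ->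
    (forall i x, 0 <= f i x) ->
    (forall x, {homo f^~ x : i j / (i <= j)%N >-> j <= i}) ->
    (forall x (e : R), 0 < e -> exists i, f i x <= e) ->
    forall e : R, 0 < e -> exists i, l (f i) <= e) ->
  (forall f, bLip f -> l f <= sublin F f) ->
  exists2 P : probability (Fspace W N) R, calP F P &
    forall g, bLip g -> \int[P]_w g (Wmat W N w) = l g.
Proof.
move=> lD lZ l0 l1 lc lF; have [Q Ql] := daniell lD lZ l0 l1 lc.
have [|P QP] := A3 (Q := Q); first by move=> g gL; rewrite Ql// lF.
have Pl g : bLip g -> \int[P]_w g (Wmat W N w) = l g.
  move=> gL; rewrite -Ql//; congr fine.
  have mg := bLip_measurable gL; have /bLipP[C _ [gC _]] := gL.
  have := @integral_pushforward _ _ _ _ R _ (@measurable_Wmat _ _ _ W N) P setT (EFin \o g).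
  rewrite preimage_setT => <- //.
  - by apply: eq_measure_integral; [exact: measurable_Wmat|move=> mW A mA _; exact/esym/QP].
  - exact/measurable_EFinP.
  - apply: (@bounded_integrable _ _ _ P (g \o Wmat W N) C).
      exact: measurable_bLip_Wmat.
    by move=> w; exact: gC.
by exists P => // g gL; rewrite Pl// lF.
Qed.

(** Iterated integration against F th lies below [sublin], and its lift gives every W_j the law F
    th. Hence calP is nonempty, and bounds valid over calP become bounds on [sup_int]. *)
Lemma ex_calP_law (th : Theta) : exists2 P : probability (Fspace W N) R, calP F P &
  forall j, (0 < j <= N)%N -> forall psi, bLip psi ->
    \int[P]_w psi (W j w) = \int[F th]_y psi y.
Proof.
have cmp k (phi : 'M[R]_(d, k) -> R) : bLip phi ->
    sublin (fun _ : unit => F th) phi <= sublin F phi.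
  elim: k phi => //= k ih phi phiL.
  have h : bLip (fun x : 'M[R]_(d, k) => sup_int (fun _ : unit => F th) (phi \o rcons_mx x)).
    exact: (bLip_sup_int tt).
  rewrite (le_trans (ih _ h))//; apply: (sublin_le th) => //; first exact: bLip_sup_int.
  by move=> x; rewrite sup_int_unit; apply: le_int_sup_int; exact: bLip_rcons_mx.
have [||||||P PF Pl] := @calP_of_functional (@sublin _ _ _ (fun _ : unit => F th) N).
- exact: sublin_unitD.
- exact: sublin_unitZ.
- move=> f fL f0; rewrite -(sublin_cst tt (fun=> F th) N 0).
  by apply: (sublin_le tt) => //; exact: bLip_cst.
- exact: sublin_cst tt _ N 1.
- exact: sublin_unit_cont.
- exact: cmp.
exists P => // -[//|k] /= kN psi psiL.
pose g (x : 'M[R]_(d, k.+1)) := psi (col ord_max x).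
have gL : bLip g.
  have /bLipP[C C0 [pb pC]] := psiL; apply/bLipP; exists C => //; split=> [x|x y].
    exact: pb.
  rewrite (le_trans (pC _ _))// ler_wpM2l// -linearB /n1.
  rewrite ler_sum// => i _; rewrite big_ord1 mxE (bigD1 ord_max)//= lerDl.
  exact: sumr_ge0.
transitivity (\int[P]_w (g \o first_cols kN) (Wmat W N w)).
  congr Rintegral; apply/funext => w /=; rewrite Wmat_first_cols; congr psi.
  by apply/matrixP => i j; rewrite !mxE ord1.
rewrite Pl; last exact: bLip_first_cols.
rewrite (sublin_first_cols tt) /= -[RHS](sublin_cst tt (fun=> F th) k).
congr sublin; apply/funext => x; rewrite sup_int_unit.
congr Rintegral; apply/funext => y /=; congr psi.
by apply/matrixP => i j; rewrite !mxE unlift_none ord1.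
Qed.

(* The increment W_{k+1} is, under every P in calP, independent of F_k in the
   one-sided sense that its conditional expectations are dominated. *)
Lemma calP_cond_le0 (th : Theta) (P : probability (Fspace W N) R) k h psi : calP F P -> (k < N)%N ->
  bLip h -> (forall x, 0 <= h x) -> bLip psi ->
  \int[P]_w (h (Wmat W k w) * (psi (W k.+1 w) - sup_int F psi)) <= 0.
Proof.
move=> PF kN hL h0 psiL.
apply: le_trans (sublin_cond_le0 th F kN hL h0 psiL).
have := PF (fun x : 'M[R]_(d, N) => h (first_cols (ltnW kN) x) *
  (psi (col (Ordinal kN) x) - sup_int F psi)).
rewrite (_ : (fun w => _) = (fun w => h (Wmat W k w) * (psi (W k.+1 w) - sup_int F psi))).
  apply; apply: bLipM; first exact: bLip_first_cols.
  apply: bLipB; last exact: bLip_cst.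
  have /bLipP[C C0 [pb pC]] := psiL; apply/bLipP; exists C => //; split=> [//|x y].
  rewrite (le_trans (pC _ _))// ler_wpM2l// -linearB /n1.
  rewrite ler_sum// => i _; rewrite big_ord1 mxE (bigD1 (Ordinal kN))//= lerDl.
  exact: sumr_ge0.
apply/funext => w; rewrite Wmat_first_cols; congr (_ * (psi _ - _)).
by apply/matrixP => i j; rewrite !mxE ord1.
Qed.

End laws.

(** * Integrable random variables and conditional expectations *)

Section integrals.
Context {R : realType} {dd : measure_display} {T : measurableType dd}.
Variable P : probability T R.
Implicit Types f g h X Y : T -> R.

Notation intble X := (P.-integrable setT (EFin \o X)).

Lemma intble_measurable X : intble X -> measurable_fun setT X.
Proof. by move=> /measurable_int/measurable_EFinP. Qed.

Lemma intble_le X Y : measurable_fun setT X -> intble Y ->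
  (forall w, `|X w| <= `|Y w|) -> intble X.
Proof.
move=> mX iY XY; apply: (le_integrable measurableT _ _ iY).
  exact/measurable_EFinP.
by move=> w _ /=; rewrite lee_fin.
Qed.

Lemma intble_eq X Y : (forall w, X w = Y w) -> intble X -> intble Y.
Proof. by move=> /funext ->. Qed.

Lemma ae_imp (A B : T -> Prop) : {ae P, forall w, A w} -> (forall w, A w -> B w) ->
  {ae P, forall w, B w}.
Proof. by move=> hA AB; apply: filterS hA => w; exact: AB. Qed.

Lemma ae_imp2 (A B C : T -> Prop) : {ae P, forall w, A w} -> {ae P, forall w, B w} ->
  (forall w, A w -> B w -> C w) -> {ae P, forall w, C w}.
Proof. by move=> hA hB ABC; apply: filterS2 hA hB => w; exact: ABC. Qed.

Lemma intble_cst a : intble (fun=> a).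
Proof. exact: finite_measure_integrable_cst. Qed.

Lemma intbleD X Y : intble X -> intble Y -> intble (fun w => X w + Y w).
Proof. by move=> iX iY; have := integrableD measurableT iX iY. Qed.

Lemma intbleB X Y : intble X -> intble Y -> intble (fun w => X w - Y w).
Proof. by move=> iX iY; have := integrableB measurableT iX iY. Qed.

Lemma intbleZ a X : intble X -> intble (fun w => a * X w).
Proof. by move=> iX; have := integrableZl measurableT a iX. Qed.

Lemma intble_norm X : intble X -> intble (fun w => `|X w|).
Proof. by move=> iX; have := integrable_abse iX. Qed.

Lemma intble_sum (I : Type) (s : seq I) (F : I -> T -> R) :
  (forall i, intble (F i)) -> intble (fun w => \sum_(i <- s) F i w).
Proof.
move=> iF; elim: s => [|i s ih].
  by under eq_fun do rewrite big_nil; exact: intble_cst.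
by under eq_fun do rewrite big_cons; apply: intbleD.
Qed.

Lemma Rint_sum (I : Type) (s : seq I) (F : I -> T -> R) : (forall i, intble (F i)) ->
  \int[P]_w (\sum_(i <- s) F i w) = \sum_(i <- s) \int[P]_w F i w.
Proof.
move=> iF; elim: s => [|i s ih].
  by under eq_Rintegral do rewrite big_nil; rewrite big_nil Rint_cst.
under eq_Rintegral do rewrite big_cons.
by rewrite RintegralD// ?ih ?big_cons//; exact: intble_sum.
Qed.

Lemma intbleM_bounded M X Y : measurable_fun setT X -> (forall w, `|X w| <= M) ->
  intble Y -> intble (fun w => X w * Y w).
Proof.
move=> mX XM iY; apply: (intble_le _ (intbleZ M iY)).
  by apply: measurable_funM => //; exact: intble_measurable.
move=> w; rewrite !normrM ler_wpM2r// (le_trans (XM w))// ler_norm//.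
Qed.

Lemma intbleM_sqr X Y : measurable_fun setT X -> measurable_fun setT Y ->
  intble (fun w => X w ^+ 2) -> intble (fun w => Y w ^+ 2) ->
  intble (fun w => X w * Y w).
Proof.
move=> mX mY iX iY; apply: (intble_le _ (intbleD iX iY)).
  exact: measurable_funM.
move=> w; rewrite [leRHS]ger0_norm ?addr_ge0 ?sqr_ge0// normrM.
rewrite -(real_normK (num_real (X w))) -(real_normK (num_real (Y w))).
by have := sqr_ge0 (`|X w| - `|Y w|); have := normr_ge0 (X w); have := normr_ge0 (Y w); nra.
Qed.

Lemma intble_of_sqr X : measurable_fun setT X -> intble (fun w => X w ^+ 2) -> intble X.
Proof.
move=> mX iX; have := intbleM_sqr (X := X) (Y := fun=> 1) mX (measurable_cst _) iX.
move=> /(_ (intble_cst _)); congr (_.-integrable _ _); apply/funext => w /=.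
by rewrite mulr1.
Qed.

Lemma intble_sqrD X Y : measurable_fun setT X -> measurable_fun setT Y ->
  intble (fun w => X w ^+ 2) -> intble (fun w => Y w ^+ 2) ->
  intble (fun w => (X w + Y w) ^+ 2).
Proof.
move=> mX mY iX iY; apply: (intble_le _ (intbleZ 2 (intbleD iX iY))).
  by apply: measurable_funX; exact: measurable_funD.
move=> w; rewrite ger0_norm ?sqr_ge0// [leRHS]ger0_norm; last first.
  by rewrite mulr_ge0// addr_ge0 ?sqr_ge0.
by have := sqr_ge0 (X w - Y w); rewrite !expr2; lra.
Qed.

Lemma Rint_le X Y : intble X -> intble Y -> (forall w, X w <= Y w) ->
  \int[P]_w X w <= \int[P]_w Y w.
Proof. by move=> iX iY XY; apply: le_Rintegral => // w _. Qed.

Lemma Rint_ae X Y : measurable_fun setT X -> measurable_fun setT Y ->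
  {ae P, forall w, X w = Y w} -> \int[P]_w X w = \int[P]_w Y w.
Proof.
move=> mX mY XY; congr fine; apply: ae_eq_integral => //; [exact/measurable_EFinP..|].
by apply: filterS XY => w /= -> _.
Qed.

Lemma intble_ae X Y : intble X -> measurable_fun setT Y ->
  {ae P, forall w, X w = Y w} -> intble Y.
Proof.
move=> iX mY XY; apply/integrableP; split; first exact/measurable_EFinP.
have /integrableP[_] := iX; congr (_ < _)%E.
apply: ae_eq_integral => //.
- by apply: measurableT_comp => //; apply/measurable_EFinP; exact: intble_measurable.
- by apply: measurableT_comp => //; exact/measurable_EFinP.
- by apply: filterS XY => w /= -> _.
Qed.

Lemma Rint_dom_decr0 (f : nat -> T -> R) g :
  (forall i, measurable_fun setT (f i)) -> intble g -> (forall i x, 0 <= f i x <= g x) ->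
  (forall x, {homo f^~ x : i j / (i <= j)%N >-> j <= i}) ->
  (forall x (e : R), 0 < e -> exists i, f i x <= e) ->
  forall e : R, 0 < e -> exists i, forall j, (i <= j)%N -> \int[P]_x f j x <= e.
Proof.
move=> mf ig fg fmono f0 e e0.
have h1 i : measurable_fun setT (EFin \o f i) by exact/measurable_EFinP.
have h2 (x : T) : setT x -> (EFin \o f i) x @[i --> \oo] --> cst 0%E x.
  move=> _; apply: cvg_EFin; first exact: nearW.
  apply/cvgrPdist_le => e' e'0 /=; have [i fi] := f0 x e' e'0.
  exists i => // j /= ij; rewrite sub0r normrN ger0_norm; last by have /andP[] := fg j x.
  by rewrite (le_trans (fmono x _ _ ij)).
have h5 i (x : T) : setT x -> (`|(EFin \o f i) x| <= (EFin \o g) x)%E.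
  by move=> _; rewrite /= lee_fin ger0_norm; have /andP[] := fg i x.
have h3 (x : T) : setT x -> (EFin \o g) x \is a fin_num by [].
have := dominated_cvg measurableT h1 h2 h3 ig h5.
rewrite integral0 => /fine_cvgP[_ /cvgrPdist_le /(_ e e0)[i _ hi]].
exists i => j ij; have := hi j ij; rewrite sub0r normrN => h.
by rewrite (le_trans (ler_norm _)).
Qed.

Definition clip (M x : R) := Num.max (- M) (Num.min x M).

Lemma clip_id M x : `|x| <= M -> clip M x = x.
Proof. by rewrite ler_norml => /andP[h1 h2]; rewrite /clip min_l// max_r. Qed.

Lemma clip_bound M x : 0 <= M -> `|clip M x| <= M.
Proof.
move=> M0; rewrite ler_norml /clip le_max lexx/= ge_max ge_min lexx orbT andbT.
by lra.
Qed.

Lemma norm_sub_clip M x : 0 <= M -> `|x - clip M x| = Num.max 0 (`|x| - M).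
Proof.
move=> M0; rewrite /clip; have [x0|x0] := lerP 0 x.
  rewrite ?(ger0_norm x0) (@max_r _ _ (- M)); last by rewrite le_min; apply/andP; split; lra.
  case: (lerP x M) => h; first by rewrite subrr normr0 max_l//; lra.
  by rewrite ger0_norm ?max_r//; lra.
rewrite (ltr0_norm x0) min_l; last lra.
case: (lerP (- M) x) => h; first by rewrite subrr normr0 max_l//; lra.
by rewrite opprK ler0_norm ?max_r//; lra.
Qed.

Lemma clip_lip M x y : `|clip M x - clip M y| <= `|x - y|.
Proof.
apply: le_trans (le_dist_max _ _ _ _) _; rewrite subrr normr0 add0r.
by apply: le_trans (le_dist_min _ _ _ _) _; rewrite subrr normr0 addr0.
Qed.

Lemma measurable_clip (D : set T) M X : measurable_fun D X -> measurable_fun D (fun w => clip M (X w)).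
Proof.
move=> mX; apply: measurable_maxr; first exact: measurable_cst.
by apply: measurable_minr => //; exact: measurable_cst.
Qed.

Lemma Rint_tail g : intble g -> forall e : R, 0 < e ->
  exists i0, forall i, (i0 <= i)%N -> \int[P]_x Num.max 0 (`|g x| - i%:R) <= e.
Proof.
move=> ig e e0; have mg := intble_measurable ig.
apply: (Rint_dom_decr0 (f := fun i x => Num.max 0 (`|g x| - i%:R)) _ (intble_norm ig)) => //.
- move=> i; apply: measurable_maxr; first exact: measurable_cst.
  apply: measurable_funB; last exact: measurable_cst.
  exact: measurableT_comp.
- by move=> i x; rewrite le_max lexx/= ge_max normr_ge0/= gerBl.
- move=> x i j ij; rewrite ge_max le_max lexx/= le_max; apply/orP; right.
  by rewrite lerD2l lerN2 ler_nat.
- move=> x e' e'0; exists (Num.trunc `|g x|).+1; rewrite max_l ?(ltW e'0)//.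
  by rewrite subr_le0 ltW// truncnS_gt.
Qed.

(** Monotone convergence with extended integrals, so that it also yields the integrability of g. *)
Lemma ge0_int_le_lim (f : nat -> T -> R) g (a : R) :
  (forall i, measurable_fun setT (f i)) -> (forall i x, 0 <= f i x) ->
  (forall x, {homo f^~ x : i j / (i <= j)%N >-> i <= j}) ->
  (forall x, exists i, forall j, (i <= j)%N -> f j x = g x) ->
  (forall i, (\int[P]_x (f i x)%:E <= a%:E)%E) -> (\int[P]_x (g x)%:E <= a%:E)%E.
Proof.
move=> mf f0 fmono fg fa.
have fgc x : (EFin \o f i) x @[i --> \oo] --> (g x)%:E.
  have [i hi] := fg x; apply: cvg_EFin; first exact: nearW.
  apply: cvg_near_cst.
  by exists i => // j /= ij; rewrite hi.
have := @cvg_monotone_convergence _ T R P setT measurableT (fun i => EFin \o f i).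
have -> : (fun x => limn (fun n => (EFin \o f n) x)) = EFin \o g.
  by apply/funext => x; apply/cvg_lim => //; exact: fgc.
move=> h; have {}h := h (fun i => proj2 (measurable_EFinP _ _) (mf i))
  (fun i x _ => f0 i x) (fun x _ i j ij => fmono x i j ij).
by apply: (cvge_to_le h); exact: nearW.
Qed.

Lemma ge0_intble X (a : R) : measurable_fun setT X -> (forall w, 0 <= X w) ->
  (\int[P]_w (X w)%:E <= a%:E)%E -> intble X.
Proof.
move=> mX X0 Xa; apply/integrableP; split; first exact/measurable_EFinP.
apply: le_lt_trans (ltry a); apply: le_trans Xa.
rewrite le_eqVlt; apply/orP; left; apply/eqP; apply: eq_integral => w _ /=.
by rewrite ger0_norm.
Qed.

Lemma ge0_Rint_le X (a : R) : measurable_fun setT X -> (forall w, 0 <= X w) ->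
  (\int[P]_w (X w)%:E <= a%:E)%E -> \int[P]_w X w <= a.
Proof.
move=> mX X0 Xa; rewrite -lee_fin fineK// integrable_fin_num//.
exact: ge0_intble Xa.
Qed.

Lemma Rint_fineK X : intble X -> (\int[P]_w X w)%:E = (\int[P]_w (X w)%:E)%E.
Proof. by move=> iX; rewrite fineK// integrable_fin_num. Qed.

Lemma markov_ge0_eq0 X : intble X -> (forall w, 0 <= X w) -> \int[P]_w X w <= 0 ->
  {ae P, forall w, X w = 0}.
Proof.
move=> iX X0 X00.
have iX0 : \int[P]_w X w = 0.
  by apply/eqP; rewrite eq_le X00/= Rintegral_ge0.
have : (\int[P]_w `|(X w)%:E| = 0)%E.
  transitivity (\int[P]_w X w)%:E; last by rewrite iX0.
  rewrite Rint_fineK//; apply: eq_integral => w _ /=.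
  by rewrite ger0_norm.
have mX : measurable_fun setT (EFin \o X) by case/integrableP: iX.
move=> /(ae_eq_integral_abs P measurableT mX); apply: filterS => w /(_ I) /=.
by case.
Qed.

End integrals.

Notation intble P X := (P.-integrable setT (EFin \o X)).

(** Approximates a multiple of a bounded function by a sum of indicators with an error of at most
    1. *)
Lemma count_sum_bounds {R : realType} (t : R) n : 0 <= t <= n%:R ->
  t <= \sum_(i < n) (i%:R < t)%R%:R <= t + 1.
Proof.
move=> /andP[t0 tn].
suff : Num.min t n%:R <= \sum_(i < n) (i%:R < t)%R%:R <= t + 1 by rewrite min_l.
elim: n {tn} => [|n /andP[ih1 ih2]]; first by rewrite big_ord0 min_r// lexx addr_ge0.
rewrite big_ord_recr/=; have [nt|nt] := ltP n%:R t; last first.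
  rewrite addr0 ih2 andbT (le_trans _ ih1)// (min_l nt).
  by rewrite ge_min lexx.
rewrite (min_r (ltW nt)) in ih1; rewrite -natr1.
apply/andP; split; first by rewrite (le_trans (y := n%:R + 1)) ?lerD2r// ge_min lexx orbT.
rewrite lerD2r (le_trans _ (ltW nt))//.
apply: (@le_trans _ _ (\sum_(i < n) 1)); last by rewrite sumr_const card_ord.
by apply: ler_sum => i _; case: (_ < _).
Qed.

Lemma le_indic {R : realType} (T : Type) (A B : set T) w : (A w -> B w) ->
  \1_A w <= \1_B w :> R.
Proof.
move=> AB; rewrite !indicE ler_nat; have [/set_mem/AB Bw|] := boolP (w \in A); last by [].
by rewrite mem_set.
Qed.

(** Exchanges the factors a and b against an unbounded x: below the level M the change costs M |b -
    a|, above it the excess of |x|. *)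
Lemma mul_trunc_le {R : realType} (a b x M : R) : 0 <= M -> 0 <= a <= 1 -> 0 <= b <= 1 ->
  a * x <= b * x + (M * `|b - a| + Num.max 0 (`|x| - M)).
Proof.
move=> M0 a01 b01; rewrite -lerBlDl -mulrBl.
apply: le_trans (ler_norm _) _; rewrite normrM distrC.
have : `|b - a| <= 1 by rewrite ler_norml; lra.
move: (normr_ge0 (b - a)) (normr_ge0 x).
move: `|b - a| `|x| => s t s0 t0 s1.
have [tM|tM] := lerP (t - M) 0; last by nra.
by rewrite addr0 mulrC ler_wpM2r//; lra.
Qed.

(** * Lipschitz test functions for the filtration *)

Section filtration.
Context {R : realType} {d : nat} {Omega : pointedType} {W : nat -> Omega -> 'cV[R]_d}.
Context {N : nat} (P : probability (Fspace W N) R).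
Implicit Types (X Y : Omega -> R) (A : set Omega).

Definition mF (V : nat -> Omega -> 'cV[R]_d) k X :=
  measurable_fun setT (X : Fspace V k -> R).

(** The exceptional P-null set is there for quasi-continuous variables of level k, which are limits
    of F_k-measurable functions only almost surely. *)
Definition aeF k X := exists2 X', mF W k X' & {ae P, forall w, X w = X' w}.

Lemma mF_indic k A : (k <= N)%N -> measurable (A : set (Fspace W k)) -> mF W N \1_A.
Proof.
by move=> kN mA; apply: measurable_indic; exact: measurable_Fspace_le mA.
Qed.

Lemma mF_bLip k (h : 'M[R]_(d, k) -> R) : (k <= N)%N -> bLip h -> mF W N (h \o Wmat W k).
Proof.
by move=> kN hL; apply: measurable_fun_Fspace_le kN _; exact: measurable_bLip_Wmat.
Qed.

Lemma intble_bLip k (h : 'M[R]_(d, k) -> R) : (k <= N)%N -> bLip h ->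
  intble P (h \o Wmat W k).
Proof.
move=> kN hL; have /bLipP[C _ [hC _]] := hL.
apply: (@bounded_integrable _ _ _ P (h \o Wmat W k) C); first exact: mF_bLip.
by move=> w; exact: hC.
Qed.

Lemma intble_indic A : measurable (A : set (Fspace W N)) -> intble P (\1_A : Omega -> R).
Proof.
move=> mA; apply: (@bounded_integrable _ _ _ P (\1_A : Omega -> R) 1).
  exact: measurable_indic.
by move=> w; rewrite indicE; case: (_ \in _); rewrite ?normr1 ?normr0.
Qed.

Let unit_bLip k (h : 'M[R]_(d, k) -> R) := bLip h /\ forall x, 0 <= h x <= 1.

Let approx k A := measurable (A : set (Fspace W N)) /\ forall e : R, 0 < e ->
  exists2 h, @unit_bLip k h & \int[P]_w `|\1_A w - h (Wmat W k w)| <= e.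

Let intble_dist k A (h : 'M[R]_(d, k) -> R) : (k <= N)%N ->
  measurable (A : set (Fspace W N)) -> unit_bLip h ->
  intble P (fun w => `|\1_A w - h (Wmat W k w)|).
Proof.
move=> kN mA [hL _]; apply: (intble_norm (P := P)); apply: (intbleB (P := P)).
  exact: intble_indic.
exact: intble_bLip.
Qed.

(** Complements use 1 - h and finite unions use maxima; the rest of a countable union is small by
    dominated convergence. *)
Let approx_sigma k : (k <= N)%N -> sigma_algebra setT (approx k).
Proof.
move=> kN; split.
- split; first exact: measurable0.
  move=> e e0; exists (fun=> 0).
    by split; [exact: bLip_cst|move=> _; rewrite lexx ler01].
  under eq_Rintegral do rewrite indic0 subrr normr0.
  by rewrite Rint_cst ltW.
- move=> A [mA Ah]; split; first by rewrite setTD; exact: measurableC.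
  move=> e e0; have [h [hL h01] hA] := Ah e e0; exists (fun x => 1 - h x).
    by split; [apply: bLipB => //; exact: bLip_cst|move=> x; have := h01 x; lra].
  apply: le_trans hA; rewrite le_eqVlt; apply/orP; left; apply/eqP.
  apply: eq_Rintegral => w _; rewrite setTD indicC.
  rewrite -normrN; congr Num.norm; rewrite indicE.
  by case: (_ \in _) => /=; ring.
- move=> A Ah; have mA i : measurable (A i : set (Fspace W N)) by have [] := Ah i.
  pose U n := \big[setU/set0]_(i < n) A i.
  have mU n : measurable (U n : set (Fspace W N)) by apply: bigsetU_measurable => i _.
  have Uh n : approx k (U n).
    rewrite /U; elim: n => [|n [mUn ih]].
      rewrite big_ord0; split; first exact: measurable0.
      move=> e e0; exists (fun=> 0).
        by split; [exact: bLip_cst|move=> _; rewrite lexx ler01].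
      under eq_Rintegral do rewrite indic0 subrr normr0.
      by rewrite Rint_cst ltW.
    rewrite big_ord_recr/=; split; first exact: measurableU.
    move=> e e0; have e2 : 0 < e / 2 by rewrite divr_gt0.
    have [h [hL h01] hA] := ih _ e2; have [g [gL g01] gA] := (Ah n).2 _ e2.
    have uh : unit_bLip h by []. have ug : unit_bLip g by [].
    have um : unit_bLip (fun x => Num.max (h x) (g x)).
      split; first exact: bLip_max.
      move=> x; have /andP[h0 h1] := h01 x; have /andP[g0 g1] := g01 x.
      by rewrite le_max h0/= ge_max h1 g1.
    exists (fun x => Num.max (h x) (g x)) => //.
    rewrite [leRHS]splitr; apply: le_trans (lerD hA gA).
    rewrite -RintegralD//; [|exact: intble_dist..].
    apply: (Rint_le (P := P)).
    + by apply: (intble_dist kN _ um); exact: measurableU.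
    + by apply: (intbleD (P := P)); exact: intble_dist.
    move=> w; rewrite (_ : \1_(_ `|` _) w = Num.max (\1_(\big[setU/set0]_(i < n) A i) w) (\1_(A n) w)).
      exact: le_dist_max.
    rewrite !indicE in_setU.
    case: (w \in \big[_/_]_(_ < _) _); case: (w \in A n) => /=;
      by rewrite ?maxxx ?(max_l ler01) ?(max_r ler01).
  split; first exact: bigcupT_measurable.
  move=> e e0; have e2 : 0 < e / 2 by rewrite divr_gt0.
  set B := \bigcup_i A i; have mB : measurable (B : set (Fspace W N)) by exact: bigcupT_measurable.
  have UB n w : \1_(U n) w <= \1_B w :> R.
    by apply: le_indic; rewrite /U -bigcup_mkord => -[i _ Aw]; exists i.
  have [n hn] : exists n, forall j, (n <= j)%N -> \int[P]_w (\1_B w - \1_(U j) w) <= e / 2.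
    apply: (@Rint_dom_decr0 _ _ _ P (fun n w => \1_B w - \1_(U n) w) (\1_B)) => //.
    + by move=> n; apply: measurable_funB; exact: measurable_indic.
    + exact: intble_indic.
    + by move=> n w; rewrite subr_ge0 UB/= gerBl.
    + move=> w i j ij; rewrite lerD2l lerN2; apply: le_indic.
      rewrite /U -!bigcup_mkord => -[l /= li Aw].
      by exists l => //=; exact: leq_trans li ij.
    + move=> w e' e'0; have [[i _ Aw]|Bw] := pselect (B w).
        exists i.+1; rewrite !indicE !mem_set ?subrr ?ltW//; last by exists i.
        by rewrite /U -bigcup_mkord; exists i => /=.
      exists 0%N; rewrite /U big_ord0 indic0 subr0 indicE memNset// ltW//.
  have [h uh hA] := (Uh n).2 _ e2.
  exists h => //; rewrite [leRHS]splitr; apply: le_trans (lerD (hn n (leqnn n)) hA).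
  have iBU : intble P (fun w => \1_B w - \1_(U n) w : R).
    by apply: (intbleB (P := P)); exact: intble_indic.
  rewrite -RintegralD//; last exact: intble_dist.
  apply: (Rint_le (P := P)); first exact: intble_dist.
    by apply: (intbleD (P := P)) => //; exact: intble_dist.
  move=> w; rewrite (_ : \1_B w - h _ =
      (\1_B w - \1_(U n) w) + (\1_(U n) w - h (Wmat W k w))); last by rewrite addrA subrK.
  by rewrite (le_trans (ler_normD _ _))// lerD2r ger0_norm// subr_ge0 UB.
Qed.

(* A monotone class argument started at the open sets. *)
Lemma lip_dense k A : (k <= N)%N -> measurable (A : set (Fspace W k)) ->
  forall e : R, 0 < e -> exists h : 'M[R]_(d, k) -> R,
    [/\ bLip h, forall x, 0 <= h x <= 1 &
        \int[P]_w `|\1_A w - h (Wmat W k w)| <= e].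
Proof.
move=> kN mA; suff : approx k A.
  by move=> [_ Ah] e /Ah[h [hL h01] hA]; exists h.
move: A mA; apply: smallest_sub; first exact: approx_sigma.
rewrite Fspace_genE => _ [j /= jk [C mC <-]]; rewrite setTI.
have [ca cb cc] := approx_sigma kN.
move: C mC; apply: smallest_sub.
  split.
  - by rewrite /= preimage_set0.
  - by move=> C hC /=; have := cb _ hC; rewrite !setTD preimage_setC.
  - by move=> C hC /=; rewrite preimage_bigcup; exact: cc.
move=> G oG; have mG : measurable ((W j.+1 @^-1` G) : set (Fspace W N)).
  rewrite -[X in measurable X]setTI; apply: (measurable_W (leq_trans jk kN)) => //.
  exact: sub_sigma_algebra.
split=> // e e0.
pose h n (x : 'M[R]_(d, k)) := obump G n (col (Ordinal jk) x).
have hE n w : h n (Wmat W k w) = obump G n (W j.+1 w).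
  by rewrite /h; congr obump; apply/matrixP => a b; rewrite !mxE ord1.
have uh n : unit_bLip (h n).
  split; last by move=> x; rewrite obump_ge0 obump_le1.
  have /bLipP[C C0 [pb pC]] := bLip_obump G n; apply/bLipP; exists C => //.
  split=> [x|x y]; first exact: pb.
  rewrite (le_trans (pC _ _))// ler_wpM2l// -linearB /n1.
  rewrite ler_sum// => i _; rewrite big_ord1 mxE (bigD1 (Ordinal jk))//= lerDl.
  exact: sumr_ge0.
have hle n w : 0 <= \1_(W j.+1 @^-1` G) w - h n (Wmat W k w).
  rewrite subr_ge0 hE indicE; have [/set_mem _|/negP Gw] := boolP (w \in _).
    exact: obump_le1.
  by rewrite obump_eq0// => h'; apply: Gw; rewrite mem_set.
have [n hn] : exists n, forall i, (n <= i)%N ->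
    \int[P]_w (\1_(W j.+1 @^-1` G) w - h i (Wmat W k w)) <= e.
  apply: (@Rint_dom_decr0 _ _ _ P
    (fun n w => \1_(W j.+1 @^-1` G) w - h n (Wmat W k w)) (\1_(W j.+1 @^-1` G))) => //.
  - move=> n; apply: measurable_funB; first exact: measurable_indic.
    by apply: (mF_bLip kN); have [] := uh n.
  - exact: intble_indic.
  - by move=> n w; rewrite hle/= gerBl obump_ge0.
  - by move=> w i l il; rewrite lerD2l lerN2; exact: obump_mono.
  - move=> w e' e'0; have [Gw|Gw] := pselect (G (W j.+1 w)).
      have [n /(_ n (leqnn n)) hn] := obump_eq1 oG Gw.
      by exists n; rewrite hE hn indicE mem_set// subrr ltW.
    by exists 0%N; rewrite hE obump_eq0// indicE memNset// subrr ltW.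
exists (h n) => //; apply: le_trans (hn n (leqnn n)).
by under eq_Rintegral do rewrite ger0_norm ?hle//.
Qed.

(** Replaces a Lipschitz test function by the indicator it approximates; as X may be unbounded, it
    is first cut at a level M, and the approximation is taken finer than e / (2 M). *)
Lemma indic_test_ge0 k X A : (k <= N)%N -> intble P X ->
  (forall h : 'M[R]_(d, k) -> R, bLip h -> (forall x, 0 <= h x <= 1) ->
    0 <= \int[P]_w (h (Wmat W k w) * X w)) ->
  measurable (A : set (Fspace W k)) -> 0 <= \int[P]_w (\1_A w * X w).
Proof.
move=> kN iX hX mA; apply/ler_addgt0Pr => e e0.
have e2 : 0 < e / 2 by rewrite divr_gt0.
have [M /(_ M (leqnn M)) XM] := Rint_tail iX e2.
have e2M : 0 < e / 2 / M.+1%:R by rewrite divr_gt0.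
have [h [hL h01 hA]] := lip_dense kN mA e2M.
have mXN := intble_measurable iX.
have mAN := measurable_Fspace_le kN mA.
have ihX : intble P (fun w => h (Wmat W k w) * X w).
  apply: (intbleM_bounded (M := 1) (P := P) _ _ iX); first exact: mF_bLip.
  by move=> w; have /andP[h0 h1] := h01 (Wmat W k w); rewrite ger0_norm.
have iAX : intble P (fun w => \1_A w * X w).
  apply: (intbleM_bounded (M := 1) (P := P) _ _ iX); first exact: measurable_indic.
  by move=> w; rewrite indicE; case: (_ \in _); rewrite ?normr1 ?normr0.
have iAh : intble P (fun w => `|\1_A w - h (Wmat W k w)|) by exact: intble_dist.
have iM : intble P (fun w => Num.max 0 (`|X w| - M%:R)).
  apply: (intble_le _ iX).
    apply: measurable_maxr; first exact: measurable_cst.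
    by apply: measurable_funB; [exact: measurableT_comp|exact: measurable_cst].
  move=> w; rewrite ger0_norm ?le_max ?lexx// ge_max normr_ge0/=.
  by rewrite gerBl.
apply: le_trans (hX h hL h01) _.
apply: (@le_trans _ _ (\int[P]_w (\1_A w * X w) +
  (\int[P]_w (M%:R * `|\1_A w - h (Wmat W k w)|) +
   \int[P]_w (Num.max 0 (`|X w| - M%:R))))).
  rewrite -RintegralD//; last exact: (intbleZ (P := P)).
  rewrite -RintegralD//; last first.
    by apply: (intbleD (P := P)) => //; exact: (intbleZ (P := P)).
  apply: (Rint_le (P := P)) => //.
    by do !apply: (intbleD (P := P)) => //; exact: (intbleZ (P := P)).
  by move=> w; apply: mul_trunc_le => //; rewrite indicE; case: (_ \in _); rewrite ?lexx ?ler01.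
rewrite lerD2l [leRHS]splitr; apply: lerD => //.
rewrite RintegralZl//; apply: (@le_trans _ _ (M%:R * (e / 2 / M.+1%:R))).
  by rewrite ler_wpM2l.
by rewrite mulrCA mulrC ler_piMl ?(ltW e2)// ler_pdivrMr// mul1r ler_nat.
Qed.

(** The function (n + 1) h is within 1 of a sum of indicators of F_k-sets, so (n + 1) E[h X] + E|X|
    >= 0 for every n; a negative E[h X] would contradict this for large n. *)
Lemma indic_test_ext k X (h : Omega -> R) M : (k <= N)%N -> intble P X ->
  (forall A, measurable (A : set (Fspace W k)) -> 0 <= \int[P]_w (\1_A w * X w)) ->
  mF W k h -> (forall w, 0 <= h w <= M) -> 0 <= \int[P]_w (h w * X w).
Proof.
move=> kN iX hX mh hM.
have mhN : mF W N h := measurable_fun_Fspace_le kN mh.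
have ihX : intble P (fun w => h w * X w).
  apply: (intbleM_bounded (M := M) (P := P) _ _ iX) => //.
  by move=> w; have /andP[h0 h1] := hM w; rewrite ger0_norm.
have M0 : 0 <= M by have /andP[] := hM point; exact: le_trans.
have iXn := intble_norm iX.
suff key n : 0 <= n.+1%:R * \int[P]_w (h w * X w) + \int[P]_w `|X w|.
  rewrite leNgt; apply/negP => neg.
  pose n := Num.trunc (\int[P]_w `|X w| / - \int[P]_w (h w * X w)).
  have := truncnS_gt (\int[P]_w `|X w| / - \int[P]_w (h w * X w)).
  rewrite -/n ltr_pdivrMr ?oppr_gt0// mulrN ltNge => /negP; apply.
  by rewrite -subr_ge0 opprK addrC key.
pose K := (Num.trunc (n.+1%:R * M)).+1.
pose A i := [set w | i%:R < n.+1%:R * h w].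
have mA i : measurable (A i : set (Fspace W k)).
  rewrite -[A i]setTI -[A i]/((fun w => i%:R < n.+1%:R * h w) @^-1` [set true]).
  apply: measurable_fun_ltr => //.
  by apply: measurable_funM => //; exact: measurable_cst.
pose s w : R := \sum_(i < K) \1_(A i) w.
have iAX i : intble P (fun w => \1_(A i) w * X w).
  apply: (intbleM_bounded (M := 1) (P := P) _ _ iX); first exact: mF_indic (mA i).
  by move=> w; rewrite indicE; case: (_ \in _); rewrite ?normr1 ?normr0.
have : 0 <= \int[P]_w (s w * X w).
  rewrite /s; under eq_Rintegral do rewrite mulr_suml.
  by rewrite (Rint_sum (P := P))//; apply: sumr_ge0 => i _; exact: hX.
move=> /le_trans; apply; rewrite -RintegralZl// -RintegralD//; last exact: (intbleZ (P := P)).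
apply: (Rint_le (P := P)).
- have : intble P (fun w => \sum_(i < K) (\1_(A i) w * X w)) by exact: intble_sum.
  by congr (integrable P setT _); apply/funext => w /=; rewrite mulr_suml.
- by apply: (intbleD (P := P)) => //; exact: (intbleZ (P := P)).
move=> w; rewrite mulrA -lerBlDl -mulrBl.
apply: le_trans (ler_norm _) _; rewrite normrM ler_piMl//.
have [h0 h1] := andP (hM w).
have /count_sum_bounds/andP[c1 c2] : 0 <= n.+1%:R * h w <= K%:R.
  rewrite mulr_ge0//= ltW// (le_lt_trans _ (truncnS_gt _))//.
  by rewrite ler_wpM2l.
have -> : s w = \sum_(i < K) (i%:R < n.+1%:R * h w)%R%:R.
  by apply: eq_bigr => i _; rewrite indicE /A mem_setE.
by rewrite ler_norml; apply/andP; split; lra.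
Qed.

End filtration.

(** The weight is chosen so that a bound E[(V r)^2] <= C E[r^2] turns the last term into E[r^2] / 2,
    which can be absorbed. *)
Lemma young_ineq {R : realType} (C x v r : R) : 0 < C ->
  r * (x * v) <= C / 2 * x ^+ 2 + (2 * C)^-1 * (v * r) ^+ 2.
Proof.
move=> C0; rewrite -(@ler_pM2l _ (2 * C)) ?mulr_gt0//.
have -> : 2 * C * (C / 2 * x ^+ 2 + (2 * C)^-1 * (v * r) ^+ 2) =
  C ^+ 2 * x ^+ 2 + (v * r) ^+ 2 by field; rewrite lt0r_neq0.
by have := sqr_ge0 (C * x - v * r); rewrite !expr2; lra.
Qed.

(** * Conditional expectations *)

Section conditional_expectation.
Context {R : realType} {d : nat} {Omega : pointedType} {W : nat -> Omega -> 'cV[R]_d}.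
Context {N : nat} (P : probability (Fspace W N) R).
Implicit Types (X Y : Omega -> R) (A : set Omega).

Lemma Rint_indicM X A : \int[P]_w (\1_A w * X w) = \int[P]_(w in A) X w.
Proof.
rewrite [RHS]Rintegral_mkcond; apply: eq_Rintegral => w _.
by rewrite /patch indicE; case: (_ \in _); rewrite ?mul1r ?mul0r.
Qed.

Lemma mF_le k k' X : (k <= k')%N -> mF W k X -> mF W k' X.
Proof. exact: measurable_fun_Fspace_le. Qed.

Lemma mF_aeF k X : mF W k X -> aeF P k X.
Proof. by move=> mX; exists X => //; exact: aeW. Qed.

Lemma aeF_map2 k (op : R -> R -> R) X Y :
  (forall X' Y', mF W k X' -> mF W k Y' -> mF W k (fun w => op (X' w) (Y' w))) ->
  aeF P k X -> aeF P k Y -> aeF P k (fun w => op (X w) (Y w)).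
Proof.
move=> hop [X' mX' XX'] [Y' mY' YY']; exists (fun w => op (X' w) (Y' w)); first exact: hop.
by apply: (ae_imp2 XX' YY') => w -> ->.
Qed.

Lemma aeFD k X Y : aeF P k X -> aeF P k Y -> aeF P k (fun w => X w + Y w).
Proof. by apply: aeF_map2 => X' Y' mX mY; exact: measurable_funD. Qed.

Lemma aeFM k X Y : aeF P k X -> aeF P k Y -> aeF P k (fun w => X w * Y w).
Proof. by apply: aeF_map2 => X' Y' mX mY; exact: measurable_funM. Qed.

Lemma aeF_cst k (a : R) : aeF P k (fun=> a).
Proof. by apply: mF_aeF; exact: measurable_cst. Qed.

Lemma aeF_sum k (I : Type) (s : seq I) (F : I -> Omega -> R) :
  (forall i, aeF P k (F i)) -> aeF P k (fun w => \sum_(i <- s) F i w).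
Proof.
move=> hF; elim: s => [|i s ih].
  by under eq_fun do rewrite big_nil; exact: aeF_cst.
by under eq_fun do rewrite big_cons; apply: aeFD.
Qed.

Lemma aeF_comp k (h : R -> R) X :
  (forall X', mF W k X' -> mF W k (fun w => h (X' w))) ->
  aeF P k X -> aeF P k (fun w => h (X w)).
Proof.
move=> hh [X' mX' XX']; exists (fun w => h (X' w)); first exact: hh.
by apply: (ae_imp XX') => w ->.
Qed.

(** The upper limit of the F_k-measurable versions is F_k-measurable even at points where they fail
    to converge. *)
Lemma aeF_lim k (X_ : nat -> Omega -> R) X : (forall i, aeF P k (X_ i)) ->
  {ae P, forall w, X_ i w @[i --> \oo] --> X w} -> aeF P k X.
Proof.
move=> h cvX; have /choice[X' X'P] : forall i, exists X', mF W k X' /\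
    {ae P, forall w, X_ i w = X' w}.
  by move=> i; have [X' mX' XX'] := h i; exists X'.
exists (fun w => fine (limn_esup (fun i => (X' i w)%:E))).
  have hl : measurable_fun setT
      ((fun w => limn_esup (fun i => (X' i w)%:E)) : Fspace W k -> \bar R).
    by apply: measurable_fun_limn_esup => i; apply/measurable_EFinP; have [] := X'P i.
  by apply: (measurableT_comp _ hl); exact: fine_measurable.
have /ae_foralln : forall i, {ae P, forall w, X_ i w = X' i w} by move=> i; have [] := X'P i.
move=> XX'; apply: (ae_imp2 cvX XX') => w cw {}XX'.
have cX' : (X' i w)%:E @[i --> \oo] --> (X w)%:E.
  apply: cvg_EFin; first exact: nearW.
  by under eq_fun do rewrite -XX'.
by have [_ ->] := cvg_limn_einf_sup cX'.
Qed.

(** The hypothesis is tested on the set where the F_k-measurable version of X is negative. *)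
Lemma ae_ge0 k X : (k <= N)%N -> intble P X -> aeF P k X ->
  (forall A, measurable (A : set (Fspace W k)) -> 0 <= \int[P]_w (\1_A w * X w)) ->
  {ae P, forall w, 0 <= X w}.
Proof.
move=> kN iX [X' mX' XX'] hX; have mX := intble_measurable iX.
have mX'N := mF_le kN mX'.
pose A := [set w | X' w < 0].
have mA : measurable (A : set (Fspace W k)).
  rewrite -[A]setTI -[A]/((fun w => X' w < 0) @^-1` [set true]).
  by apply: measurable_fun_ltr => //; exact: measurable_cst.
have mAN := measurable_Fspace_le kN mA.
have iAX : intble P (fun w => \1_A w * X w).
  apply: (intbleM_bounded (M := 1) (P := P) _ _ iX); first exact: measurable_indic.
  by move=> w; rewrite indicE; case: (_ \in _); rewrite ?normr1 ?normr0.
have mAX' : mF W N (fun w => \1_A w * X' w).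
  by apply: measurable_funM => //; exact: measurable_indic.
have aeE : {ae P, forall w, \1_A w * X w = \1_A w * X' w}.
  by apply: (ae_imp XX') => w ->.
have iAX' := intble_ae iAX mAX' aeE.
have h0 w : 0 <= - (\1_A w * X' w).
  rewrite oppr_ge0 indicE; have [|_] := boolP (w \in A); last by rewrite mul0r.
  by move=> /set_mem /ltW; rewrite mul1r.
have : {ae P, forall w, - (\1_A w * X' w) = 0}.
  apply: markov_ge0_eq0 => //.
    by apply: intble_eq (intbleZ (-1) iAX') => w; rewrite mulN1r.
  under eq_Rintegral do rewrite -mulN1r.
  rewrite RintegralZl// mulN1r oppr_le0.
  rewrite -(Rint_ae (P := P) _ mAX' aeE) ?hX//.
  exact: intble_measurable iAX.
move=> h; apply: (ae_imp2 XX' h) => w -> {}h; rewrite leNgt; apply/negP => Xw.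
by move: h; rewrite indicE mem_set// mul1r; lra.
Qed.

(** Since E[X] = 0, h may be shifted to the nonnegative h + M, where [indic_test_ext] applies;
    exchanging X and - X gives equality. *)
Lemma pull_out_bounded k X (h : Omega -> R) M : (k <= N)%N -> intble P X ->
  (forall A, measurable (A : set (Fspace W k)) -> \int[P]_w (\1_A w * X w) = 0) ->
  mF W k h -> (forall w, `|h w| <= M) -> \int[P]_w (h w * X w) = 0.
Proof.
move=> kN iX hX mh hM.
have M0 : 0 <= M by apply: le_trans (hM point).
have hpos Y : intble P Y ->
    (forall A, measurable (A : set (Fspace W k)) -> \int[P]_w (\1_A w * Y w) = 0) ->
    0 <= \int[P]_w (h w * Y w).
  move=> iY hY.
  have hM2 w : 0 <= h w + M <= 2 * M by have := hM w; rewrite ler_norml; lra.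
  have mhM : mF W k (fun w => h w + M) by apply: measurable_funD => //; exact: measurable_cst.
  have := indic_test_ext kN iY _ mhM hM2.
  rewrite (_ : \int[P]_w ((h w + M) * Y w) = \int[P]_w (h w * Y w)).
    by apply=> A mA; rewrite hY.
  under eq_Rintegral do rewrite mulrDl.
  rewrite RintegralD//; last 2 first.
  - by apply: (intbleM_bounded (M := M) (P := P)) => //; exact: mF_le mh.
  - exact: intbleZ.
  rewrite RintegralZl//; have := hY setT (@measurableT _ (Fspace W k)).
  under eq_Rintegral do rewrite indicT mul1r.
  by move=> ->; rewrite mulr0 addr0.
apply/eqP; rewrite eq_le hpos// andbT -oppr_ge0.
have iN : intble P (fun w => - 1 * X w) by exact: intbleZ.
have ihX : intble P (fun w => h w * X w).
  by apply: (intbleM_bounded (M := M) (P := P)) => //; exact: mF_le mh.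
have := hpos _ iN; rewrite (_ : \int[P]_w (h w * (-1 * X w)) = - \int[P]_w (h w * X w)).
  apply=> A mA; transitivity (- 1 * \int[P]_w (\1_A w * X w)); last by rewrite hX// mulr0.
  rewrite -RintegralZl//; last first.
    apply: (intbleM_bounded (M := 1) (P := P) _ _ iX).
      by apply: measurable_indic; exact: measurable_Fspace_le mA.
    by move=> w; rewrite indicE; case: (_ \in _); rewrite ?normr1 ?normr0.
  by apply: eq_Rintegral => w _; rewrite mulrCA.
transitivity (- 1 * \int[P]_w (h w * X w)); last by rewrite mulN1r.
rewrite -RintegralZl//.
by apply: eq_Rintegral => w _; rewrite mulrCA.
Qed.

(** The factor z is clipped at n, where the bounded case applies to its F_k-measurable version; the
    remainder vanishes by domination with |z (X - Y)|. *)
Lemma pull_out k X Y (z : Omega -> R) : (k <= N)%N -> cond_exp P k X Y ->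
  aeF P k z -> mF W N z -> intble P (fun w => z w * X w) ->
  intble P (fun w => z w * Y w) ->
  \int[P]_w (z w * X w) = \int[P]_w (z w * Y w).
Proof.
move=> kN [iX mY iY XY] [z' mz' zz'] mz izX izY.
have iXY : intble P (fun w => X w - Y w) by exact: intbleB.
have hXY A : measurable (A : set (Fspace W k)) -> \int[P]_w (\1_A w * (X w - Y w)) = 0.
  move=> mA; rewrite Rint_indicM RintegralB//; last 3 first.
  - exact: measurable_Fspace_le mA.
  - by apply: integrableS iX => //; exact: measurable_Fspace_le mA.
  - by apply: integrableS iY => //; exact: measurable_Fspace_le mA.
  by rewrite XY// subrr.
have izXY : intble P (fun w => z w * (X w - Y w)).
  by apply: intble_eq (intbleB izX izY) => w; rewrite mulrBr.
apply/eqP; rewrite -subr_eq0 -RintegralB//.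
under eq_Rintegral do rewrite -mulrBr.
rewrite -normr_le0; apply/ler_addgt0Pr => e e0; rewrite add0r.
have mXY := intble_measurable iXY.
have mdecr i : mF W N (fun w => `|z w - clip i%:R (z w)| * `|X w - Y w|).
  apply: measurable_funM; apply: measurableT_comp => //.
  by apply: measurable_funB => //; exact: measurable_clip.
have [n /(_ n (leqnn n)) hn] : exists i, forall j, (i <= j)%N ->
    \int[P]_w (`|z w - clip j%:R (z w)| * `|X w - Y w|) <= e.
  apply: (@Rint_dom_decr0 _ _ _ P (fun j w => `|z w - clip j%:R (z w)| * `|X w - Y w|)
    (fun w => `|z w * (X w - Y w)|)) => //.
  - exact: intble_norm.
  - move=> i w; rewrite mulr_ge0//= normrM ler_wpM2r// norm_sub_clip//.
    by rewrite ge_max normr_ge0/= gerBl.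
  - move=> w i j ij; rewrite ler_wpM2r// !norm_sub_clip// ge_max le_max lexx/=.
    by rewrite le_max lerD2l lerN2 ler_nat ij orbT.
  - move=> w e' e'0; exists (Num.trunc `|z w|).+1.
    by rewrite clip_id ?subrr ?normr0 ?mul0r ?ltW// truncnS_gt.
have mcz' : mF W k (fun w => clip n%:R (z' w)) by exact: measurable_clip.
have b0 : 0 <= n%:R :> R by [].
have h0 : \int[P]_w (clip n%:R (z' w) * (X w - Y w)) = 0.
  by apply: (pull_out_bounded (M := n%:R) kN iXY hXY) => // w; exact: clip_bound.
have icz : intble P (fun w => clip n%:R (z w) * (X w - Y w)).
  apply: (intbleM_bounded (M := n%:R) (P := P)) => //; first exact: measurable_clip.
  by move=> w; exact: clip_bound.
have h1 : \int[P]_w (clip n%:R (z w) * (X w - Y w)) = 0.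
  rewrite -h0; apply: Rint_ae; first exact: intble_measurable icz.
    by apply: measurable_funM => //; exact: mF_le mcz'.
  by apply: (ae_imp zz') => w ->.
apply: le_trans hn; rewrite -[X in `|X|]subr0 -h1 -RintegralB//.
under eq_Rintegral do rewrite -mulrBl.
have iB : intble P (fun w => (z w - clip n%:R (z w)) * (X w - Y w)).
  by apply: intble_eq (intbleB izXY icz) => w; rewrite mulrBl.
apply: le_trans (le_normr_Rintegral measurableT iB) _.
by under eq_Rintegral do rewrite normrM.
Qed.

(* E[Y^2] <= C E[X^2] for Y = E[X V | F_k] as soon as E[V^2 | F_k] <= C. *)
Lemma cond_exp_sqr (C : R) k X (V : Omega -> R) Y : (k <= N)%N -> 0 < C ->
  cond_exp P k (fun w => X w * V w) Y -> mF W N X -> mF W N V ->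
  intble P (fun w => X w ^+ 2) ->
  (forall r M, mF W k r -> (forall w, `|r w| <= M) ->
     intble P (fun w => (V w * r w) ^+ 2) /\
     \int[P]_w (V w * r w) ^+ 2 <= C * \int[P]_w r w ^+ 2) ->
  intble P (fun w => Y w ^+ 2).
Proof.
move=> kN C0 XY mX mV iX hV; have [iXV mY iY _] := XY.
have mYN := mF_le kN mY.
pose A i := [set w | `|Y w| <= i%:R].
have mA i : measurable (A i : set (Fspace W k)).
  rewrite -[A i]setTI -[A i]/((fun w => `|Y w| <= i%:R) @^-1` [set true]).
  by apply: measurable_fun_ler => //; exact: measurableT_comp.
(* Cutting Y where |Y| > i gives a bounded F_k-measurable [r i] with r Y = r^2. Pairing it with X V
   bounds E[r^2] by half of itself plus C / 2 times E[X^2], and then i grows. *)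
pose r i w := \1_(A i) w * Y w.
have mr i : mF W k (r i).
  by apply: measurable_funM => //; exact: measurable_indic.
have rM i w : `|r i w| <= i%:R.
  rewrite /r indicE; have [/set_mem|_] := boolP (w \in A i); first by rewrite mul1r.
  by rewrite mul0r normr0.
have rY i w : r i w * Y w = r i w ^+ 2.
  rewrite /r indicE; case: (_ \in _); first by rewrite mul1r expr2.
  by rewrite !mul0r expr0n.
have ir2 i : intble P (fun w => r i w ^+ 2).
  apply: (intble_le (P := P) _ (intble_cst P (i%:R ^+ 2))).
    by apply: measurable_funX; exact: mF_le (mr i).
  by move=> w; rewrite !normrX lerXn2r ?nnegrE// normr_nat.
apply: (@ge0_intble _ _ _ P (fun w => Y w ^+ 2) (C * \int[P]_w X w ^+ 2)).
- exact: measurable_funX.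
- by move=> w; exact: sqr_ge0.
apply: (@ge0_int_le_lim _ _ _ P (fun i w => r i w ^+ 2)).
- by move=> i; apply: measurable_funX; exact: mF_le (mr i).
- by move=> i w; exact: sqr_ge0.
- move=> w i j ij; rewrite /r !indicE; have [/set_mem Ai|_] := boolP (w \in A i).
    rewrite mem_set//=; apply: le_trans Ai _; by rewrite ler_nat.
  by rewrite mul0r expr0n/= sqr_ge0.
- move=> w; exists (Num.trunc `|Y w|).+1 => j hj.
  rewrite /r indicE mem_set ?mul1r// /A/= (le_trans (ltW (truncnS_gt _)))// ler_nat//.
move=> i; rewrite -Rint_fineK// lee_fin.
have [iVr hVr] := hV (r i) i%:R (mr i) (rM i).
have irXV : intble P (fun w => r i w * (X w * V w)).
  by apply: (intbleM_bounded (M := i%:R) (P := P)) => //; exact: mF_le (mr i).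
have E1 : \int[P]_w (r i w * (X w * V w)) = \int[P]_w r i w ^+ 2.
  rewrite (pull_out kN XY) //.
  - by apply: eq_Rintegral => w _; exact: rY.
  - exact: mF_aeF.
  - exact: mF_le (mr i).
  - by apply: intble_eq (ir2 i) => w; rewrite rY.
have : \int[P]_w (r i w * (X w * V w)) <=
    \int[P]_w (C / 2 * X w ^+ 2 + (2 * C)^-1 * (V w * r i w) ^+ 2).
  apply: Rint_le => //; first by apply: intbleD; exact: intbleZ.
  by move=> w; exact: young_ineq.
rewrite E1 RintegralD//; [|exact: intbleZ..].
rewrite !RintegralZl// => h.
have h2 : (2 * C)^-1 * \int[P]_w (V w * r i w) ^+ 2 <= 2^-1 * \int[P]_w r i w ^+ 2.
  by rewrite -ler_pdivlMl ?invr_gt0 ?mulr_gt0// invrK (le_trans hVr)// mulrA -mulrA; rewrite mulrA (mulrAC 2) divff ?mul1r.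
by move: h h2; lra.
Qed.

(** P as a measure on F_k alone, so that a density with respect to it is F_k-measurable. *)
Definition restr_prob k (A : set (Fspace W k)) : \bar R := P (A : set (Fspace W N)).

Section existence.
Variables (k : nat) (kN : (k <= N)%N).

Local Notation mu := (@restr_prob k).

Let mu0 : mu set0 = 0%E. Proof. exact: measure0. Qed.

Let mu_ge0 A : (0 <= mu A)%E. Proof. exact: measure_ge0. Qed.

Let mu_additive : semi_sigma_additive mu.
Proof.
move=> F mF tF mUF; apply: (measure_semi_sigma_additive (s := P)) => //.
  by move=> i; exact: measurable_Fspace_le (mF i).
exact: measurable_Fspace_le mUF.
Qed.

HB.instance Definition _ := isMeasure.Build _ (Fspace W k) R mu mu0 mu_ge0 mu_additive.

Let mu1 : mu setT = 1%E. Proof. exact: probability_setT. Qed.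

HB.instance Definition _ := Measure_isProbability.Build _ _ _ mu mu1.

(** The identity is measurable from F_N to F_k, and the restriction is the image of P under it. *)
Lemma ge0_integral_restr A (f : Omega -> \bar R) : measurable (A : set (Fspace W k)) ->
  measurable_fun setT (f : Fspace W k -> \bar R) -> (forall w, (0 <= f w)%E) ->
  (\int[mu]_(w in A) f w = \int[P]_(w in A) f w)%E.
Proof.
move=> mA mf f0.
have mid : measurable_fun setT (id : Fspace W N -> Fspace W k).
  by move=> _ B mB; rewrite setTI; exact: measurable_Fspace_le mB.
have := @ge0_integral_pushforward _ _ _ (Fspace W k) R _ mid P A f mA.
move=> /(_ (measurable_funTS mf) (fun w _ => f0 w)) <-.
by apply: eq_measure_integral => B mB _.
Qed.

Variable X : Omega -> R.
Hypothesis iX : intble P X.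

Let nu (A : set (Fspace W k)) := (\int[P]_(w in (A : set (Fspace W N))) (X w)%:E)%E.

Let nu0 : nu set0 = 0%E. Proof. exact: integral_set0. Qed.

Let nu_fin (A : set (Fspace W k)) : measurable A -> nu A \is a fin_num.
Proof.
move=> mA; apply: integrable_fin_num; first exact: measurable_Fspace_le mA.
by apply: integrableS iX => //; exact: measurable_Fspace_le mA.
Qed.

Let nu_additive : semi_sigma_additive nu.
Proof.
move=> F mF tF mUF.
apply: (charge_semi_sigma_additive (s := charge.induced_charge iX)) => //.
  by move=> i; exact: measurable_Fspace_le (mF i).
exact: measurable_Fspace_le mUF.
Qed.

HB.instance Definition _ := isCharge.Build _ _ _ nu nu0 nu_fin nu_additive.

Let nu_dom : nu `<< mu.
Proof.
apply/null_content_dominatesP => A mA muA; rewrite /nu/=.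
have mAN := measurable_Fspace_le kN mA.
apply/eqP; rewrite -abse_eq0 eq_le abse_ge0 andbT.
have mXA : measurable_fun (A : set (Fspace W N)) (EFin \o X).
  by apply: measurable_funTS; case/integrableP: iX.
apply: le_trans (le_abse_integral _ mAN mXA) _.
by rewrite integral_abs_eq0.
Qed.

(** The Radon-Nikodym density of the charge A -> E[X; A] with respect to the restriction of P to
    F_k. *)
Lemma ex_cond_exp : exists Y, cond_exp P k X Y.
Proof.
pose f : Fspace W k -> \bar R := charge.Radon_Nikodym nu mu.
have f_fin w : f w \is a fin_num by exact: Radon_Nikodym_fin_num.
have f_int : mu.-integrable setT f by exact: Radon_Nikodym_integrable.
have fE A : measurable (A : set (Fspace W k)) -> nu A = (\int[mu]_(w in A) f w)%E.
  by move=> mA; exact: Radon_Nikodym_integral.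
pose Y (w : Omega) := fine (f w).
have fY : f = EFin \o Y by apply/funext => w; rewrite /= fineK.
have mf : measurable_fun setT f by case/integrableP: f_int.
have mY : mF W k Y by apply/measurable_EFinP; rewrite -/(EFin \o Y) -fY.
have iY : intble P Y.
  apply/integrableP; split.
    by apply/measurable_EFinP; exact: mF_le kN mY.
  have /integrableP[_] := f_int; rewrite ge0_integral_restr// ?fY//.
  by apply: measurableT_comp => //; rewrite -fY.
exists Y; split=> // A mA.
have mAN := measurable_Fspace_le kN mA.
congr fine; rewrite -/(nu A) fE// [LHS]integralE [RHS]integralE fY.
congr (_ - _)%E; apply: ge0_integral_restr => //.
- by apply: measurable_funepos; rewrite -fY.
- by apply: measurable_funeneg; rewrite -fY.
Qed.

End existence.

End conditional_expectation.

(** * Quasi-continuity and uniform integrability *)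

Section quasi_continuity.
Context {R : realType} {d : nat} {Omega : pointedType} {W : nat -> Omega -> 'cV[R]_d}.
Context {N : nat} (PP : set (probability (Fspace W N) R)).
Implicit Types (X Y : Omega -> R).

(* QC and UI together say that X lies in the closure of Lip(F_k) under
   sup_P E_P|.|; they are easier to propagate through compositions. *)
Definition QC k X := mF W N X /\ forall e : R, 0 < e -> exists2 Y, LipF W k Y &
  forall P, PP P -> \int[P]_w Num.min 1 `|X w - Y w| <= e.

Definition UI X := [/\ mF W N X, forall P, PP P -> intble P X &
  forall e : R, 0 < e -> exists2 b : R, 0 <= b &
    forall P, PP P -> \int[P]_w Num.max 0 (`|X w| - b) <= e].

Lemma mF_min1 X Y : mF W N X -> mF W N Y -> mF W N (fun w => Num.min 1 `|X w - Y w|).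
Proof.
move=> mX mY; apply: measurable_minr; first exact: measurable_cst.
by apply: measurableT_comp => //; exact: measurable_funB.
Qed.

Lemma intble_min1 (P : probability (Fspace W N) R) X Y : mF W N X -> mF W N Y ->
  intble P (fun w => Num.min 1 `|X w - Y w|).
Proof.
move=> mX mY; apply: (@bounded_integrable _ _ _ P _ 1).
  exact: mF_min1.
by move=> w; rewrite ger0_norm ?ge_min ?lexx// le_min ler01 normr_ge0.
Qed.

Lemma intble_tail (P : probability (Fspace W N) R) X (b : R) : 0 <= b -> mF W N X ->
  intble P X -> intble P (fun w => Num.max 0 (`|X w| - b)).
Proof.
move=> b0 mX iX; apply: (intble_le _ iX).
  apply: measurable_maxr; first exact: measurable_cst.
  apply: measurable_funB; last exact: measurable_cst.
  exact: measurableT_comp.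
by move=> w; rewrite ger0_norm ?le_max ?lexx// ge_max normr_ge0/= gerBl.
Qed.

Lemma LipF_mF k Y : (k <= N)%N -> LipF W k Y -> mF W N Y.
Proof. by move=> kN [g gL <-]; exact: mF_bLip. Qed.

Lemma LipF_bounded k Y : LipF W k Y -> exists2 C : R, 0 <= C & forall w, `|Y w| <= C.
Proof. by move=> [g /bLipP[C C0 [gC _]] <-]; exists C => //= w. Qed.

Lemma QC_LipF k Y : (k <= N)%N -> LipF W k Y -> QC k Y.
Proof.
move=> kN YL; split; first exact: LipF_mF YL.
move=> e e0; exists Y => // P _; under eq_Rintegral do rewrite subrr normr0 min_r//.
by rewrite Rint_cst ltW.
Qed.

Lemma LipF_cst k (a : R) : LipF W k (fun=> a).
Proof. by exists (fun=> a) => //; exact: bLip_cst. Qed.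

Lemma QC_cst k (a : R) : (k <= N)%N -> QC k (fun=> a).
Proof. by move=> kN; apply: QC_LipF => //; exact: LipF_cst. Qed.

Lemma QC_le k k' X : (k <= k')%N -> QC k X -> QC k' X.
Proof.
move=> kk' [mX hX]; split=> // e /hX[Y YL YX]; exists Y => //; exact: LipF_le YL.
Qed.

Lemma min1_tri (a b c : R) :
  Num.min 1 `|a - c| <= Num.min 1 `|a - b| + Num.min 1 `|b - c|.
Proof.
have : `|a - c| <= `|a - b| + `|b - c| by rewrite (le_trans _ (ler_normD _ _))// addrA subrK.
move: (normr_ge0 (a - b)) (normr_ge0 (b - c)).
move: `|a - b| `|b - c| `|a - c| => x y z x0 y0 h.
by case: (lerP 1 x); case: (lerP 1 y); case: (lerP 1 z) => *; lra.
Qed.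

Lemma QC_unif k X : (k <= N)%N -> mF W N X ->
  (forall e : R, 0 < e -> exists2 X', QC k X' &
     forall P, PP P -> \int[P]_w Num.min 1 `|X w - X' w| <= e) -> QC k X.
Proof.
move=> kN mX hX; split=> // e e0; have e2 : 0 < e / 2 by rewrite divr_gt0.
have [X' [mX' X'Q] XX'] := hX _ e2; have [Y YL X'Y] := X'Q _ e2.
have mY := LipF_mF kN YL.
exists Y => // P PPP; rewrite [leRHS]splitr; apply: le_trans (lerD (XX' P PPP) (X'Y P PPP)).
rewrite -RintegralD//; [|exact: intble_min1..].
apply: Rint_le => [||w]; first exact: intble_min1.
  by apply: intbleD; exact: intble_min1.
exact: min1_tri.
Qed.

Lemma min1_scale (C s t u : R) : 0 <= C -> 0 <= s -> 0 <= t -> u <= C * (s + t) ->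
  Num.min 1 u <= (C + 1) * (Num.min 1 s + Num.min 1 t).
Proof.
move=> C0 s0 t0 h.
have [s1|s1] := lerP 1 s.
  rewrite (le_trans (y := 1)) ?ge_min ?lexx// -[leLHS]mulr1 ler_pM//; first lra.
  by rewrite lerDl le_min ler01.
have [t1|t1] := lerP 1 t.
  rewrite (le_trans (y := 1)) ?ge_min ?lexx// -[leLHS]mulr1 ler_pM//; first lra.
  by rewrite lerDr.
rewrite (le_trans (y := u)) ?ge_min ?lexx ?orbT// (le_trans h)//.
by rewrite ler_wpM2r ?addr_ge0// lerDl.
Qed.

Lemma LipF_map2 k (op : R -> R -> R) (C : R) X Y :
  (forall x y x' y', `|op x y - op x' y'| <= C * (`|x - x'| + `|y - y'|)) ->
  LipF W k X -> LipF W k Y -> LipF W k (fun w => op (X w) (Y w)).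
Proof.
move=> opC [f fL <-] [g gL <-]; exists (fun x => op (f x) (g x)) => //.
have /bLipP[Cf Cf0 [fb fl]] := fL; have /bLipP[Cg Cg0 [gb gl]] := gL.
have C0 : 0 <= C.
  have := opC 1 0 0 0; rewrite subrr normr0 addr0 subr0 normr1 mulr1; exact: le_trans.
apply/bLipP; exists (`|op 0 0| + C * (Cf + Cg)).
  by rewrite addr_ge0// mulr_ge0// addr_ge0.
split=> [x|x y].
  rewrite -[op _ _](subrK (op 0 0)) addrC (le_trans (ler_normD _ _))// lerD2l.
  by rewrite (le_trans (opC _ _ _ _))// ler_wpM2l// !subr0 lerD.
rewrite (le_trans (opC _ _ _ _))// (@le_trans _ _ (C * (Cf + Cg) * n1 (x - y)))//.
  by rewrite -mulrA ler_wpM2l// mulrDl lerD.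
by rewrite ler_wpM2r ?n1_ge0// lerDr.
Qed.

Lemma QC_map2 k (op : R -> R -> R) (C : R) X Y : (k <= N)%N ->
  (forall x y x' y', `|op x y - op x' y'| <= C * (`|x - x'| + `|y - y'|)) ->
  mF W N (fun w => op (X w) (Y w)) ->
  QC k X -> QC k Y -> QC k (fun w => op (X w) (Y w)).
Proof.
move=> kN opC mop [mX hX] [mY hY]; split=> // e e0.
have C0 : 0 <= C.
  have := opC 1 0 0 0; rewrite subrr normr0 addr0 subr0 normr1 mulr1; exact: le_trans.
have C1 : 0 < C + 1 by rewrite ltr_wpDl.
have e2 : 0 < e / 2 / (C + 1) by rewrite !divr_gt0.
have [X' X'L XX'] := hX _ e2; have [Y' Y'L YY'] := hY _ e2.
exists (fun w => op (X' w) (Y' w)) => [|P PPP]; first exact: LipF_map2 opC X'L Y'L.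
have mX' := LipF_mF kN X'L; have mY' := LipF_mF kN Y'L.
have mop' := LipF_mF kN (LipF_map2 opC X'L Y'L).
apply: (@le_trans _ _ ((C + 1) * (\int[P]_w Num.min 1 `|X w - X' w| +
    \int[P]_w Num.min 1 `|Y w - Y' w|))).
  rewrite -RintegralD//; [|exact: intble_min1..].
  rewrite -RintegralZl//; last by apply: intbleD; exact: intble_min1.
  apply: Rint_le => [||w]; first exact: intble_min1.
    by apply: intbleZ; apply: intbleD; exact: intble_min1.
  exact: min1_scale.
rewrite -ler_pdivlMl// (le_trans (lerD (XX' P PPP) (YY' P PPP)))//.
by rewrite -mulrDl -splitr mulrC.
Qed.

Lemma QCD k X Y : (k <= N)%N -> QC k X -> QC k Y -> QC k (fun w => X w + Y w).
Proof.
move=> kN qX qY; apply: (QC_map2 (op := +%R) (C := 1)) => //.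
  by move=> x y x' y'; rewrite mul1r opprD addrACA ler_normD.
by apply: measurable_funD; [case: qX|case: qY].
Qed.

Lemma QCZ k a X : (k <= N)%N -> QC k X -> QC k (fun w => a * X w).
Proof.
move=> kN qX; apply: (QC_map2 (op := fun x _ => a * x) (C := `|a|) (Y := X)) => //.
  by move=> x y x' y'; rewrite -mulrBr normrM ler_wpM2l// lerDl.
by apply: measurable_funM; [exact: measurable_cst|case: qX].
Qed.

Lemma QCB k X Y : (k <= N)%N -> QC k X -> QC k Y -> QC k (fun w => X w - Y w).
Proof.
move=> kN qX qY; apply: (QC_map2 (op := fun x y => x - y) (C := 1)) => //.
  move=> x y x' y'; rewrite mul1r (_ : x - y - (x' - y') = (x - x') - (y - y')).
    exact: ler_normB.
  by ring.
by apply: measurable_funB; [case: qX|case: qY].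
Qed.

Lemma QC_min k X Y : (k <= N)%N -> QC k X -> QC k Y ->
  QC k (fun w => Num.min (X w) (Y w)).
Proof.
move=> kN qX qY; apply: (QC_map2 (op := Num.min) (C := 1)) => //.
  by move=> x y x' y'; rewrite mul1r le_dist_min.
by apply: measurable_minr; [case: qX|case: qY].
Qed.

Lemma QC_norm k X : (k <= N)%N -> QC k X -> QC k (fun w => `|X w|).
Proof.
move=> kN qX; apply: (QC_map2 (op := fun x _ => `|x|) (C := 1) (Y := X)) => //.
  by move=> x y x' y'; rewrite mul1r (le_trans (ler_dist_dist _ _))// lerDl.
by apply: measurableT_comp => //; case: qX.
Qed.

Lemma QC_sum k (I : Type) (s : seq I) (F : I -> Omega -> R) : (k <= N)%N ->
  (forall i, QC k (F i)) -> QC k (fun w => \sum_(i <- s) F i w).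
Proof.
move=> kN hF; elim: s => [|i s ih].
  by under eq_fun do rewrite big_nil; exact: QC_cst.
by under eq_fun do rewrite big_cons; apply: QCD.
Qed.

(** An approximating function is bounded by some M, and the excess of |X| over M is at most the
    distance between the two. *)
Lemma QC_tight k X : (k <= N)%N -> QC k X -> forall e : R, 0 < e ->
  exists2 M : R, 0 <= M &
    forall P, PP P -> \int[P]_w Num.min 1 `|X w - clip M (X w)| <= e.
Proof.
move=> kN [mX hX] e e0; have [Y YL XY] := hX _ e0.
have [M M0 YM] := LipF_bounded YL; exists M => // P PPP; apply: le_trans (XY P PPP).
have mY := LipF_mF kN YL.
apply: Rint_le => [||w]; [|exact: intble_min1|].
  by apply: intble_min1 => //; exact: measurable_clip.
rewrite le_min ge_min lexx/= ge_min; apply/orP; right.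
rewrite norm_sub_clip// ge_max normr_ge0/= lerBlDr.
have := ler_normD (X w - Y w) (Y w); rewrite subrK => /le_trans; apply.
by rewrite lerD2l.
Qed.

(** Where clipping at M + 1 changes x, the distance to the clipping at M exceeds 1 and the truncated
    error is exactly 1. The integral in [QC_tight] thus bounds the exceptional event together with
    any error capped at 1 on it. *)
Lemma clip_eq_or (M x : R) : 0 <= M ->
  x = clip (M + 1) x \/ Num.min 1 `|x - clip M x| = 1.
Proof.
move=> M0; have [h|h] := lerP `|x| (M + 1); first by left; rewrite clip_id.
right; rewrite norm_sub_clip// max_r; last lra.
by rewrite min_l//; lra.
Qed.

(** Multiplication is not Lipschitz, but the product of the clipped factors is; tightness pays for
    the clipping. *)
Lemma QCM k X Y : (k <= N)%N -> QC k X -> QC k Y -> QC k (fun w => X w * Y w).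
Proof.
move=> kN qX qY; have [mX _] := qX; have [mY _] := qY.
apply: QC_unif => //; first exact: measurable_funM.
move=> e e0; have e2 : 0 < e / 2 by rewrite divr_gt0.
have [M M0 hM] := QC_tight kN qX e2; have [L L0 hL] := QC_tight kN qY e2.
pose X' w := clip (M + 1) (X w); pose Y' w := clip (L + 1) (Y w).
have M10 : 0 <= M + 1 by rewrite addr_ge0.
have L10 : 0 <= L + 1 by rewrite addr_ge0.
have mX' : mF W N X' by exact: measurable_clip.
have mY' : mF W N Y' by exact: measurable_clip.
exists (fun w => X' w * Y' w).
  apply: (QC_map2 (op := fun x y => clip (M + 1) x * clip (L + 1) y) (C := M + L + 2)) => //.
    move=> x y x' y'.
    have -> : clip (M + 1) x * clip (L + 1) y - clip (M + 1) x' * clip (L + 1) y' =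
      clip (M + 1) x * (clip (L + 1) y - clip (L + 1) y') +
      (clip (M + 1) x - clip (M + 1) x') * clip (L + 1) y' by ring.
    rewrite (le_trans (ler_normD _ _))// !normrM.
    apply: (@le_trans _ _ ((M + 1) * `|y - y'| + `|x - x'| * (L + 1))).
      by apply: lerD; apply: ler_pM => //; rewrite ?clip_bound// clip_lip.
    have := normr_ge0 (x - x'); have := normr_ge0 (y - y').
    by move: `|x - x'| `|y - y'| => s t s0 t0; clear -M0 L0 s0 t0; nra.
  exact: measurable_funM.
move=> P PPP; rewrite [leRHS]splitr; apply: le_trans (lerD (hM P PPP) (hL P PPP)).
rewrite -RintegralD//; last 2 first.
- by apply: intble_min1 => //; exact: measurable_clip.
- by apply: intble_min1 => //; exact: measurable_clip.
apply: Rint_le => [||w].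
- by apply: intble_min1; exact: measurable_funM.
- by apply: intbleD; apply: intble_min1 => //; exact: measurable_clip.
have nn (a : R) : 0 <= Num.min 1 `|a| by rewrite le_min ler01 normr_ge0.
have [hx|->] := clip_eq_or (X w) M0; last first.
  by rewrite (le_trans (y := 1)) ?ge_min ?lexx// lerDl.
have [hy|->] := clip_eq_or (Y w) L0; last first.
  by rewrite (le_trans (y := 1)) ?ge_min ?lexx// lerDr.
by rewrite /X' /Y' -hx -hy subrr normr0 min_r// addr_ge0.
Qed.

Lemma QC_n1 k p q (Z : Omega -> 'M[R]_(p, q)) z : (k <= N)%N ->
  (forall i j, QC k (fun w => Z w i j)) -> QC k (fun w => n1 (Z w - z)).
Proof.
move=> kN hZ; apply: QC_sum => // i; apply: QC_sum => // j; apply: QC_norm => //.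
under eq_fun do rewrite !mxE.
by apply: QCB => //; exact: QC_cst.
Qed.

(** On a ball the composition is approximated by McShane's minimum, which is quasi-continuous term
    by term; outside the ball the capped error is paid for by tightness of the norm of Z. *)
Lemma QC_comp_locally_lip k p q (A : set 'M[R]_(p, q))
    (G : 'M[R]_(p, q) -> Omega -> R) (Z : Omega -> 'M[R]_(p, q)) : (k <= N)%N ->
  (forall al, exists2 L : R, 0 <= L & forall w x z, A x -> A z ->
    n1 x <= al -> n1 z <= al -> `|G x w - G z w| <= L * n1 (x - z)) ->
  (forall z, A z -> QC k (G z)) ->
  (forall w, A (Z w)) -> (forall i j, QC k (fun w => Z w i j)) ->
  QC k (fun w => G (Z w) w).
Proof.
move=> kN GL qG ZA qZ.
have mGZ : mF W N (fun w => G (Z w) w).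
  apply: (measurable_comp_locally_lip (T := Fspace W N) GL) => //.
    by move=> z /qG[].
  by move=> i j; have [] := qZ i j.
apply: QC_unif => // e e0; have e2 : 0 < e / 2 by rewrite divr_gt0.
have qn : QC k (fun w => n1 (Z w)).
  by have := QC_n1 0 kN qZ; under eq_fun do rewrite subr0.
have [M M0 hM] := QC_tight kN qn e2.
set z0 := Z point; pose al := M + 1 + n1 z0.
have z0al : n1 z0 <= al by rewrite lerDr addr_ge0.
have [L [s [sA hs]]] := locally_lip_approx (GL _) (ZA point) z0al e2.
have qX' : QC k (fun w => mcshane (G^~ w) L z0 s (Z w)).
  have qt z : A z -> QC k (fun w => G z w + L * n1 (Z w - z)).
    by move=> Az; apply: QCD => //; [exact: qG|apply: QCZ => //; exact: QC_n1].
  rewrite /mcshane; move: s sA {hs}; elim=> [|z s ih] sA.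
    by apply: qt; exact: ZA.
  apply: QC_min => //; first by apply/qt/sA; rewrite !inE eqxx orbT.
  by apply: ih => y; rewrite inE => /orP[|] hy; apply: sA; rewrite !inE hy ?orbT.
exists (fun w => mcshane (G^~ w) L z0 s (Z w)) => // P PPP.
have [mX' _] := qX'; have [mn _] := qn.
apply: (@le_trans _ _ (\int[P]_w (e / 2 + Num.min 1 `|n1 (Z w) - clip M (n1 (Z w))|))).
  apply: Rint_le => [||w]; first exact: intble_min1.
    apply: intbleD; first exact: intble_cst.
    by apply: intble_min1 => //; exact: measurable_clip.
  have [hc|->] := clip_eq_or (n1 (Z w)) M0; last first.
    by rewrite (le_trans (y := 1)) ?ge_min ?lexx// lerDr ltW.
  have zal : n1 (Z w) <= al.
    have := clip_bound (n1 (Z w)) (addr_ge0 M0 ler01); rewrite -hc ger0_norm ?n1_ge0//.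
    by move=> /le_trans; apply; rewrite lerDl n1_ge0.
  have := hs w (Z w) (ZA w) zal; rewrite distrC => h.
  rewrite (le_trans (y := e / 2)) ?lerDl ?le_min ?ler01 ?normr_ge0//.
  by rewrite ge_min h orbT.
rewrite RintegralD//; last 2 first.
- exact: intble_cst.
- by apply: intble_min1 => //; exact: measurable_clip.
by rewrite Rint_cst [leRHS]splitr lerD2l hM.
Qed.

(** A Borel-Cantelli argument: with errors 2^-(i+1) the sum of the capped distances is integrable,
    so Lipschitz functions of the first k noises converge to X almost surely. *)
Lemma QC_aeF k X (P : probability (Fspace W N) R) : (k <= N)%N -> PP P -> QC k X ->
  aeF P k X.
Proof.
move=> kN PPP [mX hX].
have /choice[Y YP] : forall i : nat, exists Y, LipF W k Y /\
    \int[P]_w Num.min 1 `|X w - Y w| <= 1 / (2 ^ i.+1)%:R.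
  move=> i; have [|Y YL h] := hX (1 / (2 ^ i.+1)%:R).
    by rewrite divr_gt0// ltr0n expn_gt0.
  by exists Y; split => //; exact: h.
have mY i : mF W N (Y i) by apply: LipF_mF kN _; have [] := YP i.
pose f i w := Num.min 1 `|X w - Y i w|.
have f0 i w : 0 <= f i w by rewrite le_min ler01 normr_ge0.
have mf i : mF W N (f i) by exact: mF_min1.
have sum_fin : (\int[P]_w (\sum_(i <oo) (f i w)%:E) < +oo)%E.
  rewrite (@integral_nneseries _ (Fspace W N) R P setT measurableT (fun i w => (f i w)%:E)); last 2 first.
  - by move=> i; apply/measurable_EFinP; exact: mf.
  - by move=> i w _; rewrite lee_fin.
  apply: le_lt_trans (ltry 1); apply: le_trans (epsilon_trick0 xpredT ler01).
  apply: lee_nneseries => [i _ _|i *]; first by apply: integral_ge0 => w _; rewrite lee_fin.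
  by rewrite -Rint_fineK ?lee_fin; [have [] := YP i|exact: intble_min1].
apply: (aeF_lim (X_ := Y)).
  move=> i; apply: mF_aeF; have [[g gL <-] _] := YP i; exact: measurable_bLip_Wmat.
have ifs : P.-integrable setT (fun w => \sum_(i <oo) (f i w)%:E)%E.
  apply/integrableP; split.
    apply: ge0_emeasurable_sum => [i w _ _|i _]; first by rewrite lee_fin.
    by apply/measurable_EFinP; exact: mf.
  apply: le_lt_trans sum_fin; rewrite le_eqVlt; apply/orP; left; apply/eqP.
  apply: eq_integral => w _.
  by rewrite gee0_abs// nneseries_ge0// => i _ _; rewrite lee_fin.
apply: (ae_imp (integrable_ae measurableT ifs)) => w /(_ I) fin.
have cf : f i w @[i --> \oo] --> 0.
  apply: cvg_series_cvg_0.
  apply: nnseries_is_cvg => [//|]; rewrite ltey_eq fin//.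
apply/cvgrPdist_le => e e0.
have e1 : 0 < Num.min e (1 / 2) by rewrite lt_min e0 divr_gt0.
move/cvgrPdist_le : cf => /(_ _ e1)[n _ hn]; exists n => // i /= /hn.
rewrite sub0r normrN ger0_norm// /f; move: (`|X w - Y i w|) => t.
by rewrite le_min => /andP[]; case: (lerP 1 t) => *; lra.
Qed.

End quasi_continuity.

Lemma young1 {R : realType} (e t : R) : 0 < e -> t <= e / 2 + (2 * e)^-1 * t ^+ 2.
Proof.
move=> e0; rewrite -(@ler_pM2l _ (2 * e)) ?mulr_gt0//.
have -> : 2 * e * (e / 2 + (2 * e)^-1 * t ^+ 2) = e ^+ 2 + t ^+ 2.
  by field; rewrite lt0r_neq0.
by have := sqr_ge0 (e - t); rewrite !expr2; lra.
Qed.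

Lemma sqr_affine_le {R : realType} (a b x C M : R) : `|a| <= C -> `|b| <= M ->
  `|a + b * x| ^+ 2 <= 2 * C ^+ 2 + 2 * M ^+ 2 * `|x| ^+ 2.
Proof.
move=> aC bM; rewrite real_normK ?num_real//.
have h1 : a ^+ 2 <= C ^+ 2.
  by rewrite -(real_normK (num_real a)) lerXn2r ?nnegrE// (le_trans _ aC).
have h2 : (b * x) ^+ 2 <= M ^+ 2 * `|x| ^+ 2.
  rewrite exprMn real_normK ?num_real// ler_wpM2r ?sqr_ge0//.
  by rewrite -(real_normK (num_real b)) lerXn2r ?nnegrE// (le_trans _ bM).
by rewrite -mulrA; have := sqr_ge0 (a - b * x); rewrite !expr2 in h1 h2 *; lra.
Qed.

Lemma tailD {R : realType} (a b s t u : R) : s <= t + u ->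
  Num.max 0 (s - (a + b)) <= Num.max 0 (t - a) + Num.max 0 (u - b).
Proof.
move=> h; have h1 : t - a <= Num.max 0 (t - a) by rewrite le_max lexx orbT.
have h2 : u - b <= Num.max 0 (u - b) by rewrite le_max lexx orbT.
rewrite ge_max addr_ge0 ?le_max ?lexx//=; lra.
Qed.

Lemma le_min1_scale {R : realType} (b s t : R) : 0 <= b -> 0 <= t -> s <= t ->
  s <= 2 * b ->
  s <= (2 * b + 1) * Num.min 1 t.
Proof.
move=> b0 t0 st s2; case: (lerP 1 t) => ht; first by rewrite mulr1; lra.
by have := mulr_ge0 b0 t0; lra.
Qed.

(** * Uniform integrability over a family of measures *)

Section uniform_integrability.
Context {R : realType} {d : nat} {Omega : pointedType} {W : nat -> Omega -> 'cV[R]_d}.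
Context {N : nat} (PP : set (probability (Fspace W N) R)).
Implicit Types (X Y : Omega -> R).

Notation UI := (UI PP). Notation QC := (QC PP).

Lemma UI_le X Y : mF W N X -> (forall w, `|X w| <= `|Y w|) -> UI Y -> UI X.
Proof.
move=> mX XY [mY iY hY]; split=> // [P PPP|e e0].
  exact: intble_le (iY P PPP) XY.
have [b b0 hb] := hY e e0; exists b => // P PPP; apply: le_trans (hb P PPP).
have iX := intble_le mX (iY P PPP) XY.
apply: Rint_le => [||w]; [exact: intble_tail|by apply: intble_tail => //; exact: iY|].
by rewrite ge_max le_max lexx/= le_max lerD2r XY orbT.
Qed.

Lemma UID X Y : UI X -> UI Y -> UI (fun w => X w + Y w).
Proof.
move=> [mX iX hX] [mY iY hY]; split=> [|P PPP|e e0].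
- exact: measurable_funD.
- by apply: intbleD; [exact: iX|exact: iY].
have e2 : 0 < e / 2 by rewrite divr_gt0.
have [a a0 ha] := hX _ e2; have [b b0 hb] := hY _ e2.
exists (a + b) => [|P PPP]; first exact: addr_ge0.
rewrite [leRHS]splitr; apply: le_trans (lerD (ha P PPP) (hb P PPP)).
have tX := intble_tail a0 mX (iX P PPP); have tY := intble_tail b0 mY (iY P PPP).
rewrite -RintegralD//; apply: Rint_le => [||w]; [|exact: intbleD|].
  apply: intble_tail; [exact: addr_ge0|exact: measurable_funD|].
  by apply: intbleD; [exact: iX|exact: iY].
exact: tailD (ler_normD _ _).
Qed.

Lemma UI_cst a : UI (fun=> a).
Proof.
split=> [|P _|e e0]; [exact: measurable_cst|exact: intble_cst|].
exists `|a| => // P _; under eq_Rintegral do rewrite subrr max_l//.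
by rewrite Rint_cst ltW.
Qed.

Lemma UIZ a X : UI X -> UI (fun w => a * X w).
Proof.
move=> [mX iX hX]; split=> [|P PPP|e e0].
- by apply: measurable_funM => //; exact: measurable_cst.
- by apply: intbleZ; exact: iX.
have a1 : 0 < `|a| + 1 by rewrite ltr_wpDl.
have ea : 0 < e / (`|a| + 1) by rewrite divr_gt0.
have [b b0 hb] := hX _ ea; exists ((`|a| + 1) * b); first by rewrite mulr_ge0// ltW.
move=> P PPP; have tX := intble_tail b0 mX (iX P PPP).
apply: (@le_trans _ _ ((`|a| + 1) * \int[P]_w Num.max 0 (`|X w| - b))).
  rewrite -RintegralZl//; apply: Rint_le => [||w]; [|exact: intbleZ|].
    apply: intble_tail; first by rewrite mulr_ge0// ltW.
      by apply: measurable_funM => //; exact: measurable_cst.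
    by apply: intbleZ; exact: iX.
  rewrite ge_max mulr_ge0 ?(ltW a1) ?le_max ?lexx//= normrM.
  apply: (@le_trans _ _ ((`|a| + 1) * (`|X w| - b))).
    by rewrite mulrBr lerD2r ler_wpM2r// lerDl.
  by rewrite ler_pM2l// le_max lexx orbT.
by rewrite mulrC -ler_pdivlMr// hb.
Qed.

Lemma UI_sum (I : Type) (s : seq I) (F : I -> Omega -> R) :
  (forall i, UI (F i)) -> UI (fun w => \sum_(i <- s) F i w).
Proof.
move=> hF; elim: s => [|i s ih].
  by under eq_fun do rewrite big_nil; exact: UI_cst.
by under eq_fun do rewrite big_cons; apply: UID.
Qed.

Lemma UI_eq X Y : (forall w, X w = Y w) -> UI X -> UI Y.
Proof. by move=> /funext ->. Qed.

Definition UI2 X := mF W N X /\ UI (fun w => X w ^+ 2).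

Lemma UI2_le X Y : mF W N X -> (forall w, `|X w| <= `|Y w|) -> UI2 Y -> UI2 X.
Proof.
move=> mX XY [mY uY]; split=> //; apply: UI_le uY; first exact: measurable_funX.
by move=> w; rewrite !normrX lerXn2r ?nnegrE.
Qed.

Lemma UI2D X Y : UI2 X -> UI2 Y -> UI2 (fun w => X w + Y w).
Proof.
move=> [mX uX] [mY uY]; split; first exact: measurable_funD.
apply: (UI_le _ _ (UIZ 2 (UID uX uY))).
  by apply: measurable_funX; exact: measurable_funD.
move=> w; rewrite ger0_norm ?sqr_ge0// [leRHS]ger0_norm; last first.
  by rewrite mulr_ge0// addr_ge0 ?sqr_ge0.
by have := sqr_ge0 (X w - Y w); rewrite !expr2; lra.
Qed.

Lemma UI2_cst a : UI2 (fun=> a).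
Proof. by split; [exact: measurable_cst|exact: UI_cst]. Qed.

Lemma UI2Z a X : UI2 X -> UI2 (fun w => a * X w).
Proof.
move=> [mX uX]; split; first by apply: measurable_funM => //; exact: measurable_cst.
by apply: UI_eq (UIZ (a ^+ 2) uX) => w; rewrite exprMn.
Qed.

Lemma UI2_sum (I : Type) (s : seq I) (F : I -> Omega -> R) :
  (forall i, UI2 (F i)) -> UI2 (fun w => \sum_(i <- s) F i w).
Proof.
move=> hF; elim: s => [|i s ih].
  by under eq_fun do rewrite big_nil; exact: UI2_cst.
by under eq_fun do rewrite big_cons; apply: UI2D.
Qed.

Lemma UI2_norm X : UI2 X -> UI2 (fun w => `|X w|).
Proof.
move=> uX; apply: (UI2_le _ _ uX); last by move=> w; rewrite normr_id.
by case: uX => mX _; exact: measurableT_comp.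
Qed.

Lemma UI2M X Y : UI2 X -> UI2 Y -> UI (fun w => X w * Y w).
Proof.
move=> [mX uX] [mY uY]; apply: (UI_le _ _ (UID uX uY)); first exact: measurable_funM.
move=> w; rewrite [leRHS]ger0_norm ?addr_ge0 ?sqr_ge0// normrM.
rewrite -(real_normK (num_real (X w))) -(real_normK (num_real (Y w))).
move: (normr_ge0 (X w)) (normr_ge0 (Y w)); move: `|X w| `|Y w| => s t s0 t0.
by have := sqr_ge0 (s - t); rewrite !expr2; nra.
Qed.

Lemma UI2_UI X : UI2 X -> UI X.
Proof.
by move=> uX; apply: UI_eq (UI2M uX (UI2_cst 1)) => w; rewrite mulr1.
Qed.

Lemma UI_bound X : UI X -> exists2 C : R, 0 <= C &
  forall P, PP P -> \int[P]_w `|X w| <= C.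
Proof.
move=> [mX iX hX]; have [b b0 hb] := hX 1 ltr01.
exists (1 + b) => [|P PPP]; first exact: addr_ge0.
have tX := intble_tail b0 mX (iX P PPP).
apply: (@le_trans _ _ (\int[P]_w (Num.max 0 (`|X w| - b) + b))).
  apply: Rint_le => [||w]; first by apply: intble_norm; exact: iX.
    by apply: intbleD => //; exact: intble_cst.
  by rewrite -lerBlDr le_max lexx orbT.
by rewrite RintegralD//; [rewrite Rint_cst lerD2r hb|exact: intble_cst].
Qed.

(** The threshold is 2 b because S > 2 b implies S <= 2 (S - b). *)
Lemma UI_truncated X S : UI X -> UI S -> (forall w, 0 <= S w) ->
  (forall w, `|X w| <= S w) -> forall e : R, 0 < e -> exists2 M : R, 0 <= M &
  forall P, PP P -> \int[P]_w (\1_[set w | M < S w] w * `|X w|) <= e.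
Proof.
move=> uX [mS iS hS] S0 XS e e0; have e2 : 0 < e / 2 by rewrite divr_gt0.
have [b b0 hb] := hS _ e2; exists (2 * b) => [|P PPP]; first by rewrite mulr_ge0.
have tS := intble_tail b0 mS (iS P PPP).
apply: (@le_trans _ _ (2 * \int[P]_w Num.max 0 (`|S w| - b))); last first.
  by rewrite -ler_pdivlMl// mulrC hb.
rewrite -RintegralZl//; apply: Rint_le => [||w]; last first.
- rewrite (ger0_norm (S0 w)) indicE; have [/set_mem/= h|_] := boolP (w \in _); last first.
    by rewrite mul0r mulr_ge0// le_max lexx.
  rewrite mul1r (le_trans (XS w))// max_r; last by lra.
  by lra.
- exact: intbleZ.
apply: (intbleM_bounded (M := 1)).
- apply: measurable_indic; rewrite -[X in measurable X]setTI.
  rewrite -[X in _ `&` X]/((fun w => 2 * b < S w) @^-1` [set true]).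
  by apply: measurable_fun_ltr => //; exact: measurable_cst.
- by move=> w; rewrite indicE; case: (_ \in _); rewrite ?normr1 ?normr0.
- by apply: intble_norm; case: uX => _ + _; apply.
Qed.

(** The part of X beyond b is small by uniform integrability. After clipping at b the difference is
    at most 2 b, hence at most 2 b + 1 times the capped distance. *)
Lemma QC_UI_dense k X : (k <= N)%N -> QC k X -> UI X -> forall e : R, 0 < e ->
  exists2 Y, LipF W k Y & forall P, PP P -> \int[P]_w `|X w - Y w| <= e.
Proof.
move=> kN [_ qX] [mX iX hX] e e0; have e2 : 0 < e / 2 by rewrite divr_gt0.
have [b b0 hb] := hX _ e2.
have b1 : 0 < 2 * b + 1 by lra.
have eb : 0 < e / 2 / (2 * b + 1) by rewrite divr_gt0.
have [Y YL hY] := qX _ eb.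
have YL' : LipF W k (fun w => clip b (Y w)).
  apply: (LipF_map2 (op := fun x _ => clip b x) (C := 1) _ YL YL) => x y x' y'.
  by rewrite mul1r (le_trans (clip_lip _ _ _))// lerDl.
exists (fun w => clip b (Y w)) => // P PPP.
have mY := LipF_mF kN YL; have mY' := LipF_mF kN YL'.
have tX := intble_tail b0 mX (iX P PPP).
rewrite [leRHS]splitr; apply: (@le_trans _ _ (\int[P]_w Num.max 0 (`|X w| - b) +
    (2 * b + 1) * \int[P]_w Num.min 1 `|X w - Y w|)); last first.
  by apply: lerD; [exact: hb|rewrite mulrC -ler_pdivlMr// hY].
rewrite -RintegralZl//; last exact: intble_min1.
rewrite -RintegralD//; last by apply: intbleZ; exact: intble_min1.
apply: Rint_le => [||w].
- apply: intble_norm; apply: intbleB; first exact: iX.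
  have [C _ YC] := LipF_bounded YL'.
  exact: (@bounded_integrable _ _ _ P _ C).
- by apply: intbleD => //; apply: intbleZ; exact: intble_min1.
apply: (@le_trans _ _ (`|X w - clip b (X w)| + `|clip b (X w) - clip b (Y w)|)).
  by rewrite (le_trans _ (ler_normD _ _))// addrA subrK.
rewrite norm_sub_clip// lerD2l.
apply: le_min1_scale => //; first exact: clip_lip.
apply: le_trans (ler_normB _ _) _.
by rewrite mulr2n mulrDl mul1r; apply: lerD; exact: clip_bound.
Qed.

End uniform_integrability.

(** * From L_c^p to quasi-continuity and uniform integrability *)

Section Lc.
Context {R : realType} {d : nat} {Theta : Type}.
Context {F : Theta -> probability (borel 'cV[R]_d) R}.
Context {Omega : pointedType} {W : nat -> Omega -> 'cV[R]_d} {N : nat}.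
Implicit Types (X Y : Omega -> R).

Notation PP := (@calP _ _ _ F _ W N).

Lemma polar_null (B : set (Fspace W N)) P : polar F B -> PP P -> P B = 0%E.
Proof.
move=> [_ supB] PPP; apply/eqP; rewrite eq_le measure_ge0 andbT -supB.
by apply: ereal_sup_ubound; exists P.
Qed.

Lemma qs_eq_ae X Y P : qs_eq F W N X Y -> PP P -> {ae P, forall w, X w = Y w}.
Proof.
move=> [B Bp XY] PPP; exists B; split.
- by case: Bp.
- exact: polar_null.
- by move=> w /=; apply: contra_notP => /XY.
Qed.

Lemma Ehat_le X P : PP P -> (\int[P]_w (X w)%:E <= Ehat F W N X)%E.
Proof. by move=> PPP; apply: ereal_sup_ubound; exists P. Qed.

Lemma cnorm_lt (p : nat) X (e : R) : (0 < p)%N -> 0 < e ->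
  (cnorm F W N p X < e%:E)%E -> forall P, PP P ->
  (\int[P]_w (`|X w| ^+ p)%:E <= (e ^+ p)%:E)%E.
Proof.
move=> p0 e0 Xe P PPP.
have I0 : (0 <= \int[P]_w (`|X w| ^+ p)%:E)%E.
  by apply: integral_ge0 => w _; rewrite lee_fin exprn_ge0.
have p0' : 0 < p%:R :> R by rewrite ltr0n.
have : ((\int[P]_w (`|X w| ^+ p)%:E) `^ p%:R^-1 <= e%:E)%E.
  apply: le_trans (ltW Xe); rewrite /cnorm.
  apply: gt0_ler_poweR; rewrite ?in_itv/= ?leey ?andbT//.
    by rewrite (le_trans I0)//; exact: Ehat_le.
  exact: Ehat_le.
move=> /(gt0_ler_poweR (ltW p0')) h.
have := h _ _; rewrite -poweRrM mulVf ?gt_eqF// poweRe1//.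
have ein : e%:E \in `[0%E, +oo%E] by rewrite in_itv/= leey andbT lee_fin ltW.
have Iin : ((\int[P]_w (`|X w| ^+ p)%:E) `^ p%:R^-1)%E \in `[0%E, +oo%E].
  by rewrite in_itv/= leey andbT poweR_ge0.
move=> /(_ Iin ein).
by rewrite poweR_EFin powR_mulrn ?(ltW e0).
Qed.

Lemma cnorm_le2 P0 X (a : R) : PP P0 -> 0 <= a ->
  (forall P, PP P -> (\int[P]_w (`|X w| ^+ 2)%:E <= (a ^+ 2)%:E)%E) ->
  (cnorm F W N 2 X <= a%:E)%E.
Proof.
move=> PP0 a0 hX; rewrite /cnorm; set E := Ehat _ _ _ _.
have E0 : (0 <= E)%E.
  apply: le_trans (Ehat_le _ PP0).
  by apply: integral_ge0 => w _; rewrite lee_fin exprn_ge0.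
have Ea : (E <= (a ^+ 2)%:E)%E by apply: ge_ereal_sup => _ [P PPP <-]; exact: hX.
have -> : a%:E = ((a ^+ 2)%:E `^ 2^-1)%E.
  by rewrite poweR_EFin -powR_mulrn// -powRrM mulfV ?powRr1// pnatr_eq0.
apply: gt0_ler_poweR => //; rewrite in_itv/= ?leey ?andbT//.
by rewrite lee_fin sqr_ge0.
Qed.

(** A polar set is null under every P of calP, so the F_k-measurable representative may be replaced
    by X inside each integral. *)
Lemma Lc_approx (p : nat) k X : (0 < p)%N -> (k <= N)%N -> Lc F W N p k X ->
  mF W N X /\ forall e : R, 0 < e -> exists2 Y, LipF W k Y &
    forall P, PP P -> intble P (fun w => `|X w - Y w| ^+ p) /\
      \int[P]_w `|X w - Y w| ^+ p <= e.
Proof.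
move=> p0 kN [mX [X' [XX' mX' _ hX']]]; split=> // e e0.
(* A norm bound of at most 1 does not increase when raised to the power p. *)
have e1 : 0 < Num.min 1 e by rewrite lt_min ltr01.
have [Y YL hY] := hX' _ e1; exists Y => // P PPP.
have mY := LipF_mF kN YL; have mX'N := mF_le kN mX'.
have mp Z : mF W N Z -> mF W N (fun w => `|Z w - Y w| ^+ p).
  move=> mZ; apply: measurable_funX; apply: measurableT_comp => //.
  exact: measurable_funB.
have h := cnorm_lt p0 e1 hY PPP.
have iX' : intble P (fun w => `|X' w - Y w| ^+ p).
  by apply: ge0_intble h; [exact: mp|move=> w; exact: exprn_ge0].
have ae : {ae P, forall w, `|X' w - Y w| ^+ p = `|X w - Y w| ^+ p}.
  by apply: (ae_imp (qs_eq_ae XX' PPP)) => w ->.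
split; first by apply: intble_ae iX' _ ae; exact: mp.
rewrite -(Rint_ae (mp _ mX'N) (mp _ mX) ae).
apply: (@le_trans _ _ (Num.min 1 e ^+ p)).
  by apply: ge0_Rint_le h; [exact: mp|move=> w; exact: exprn_ge0].
apply: (@le_trans _ _ (Num.min 1 e)); last by rewrite ge_min lexx orbT.
rewrite -(prednK p0) exprS ger_pMr//.
by apply: exprn_ile1; [exact: ltW|rewrite ge_min lexx].
Qed.

Lemma Lc1_QC k X : (k <= N)%N -> Lc F W N 1 k X -> QC PP k X /\ UI PP X.
Proof.
move=> kN /(Lc_approx (ltn0Sn _) kN)[mX hX]; split.
  split=> // e /hX[Y YL hY]; exists Y => // P PPP; have [iXY XYe] := hY P PPP.
  have mY := LipF_mF kN YL.
  apply: le_trans XYe; apply: Rint_le => //; first exact: intble_min1.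
  by move=> w; rewrite expr1 ge_min lexx orbT.
have iX P : PP P -> intble P X.
  move=> PPP; have [Y YL hY] := hX 1 ltr01; have [iXY _] := hY P PPP.
  have [C C0 YC] := LipF_bounded YL.
  apply: intble_le (intbleD iXY (intble_cst P C)) _ => // w.
  rewrite expr1 [leRHS]ger0_norm ?addr_ge0// -[X w in leLHS](subrK (Y w)).
  by rewrite (le_trans (ler_normD _ _))// lerD2l.
split=> // e /hX[Y YL hY]; have [C C0 YC] := LipF_bounded YL; exists C => // P PPP.
have [iXY XYe] := hY P PPP; apply: le_trans XYe; apply: Rint_le => //.
  by apply: intble_tail => //; exact: iX.
move=> w; rewrite expr1 ge_max normr_ge0/= lerBlDr -[X w in leLHS](subrK (Y w)).
by rewrite (le_trans (ler_normD _ _))// lerD2l.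
Qed.

Lemma Lc2_QC k X : (k <= N)%N -> Lc F W N 2 k X -> QC PP k X /\ UI2 PP X.
Proof.
move=> kN /(Lc_approx (ltn0Sn _) kN)[mX hX]; split.
  (* The accuracy e^2 fits Young's inequality t <= e / 2 + t^2 / (2 e), which passes from the L^2 to
     the L^1 distance. *)
  split=> // e e0; have [|Y YL hY] := hX (e ^+ 2); first exact: exprn_gt0.
  exists Y => // P PPP; have [iXY XYe] := hY P PPP.
  have mY := LipF_mF kN YL.
  apply: (@le_trans _ _ (\int[P]_w (e / 2 + (2 * e)^-1 * `|X w - Y w| ^+ 2))).
    apply: Rint_le => [||w]; first exact: intble_min1.
      by apply: intbleD; [exact: intble_cst|exact: intbleZ].
    rewrite (le_trans (y := `|X w - Y w|)) ?ge_min ?lexx ?orbT//.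
    exact: young1.
  rewrite RintegralD//; [|exact: intble_cst|exact: intbleZ].
  rewrite Rint_cst RintegralZl// [leRHS]splitr lerD2l.
  rewrite ler_pdivrMl ?mulr_gt0// (le_trans XYe)//.
  by rewrite (_ : 2 * e * (e / 2) = e ^+ 2)//; field.
have UIX : UI PP (fun w => X w ^+ 2); last by [].
have mX2 : mF W N (fun w => X w ^+ 2) by exact: measurable_funX.
have key (x y C : R) : `|y| <= C -> x ^+ 2 <= 2 * `|x - y| ^+ 2 + 2 * C ^+ 2.
  move=> yC; rewrite real_normK ?num_real//.
  have : y ^+ 2 <= C ^+ 2 by rewrite -(real_normK (num_real y)) lerXn2r ?nnegrE// (le_trans _ yC).
  by have := sqr_ge0 (x - 2 * y); rewrite !expr2; lra.
have iX P : PP P -> intble P (fun w => X w ^+ 2).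
  move=> PPP; have [Y YL hY] := hX 1 ltr01; have [iXY _] := hY P PPP.
  have [C C0 YC] := LipF_bounded YL.
  apply: intble_le (intbleD (intbleZ 2 iXY) (intble_cst P (2 * C ^+ 2))) _ => // w.
  rewrite ger0_norm ?sqr_ge0// [leRHS]ger0_norm; first exact: key.
  by rewrite addr_ge0// mulr_ge0// exprn_ge0.
split=> // e e0; have [|Y YL hY] := hX (e / 2); first exact: divr_gt0.
have [C C0 YC] := LipF_bounded YL; exists (2 * C ^+ 2) => [|P PPP].
  by rewrite mulr_ge0// exprn_ge0.
have [iXY XYe] := hY P PPP.
apply: (@le_trans _ _ (2 * \int[P]_w `|X w - Y w| ^+ 2)); last first.
  by rewrite -ler_pdivlMl// mulrC.
rewrite -RintegralZl//; apply: Rint_le => [||w]; last first.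
- rewrite ge_max mulr_ge0 ?exprn_ge0//= ger0_norm ?sqr_ge0// lerBlDr.
  exact: key.
- exact: intbleZ.
- by apply: intble_tail => //; [rewrite mulr_ge0// exprn_ge0|exact: iX].
Qed.

(** The perturbed controls have this form. The F_k-measurable representative and its Lipschitz
    approximations are transformed by the same affine map. *)
Lemma Lc2_affine P0 k X (f g : 'M[R]_(d, k) -> R) : PP P0 -> (k <= N)%N ->
  bLip f -> bLip g -> Lc F W N 2 k X ->
  Lc F W N 2 k (fun w => f (Wmat W k w) + g (Wmat W k w) * X w).
Proof.
move=> PP0 kN fL gL [mX [X' [XX' mX' X'fin hX']]].
have /bLipP[C C0 [fC _]] := fL; have /bLipP[M M0 [gM _]] := gL.
pose T (Z : Omega -> R) w := f (Wmat W k w) + g (Wmat W k w) * Z w.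
have mT j Z : (k <= j)%N -> mF W j Z -> mF W j (T Z).
  move=> kj mZ; apply: measurable_funD.
    by apply: mF_le kj _; exact: measurable_bLip_Wmat.
  apply: measurable_funM => //.
  by apply: mF_le kj _; exact: measurable_bLip_Wmat.
split; first exact: mT.
exists (T X'); split.
- have [B Bp XX'B] := XX'; exists B => // w Bw.
  by rewrite /T XX'B.
- exact: mT.
- set E := Ehat F W N (fun w => `|X' w| ^+ 2) in X'fin.
  have mX'N := mF_le kN mX'.
  have hE P : PP P -> (\int[P]_w (`|X' w| ^+ 2)%:E <= E)%E.
    by move=> PPP; exact: Ehat_le.
  have Efin : E \is a fin_num.
    rewrite ge0_fin_numE//; apply: le_trans (hE _ PP0).
    by apply: integral_ge0 => w _; rewrite lee_fin exprn_ge0.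
  have hE' P : PP P -> (\int[P]_w (`|X' w| ^+ 2)%:E <= (fine E)%:E)%E.
    by move=> PPP; rewrite fineK//; exact: hE.
  apply: (@le_lt_trans _ _ (2 * C ^+ 2 + 2 * M ^+ 2 * fine E)%:E); last exact: ltry.
  apply: ge_ereal_sup => _ [P PPP <-].
  have iX' : intble P (fun w => `|X' w| ^+ 2).
    apply: ge0_intble (hE' _ PPP).
      by apply: measurable_funX; exact: measurableT_comp.
    by move=> w; exact: exprn_ge0.
  have iB : intble P (fun w => 2 * C ^+ 2 + 2 * M ^+ 2 * `|X' w| ^+ 2).
    by apply: intbleD; [exact: intble_cst|exact: intbleZ].
  have key w : `|T X' w| ^+ 2 <= 2 * C ^+ 2 + 2 * M ^+ 2 * `|X' w| ^+ 2.
    exact: sqr_affine_le.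
  have iT : intble P (fun w => `|T X' w| ^+ 2).
    apply: intble_le iB _.
      by apply: measurable_funX; apply: measurableT_comp => //; exact: mT.
    move=> w; rewrite ger0_norm ?exprn_ge0// [leRHS]ger0_norm//.
    by rewrite (le_trans _ (key w))// exprn_ge0.
  rewrite -(Rint_fineK iT) lee_fin; apply: le_trans (Rint_le iT iB key) _.
  rewrite RintegralD//; [|exact: intble_cst|exact: intbleZ].
  rewrite Rint_cst RintegralZl// lerD2l ler_wpM2l ?mulr_ge0 ?exprn_ge0//.
  rewrite -lee_fin (Rint_fineK iX') hE'//.
move=> e e0; have M1 : 0 < M + 1 by rewrite ltr_wpDl.
have e1 : 0 < e / 2 / (M + 1) by rewrite !divr_gt0.
have [Y YL hY] := hX' _ e1; exists (T Y).
  have [h hL <-] := YL; exists (fun x => f x + g x * h x) => //.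
  by apply: bLipD => //; exact: bLipM.
have mY := LipF_mF kN YL; have mX'N := mF_le kN mX'.
apply: (@le_lt_trans _ _ (e / 2)%:E); last by rewrite lte_fin ltr_pdivrMr// mulr_natr mulr2n ltrDl.
apply: (cnorm_le2 PP0); first by rewrite ltW// divr_gt0.
move=> P PPP; have h := cnorm_lt (ltn0Sn _) e1 hY PPP.
have mXY : mF W N (fun w => `|X' w - Y w| ^+ 2).
  apply: measurable_funX; apply: measurableT_comp => //; exact: measurable_funB.
have iXY : intble P (fun w => `|X' w - Y w| ^+ 2).
  by apply: ge0_intble h => // w; exact: exprn_ge0.
have key w : `|T X' w - T Y w| ^+ 2 <= (M + 1) ^+ 2 * `|X' w - Y w| ^+ 2.
  rewrite -exprMn lerXn2r ?nnegrE ?mulr_ge0 ?(ltW M1)//.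
  have -> : T X' w - T Y w = g (Wmat W k w) * (X' w - Y w) by rewrite /T; ring.
  rewrite normrM ler_wpM2r//.
  by rewrite (le_trans (gM _))// lerDl.
have iT : intble P (fun w => `|T X' w - T Y w| ^+ 2).
  apply: intble_le (intbleZ ((M + 1) ^+ 2) iXY) _.
    apply: measurable_funX; apply: measurableT_comp => //.
    by apply: measurable_funB; exact: mT.
  move=> w; rewrite ger0_norm ?exprn_ge0// [leRHS]ger0_norm//.
  by rewrite (le_trans _ (key w))// exprn_ge0.
rewrite -(Rint_fineK iT) lee_fin; apply: le_trans (Rint_le iT (intbleZ _ iXY) key) _.
rewrite RintegralZl// -ler_pdivlMl ?exprn_gt0//.
apply: (@le_trans _ _ ((e / 2 / (M + 1)) ^+ 2)).
  by apply: ge0_Rint_le h => // w; exact: exprn_ge0.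
by rewrite expr_div_n mulrC.
Qed.

End Lc.

(** If x y exceeds 4 a b, then x > 2 a or y > 2 b, and the corresponding excess is at least half of
    x or of y. *)
Lemma mul_tail_le {R : realType} (a b x y : R) : 0 <= a -> 0 <= b -> 0 <= x -> 0 <= y ->
  Num.max 0 (x * y - 4 * (a * b)) <=
  2 * (Num.max 0 (x - a) * y) + 2 * (x * Num.max 0 (y - b)).
Proof.
move=> a0 b0 x0 y0; have p0 : 0 <= Num.max 0 (x - a) by rewrite le_max lexx.
have q0 : 0 <= Num.max 0 (y - b) by rewrite le_max lexx.
have p1 : x - a <= Num.max 0 (x - a) by rewrite le_max lexx orbT.
have q1 : y - b <= Num.max 0 (y - b) by rewrite le_max lexx orbT.
move: p0 q0 p1 q1; move: (Num.max 0 (x - a)) (Num.max 0 (y - b)) => p q p0 q0 p1 q1.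
rewrite ge_max; apply/andP; split; first by rewrite addr_ge0// mulr_ge0// mulr_ge0.
have [xa|xa] := lerP (2 * a) x.
  have h1 : x * y <= 2 * (p * y) by rewrite mulrA ler_wpM2r//; lra.
  have h2 := mulr_ge0 a0 b0; have h3 := mulr_ge0 x0 q0; lra.
have [yb|yb] := lerP (2 * b) y.
  have h1 : x * y <= 2 * (x * q) by rewrite mulrCA ler_wpM2l//; lra.
  have h2 := mulr_ge0 a0 b0; have h3 := mulr_ge0 p0 y0; lra.
have h1 : x * y <= (2 * a) * (2 * b) by apply: ler_pM => //; exact: ltW.
have h2 := mulr_ge0 p0 y0; have h3 := mulr_ge0 x0 q0; lra.
Qed.

Lemma max0_mono {R : realType} (a b : R) : a <= b -> Num.max 0 a <= Num.max 0 b.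
Proof. by move=> ab; rewrite ge_max !le_max lexx ab orbT. Qed.

Lemma clip_sqr_lip {R : realType} (M b x y : R) : 0 <= M ->
  `|Num.max 0 (clip M x ^+ 2 - b) - Num.max 0 (clip M y ^+ 2 - b)| <= 2 * M * `|x - y|.
Proof.
move=> M0; apply: le_trans (le_dist_max _ _ _ _) _.
rewrite subrr normr0 add0r (_ : _ - b - _ = (clip M x - clip M y) * (clip M x + clip M y)); last by ring.
rewrite normrM mulrC ler_pM ?clip_lip//.
rewrite (le_trans (ler_normD _ _))// mulr2n mulrDl mul1r.
by apply: lerD; exact: clip_bound.
Qed.

Lemma clip_sqr_mono {R : realType} (M N x : R) : 0 <= M <= N -> clip M x ^+ 2 <= clip N x ^+ 2.
Proof.
move=> /andP[M0 MN]; rewrite -(real_normK (num_real (clip M x))).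
rewrite -(real_normK (num_real (clip N x))) lerXn2r ?nnegrE//.
have [xM|xM] := lerP `|x| M; first by rewrite !clip_id// (le_trans xM).
rewrite (le_trans (clip_bound _ M0))//.
have [xN|xN] := lerP `|x| N; first by rewrite [clip N x]clip_id// ltW.
have N0 : 0 <= N := le_trans M0 MN.
have NN : - N <= N by rewrite (le_trans _ N0)// oppr_le0.
move: xN; rewrite ltr_normr => /orP[] xN.
  by rewrite /clip min_r ?(ltW xN)// max_r// ger0_norm.
have xN' : x <= - N by lra.
by rewrite /clip min_l ?(le_trans xN')// max_l// normrN ger0_norm.
Qed.

(** * Conditional moments of the noise *)

Section conditional_moments.
Context {R : realType} {d : nat} {Theta : Type}.
Context {F : Theta -> probability (borel 'cV[R]_d) R}.
Context {Omega : pointedType} {W : nat -> Omega -> 'cV[R]_d} {N : nat}.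
Hypothesis A3 : forall Q : probability (borel 'M[R]_(d, N)) R, calA F Q ->
  exists P : probability (Fspace W N) R,
    forall B : set (borel 'M[R]_(d, N)), measurable B ->
      Q B = P (Wmat W N @^-1` B).
Hypothesis hTheta : inhabited Theta.
Implicit Types (X Y : Omega -> R).

Notation PP := (@calP _ _ _ F _ W N).

(** Each F th is the law of W_k under some measure of calP. *)
Lemma sup_int_le_calP k psi (ka : R) : (0 < k <= N)%N -> bLip psi ->
  (forall P, PP P -> \int[P]_w psi (W k w) <= ka) -> sup_int F psi <= ka.
Proof.
move=> kN pL h; apply: ge_sup; first by case: hTheta => th; exists (\int[F th]_y psi y), th.
move=> _ [th _ <-]; have [P PPP hP] := ex_calP_law A3 th.
by rewrite -(hP k)// h.
Qed.

Lemma mF_Wentry k l : (k < N)%N -> mF W N (fun w => W k.+1 w l 0).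
Proof. by move=> kN; apply: measurable_Wentry. Qed.

Lemma mF_psiW k psi : (k < N)%N -> bLip psi -> mF W N (fun w => psi (W k.+1 w)).
Proof.
move=> kN /bLipP[C C0 [pC pL]].
have GL : forall al : R, exists2 L : R, 0 <= L & forall (w : Omega) x z,
    setT x -> setT z -> n1 x <= al -> n1 z <= al -> `|psi x - psi z| <= L * n1 (x - z).
  by move=> al; exists C.
apply: (measurable_comp_locally_lip (T := Fspace W N) GL) => //.
by move=> i j; rewrite (ord1 j); exact: mF_Wentry.
Qed.

(** Lipschitz test functions are handled by [calP_cond_le0], since ka dominates [sup_int F psi]; the
    two test-function lemmas extend the inequality to bounded F_k-measurable weights. *)
Lemma calP_cond_bounded (P : probability (Fspace W N) R) k psi (ka M : R) (h : Omega -> R) :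
  PP P -> (k < N)%N -> bLip psi -> (forall P, PP P -> \int[P]_w psi (W k.+1 w) <= ka) ->
  mF W k h -> (forall w, 0 <= h w <= M) ->
  \int[P]_w (h w * psi (W k.+1 w)) <= ka * \int[P]_w h w.
Proof.
move=> PPP kN pL hka mh hM; have kN' := ltnW kN.
have iW : intble P (fun w => psi (W k.+1 w)).
  have /bLipP[C C0 [pC _]] := pL.
  apply: (@bounded_integrable _ _ _ P _ C) => [|w]; last exact: pC.
  exact: mF_psiW.
have h0 w : 0 <= h w by have /andP[] := hM w.
have ih : intble P h.
  apply: (@bounded_integrable _ _ _ P _ M) => [|w]; first exact: mF_le kN' mh.
  by rewrite ger0_norm//; have /andP[] := hM w.
have iX : intble P (fun w => ka - psi (W k.+1 w)) by apply: intbleB => //; exact: intble_cst.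
have hb w : `|h w| <= M by rewrite ger0_norm//; have /andP[] := hM w.
have ihW : intble P (fun w => h w * psi (W k.+1 w)).
  by apply: (@intbleM_bounded _ _ _ P M _ _ _ hb iW); exact: mF_le kN' mh.
have [th] := hTheta.
have key : 0 <= \int[P]_w (h w * (ka - psi (W k.+1 w))).
  apply: (indic_test_ext kN' iX) mh hM => A mA.
  apply: (indic_test_ge0 kN' iX) mA => g gL g01.
  have g0 x : 0 <= g x by have /andP[] := g01 x.
  have ig := intble_bLip P kN' gL.
  have igc a : intble P (fun w => g (Wmat W k w) * a).
    by apply: intble_eq (intbleZ a ig) => w; rewrite mulrC.
  have igW : intble P (fun w => g (Wmat W k w) * psi (W k.+1 w)).
    apply: (intbleM_bounded (M := 1)) iW; first exact: intble_measurable ig.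
    by move=> w; have /andP[g0' g1] := g01 (Wmat W k w); rewrite ger0_norm.
  have := calP_cond_le0 th PPP kN gL g0 pL.
  under eq_Rintegral do rewrite mulrBr.
  rewrite RintegralB//.
  under [X in _ -> _ <= X]eq_Rintegral do rewrite mulrBr.
  rewrite [X in _ -> _ <= X]RintegralB//.
  rewrite !subr_ge0 subr_le0 => /le_trans; apply.
  apply: Rint_le.
  - exact: igc.
  - exact: igc.
  - by move=> w; rewrite ler_wpM2l//; apply: sup_int_le_calP pL hka.
move: key; under eq_Rintegral do rewrite mulrBr.
rewrite RintegralB//; last by apply: intble_eq (intbleZ ka ih) => w; rewrite mulrC.
rewrite subr_ge0 => /le_trans; apply.
by under eq_Rintegral do rewrite mulrC; rewrite RintegralZl.
Qed.

(* The unconditional bound passes to the conditional one because W_{k+1} is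
   independent of F_k in the sense of calP_cond_le0. *)
Lemma calP_cond_moment (P : probability (Fspace W N) R) k l (b ka : R) (h : Omega -> R) :
  PP P -> (k < N)%N -> 0 <= b ->
  (forall P, PP P -> intble P (fun w => Num.max 0 (W k.+1 w l 0 ^+ 2 - b)) /\
     \int[P]_w Num.max 0 (W k.+1 w l 0 ^+ 2 - b) <= ka) ->
  mF W N h -> aeF P k h -> (forall w, 0 <= h w) -> intble P h ->
  intble P (fun w => h w * Num.max 0 (W k.+1 w l 0 ^+ 2 - b)) /\
  \int[P]_w (h w * Num.max 0 (W k.+1 w l 0 ^+ 2 - b)) <= ka * \int[P]_w h w.
Proof.
move=> PPP kN b0 hka mh [h' mh' hh'] h0 ih; have kN' := ltnW kN.
have ka0 : 0 <= ka.
  have [_] := hka _ PPP; apply: le_trans; apply: Rintegral_ge0 => w _.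
  by rewrite le_max lexx.
pose V w : R := Num.max 0 (W k.+1 w l 0 ^+ 2 - b).
have mW : mF W N (fun w => W k.+1 w l 0) by exact: mF_Wentry.
have mmx X : mF W N X -> mF W N (fun w => Num.max 0 (X w)).
  by move=> mX; apply: measurable_maxr => //; exact: measurable_cst.
have mVc (X : Omega -> R) : mF W N X -> mF W N (fun w => Num.max 0 (X w ^+ 2 - b)).
  move=> mX; apply: mmx; apply: measurable_funB; last exact: measurable_cst.
  exact: measurable_funX.
have V0 w : 0 <= V w by rewrite le_max lexx.
(* The F_k-measurable version is nonnegative only almost surely, hence the positive part. *)
pose hp w : R := Num.max 0 (h' w).
have hhp : {ae P, forall w, h w = hp w}.
  by apply: (ae_imp hh') => w e; rewrite /hp -e max_r.
have mhpk : mF W k hp by apply: measurable_maxr => //; exact: measurable_cst.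
have mhp := mF_le kN' mhpk.
have hp0 w : 0 <= hp w by rewrite le_max lexx.
have ihp : intble P hp := intble_ae ih mhp hhp.
(* Capping the weight and clipping the noise at i makes [calP_cond_bounded] applicable. The products
   increase with i and are stationary as soon as i exceeds [hp w] plus the absolute value of the
   noise. *)
pose f (i : nat) w : R := Num.min i%:R (hp w) * Num.max 0 (clip i%:R (W k.+1 w l 0) ^+ 2 - b).
have mmin i : mF W k (fun w => Num.min i%:R (hp w)).
  by apply: measurable_minr => //; exact: measurable_cst.
have min0 i w : 0 <= Num.min i%:R (hp w) by rewrite le_min ler0n hp0.
have key : (\int[P]_w (hp w * V w)%:E <= (ka * \int[P]_w hp w)%:E)%E.
  apply: (@ge0_int_le_lim _ _ (Fspace W N) P f).
  - move=> i; apply: measurable_funM; first exact: mF_le kN' (mmin i).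
    by apply: mVc; exact: measurable_clip.
  - by move=> i w; rewrite mulr_ge0// le_max lexx.
  - move=> w i j ij; have ijR : i%:R <= j%:R :> R by rewrite ler_nat.
    apply: ler_pM => //; first by rewrite le_max lexx.
      by rewrite le_min !ge_min ijR lexx orbT.
    by apply: max0_mono; rewrite lerD2r clip_sqr_mono// ler0n.
  - move=> w; have [i hi] : exists i : nat, hp w + `|W k.+1 w l 0| <= i%:R.
      exists (Num.bound (hp w + `|W k.+1 w l 0|)).
      by apply/ltW/archi_boundP; rewrite addr_ge0.
    exists i => j ij; have jR : hp w + `|W k.+1 w l 0| <= j%:R.
      by rewrite (le_trans hi)// ler_nat.
    have hn := normr_ge0 (W k.+1 w l 0); have hw := hp0 w.
    rewrite /f /V clip_id ?min_r//; clear -hn hw jR; lra.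
  - move=> i.
    pose psi (y : 'cV[R]_d) := Num.max 0 (clip i%:R (y l 0) ^+ 2 - b).
    have pL : bLip psi.
      apply/bLipP; exists (i%:R ^+ 2 + 2 * i%:R).
        by rewrite addr_ge0// ?mulr_ge0// exprn_ge0.
      split=> [y|x y].
        rewrite ger0_norm ?le_max ?lexx// ge_max addr_ge0 ?mulr_ge0 ?exprn_ge0//=.
        apply: (@le_trans _ _ (i%:R ^+ 2)); last by rewrite lerDl mulr_ge0.
        rewrite lerBlDr (le_trans (y := i%:R ^+ 2))// ?lerDl//.
        rewrite -(real_normK (num_real (clip _ _))) lerXn2r ?nnegrE//.
        exact: clip_bound.
      rewrite (le_trans (clip_sqr_lip _ _ _ _))//.
      apply: ler_pM; rewrite ?mulr_ge0// ?lerDr ?exprn_ge0//.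
      by have := le_entry_n1 (x - y) l 0; rewrite !mxE.
    have minM w : 0 <= Num.min i%:R (hp w) <= i%:R by rewrite min0 ge_min lexx.
    have mw : mF W N (fun w => psi (W k.+1 w)) by apply: mVc; exact: measurable_clip.
    have ipsi (P' : probability (Fspace W N) R) : intble P' (fun w => psi (W k.+1 w)).
      have /bLipP[C C0 [pC _]] := pL.
      by apply: (@bounded_integrable _ _ _ P' _ C).
    have ifi : intble P (f i).
      apply: (intbleM_bounded (M := i%:R)) (ipsi P); first exact: mF_le kN' (mmin i).
      by move=> w; rewrite ger0_norm//; have /andP[] := minM w.
    rewrite -(Rint_fineK ifi) lee_fin.
    apply: (le_trans (calP_cond_bounded PPP kN pL (ka := ka) _ (mmin i) minM)).
      move=> P' PP'; have [iV hV] := hka _ PP'; apply: le_trans hV.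
      apply: Rint_le => // w; apply: max0_mono; rewrite lerD2r.
      rewrite -(real_normK (num_real (clip _ _))) -(real_normK (num_real (W _ _ _ _))).
      rewrite lerXn2r ?nnegrE//.
      have := clip_lip i%:R (W k.+1 w l 0) 0.
      by rewrite [clip _ 0]clip_id ?normr0// !subr0.
    rewrite ler_wpM2l//; apply: Rint_le => //.
      by apply: (@bounded_integrable _ _ _ P _ i%:R) => [|w]; [exact: mF_le kN' (mmin i)|rewrite ger0_norm//; have /andP[] := minM w].
    by move=> w; rewrite ge_min lexx orbT.
have mhpV : mF W N (fun w => hp w * V w) by apply: measurable_funM => //; exact: mVc.
have mhV : mF W N (fun w => h w * V w) by apply: measurable_funM => //; exact: mVc.
have ihpV : intble P (fun w => hp w * V w).
  by apply: ge0_intble key => // w; rewrite mulr_ge0.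
have aeV : {ae P, forall w, hp w * V w = h w * V w} by apply: (ae_imp hhp) => w ->.
split; first exact: intble_ae ihpV mhV aeV.
rewrite -(Rint_ae mhpV mhV aeV) (Rint_ae mh mhp hhp).
by rewrite -lee_fin (Rint_fineK ihpV).
Qed.

(* The states and the directions belong to DD k, which multiplication by
   W_{k+1} maps into DD (k + 1). *)
Definition DD k X := QC PP k X /\ UI2 PP X.

Lemma DD_mF k X : DD k X -> mF W N X. Proof. by case=> -[]. Qed.

Lemma DD_intble2 k X P : DD k X -> PP P -> intble P (fun w => X w ^+ 2).
Proof. by move=> [_ [_ [_ + _]]] PPP; exact. Qed.

Lemma DD_le k k' X : (k <= k')%N -> DD k X -> DD k' X.
Proof. by move=> kk' [qX uX]; split=> //; exact: QC_le qX. Qed.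

Lemma DDD k X Y : (k <= N)%N -> DD k X -> DD k Y -> DD k (fun w => X w + Y w).
Proof. by move=> kN [qX uX] [qY uY]; split; [exact: QCD|exact: UI2D]. Qed.

Lemma DDZ k a X : (k <= N)%N -> DD k X -> DD k (fun w => a * X w).
Proof. by move=> kN [qX uX]; split; [exact: QCZ|exact: UI2Z]. Qed.

Lemma DD_cst k a : (k <= N)%N -> DD k (fun=> a).
Proof. by move=> kN; split; [exact: QC_cst|exact: UI2_cst]. Qed.

Lemma DD_sum k (I : Type) (s : seq I) (G : I -> Omega -> R) : (k <= N)%N ->
  (forall i, DD k (G i)) -> DD k (fun w => \sum_(i <- s) G i w).
Proof.
move=> kN h; split; first by apply: QC_sum => // i; have [] := h i.
by apply: UI2_sum => i; have [] := h i.
Qed.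

Lemma DD_norm k X : (k <= N)%N -> DD k X -> DD k (fun w => `|X w|).
Proof. by move=> kN [qX uX]; split; [exact: QC_norm|exact: UI2_norm]. Qed.

Section noise_products.
Hypothesis hW : forall k, (0 < k <= N)%N -> mxLc F W N 2 k (W k).

Lemma DD_W k l : (k < N)%N -> DD k.+1 (fun w => W k.+1 w l 0).
Proof.
move=> kN; have h : (0 < k.+1 <= N)%N by [].
exact: Lc2_QC (hW h l 0).
Qed.

(** The case b = 0 of [calP_cond_moment], with one constant for all P and all weights; adding 1
    makes it positive. *)
Lemma W_cond_sqr k l : (k < N)%N -> exists2 C : R, 0 < C & forall P h, PP P ->
  mF W N h -> aeF P k h -> (forall w, 0 <= h w) -> intble P h ->
  intble P (fun w => h w * W k.+1 w l 0 ^+ 2) /\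
  \int[P]_w (h w * W k.+1 w l 0 ^+ 2) <= C * \int[P]_w h w.
Proof.
move=> kN; have [_ [mW uW]] := DD_W l kN.
have [C C0 hC] := UI_bound uW; exists (C + 1); first by rewrite ltr_wpDl.
have e w : W k.+1 w l 0 ^+ 2 = Num.max 0 (W k.+1 w l 0 ^+ 2 - 0).
  by rewrite subr0 max_r// sqr_ge0.
move=> P h PPP mh ah h0 ih.
have -> : (fun w => h w * W k.+1 w l 0 ^+ 2) =
    (fun w => h w * Num.max 0 (W k.+1 w l 0 ^+ 2 - 0)).
  by apply/funext => w; rewrite -e.
have [iV hV] : intble P (fun w => h w * Num.max 0 (W k.+1 w l 0 ^+ 2 - 0)) /\
    \int[P]_w (h w * Num.max 0 (W k.+1 w l 0 ^+ 2 - 0)) <= (C + 1) * \int[P]_w h w.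
  apply: calP_cond_moment => // P' PP'.
  have -> : (fun w => Num.max 0 (W k.+1 w l 0 ^+ 2 - 0)) = (fun w => W k.+1 w l 0 ^+ 2).
    by apply/funext => w; rewrite -e.
  split; first by case: uW => _ + _; exact.
  apply: (@le_trans _ _ C); last by rewrite lerDl.
  apply: le_trans (hC _ PP').
  by rewrite le_eqVlt; apply/orP; left; apply/eqP; apply: eq_Rintegral => w _; rewrite ger0_norm// sqr_ge0.
by split.
Qed.

(** By [mul_tail_le] the tail of X^2 W^2 is bounded by the tail of X^2 times W^2 and X^2 times the
    tail of W^2. Given F_k, the first costs a constant factor, and the second a small factor times a
    bound on E[X^2]. *)
Lemma DDM_W k l X : (k < N)%N -> DD k X -> DD k.+1 (fun w => X w * W k.+1 w l 0).
Proof.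
move=> kN DX; have DW := DD_W l kN; have kN' := ltnW kN.
have [qX [mX uX]] := DX; have [qW [mW uW]] := DW.
split; first by apply: QCM => //; apply: QC_le qX.
have mXW : mF W N (fun w => X w * W k.+1 w l 0) by exact: measurable_funM.
split=> //; have [C C0 hC] := W_cond_sqr l kN.
have aX P : PP P -> aeF P k X by move=> PPP; exact: QC_aeF qX.
have aX2 P : PP P -> aeF P k (fun w => X w ^+ 2).
  by move=> PPP; apply: (aeF_comp (h := fun x => x ^+ 2)) (aX _ PPP) => X'; exact: measurable_funX.
have mX2 : mF W N (fun w => X w ^+ 2) by exact: measurable_funX.
have iX2 P : PP P -> intble P (fun w => X w ^+ 2) by exact: DD_intble2 DX.
have i1 P : PP P -> intble P (fun w => X w ^+ 2 * W k.+1 w l 0 ^+ 2).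
  by move=> PPP; have [] := hC _ _ PPP mX2 (aX2 _ PPP) (fun w => sqr_ge0 _) (iX2 _ PPP).
split=> [|P PPP|e e0].
- exact: measurable_funX.
- by apply: intble_eq (i1 P PPP) => w; rewrite exprMn.
have [K K0 hK] := UI_bound uX.
have [_ _ tX] := uX; have [_ iW2 tW] := uW.
(* Both products come with a factor 2 below, so e / 4 each leaves room; C and K + 1 are the factors
   picked up under the conditional bounds. *)
have [|a a0 ha] := tX (e / 4 / C); first by rewrite !divr_gt0.
have [|b b0 hb] := tW (e / 4 / (K + 1)); first by rewrite !divr_gt0// ltr_wpDl.
exists (4 * (a * b)) => [|P PPP]; first by rewrite mulr_ge0// mulr_ge0.
pose hX w : R := Num.max 0 (X w ^+ 2 - a).
have mhX : mF W N hX.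
  apply: measurable_maxr; first exact: measurable_cst.
  by apply: measurable_funB => //; exact: measurable_cst.
have hX0 w : 0 <= hX w by rewrite le_max lexx.
have ahX : aeF P k hX.
  apply: (aeF_comp (h := fun x => Num.max 0 (x ^+ 2 - a))) (aX _ PPP) => X' mX'.
  apply: measurable_maxr; first exact: measurable_cst.
  by apply: measurable_funB; [exact: measurable_funX|exact: measurable_cst].
have eX w : Num.max 0 (`|X w ^+ 2| - a) = hX w by rewrite ger0_norm ?sqr_ge0.
have ihX : intble P hX.
  by apply: intble_eq (intble_tail a0 mX2 (iX2 _ PPP)) => w; exact: eX.
have hahX : \int[P]_w hX w <= e / 4 / C.
  by have -> : \int[P]_w hX w = \int[P]_w Num.max 0 (`|X w ^+ 2| - a);
    [apply: eq_Rintegral => w _; rewrite eX|exact: ha].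
have [iA hA] := hC _ _ PPP mhX ahX hX0 ihX.
have [iB hB] : intble P (fun w => X w ^+ 2 * Num.max 0 (W k.+1 w l 0 ^+ 2 - b)) /\
    \int[P]_w (X w ^+ 2 * Num.max 0 (W k.+1 w l 0 ^+ 2 - b)) <=
      e / 4 / (K + 1) * \int[P]_w X w ^+ 2.
  apply: calP_cond_moment => //; last 3 first.
  - exact: aX2.
  - by move=> w; exact: sqr_ge0.
  - exact: iX2.
  move=> P' PP'; have eW w : Num.max 0 (`|W k.+1 w l 0 ^+ 2| - b) = Num.max 0 (W k.+1 w l 0 ^+ 2 - b).
    by rewrite ger0_norm ?sqr_ge0.
  split; last first.
    have -> : \int[P']_w Num.max 0 (W k.+1 w l 0 ^+ 2 - b) =
      \int[P']_w Num.max 0 (`|W k.+1 w l 0 ^+ 2| - b) by apply: eq_Rintegral => w _; rewrite eW.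
    exact: hb.
  apply: (@intble_eq _ _ _ P' _ _ eW); apply: intble_tail => //; last exact: iW2.
  exact: measurable_funX.
have iXW : intble P (fun w => (X w * W k.+1 w l 0) ^+ 2).
  by apply: intble_eq (i1 P PPP) => w; rewrite exprMn.
apply: (@le_trans _ _ (2 * \int[P]_w (hX w * W k.+1 w l 0 ^+ 2) +
    2 * \int[P]_w (X w ^+ 2 * Num.max 0 (W k.+1 w l 0 ^+ 2 - b)))).
  rewrite -RintegralZl// -(@RintegralZl _ _ _ P _ _ _ _ iB)//.
  rewrite -RintegralD//; [|exact: intbleZ..].
  apply: Rint_le => [||w].
  - by apply: intble_tail => //; [rewrite mulr_ge0// mulr_ge0|exact: measurable_funX].
  - by apply: intbleD; exact: intbleZ.
  rewrite ger0_norm ?sqr_ge0// exprMn; apply: mul_tail_le => //; exact: sqr_ge0.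
have hA' : \int[P]_w (hX w * W k.+1 w l 0 ^+ 2) <= e / 4.
  by apply: le_trans hA _; rewrite mulrC -ler_pdivlMr.
have hB' : \int[P]_w (X w ^+ 2 * Num.max 0 (W k.+1 w l 0 ^+ 2 - b)) <= e / 4.
  have K1 : 0 < K + 1 by rewrite ltr_wpDl.
  apply: le_trans hB _; rewrite mulrAC ler_pdivrMr// ler_wpM2l//; first by rewrite divr_ge0// ltW.
  rewrite (le_trans (y := K)) ?lerDl//; apply: le_trans (hK _ PPP).
  by rewrite le_eqVlt; apply/orP; left; apply/eqP; apply: eq_Rintegral => w _; rewrite ger0_norm// sqr_ge0.
clear -hA' hB' e0; lra.
Qed.

End noise_products.

End conditional_moments.

(** * Differentiable coefficients *)

(** The function phi is controlled only on [0, 1]. Composing with the clamp onto [0, 1] gives a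
    continuous function on the line with the same derivatives at interior points. *)
Lemma mvt_within {R : realType} (phi dphi : R -> R) :
  (forall t : R, 0 <= t <= 1 -> forall e : R, 0 < e -> exists2 r : R, 0 < r &
    forall s : R, 0 <= s <= 1 -> `|s - t| < r ->
      `|phi s - phi t - dphi t * (s - t)| <= e * `|s - t|) ->
  exists2 c : R, 0 <= c <= 1 & phi 1 - phi 0 = dphi c.
Proof.
move=> hphi; pose c (t : R) : R := Num.max 0 (Num.min t 1).
have c01 t : 0 <= c t <= 1 by rewrite le_max lexx/= ge_max ler01 ge_min lexx orbT.
have cid (t : R) : 0 <= t <= 1 -> c t = t by move=> /andP[t0 t1]; rewrite /c min_l// max_r.
have clip01 s t : `|c s - c t| <= `|s - t|.
  rewrite (le_trans (le_dist_max _ _ _ _))// subrr normr0 add0r.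
  by rewrite (le_trans (le_dist_min _ _ _ _))// subrr normr0 addr0.
pose f t := phi (c t).
have cf : continuous f.
  move=> t; apply/cvgrPdist_le => e e0.
  have [r r0 hr] := hphi _ (c01 t) 1 ltr01.
  have D0 : 0 < `|dphi (c t)| + 1 by rewrite ltr_wpDl.
  have d0 : 0 < Num.min r (e / (`|dphi (c t)| + 1)) by rewrite lt_min r0 divr_gt0.
  apply: filterS (nbhsx_ballx t _ d0) => s; rewrite -ball_normE/= distrC lt_min => /andP[sr se].
  have h1 := hr _ (c01 s) (le_lt_trans (clip01 s t) sr).
  rewrite distrC -[f s - f t](subrK (dphi (c t) * (c s - c t))).
  rewrite (le_trans (ler_normD _ _))// normrM.
  apply: (@le_trans _ _ ((`|dphi (c t)| + 1) * `|s - t|)); last first.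
    by rewrite mulrC -ler_pdivlMr// ltW.
  rewrite mulrDl addrC lerD ?ler_wpM2l ?clip01//.
  by rewrite (le_trans h1)// !mul1r clip01.
have df (t : R) : t \in `]0, 1[%R -> is_derive t (1 : R) f (dphi t).
  rewrite in_itv/= => /andP[t0 t1].
  have t01 : 0 <= t <= 1 by rewrite !ltW.
  have lim : h^-1 *: ((f \o shift t) (h *: 1) - f t) @[h --> 0^'] --> dphi t.
    apply/cvgrPdist_le => e e0; have [r r0 hr] := hphi _ t01 _ e0.
    pose r' := Num.min r (Num.min t (1 - t)).
    have r'0 : 0 < r' by rewrite !lt_min r0 t0 subr_gt0.
    have nb := dnbhs0_lt r'0 : \forall h \near (0 : R)^', `|h| < r'.
    near=> h.
    have h0 : h != 0 by near: h; exact: nbhs_dnbhs_neq.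
    have : `|h| < r' by near: h.
    rewrite !lt_min => /and3P[hr1 hr2 hr3].
    have s01 : 0 <= h + t <= 1 by move: hr2 hr3; rewrite !ltr_norml => /andP[? ?] /andP[? ?]; lra.
    have := hr (h + t) s01; rewrite addrK => /(_ hr1) hh.
    rewrite /f /= cid; last by rewrite [_ *: _]mulr1.
    rewrite (cid t)// [_ *: 1]mulr1 distrC.
    rewrite -(@ler_pM2l _ `|h|) ?normr_gt0// -normrM mulrBr mulrC.
    have -> : h^-1 *: (phi (h + t) - phi t) * h = phi (h + t) - phi t.
      by rewrite -[_ *: _]/(_ * _) mulrAC mulVf// mul1r.
    by rewrite [h * dphi t]mulrC [`|h| * e]mulrC.
  by apply: DeriveDef; [apply/cvg_ex; exists (dphi t)|exact: cvg_lim].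
have [x x01 hx] := MVT ltr01 df (continuous_subspaceT cf).
exists x; first by move: x01; rewrite in_itv/= => /andP[? ?]; rewrite !ltW.
by move: hx; rewrite /f !cid ?ler01 ?lexx// subr0 mulr1.
Unshelve. all: by end_near.
Qed.

Section matrix_norm.
Context {R : realType}.

Lemma n1_mulmx p q r (A : 'M[R]_(p, q)) (B : 'M[R]_(q, r)) : n1 (A *m B) <= n1 A * n1 B.
Proof.
rewrite /n1 mulr_suml; apply: ler_sum => i _.
apply: (@le_trans _ _ (\sum_j \sum_k `|A i k| * `|B k j|)).
  apply: ler_sum => j _; rewrite mxE; apply: le_trans (ler_norm_sum _ _ _) _.
  by apply: ler_sum => k _; rewrite normrM.
rewrite exchange_big/= mulr_suml; apply: ler_sum => k _.
rewrite -mulr_sumr ler_wpM2l// (bigD1 k)//= lerDl.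
by apply: sumr_ge0 => k' _; apply: sumr_ge0.
Qed.

Lemma n1_tr p q (A : 'M[R]_(p, q)) : n1 A^T = n1 A.
Proof.
rewrite /n1 exchange_big/=; apply: eq_bigr => i _; apply: eq_bigr => j _.
by rewrite mxE.
Qed.

Lemma n1_col_mx p q r (A : 'M[R]_(p, r)) (B : 'M[R]_(q, r)) :
  n1 (col_mx A B) = n1 A + n1 B.
Proof.
rewrite /n1 big_split_ord/=; congr (_ + _); apply: eq_bigr => i _; apply: eq_bigr => j _.
  by rewrite col_mxEu.
by rewrite col_mxEd.
Qed.

Lemma n1_row_mx p q r (A : 'M[R]_(p, q)) (B : 'M[R]_(p, r)) :
  n1 (row_mx A B) = n1 A + n1 B.
Proof. by rewrite -n1_tr tr_row_mx n1_col_mx !n1_tr. Qed.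

Lemma n1_cV q (v : 'cV[R]_q) : n1 v = \sum_i `|v i 0|.
Proof. by apply: eq_bigr => i _; rewrite big_ord1. Qed.

End matrix_norm.

(* The common properties of b, sigma^l, f and phi that the proof uses; the
   argument z is (x, u), or x for phi. *)
Record nice {R : realType} (Omega : Type) (p q : nat) (A : set 'cV[R]_q)
    (G : 'cV[R]_q -> Omega -> 'cV[R]_p) (J : 'cV[R]_q -> Omega -> 'M[R]_(p, q))
    (g : R -> R) := Nice {
  nice_cvx : forall z z' (t : R), A z -> A z' -> 0 <= t <= 1 -> A (z + t *: (z' - z));
  nice_derive : forall w z, A z -> is_derivative_within A (G^~ w) z (J z w);
  nice_mono : forall r s, 0 <= r -> r <= s -> 0 <= g r <= g s;
  nice_bound : forall w z, A z -> n1 (J z w) <= g (n1 z);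
  nice_modulus : forall al e : R, 0 < e -> exists2 r : R, 0 < r & forall w z z',
    A z -> A z' -> n1 z <= al -> n1 z' <= al -> n1 (z - z') < r ->
    n1 (J z w - J z' w) <= e }.

Section nice.
Context {R : realType} {Omega : pointedType} {p q : nat} {A : set 'cV[R]_q}.
Context {G : 'cV[R]_q -> Omega -> 'cV[R]_p} {J : 'cV[R]_q -> Omega -> 'M[R]_(p, q)}.
Context {g : R -> R} (hG : nice A G J g).

Lemma n1_segment (z z' : 'cV[R]_q) (t al : R) : 0 <= t <= 1 -> n1 z <= al -> n1 z' <= al ->
  n1 (z + t *: (z' - z)) <= al.
Proof.
move=> /andP[t0 t1] hz hz'.
have -> : z + t *: (z' - z) = (1 - t) *: z + t *: z'.
  by rewrite scalerBr scalerBl scale1r; rewrite addrA addrAC.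
rewrite (le_trans (le_n1D _ _))// !n1Z !ger0_norm ?subr_ge0//.
have -> : al = (1 - t) * al + t * al by ring.
by rewrite lerD// ler_wpM2l// subr_ge0.
Qed.

(** Stated per component, because the intermediate point may differ from one component to
    another. *)
Lemma nice_mvt w z z' i : A z -> A z' -> exists2 t : R, 0 <= t <= 1 &
  G z' w i 0 - G z w i 0 = (J (z + t *: (z' - z)) w *m (z' - z)) i 0.
Proof.
move=> Az Az'; set v := z' - z.
have [|t t01 ht] := mvt_within (phi := fun t => G (z + t *: v) w i 0)
    (dphi := fun t => (J (z + t *: v) w *m v) i 0).
- move=> t t01 e e0.
  have v1 : 0 < n1 v + 1 by rewrite ltr_wpDl ?n1_ge0.
  have At : A (z + t *: v) by exact: (nice_cvx hG).
  have ev : 0 < e / (n1 v + 1) by rewrite divr_gt0.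
  have [r r0 hr] := nice_derive hG w At ev.
  exists (r / (n1 v + 1)); first by rewrite divr_gt0.
  move=> s s01 st; have As : A (z + s *: v) by exact: (nice_cvx hG).
  have ds : z + s *: v - (z + t *: v) = (s - t) *: v.
    by rewrite opprD addrACA subrr add0r scalerBl.
  have vle : enorm ((s - t) *: v) <= (n1 v + 1) * `|s - t|.
    by rewrite (le_trans (enorm_le_n1 _))// n1Z mulrC ler_wpM2r// lerDl.
  have h := hr _ As; rewrite ds -scalemxAr in h.
  have hs : (n1 v + 1) * `|s - t| < r by rewrite mulrC -ltr_pdivlMr.
  have {}h := h (le_lt_trans vle hs).
  have := le_trans (le_entry_enorm _ i 0) h; rewrite !mxE [_ * (s - t)]mulrC.
  move/le_trans; apply.
  by rewrite (le_trans (ler_wpM2l (ltW ev) vle))// mulrA divfK ?gt_eqF.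
- exists t => //; by move: ht; rewrite scale1r scale0r addr0 /v addrCA subrr addr0.
Qed.

Lemma nice_lip w z z' i al : A z -> A z' -> n1 z <= al -> n1 z' <= al ->
  `|G z' w i 0 - G z w i 0| <= g al * n1 (z' - z).
Proof.
move=> Az Az' hz hz'; have [t t01 ->] := nice_mvt w i Az Az'.
rewrite (le_trans (le_entry_n1 _ _ _))// (le_trans (n1_mulmx _ _))//.
rewrite ler_wpM2r ?n1_ge0//.
have At : A (z + t *: (z' - z)) by exact: (nice_cvx hG).
rewrite (le_trans (nice_bound hG w At))//.
by have /andP[] := nice_mono hG (n1_ge0 _) (n1_segment t01 hz hz').
Qed.

(** The mean value form reduces the remainder to a difference of Jacobians, which is small uniformly
    in w. *)
Lemma nice_taylor al (e : R) : 0 < e -> exists2 r : R, 0 < r & forall w z z' i,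
  A z -> A z' -> n1 z <= al -> n1 z' <= al -> n1 (z' - z) < r ->
  `|G z' w i 0 - G z w i 0 - (J z w *m (z' - z)) i 0| <= e * n1 (z' - z).
Proof.
move=> /(nice_modulus hG al)[r r0 hr]; exists r => // w z z' i Az Az' hz hz' zz'.
have [t t01 ->] := nice_mvt w i Az Az'.
have -> : forall a b : 'M[R]_(p, q), (a *m (z' - z)) i 0 - (b *m (z' - z)) i 0 =
    ((a - b) *m (z' - z)) i 0 by move=> a b; rewrite mulmxBl !mxE.
rewrite (le_trans (le_entry_n1 _ _ _))// (le_trans (n1_mulmx _ _))//.
rewrite ler_wpM2r ?n1_ge0//; apply: hr => //.
- exact: (nice_cvx hG).
- exact: n1_segment.
- rewrite addrAC subrr add0r n1Z; have /andP[t0 t1] := t01; rewrite ger0_norm//.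
  by rewrite (le_lt_trans _ zz')// ler_piMl// n1_ge0.
Qed.

Lemma nice_growth w z z' i al : A z -> A z' -> n1 z <= al -> n1 z' <= al ->
  `|G z' w i 0| <= `|G z w i 0| + g al * n1 (z' - z).
Proof.
move=> Az Az' hz hz'; rewrite -[G z' w i 0](subrK (G z w i 0)) addrC.
by rewrite (le_trans (ler_normD _ _))// lerD2l nice_lip.
Qed.

(** Only the end point z + v has to lie in A: by convexity the quotients use points of the
    segment. *)
Lemma nice_direction w z v i : A z -> A (z + v) ->
  (fun j : nat => j.+1%:R * (G (z + j.+1%:R^-1 *: v) w i 0 - G z w i 0)) @ \oo -->
  (J z w *m v) i 0.
Proof.
move=> Az Azv; apply/cvgrPdist_le => e e0.
have v1 : 0 < n1 v + 1 by rewrite ltr_wpDl ?n1_ge0.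
have ev : 0 < e / (n1 v + 1) by rewrite divr_gt0.
have [r r0 hr] := nice_derive hG w Az ev.
exists (Num.bound ((n1 v + 1) / r)) => // j /= hj.
set s : R := j.+1%:R^-1.
have s0 : 0 < s by rewrite invr_gt0.
have s01 : 0 <= s <= 1 by rewrite ltW//= invf_le1// ler1n.
have As : A (z + s *: v).
  by have := nice_cvx hG Az Azv s01; rewrite addrAC subrr add0r.
have vle : enorm (s *: v) <= (n1 v + 1) * s.
  by rewrite (le_trans (enorm_le_n1 _))// n1Z mulrC gtr0_norm// ler_wpM2r// ?lerDl// ltW.
have vr : (n1 v + 1) * s < r.
  rewrite /s -ltr_pdivlMr ?invr_gt0// invrK mulrC -ltr_pdivrMr//.
  have : (n1 v + 1) / r < (Num.bound ((n1 v + 1) / r))%:R by rewrite archi_boundP// divr_ge0// ltW.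
  move/lt_le_trans; apply; rewrite ler_nat; exact: leq_trans hj _.
have := hr _ As; rewrite addrAC subrr add0r => /(_ (le_lt_trans vle vr)) h.
have {h} := le_trans (le_entry_enorm _ i 0) h; rewrite -scalemxAr !mxE => h.
rewrite distrC -(@ler_pM2l _ s)// -[X in X * `|_|](gtr0_norm s0) -normrM mulrBr mulrA.
rewrite mulVf ?pnatr_eq0// mul1r (le_trans h)//.
rewrite (le_trans (ler_wpM2l (ltW ev) vle))// mulrA divfK ?gt_eqF//.
by rewrite mulrC.
Qed.

End nice.

Lemma modulus_small {R : realType} (rho : R -> R) : modulus rho ->
  forall e : R, 0 < e -> exists2 r : R, 0 < r & forall s, 0 <= s < r -> rho s <= e.
Proof.
move=> [_ _ rho0 /cvgrPdist_le cr] e e0.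
have [r /= r0 hr] := cr _ e0; exists r => // s /andP[s0 sr].
have [->|sn0] := eqVneq s 0; first by rewrite rho0 ltW.
have sp : 0 < s by rewrite lt0r sn0.
have := hr s; rewrite /= !sub0r !normrN gtr0_norm// => /(_ sr sp).
exact: le_trans (ler_norm _).
Qed.

Lemma n1_udsubmx {R : realType} n m (z : 'cV[R]_(n + m)) :
  n1 z = n1 (usubmx z) + n1 (dsubmx z).
Proof. by rewrite -[in LHS](vsubmxK z) n1_col_mx. Qed.

Lemma n1_lrsubmx {R : realType} p n m (J : 'M[R]_(p, n + m)) (L : R) :
  enorm (lsubmx J) <= L -> enorm (rsubmx J) <= L -> n1 J <= (p * (n + m))%:R * L.
Proof.
move=> hl hr; rewrite -[J]hsubmxK n1_row_mx mulnDr natrD mulrDl.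
by apply: lerD; apply: le_trans (n1_le_enorm _) _; rewrite ler_wpM2l.
Qed.

Section UI_norm.
Context {R : realType} {d : nat} {Omega : pointedType} {W : nat -> Omega -> 'cV[R]_d}.
Context {N : nat} (PP : set (probability (Fspace W N) R)).

Lemma UI_norm X : UI PP X -> UI PP (fun w => `|X w|).
Proof.
move=> uX; apply: (UI_le _ _ uX); last by move=> w; rewrite normr_id.
by case: uX => mX _ _; exact: measurableT_comp.
Qed.

End UI_norm.

Section composites.
Context {R : realType} {d : nat} {Omega : pointedType} {W : nat -> Omega -> 'cV[R]_d}.
Context {N : nat} {PP : set (probability (Fspace W N) R)}.
Context {p q : nat} {A : set 'cV[R]_q}.
Context {G : 'cV[R]_q -> Omega -> 'cV[R]_p} {J : 'cV[R]_q -> Omega -> 'M[R]_(p, q)}.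
Context {g : R -> R} (hG : nice A G J g).
Variable k : nat.
Hypothesis kN : (k <= N)%N.
Hypothesis qG : forall z, A z -> forall i, QC PP k (fun w => G z w i 0).
Variable Z : Omega -> 'cV[R]_q.
Hypothesis ZA : forall w, A (Z w).
Hypothesis qZ : forall i, QC PP k (fun w => Z w i 0).

Lemma nice_ge0 r : 0 <= r -> 0 <= g r.
Proof. by move=> r0; have /andP[] := nice_mono hG r0 (lexx r). Qed.

Lemma nice_locally_lip i al : exists2 L : R, 0 <= L & forall w x z, A x -> A z ->
  n1 x <= al -> n1 z <= al -> `|G x w i 0 - G z w i 0| <= L * n1 (x - z).
Proof.
exists (g (Num.max 0 al)); first by rewrite nice_ge0// le_max lexx.
move=> w x z Ax Az hx hz; apply: (nice_lip hG) => //.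
  by rewrite le_max hz orbT.
by rewrite le_max hx orbT.
Qed.

Lemma nice_QC i : QC PP k (fun w => G (Z w) w i 0).
Proof.
apply: (QC_comp_locally_lip kN (G := fun z w => G z w i 0) (nice_locally_lip i)) => //.
  by move=> z Az; exact: qG.
by move=> a b; rewrite (ord1 b).
Qed.

Section direction.
Variable V : Omega -> 'cV[R]_q.
Hypothesis VA : forall w, A (Z w + V w).
Hypothesis qV : forall i, QC PP k (fun w => V w i 0).

Let ZV_ j w := Z w + j.+1%:R^-1 *: V w.

Let ZVA j w : A (ZV_ j w).
Proof.
have := nice_cvx hG (ZA w) (VA w) (t := j.+1%:R^-1).
by rewrite addrAC subrr add0r; apply; rewrite invr_ge0 ler0n/= invf_le1// ler1n.
Qed.

(** The difference quotients are quasi-continuous as compositions. Taylor's estimate is uniform in w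
    on balls, and tightness of Z and V covers the rest, so the limit is uniform over the
    measures. *)
Lemma nice_direction_QC i : QC PP k (fun w => (J (Z w) w *m V w) i 0).
Proof.
pose D_ j w := j.+1%:R * (G (ZV_ j w) w i 0 - G (Z w) w i 0).
have qn (X : Omega -> 'cV[R]_q) : (forall i, QC PP k (fun w => X w i 0)) ->
    QC PP k (fun w => n1 (X w)).
  move=> qX; have -> : (fun w => n1 (X w)) = (fun w => n1 (X w - 0)).
    by apply/funext => w; rewrite subr0.
  by apply: QC_n1 => // a b; rewrite (ord1 b).
have qZV j a : QC PP k (fun w => ZV_ j w a 0).
  rewrite /ZV_; under eq_fun do rewrite !mxE.
  by apply: QCD => //; exact: QCZ.
have qD j : QC PP k (D_ j).
  apply: QCZ => //; apply: QCB => //; last exact: nice_QC.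
  apply: (QC_comp_locally_lip kN (G := fun z w => G z w i 0) (nice_locally_lip i)) => //.
    by move=> z Az; exact: qG.
  by move=> a b; rewrite (ord1 b).
have mJV : mF W N (fun w => (J (Z w) w *m V w) i 0).
  apply: (@measurable_fun_cvg _ (Fspace W N) R setT D_).
    by move=> j; case: (qD j).
  by move=> w _; exact: (nice_direction hG).
apply: QC_unif => // e e0; have e4 : 0 < e / 2 / 2 by rewrite !divr_gt0.
have qnZ := qn _ qZ; have qnV := qn _ qV.
have [M1 M10 hM1] := QC_tight kN qnZ e4; have [M2 M20 hM2] := QC_tight kN qnV e4.
(* Bounds the base point and the displaced one, as the step is at most 1. *)
pose al := (M1 + 1) + (M2 + 1).
have al0 : 0 < al by rewrite /al; lra.
have e' : 0 < e / 2 / al by rewrite !divr_gt0.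
have [r r0 hr] := nice_taylor hG al e'.
(* The displacement is at most al / (j + 1), which must stay below the Taylor radius. *)
pose j := Num.bound (al / r).
have jr : al / j.+1%:R < r.
  rewrite ltr_pdivrMr// mulrC -ltr_pdivrMr//.
  have : al / r < j%:R by rewrite archi_boundP// divr_ge0// ltW.
  by move/lt_le_trans; apply; rewrite ler_nat.
exists (D_ j) => // P PPP; have [mD _] := qD j; have [mZ _] := qnZ; have [mV _] := qnV.
have iZ : intble P (fun w => Num.min 1 `|n1 (Z w) - clip M1 (n1 (Z w))|).
  by apply: intble_min1 => //; exact: measurable_clip.
have iV : intble P (fun w => Num.min 1 `|n1 (V w) - clip M2 (n1 (V w))|).
  by apply: intble_min1 => //; exact: measurable_clip.
apply: (@le_trans _ _ (\int[P]_w (e / 2 + (Num.min 1 `|n1 (Z w) - clip M1 (n1 (Z w))| +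
    Num.min 1 `|n1 (V w) - clip M2 (n1 (V w))|)))); last first.
  rewrite RintegralD//; [|exact: intble_cst|exact: intbleD].
  rewrite Rint_cst RintegralD// [leRHS]splitr lerD2l [leRHS]splitr.
  by apply: lerD; [exact: hM1|exact: hM2].
apply: Rint_le => [||w]; first exact: intble_min1.
  by apply: intbleD; [exact: intble_cst|exact: intbleD].
have nn (a : R) : 0 <= Num.min 1 `|a| by rewrite le_min ler01 normr_ge0.
have e2 : 0 <= e / 2 by rewrite divr_ge0// ltW.
have [hz|->] := clip_eq_or (n1 (Z w)) M10; last first.
  by rewrite (le_trans (y := 1)) ?ge_min ?lexx// addrCA lerDl addr_ge0.
have [hv|->] := clip_eq_or (n1 (V w)) M20; last first.
  by rewrite (le_trans (y := 1)) ?ge_min ?lexx// addrA lerDr addr_ge0.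
have Zle : n1 (Z w) <= M1 + 1.
  by rewrite hz (le_trans (ler_norm _))// clip_bound// addr_ge0.
have Vle : n1 (V w) <= M2 + 1.
  by rewrite hv (le_trans (ler_norm _))// clip_bound// addr_ge0.
apply: (@le_trans _ _ (e / 2)); last by rewrite lerDl addr_ge0.
rewrite ge_min; apply/orP; right; rewrite distrC.
pose s : R := j.+1%:R^-1.
have s0 : 0 < s by rewrite invr_gt0.
have s1 : s <= 1 by rewrite invf_le1// ler1n.
have dZ : ZV_ j w - Z w = s *: V w by rewrite /ZV_ addrAC subrr add0r.
have nsV : n1 (s *: V w) = s * n1 (V w) by rewrite n1Z gtr0_norm.
have Val : n1 (V w) <= al by rewrite /al; lra.
have h : `|G (ZV_ j w) w i 0 - G (Z w) w i 0 - (J (Z w) w *m (ZV_ j w - Z w)) i 0|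
    <= e / 2 / al * n1 (ZV_ j w - Z w).
  apply: hr => //.
  - by rewrite /al; lra.
  - rewrite /ZV_ (le_trans (le_n1D _ _))// lerD// nsV.
    by rewrite (le_trans _ Vle)// ler_piMl// n1_ge0.
  - rewrite dZ nsV (le_lt_trans _ jr)// mulrC ler_wpM2r// ltW//.
rewrite dZ nsV -scalemxAr mxE in h.
rewrite -(@ler_pM2l _ s)// -[X in X * `|_|](gtr0_norm s0) -normrM mulrBr mulrA.
rewrite mulVf ?pnatr_eq0// mul1r (le_trans h)// mulrCA ler_pM2l//.
by rewrite mulrAC ler_pdivrMr// ler_wpM2l.
Qed.

End direction.

Lemma nice_growth_norm z0 w i : A z0 ->
  `|G (Z w) w i 0| <= `|G z0 w i 0| + g (n1 (Z w) + n1 z0) * (n1 (Z w) + n1 z0).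
Proof.
move=> Az0; have h1 : n1 (Z w) <= n1 (Z w) + n1 z0 by rewrite lerDl n1_ge0.
have h2 : n1 z0 <= n1 (Z w) + n1 z0 by rewrite lerDr n1_ge0.
rewrite (le_trans (nice_growth hG w i Az0 (ZA w) h2 h1))// lerD2l ler_wpM2l//.
  by rewrite nice_ge0// addr_ge0 ?n1_ge0.
by rewrite (le_trans (le_n1D _ _))// n1N.
Qed.

End composites.

Definition affine_bound {R : realType} (C r : R) := C * (1 + r).

Section composites_bounds.
Context {R : realType} {d : nat} {Omega : pointedType} {W : nat -> Omega -> 'cV[R]_d}.
Context {N : nat} {PP : set (probability (Fspace W N) R)}.
Context {p q : nat} {A : set 'cV[R]_q}.
Context {G : 'cV[R]_q -> Omega -> 'cV[R]_p} {J : 'cV[R]_q -> Omega -> 'M[R]_(p, q)}.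
Context {C : R} {k : nat} (kN : (k <= N)%N).
Context {Z : Omega -> 'cV[R]_q} (ZA : forall w, A (Z w)).
Hypothesis qZ : forall i, QC PP k (fun w => Z w i 0) /\ UI2 PP (fun w => Z w i 0).

Lemma UI2_n1 : UI2 PP (fun w => n1 (Z w)).
Proof.
under eq_fun do rewrite n1_cV.
by apply: UI2_sum => i; apply: UI2_norm; case: (qZ i).
Qed.

(** A bounded Jacobian gives linear growth, so squares stay uniformly integrable. *)
Lemma nice_UI2 i : nice A G J (fun=> C) ->
  (forall z, A z -> forall i, QC PP k (fun w => G z w i 0) /\ UI2 PP (fun w => G z w i 0)) ->
  QC PP k (fun w => G (Z w) w i 0) /\ UI2 PP (fun w => G (Z w) w i 0).
Proof.
move=> hG qG.
have qGZ : QC PP k (fun w => G (Z w) w i 0).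
  apply: (nice_QC hG kN _ ZA _) => [z Az j|j]; first by case: (qG z Az j).
  by case: (qZ j).
split=> //; have [mGZ _] := qGZ; have Az0 := ZA point.
apply: (UI2_le mGZ _ (UI2D (UI2_norm (proj2 (qG _ Az0 i)))
  (UI2Z C (UI2D UI2_n1 (UI2_cst PP (n1 (Z point))))))).
move=> w; rewrite [leRHS]ger0_norm ?addr_ge0 ?mulr_ge0 ?addr_ge0 ?n1_ge0//.
  exact: nice_growth_norm hG _ ZA _ _ _ Az0.
by have := nice_ge0 hG (lexx 0).
Qed.

(** A Jacobian of linear growth gives quadratic growth: square-uniformly integrable arguments yield
    uniform integrability of the value itself. *)
Lemma nice_UI i : nice A G J (affine_bound C) ->
  (forall z, A z -> forall i, QC PP k (fun w => G z w i 0) /\ UI PP (fun w => G z w i 0)) ->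
  QC PP k (fun w => G (Z w) w i 0) /\ UI PP (fun w => G (Z w) w i 0).
Proof.
move=> hG qG.
have qGZ : QC PP k (fun w => G (Z w) w i 0).
  apply: (nice_QC hG kN _ ZA _) => [z Az j|j]; first by case: (qG z Az j).
  by case: (qZ j).
split=> //; have [mGZ _] := qGZ; have Az0 := ZA point.
have uS := UI2D UI2_n1 (UI2_cst PP (n1 (Z point))).
have [_ uG] := qG _ Az0 i.
apply: (UI_le mGZ _ (UID (UI_norm uG) (UI2M (UI2Z C (UI2D (UI2_cst PP 1) uS)) uS))).
have C0 : 0 <= C by have := nice_ge0 hG (lexx 0); rewrite /affine_bound addr0 mulr1.
move=> w; rewrite [leRHS]ger0_norm ?addr_ge0 ?mulr_ge0 ?addr_ge0 ?n1_ge0//.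
exact: nice_growth_norm hG _ ZA _ _ _ Az0.
Qed.

End composites_bounds.

Lemma affine_mul_le {R : realType} (a b r : R) : 0 <= a -> 0 <= b -> r <= b ->
  1 + r + a <= (1 + a) * (1 + b).
Proof. by nra. Qed.

(** * The coefficients as functions of the pair (x, u) *)

Section coefficients.
Context {R : realType} {Omega : pointedType} {n m d N : nat}.
Hypotheses (hN : (0 < N)%N) (hd : (0 < d)%N).
Context (U : nat -> set 'cV[R]_m).
Hypothesis U_nonempty : forall k, (k < N)%N -> U k !=set0.
Hypothesis U_convex : forall k, (k < N)%N ->
  convex_set (U k : set (convex_lmodType 'cV[R]_m)).
Context (c : coefficients R Omega n m d) (D : derivatives R Omega n m d).
Hypotheses (hD : differentiable_coefficients N U c D) (h2 : H2 N U D) (h3 : H3 N U D).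

Lemma U_segment k u v (t : R) : (k < N)%N -> U k u -> U k v -> 0 <= t <= 1 ->
  U k (u + t *: (v - u)).
Proof.
move=> kN Uu Uv /andP[t0 t1].
have h : U k (t *: v + (1 - t) *: u).
  by have := @U_convex k kN v u (Itv01 t0 t1); rewrite !inE => /(_ Uv Uu).
have -> // : u + t *: (v - u) = t *: v + (1 - t) *: u.
by rewrite scalerBr scalerBl scale1r addrCA addrA.
Qed.

(** The pair (x, u) is stacked into one column and scalars become 1 x 1 matrices, so that the record
    [nice] covers b, sigma^l, f and phi alike. *)
Definition zdom k : set 'cV[R]_(n + m) := [set z | U k (dsubmx z)].
Definition zb k (z : 'cV[R]_(n + m)) w := c_b c k (usubmx z) (dsubmx z) w.
Definition zDb k (z : 'cV[R]_(n + m)) w := Db D k (usubmx z) (dsubmx z) w.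
Definition zs l k (z : 'cV[R]_(n + m)) w := c_sigma c l k (usubmx z) (dsubmx z) w.
Definition zDs l k (z : 'cV[R]_(n + m)) w := Dsigma D l k (usubmx z) (dsubmx z) w.
Definition zf k (z : 'cV[R]_(n + m)) w : 'cV[R]_1 :=
  (c_f c k (usubmx z) (dsubmx z) w)%:M.
Definition zDf k (z : 'cV[R]_(n + m)) w := Df D k (usubmx z) (dsubmx z) w.
Definition zphi (x : 'cV[R]_n) w : 'cV[R]_1 := (c_phi c x w)%:M.

Lemma zdom_cvx k z z' (t : R) : (k < N)%N -> zdom k z -> zdom k z' -> 0 <= t <= 1 ->
  zdom k (z + t *: (z' - z)).
Proof.
move=> kN Az Az' t01; rewrite /zdom/=.
have -> : dsubmx (z + t *: (z' - z)) = dsubmx z + t *: (dsubmx z' - dsubmx z).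
  by rewrite linearD/= linearZ/= linearB.
exact: U_segment.
Qed.

(** One factor turns [enorm] into [n1] for all Jacobians: they have n rows or a single one, and at
    most n + m columns. *)
Let K : R := (n.+1 * (n + m).+1)%:R.

Let K0 : 0 <= K. Proof. exact: ler0n. Qed.

Let n1_K p q (J : 'M[R]_(p, q)) : (p <= n.+1)%N -> (q <= n + m)%N -> n1 J <= K * enorm J.
Proof.
move=> pn qn; rewrite (le_trans (n1_le_enorm _))// ler_wpM2r ?enorm_ge0//.
by rewrite /K ler_nat leq_mul// leqW.
Qed.

Let enorm_u (z : 'cV[R]_(n + m)) : enorm (usubmx z) <= n1 z.
Proof. by rewrite (le_trans (enorm_le_n1 _))// [leRHS]n1_udsubmx lerDl n1_ge0. Qed.

Let enorm_d (z : 'cV[R]_(n + m)) : enorm (dsubmx z) <= n1 z.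
Proof. by rewrite (le_trans (enorm_le_n1 _))// [leRHS]n1_udsubmx lerDr n1_ge0. Qed.

Let zmodulus p k (J : 'cV[R]_(n + m) -> Omega -> 'M[R]_(p, n + m)) : (p <= n.+1)%N ->
  (forall al : R, 0 < al -> exists2 rho : R -> R, modulus rho & forall w z z',
    zdom k z -> zdom k z' -> n1 z <= al -> n1 z' <= al ->
    enorm (J z w - J z' w) <=
      rho (enorm (usubmx z - usubmx z') + enorm (dsubmx z - dsubmx z'))) ->
  forall al e : R, 0 < e -> exists2 r : R, 0 < r & forall w z z',
    zdom k z -> zdom k z' -> n1 z <= al -> n1 z' <= al -> n1 (z - z') < r ->
    n1 (J z w - J z' w) <= e.
Proof.
move=> pn hJ al e e0; have al1 : 0 < Num.max 1 al by rewrite lt_max ltr01.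
have [rho mrho hrho] := hJ _ al1.
have K1 : 0 < K + 1 by rewrite ltr_wpDl.
have [|r r0 hr] := modulus_small mrho (e := e / (K + 1)); first exact: divr_gt0.
exists r => // w z z' Az Az' hz hz' zz'.
rewrite (le_trans (n1_K _ pn (leqnn _)))//.
apply: (@le_trans _ _ (K * (e / (K + 1)))).
  rewrite ler_wpM2l//; apply: le_trans (hrho w z z' Az Az' _ _) _.
  - by rewrite le_max hz orbT.
  - by rewrite le_max hz' orbT.
  apply: hr; rewrite addr_ge0 ?enorm_ge0//=; apply: le_lt_trans zz'.
  by rewrite n1_udsubmx !linearB/= lerD// enorm_le_n1.
by rewrite mulrCA ger_pMr// ler_pdivrMr// mul1r lerDl.
Qed.

Lemma ex_nice : exists2 C : R, 0 < C & [/\ forall k, (k < N)%N -> nice (zdom k) (zb k) (zDb k) (fun=> C),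
  forall k l, (k < N)%N -> nice (zdom k) (zs l k) (zDs l k) (fun=> C),
  forall k, (k < N)%N -> nice (zdom k) (zf k) (zDf k) (affine_bound C) &
  nice setT zphi (phi_x D) (affine_bound C)].
Proof.
have [L L0 hL] := h2; have [u0 Uu0] := U_nonempty hN.
(* The bound on phi_x in (H2) also involves a control; evaluating it at the fixed [u0] leaves a
   bound in x alone. *)
pose C := K * (L * (1 + enorm u0)) + 1.
have KL0 : 0 <= K * (L * (1 + enorm u0)).
  by rewrite mulr_ge0// mulr_ge0 ?(ltW L0)// addr_ge0// enorm_ge0.
have C0 : 0 < C by rewrite ltr_wpDl.
have KLC : K * L <= C.
  rewrite (le_trans (y := K * (L * (1 + enorm u0))))//; last by rewrite lerDl.
  by rewrite ler_wpM2l// ler_peMr ?(ltW L0)// lerDl enorm_ge0.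
have lr p (J : 'M[R]_(p, n + m)) (M : R) : (p <= n.+1)%N -> 0 <= M ->
    enorm (lsubmx J) <= M -> enorm (rsubmx J) <= M -> n1 J <= K * M.
  move=> pn M0 hl hr; rewrite (le_trans (n1_lrsubmx hl hr))// ler_wpM2r//.
  by rewrite /K ler_nat leq_mul.
have aff r s : 0 <= r -> r <= s -> 0 <= affine_bound C r <= affine_bound C s.
  move=> r0 rs; rewrite /affine_bound mulr_ge0 ?(ltW C0) ?addr_ge0//=.
  by rewrite ler_pM2l// lerD2l.
(* (H2) bounds b_x and b_u in one sum with the derivatives of sigma^l, so an index l is needed to
   extract them. *)
pose l0 : 'I_d := Ordinal hd.
have zK (z : 'cV[R]_(n + m)) : z = col_mx (usubmx z) (dsubmx z) by rewrite vsubmxK.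
exists C => //; split=> [k kN|k l kN|k kN|].
- split=> [z z' t|w z Az|*|w z Az|].
  + exact: zdom_cvx.
  + have [hb _ _] := hD.1 k kN w (usubmx z) (dsubmx z) Az.
    by rewrite [X in is_derivative_within _ _ X]zK; exact: hb.
  + by rewrite lexx ltW.
  + have [h _] := hL k kN w (usubmx z) (dsubmx z) Az; have {}h := h l0.
    rewrite (le_trans _ KLC)//; apply: lr => //; [exact: ltW|..];
      apply: le_trans h; rewrite /zDb -/(b_x _ _ _ _ _) -/(b_u _ _ _ _ _).
      by rewrite -!addrA lerDl !addr_ge0 ?enorm_ge0.
    by rewrite -!addrA addrCA lerDl !addr_ge0 ?enorm_ge0.
  + apply: zmodulus => // al al0; have [rho mr hr] := h3 al0; exists rho => //.
    move=> w z z' Az Az' hz hz'.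
    have [||||h _ _] := hr k kN w (usubmx z) (usubmx z') (dsubmx z) (dsubmx z') Az Az';
      [exact: le_trans (enorm_u _) _|exact: le_trans (enorm_u _) _|
       exact: le_trans (enorm_d _) _|exact: le_trans (enorm_d _) _|].
    by apply: le_trans h; rewrite lerDl enorm_ge0.
- split=> [z z' t|w z Az|*|w z Az|].
  + exact: zdom_cvx.
  + have [_ hs _] := hD.1 k kN w (usubmx z) (dsubmx z) Az.
    by rewrite [X in is_derivative_within _ _ X]zK; exact: hs.
  + by rewrite lexx ltW.
  + have [h _] := hL k kN w (usubmx z) (dsubmx z) Az; have {}h := h l.
    rewrite (le_trans _ KLC)//; apply: lr => //; [exact: ltW|..];
      apply: le_trans h; rewrite /zDs -/(sigma_x _ _ _ _ _ _) -/(sigma_u _ _ _ _ _ _).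
      by rewrite addrAC lerDr !addr_ge0 ?enorm_ge0.
    by rewrite lerDr !addr_ge0 ?enorm_ge0.
  + apply: zmodulus => // al al0; have [rho mr hr] := h3 al0; exists rho => //.
    move=> w z z' Az Az' hz hz'.
    have [||||_ h _] := hr k kN w (usubmx z) (usubmx z') (dsubmx z) (dsubmx z') Az Az';
      [exact: le_trans (enorm_u _) _|exact: le_trans (enorm_u _) _|
       exact: le_trans (enorm_d _) _|exact: le_trans (enorm_d _) _|].
    by apply: le_trans (h l); rewrite lerDl enorm_ge0.
- split=> [z z' t|w z Az|r s|w z Az|].
  + exact: zdom_cvx.
  + have [_ _ hf] := hD.1 k kN w (usubmx z) (dsubmx z) Az.
    by rewrite [X in is_derivative_within _ _ X]zK; exact: hf.
  + exact: aff.
  + have [_ h] := hL k kN w (usubmx z) (dsubmx z) Az.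
    have Lz0 : 0 <= L * (1 + n1 z) by rewrite mulr_ge0 ?(ltW L0)// addr_ge0// n1_ge0.
    have {}h : enorm (f_x D k (usubmx z) (dsubmx z) w) + enorm (f_u D k (usubmx z) (dsubmx z) w) +
        enorm (phi_x D (usubmx z) w) <= L * (1 + n1 z).
      apply: le_trans h _; rewrite ler_pM2l// -addrA lerD2l.
      by rewrite n1_udsubmx lerD// enorm_le_n1.
    apply: (@le_trans _ _ (K * (L * (1 + n1 z)))).
      apply: lr => //; apply: le_trans h; rewrite /zDf -/(f_x _ _ _ _ _) -/(f_u _ _ _ _ _).
        by rewrite -addrA lerDl addr_ge0 ?enorm_ge0.
      by rewrite addrAC lerDr addr_ge0 ?enorm_ge0.
    by rewrite /affine_bound mulrA ler_wpM2r// addr_ge0// n1_ge0.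
  + apply: zmodulus => // al al0; have [rho mr hr] := h3 al0; exists rho => //.
    move=> w z z' Az Az' hz hz'.
    have [||||_ _ h] := hr k kN w (usubmx z) (usubmx z') (dsubmx z) (dsubmx z') Az Az';
      [exact: le_trans (enorm_u _) _|exact: le_trans (enorm_u _) _|
       exact: le_trans (enorm_d _) _|exact: le_trans (enorm_d _) _|].
    by apply: le_trans h; rewrite lerDl enorm_ge0.
- split=> [//|w x _|r s|w x _|al e e0].
  + exact: hD.2.
  + exact: aff.
  + have [_ h] := hL 0%N hN w x u0 Uu0.
    rewrite (le_trans (n1_K _ _ (leq_addr _ _)))//.
    apply: (@le_trans _ _ (K * (L * (1 + enorm u0) * (1 + n1 x)))); last first.
      by rewrite /affine_bound mulrA ler_wpM2r ?lerDl// addr_ge0// n1_ge0.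
    rewrite ler_wpM2l//; apply: (@le_trans _ _ (L * (1 + enorm x + enorm u0))).
      by apply: le_trans h; rewrite lerDr addr_ge0 ?enorm_ge0.
    rewrite -mulrA ler_pM2l//.
    exact: affine_mul_le (enorm_ge0 _) (n1_ge0 _) (enorm_le_n1 _).
  (* (H3) compares phi_x at two states together with derivatives at two controls; both controls are
     taken to be [u0], which the radius must include. *)
  + pose al' := Num.max 1 (Num.max al (enorm u0)).
    have al'0 : 0 < al' by rewrite lt_max ltr01.
    have [rho mr hr] := h3 al'0.
    have K1 : 0 < K + 1 by rewrite ltr_wpDl.
    have [|r r0 hrr] := modulus_small mr (e := e / (K + 1)); first exact: divr_gt0.
    exists r => // w x x' _ _ hx hx' xx'.
    rewrite (le_trans (n1_K _ _ (leq_addr _ _)))//.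
    apply: (@le_trans _ _ (K * (e / (K + 1)))); last first.
      by rewrite mulrCA ger_pMr// ler_pdivrMr// mul1r lerDl.
    rewrite ler_wpM2l//.
    have u0al : enorm u0 <= al' by rewrite !le_max lexx !orbT.
    have xal (y : 'cV[R]_n) : n1 y <= al -> enorm y <= al'.
      by move=> hy; rewrite !le_max (le_trans (enorm_le_n1 _) hy) orbT.
    have [h _ _] := hr 0%N hN w x x' u0 u0 Uu0 Uu0 (xal _ hx) (xal _ hx') u0al u0al.
    apply: le_trans (le_trans h _); first by rewrite lerDr enorm_ge0.
    apply: hrr; rewrite addr_ge0 ?enorm_ge0//=; apply: le_lt_trans xx'.
    rewrite subrr; have -> : enorm (0 : 'cV[R]_m) = 0.
      by apply/le_anti; rewrite enorm_ge0 andbT -(n1_0 (R := R) m 1) enorm_le_n1.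
    by rewrite addr0 enorm_le_n1.
Qed.

End coefficients.

(** * States, costs and their variations *)

Section dynamics.
Context {R : realType} {Omega : pointedType} {n m d N : nat} {Theta : Type}.
Context {F : Theta -> probability (borel 'cV[R]_d) R} {W : nat -> Omega -> 'cV[R]_d}.
Hypothesis A3 : forall Q : probability (borel 'M[R]_(d, N)) R, calA F Q ->
  exists P : probability (Fspace W N) R,
    forall B : set (borel 'M[R]_(d, N)), measurable B ->
      Q B = P (Wmat W N @^-1` B).
Hypothesis hTheta : inhabited Theta.
Hypothesis hW : forall k, (0 < k <= N)%N -> mxLc F W N 2 k (W k).
Context (U : nat -> set 'cV[R]_m).
Context (c : coefficients R Omega n m d) (D : derivatives R Omega n m d).
Hypothesis h1 : H1 F W N U c.
Context (C : R).
Hypothesis C0 : 0 < C.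
Hypothesis nb : forall k, (k < N)%N -> nice (zdom U k) (zb c k) (zDb D k) (fun=> C).
Hypothesis ns : forall k l, (k < N)%N -> nice (zdom U k) (zs c l k) (zDs D l k) (fun=> C).
Hypothesis nf : forall k, (k < N)%N ->
  nice (zdom U k) (zf c k) (zDf D k) (affine_bound C).
Hypothesis nphi : nice setT (zphi c) (phi_x D) (affine_bound C).
Context (x0 : 'cV[R]_n).

Notation PP := (@calP _ _ _ F _ W N).
Notation DD := (@DD _ _ _ F _ W N).
Notation X := (state W c x0).
Implicit Types (v : nat -> Omega -> 'cV[R]_m).

Definition zst v k w := col_mx (X v k w) (v k w).

Lemma DD_n1 k q (Z : Omega -> 'cV[R]_q) : (k <= N)%N ->
  (forall i, DD k (fun w => Z w i 0)) -> DD k (fun w => n1 (Z w)).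
Proof.
move=> kN hZ; under eq_fun do rewrite n1_cV.
by apply: DD_sum => // i; exact: DD_norm.
Qed.

Lemma zb_DD k z : (k < N)%N -> zdom U k z -> forall i, DD k (fun w => zb c k z w i 0).
Proof.
move=> kN Uz i; have [hb _ _] := h1.1 k kN (usubmx z) (dsubmx z) Uz.
exact: Lc2_QC (ltnW kN) (hb i 0).
Qed.

Lemma zs_DD k l z : (k < N)%N -> zdom U k z -> forall i, DD k (fun w => zs c l k z w i 0).
Proof.
move=> kN Uz i; have [_ hs _] := h1.1 k kN (usubmx z) (dsubmx z) Uz.
exact: Lc2_QC (ltnW kN) (hs l i 0).
Qed.

Lemma zfE k z w i : zf c k z w i 0 = c_f c k (usubmx z) (dsubmx z) w.
Proof. by rewrite /zf (ord1 i) !mxE eqxx mulr1n. Qed.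

Lemma zphiE x w i : zphi c x w i 0 = c_phi c x w.
Proof. by rewrite /zphi (ord1 i) !mxE eqxx mulr1n. Qed.

Lemma zf_QC k z : (k < N)%N -> zdom U k z -> forall i,
  QC PP k (fun w => zf c k z w i 0) /\ UI PP (fun w => zf c k z w i 0).
Proof.
move=> kN Uz i; have [_ _ hf] := h1.1 k kN (usubmx z) (dsubmx z) Uz.
under eq_fun do rewrite zfE; exact: Lc1_QC (ltnW kN) hf.
Qed.

Lemma zphi_QC x : forall i,
  QC PP N (fun w => zphi c x w i 0) /\ UI PP (fun w => zphi c x w i 0).
Proof.
move=> i; under eq_fun do rewrite zphiE.
exact: Lc1_QC (leqnn N) (h1.2 x).
Qed.

Lemma state_step v j w i : X v j.+1 w i 0 =
  zb c j (zst v j w) w i 0 + \sum_l W j.+1 w l 0 * zs c l j (zst v j w) w i 0.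
Proof.
rewrite /zst /zb /= mxE !col_mxKu !col_mxKd summxE; congr (_ + _).
by apply: eq_bigr => l _; rewrite mxE /zs col_mxKu col_mxKd.
Qed.

Lemma zst_dom v k w : admissible F W N U v -> (k < N)%N -> zdom U k (zst v k w).
Proof. by move=> adv kN; rewrite /zdom/= col_mxKd; exact: (adv k kN).1. Qed.

Lemma control_DD v k : admissible F W N U v -> (k < N)%N ->
  forall i, DD k (fun w => v k w i 0).
Proof. by move=> adv kN i; exact: Lc2_QC (ltnW kN) ((adv k kN).2 i 0). Qed.

Lemma col_mx_DD k a b (Y : Omega -> 'cV[R]_a) (Z : Omega -> 'cV[R]_b) :
  (forall i, DD k (fun w => Y w i 0)) -> (forall i, DD k (fun w => Z w i 0)) ->
  forall i, DD k (fun w => col_mx (Y w) (Z w) i 0).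
Proof.
move=> hY hZ i; case: (split_ordP i) => j ->.
  by under eq_fun do rewrite col_mxEu.
by under eq_fun do rewrite col_mxEd.
Qed.

(** The coefficients stay at level j by [nice_UI2], and only the product with the new noise, treated
    by [DDM_W], raises the level. *)
Lemma state_DD v : admissible F W N U v -> forall k, (k <= N)%N ->
  forall i, DD k (fun w => X v k w i 0).
Proof.
move=> adv; elim=> [_ i|j ih jN i]; first exact: DD_cst.
have jN' := ltnW jN.
have zD : forall i, DD j (fun w => zst v j w i 0).
  by apply: col_mx_DD; [exact: ih|exact: control_DD].
have zd w : zdom U j (zst v j w) by exact: zst_dom.
under eq_fun do rewrite state_step.
apply: DDD => //.
  apply: DD_le (leqnSn j) _; apply: (nice_UI2 jN' zd zD i (nb jN)) => z Az a.
  exact: zb_DD.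
apply: DD_sum => // l; under eq_fun do rewrite mulrC.
apply: (DDM_W A3 hTheta hW) => //; apply: (nice_UI2 jN' zd zD i (ns l jN)) => z Az a.
exact: zs_DD.
Qed.

Lemma zst_DD v k : admissible F W N U v -> (k < N)%N ->
  forall i, DD k (fun w => zst v k w i 0).
Proof.
move=> adv kN; apply: col_mx_DD; last exact: control_DD.
by apply: state_DD => //; exact: ltnW.
Qed.

Lemma total_costE v w : total_cost W N c x0 v w =
  \sum_(k < N) zf c k (zst v k w) w 0 0 + zphi c (X v N w) w 0 0.
Proof.
rewrite zphiE; congr (_ + _); apply: eq_bigr => k _.
by rewrite zfE col_mxKu col_mxKd.
Qed.

Lemma total_cost_QC v : admissible F W N U v ->
  QC PP N (total_cost W N c x0 v) /\ UI PP (total_cost W N c x0 v).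
Proof.
move=> adv; have -> : total_cost W N c x0 v = fun w =>
    \sum_(k < N) zf c k (zst v k w) w 0 0 + zphi c (X v N w) w 0 0.
  by apply/funext => w; exact: total_costE.
have hf (k : 'I_N) : QC PP k (fun w => zf c k (zst v k w) w 0 0) /\
    UI PP (fun w => zf c k (zst v k w) w 0 0).
  apply: (nice_UI (ltnW (ltn_ord k)) _ (zst_DD adv (ltn_ord k)) 0 (nf (ltn_ord k))).
    by move=> w; exact: zst_dom.
  by move=> z Az i; exact: zf_QC.
have [qp up] : QC PP N (fun w => zphi c (X v N w) w 0 0) /\
    UI PP (fun w => zphi c (X v N w) w 0 0).
  apply: (nice_UI (leqnn N) _ (state_DD adv (leqnn N)) 0 nphi) => [//|z _ i].
  exact: zphi_QC.
split; first apply: QCD => //; last apply: UID => //.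
  by apply: QC_sum => // k; have [q _] := hf k; apply: QC_le q; exact: ltnW.
by apply: UI_sum => k; have [_] := hf k.
Qed.

End dynamics.

Lemma n1_le_entries {R : realType} q (v : 'cV[R]_q) (B : R) :
  (forall i, `|v i 0| <= B) -> n1 v <= q%:R * B.
Proof.
move=> h; rewrite n1_cV; apply: (le_trans (ler_sum _ (fun i _ => h i))).
by rewrite sumr_const card_ord mulr_natl.
Qed.

Lemma finite_radius {R : realType} (I : finType) (Q : I -> R -> Prop) :
  (forall i r s, s <= r -> Q i r -> Q i s) ->
  (forall i, exists2 r : R, 0 < r & Q i r) -> exists2 r : R, 0 < r & forall i, Q i r.
Proof.
move=> anti hQ; suff : exists2 r : R, 0 < r & forall i, i \in enum I -> Q i r.
  by move=> [r r0 hr]; exists r => // i; apply: hr; rewrite mem_enum.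
elim: (enum I) => [|i s [r r0 hr]]; first by exists 1.
have [r' r'0 hr'] := hQ i; exists (Num.min r r'); first by rewrite lt_min r0.
move=> j; rewrite inE => /orP[/eqP ->|/hr h]; [apply: anti hr'|apply: anti h];
  by rewrite ge_min lexx ?orbT.
Qed.

(** The increment z' - z has size e b and differs from e v by at most e e2. The Taylor remainder
    contributes e1 b, and the Jacobian applied to the deviation contributes [g al] times e2. *)
Lemma nice_expand {R : realType} {Omega : pointedType} {p q : nat} {A : set 'cV[R]_q}
    {G : 'cV[R]_q -> Omega -> 'cV[R]_p} {J : 'cV[R]_q -> Omega -> 'M[R]_(p, q)}
    {g : R -> R} (al e1 : R) : nice A G J g -> 0 <= al -> 0 < e1 ->
  exists2 r : R, 0 < r & forall w z z' (v : 'cV[R]_q) (e b e2 : R) i, A z -> A z' ->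
    n1 z <= al -> n1 z' <= al -> n1 (z' - z) < r -> n1 (z' - z) <= e * b ->
    n1 (z' - z - e *: v) <= e * e2 -> 
    `|G z' w i 0 - G z w i 0 - e * (J z w *m v) i 0| <= e * (e1 * b + g al * e2).
Proof.
move=> hG al0 e10; have [r r0 hr] := nice_taylor hG al e10; exists r => //.
move=> w z z' v e b e2 i Az Az' hz hz' zz' hb he2.
have -> : G z' w i 0 - G z w i 0 - e * (J z w *m v) i 0 =
  (G z' w i 0 - G z w i 0 - (J z w *m (z' - z)) i 0) + (J z w *m (z' - z - e *: v)) i 0.
  rewrite (mulmxBr (J z w) (z' - z) (e *: v)) -scalemxAr.
  by move: (J z w *m (z' - z)) (J z w *m v) => a b'; rewrite !mxE; ring.
rewrite (le_trans (ler_normD _ _))// mulrDr; apply: lerD.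
  rewrite (le_trans (hr w z z' i Az Az' hz hz' zz'))// mulrCA.
  by rewrite ler_wpM2l// ltW.
rewrite (le_trans (le_entry_n1 _ _ _))// (le_trans (n1_mulmx _ _))//.
rewrite mulrCA; apply: ler_pM => //; rewrite ?n1_ge0//.
rewrite (le_trans (nice_bound hG w Az))//.
by have /andP[] := nice_mono hG (n1_ge0 z) hz.
Qed.

Lemma sqr_arith {R : realType} (s : R) : 0 <= s ->
  2 * s * (1 + 3 * s) <= 6 * ((1 + s) * (1 + s)).
Proof. by nra. Qed.

Lemma le_add3 {R : realType} (a b s t : R) : a <= t -> t <= 2 * s -> b <= s ->
  a + b <= 3 * s.
Proof. by lra. Qed.

(** The tolerances chosen in the expansions below each spend at most half of e. *)
Lemma small_split {R : realType} (M a b e : R) : 0 < M -> 0 <= a -> 0 < b -> 0 < e ->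
  M * (e / (2 * M * (a + 1)) * a + b * (e / (2 * M * b))) <= e.
Proof.
move=> M0 a0 b0 e0; have a1 : 0 < a + 1 by lra.
have -> : M * (e / (2 * M * (a + 1)) * a + b * (e / (2 * M * b))) =
  e * ((a / (a + 1) + 1) / 2) by field; rewrite !gt_eqF.
have h : a / (a + 1) <= 1 by rewrite ler_pdivrMr// mul1r lerDl.
by rewrite ger_pMr//; lra.
Qed.

(** * Linearization of the state and of the cost *)

Section variation.
Context {R : realType} {Omega : pointedType} {n m d N : nat} {Theta : Type}.
Context {F : Theta -> probability (borel 'cV[R]_d) R} {W : nat -> Omega -> 'cV[R]_d}.
Hypothesis A3 : forall Q : probability (borel 'M[R]_(d, N)) R, calA F Q ->
  exists P : probability (Fspace W N) R,
    forall B : set (borel 'M[R]_(d, N)), measurable B ->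
      Q B = P (Wmat W N @^-1` B).
Hypothesis hTheta : inhabited Theta.
Hypothesis hW : forall k, (0 < k <= N)%N -> mxLc F W N 2 k (W k).
Context (U : nat -> set 'cV[R]_m).
Context (c : coefficients R Omega n m d) (D : derivatives R Omega n m d).
Hypothesis h1 : H1 F W N U c.
Context (C : R).
Hypothesis C0 : 0 < C.
Hypothesis nb : forall k, (k < N)%N -> nice (zdom U k) (zb c k) (zDb D k) (fun=> C).
Hypothesis ns : forall k l, (k < N)%N -> nice (zdom U k) (zs c l k) (zDs D l k) (fun=> C).
Hypothesis nf : forall k, (k < N)%N ->
  nice (zdom U k) (zf c k) (zDf D k) (affine_bound C).
Hypothesis nphi : nice setT (zphi c) (phi_x D) (affine_bound C).
Context (x0 : 'cV[R]_n).

Notation PP := (@calP _ _ _ F _ W N).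
Notation DD := (@DD _ _ _ F _ W N).
Notation X := (state W c x0).
Notation zst := (zst (W := W) c x0).

Context (u xi : nat -> Omega -> 'cV[R]_m).

Definition perturbed (e : R) k w := u k w + e *: xi k w.

Hypothesis adm : forall e : R, 0 <= e <= 1 -> admissible F W N U (perturbed e).
Hypothesis xiD : forall k, (k < N)%N -> forall i, DD k (fun w => xi k w i 0).

Fixpoint state_variation k w : 'cV[R]_n := if k is j.+1 then
    zDb D j (zst u j w) w *m col_mx (state_variation j w) (xi j w) +
    \sum_l W j.+1 w l 0 *: (zDs D l j (zst u j w) w *m col_mx (state_variation j w) (xi j w))
  else 0.

(** A pathwise majorant of both the linearized state and the quotient n1 (X^e - X) / e: C bounds the
    Jacobians and n is the number of components. *)
Fixpoint dominator k w : R := if k is j.+1 then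
    n%:R * (C * (1 + \sum_l `|W j.+1 w l 0|) * (dominator j w + n1 (xi j w)))
  else 0.

Definition cost_variation w : R :=
  \sum_(k < N) (zDf D k (zst u k w) w *m col_mx (state_variation k w) (xi k w)) 0 0 +
  (phi_x D (X u N w) w *m state_variation N w) 0 0.

Lemma sum_absW_ge0 k w : 0 <= \sum_(l < d) `|W k w l 0|.
Proof. exact: sumr_ge0. Qed.

Lemma dominator_ge0 k w : 0 <= dominator k w.
Proof.
elim: k => //= k ih; rewrite mulr_ge0// mulr_ge0 ?addr_ge0 ?n1_ge0//.
by rewrite mulr_ge0 ?(ltW C0)// addr_ge0// sum_absW_ge0.
Qed.

Lemma perturbed0 : perturbed 0 = u.
Proof. by apply/funext => k; apply/funext => w; rewrite /perturbed scale0r addr0. Qed.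

Lemma adm0 : admissible F W N U u.
Proof. by rewrite -perturbed0; apply: adm; rewrite lexx ler01. Qed.

(** The product with 1 + sum of |W^l| is expanded so that each noise multiplies a variable of level
    j, as [DDM_W] requires. *)
Lemma dominator_DD k : (k <= N)%N -> DD k (dominator k).
Proof.
elim: k => [_|j ih jN]; first exact: DD_cst.
have jN' := ltnW jN; pose Y w := dominator j w + n1 (xi j w).
have Y0 w : 0 <= Y w by rewrite addr_ge0 ?n1_ge0// dominator_ge0.
have YD : DD j Y by apply: DDD => //; [exact: ih|apply: DD_n1 => //; exact: xiD].
have -> : dominator j.+1 = fun w =>
    (n%:R * C) * (Y w + \sum_(l < d) `|Y w * W j.+1 w l 0|).
  apply/funext => w /=; rewrite -/(Y w).
  have -> : \sum_(l < d) `|Y w * W j.+1 w l 0| = (\sum_(l < d) `|W j.+1 w l 0|) * Y w.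
    rewrite mulr_suml; apply: eq_bigr => l _.
    by rewrite normrM (ger0_norm (Y0 w)) mulrC.
  by ring.
apply: DDZ => //; apply: DDD => //; first exact: DD_le YD.
by apply: DD_sum => // l; apply: DD_norm => //; exact: (DDM_W A3 hTheta hW).
Qed.

Lemma perturbed_dist k w (e : R) : 0 <= e ->
  n1 (zst (perturbed e) k w - zst u k w) =
  n1 (X (perturbed e) k w - X u k w) + e * n1 (xi k w).
Proof.
move=> e0; rewrite /zst opp_col_mx add_col_mx n1_col_mx; congr (_ + _).
by rewrite /perturbed addrAC subrr add0r n1Z ger0_norm.
Qed.

Lemma state_dist (e : R) k w : 0 <= e <= 1 -> (k <= N)%N ->
  n1 (X (perturbed e) k w - X u k w) <= e * dominator k w.
Proof.
move=> e01; have [e0 _] := andP e01; elim: k => [_|j ih jN].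
  by rewrite subrr n1_0 mulr0.
have hz : n1 (zst (perturbed e) j w - zst u j w) <= e * (dominator j w + n1 (xi j w)).
  by rewrite perturbed_dist// mulrDr lerD2r ih// ltnW.
have zd1 := zst_dom c x0 w (adm e01) jN; have zd2 := zst_dom c x0 w adm0 jN.
set z := zst u j w in hz zd2; set z' := zst (perturbed e) j w in hz zd1.
have nle (a b : 'cV[R]_(n + m)) : n1 a <= Num.max (n1 a) (n1 b) by rewrite le_max lexx.
have nle' (a b : 'cV[R]_(n + m)) : n1 a <= Num.max (n1 b) (n1 a) by rewrite le_max lexx orbT.
rewrite /dominator -/(dominator j w) [leRHS]mulrCA.
apply: n1_le_entries => i; rewrite [X in `|X|]mxE [X in _ + X]mxE !state_step.
rewrite -/z -/z' opprD addrACA -sumrB (le_trans (ler_normD _ _))//.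
have hC (G : 'cV[R]_(n + m) -> Omega -> 'cV[R]_n) J : nice (zdom U j) G J (fun=> C) ->
    `|G z' w i 0 - G z w i 0| <= C * (e * (dominator j w + n1 (xi j w))).
  move=> hG; apply: le_trans (nice_lip hG w i zd2 zd1 (nle _ z') (nle' _ z)) _.
  by rewrite ler_wpM2l// ltW.
apply: (@le_trans _ _ (C * (e * (dominator j w + n1 (xi j w))) +
   \sum_l `|W j.+1 w l 0| * (C * (e * (dominator j w + n1 (xi j w)))))).
  apply: lerD; first exact: hC (nb jN).
  apply: le_trans (ler_norm_sum _ _ _) _; apply: ler_sum => l _.
  by rewrite -mulrBr normrM ler_wpM2l// (hC _ _ (ns l jN)).
rewrite le_eqVlt; apply/orP; left; apply/eqP.
rewrite -!mulr_suml; ring.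
Qed.

Lemma variation_le k w : (k <= N)%N -> n1 (state_variation k w) <= dominator k w.
Proof.
elim: k => [_|j ih jN]; first by rewrite n1_0.
have zd := zst_dom c x0 w adm0 jN.
have hC (G : 'cV[R]_(n + m) -> Omega -> 'cV[R]_n) J i : nice (zdom U j) G J (fun=> C) ->
    `|(J (zst u j w) w *m col_mx (state_variation j w) (xi j w)) i 0| <=
      C * (dominator j w + n1 (xi j w)).
  move=> hG; rewrite (le_trans (le_entry_n1 _ _ _))// (le_trans (n1_mulmx _ _))//.
  apply: ler_pM; rewrite ?n1_ge0//; first exact: (nice_bound hG).
  by rewrite n1_col_mx lerD2r ih// ltnW.
apply: n1_le_entries => i; rewrite [state_variation _ _]/= [X in `|X|]mxE summxE.
rewrite (le_trans (ler_normD _ _))// mulrAC mulrDr mulr1; apply: lerD.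
  exact: hC (nb jN).
rewrite mulr_sumr; apply: le_trans (ler_norm_sum _ _ _) _; apply: ler_sum => l _.
by rewrite mxE normrM mulrC ler_wpM2r// (hC _ _ _ (ns l jN)).
Qed.

(** One variable above every quantity in the expansion, so that a single truncation makes all
    estimates uniform in w. *)
Definition size_bound w : R :=
  \sum_(k < N) (n1 (zst u k w) + dominator k w + n1 (xi k w) +
    \sum_l `|W k.+1 w l 0|) + n1 (X u N w) + dominator N w.

Let size_term_ge0 k w : 0 <= n1 (zst u k w) + dominator k w + n1 (xi k w) +
    \sum_l `|W k.+1 w l 0|.
Proof. by rewrite !addr_ge0 ?n1_ge0 ?dominator_ge0 ?sum_absW_ge0. Qed.

Lemma size_bound_ge0 w : 0 <= size_bound w.
Proof. by rewrite !addr_ge0 ?n1_ge0 ?dominator_ge0//; apply: sumr_ge0. Qed.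

Lemma size_bound_term k w : (k < N)%N -> [/\ n1 (zst u k w) <= size_bound w,
  dominator k w <= size_bound w, n1 (xi k w) <= size_bound w &
  \sum_l `|W k.+1 w l 0| <= size_bound w].
Proof.
move=> kN; have h : n1 (zst u k w) + dominator k w + n1 (xi k w) +
    \sum_l `|W k.+1 w l 0| <= size_bound w.
  apply: (@le_trans _ _ (\sum_(k < N) (n1 (zst u k w) + dominator k w + n1 (xi k w) +
      \sum_l `|W k.+1 w l 0|))).
    by rewrite (bigD1 (Ordinal kN))//= lerDl; apply: sumr_ge0 => j _; exact: size_term_ge0.
  by rewrite /size_bound -[leRHS]addrA lerDl addr_ge0 ?n1_ge0 ?dominator_ge0.
have h1' := n1_ge0 (zst u k w); have h2 := dominator_ge0 k w.
have h3 := n1_ge0 (xi k w); have h4 := sum_absW_ge0 k.+1 w.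
move: h h1' h2 h3 h4; move: (n1 _) (dominator k w) (n1 _) (\sum_l _) (size_bound w).
by move=> a b e f g *; split; lra.
Qed.

Lemma size_bound_terminal w : n1 (X u N w) <= size_bound w /\ dominator N w <= size_bound w.
Proof.
have h : 0 <= \sum_(k < N) (n1 (zst u k w) + dominator k w + n1 (xi k w) +
    \sum_l `|W k.+1 w l 0|) by apply: sumr_ge0.
rewrite /size_bound; have h2 := n1_ge0 (X u N w); have h3 := dominator_ge0 N w.
by split; [rewrite addrAC lerDr addr_ge0|rewrite lerDr addr_ge0].
Qed.

(** The state and control increments contribute e times [al] each, hence 2 al; a further [al] for
    the unperturbed point gives 3 al. *)
Lemma perturbed_size (e : R) k w al : 0 <= e <= 1 -> (k < N)%N -> size_bound w <= al ->
  [/\ n1 (zst u k w) <= 3 * al, n1 (zst (perturbed e) k w) <= 3 * al &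
      n1 (zst (perturbed e) k w - zst u k w) <= e * (2 * al)].
Proof.
move=> e01 kN Sal; have [e0 e1] := andP e01; have [s1 s2 s3 _] := size_bound_term w kN.
have S0 := size_bound_ge0 w.
have dz : n1 (zst (perturbed e) k w - zst u k w) <= e * (2 * al).
  rewrite perturbed_dist// (le_trans (lerD (state_dist w e01 (ltnW kN)) (lexx _)))//.
  by rewrite -mulrDr ler_wpM2l//; lra.
split=> //; first lra.
rewrite -[zst (perturbed e) k w](subrK (zst u k w)) (le_trans (le_n1D _ _))//.
have : e * (2 * al) <= 2 * al by rewrite ler_piMl// mulr_ge0//; lra.
lra.
Qed.

Lemma zst_expand (e : R) k w (b : R) :
  n1 (X (perturbed e) k w - X u k w - e *: state_variation k w) <= b ->
  n1 (zst (perturbed e) k w - zst u k w - e *: col_mx (state_variation k w) (xi k w)) <= b.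
Proof.
rewrite /zst scale_col_mx !opp_col_mx !add_col_mx n1_col_mx /perturbed.
by rewrite [u k w + _ - _]addrAC subrr add0r subrr n1_0 addr0.
Qed.

Let unif (I : finType) p q (A : I -> set 'cV[R]_q) (G : I -> 'cV[R]_q -> Omega -> 'cV[R]_p)
    (J : I -> 'cV[R]_q -> Omega -> 'M[R]_(p, q)) (g : R -> R) (al e1 : R) :
  (forall l, nice (A l) (G l) (J l) g) -> 0 <= al -> 0 < e1 ->
  exists2 r : R, 0 < r & forall l w z z' (v : 'cV[R]_q) (e b e2 : R) i, A l z -> A l z' ->
    n1 z <= al -> n1 z' <= al -> n1 (z' - z) < r -> n1 (z' - z) <= e * b ->
    n1 (z' - z - e *: v) <= e * e2 ->
    `|G l z' w i 0 - G l z w i 0 - e * (J l z w *m v) i 0| <= e * (e1 * b + g al * e2).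
Proof.
move=> hG al0 e10; pose Q l r := forall w z z' (v : 'cV[R]_q) (e b e2 : R) i, A l z -> A l z' ->
    n1 z <= al -> n1 z' <= al -> n1 (z' - z) < r -> n1 (z' - z) <= e * b ->
    n1 (z' - z - e *: v) <= e * e2 ->
    `|G l z' w i 0 - G l z w i 0 - e * (J l z w *m v) i 0| <= e * (e1 * b + g al * e2).
apply: (finite_radius (Q := Q)) => [l r s sr h w z z' v e b e3 i Az Az' hz hz' zz'|l].
  by apply: h => //; exact: lt_le_trans sr.
exact: nice_expand (hG l) al0 e10.
Qed.

(** By induction on time: [nice_expand] turns accuracy e2 at time j into accuracy e0 at time j + 1,
    the noise being at most [al] on the truncated set. *)
Lemma state_expand al : 0 <= al -> forall k, (k <= N)%N -> forall e0 : R, 0 < e0 ->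
  exists2 r : R, 0 < r & forall (e : R) w, 0 < e -> e < r -> e <= 1 -> size_bound w <= al ->
    n1 (X (perturbed e) k w - X u k w - e *: state_variation k w) <= e * e0.
Proof.
move=> al0; elim=> [_ e0 e00|j ih jN e0 e00].
  exists 1 => // e w ep _ _ _.
  by rewrite /= subrr scaler0 subr0 n1_0 mulr_ge0// ltW.
pose M := (n%:R + 1) * (1 + al).
have n0 : 0 < n%:R + 1 :> R by rewrite ltr_wpDl.
have a1 : 0 < 1 + al by rewrite ltr_pwDl.
have M0 : 0 < M by rewrite mulr_gt0.
have a2 : 0 <= 2 * al by rewrite mulr_ge0.
have a21 : 0 < 2 * al + 1 by rewrite ltr_wpDl.
pose e1 := e0 / (2 * M * (2 * al + 1)); pose e2 := e0 / (2 * M * C).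
have e10 : 0 < e1 by rewrite divr_gt0// !mulr_gt0.
have e20 : 0 < e2 by rewrite divr_gt0// !mulr_gt0.
have al3 : 0 <= 3 * al by rewrite mulr_ge0.
have [rb rb0 hb] := nice_expand (nb jN) al3 e10.
have [rs rs0 hs] := unif (fun l => ns l jN) al3 e10.
have [ri ri0 hi] := ih (ltnW jN) _ e20.
(* The increment is at most 2 al e; dividing by the positive 2 al + 1 puts it below both Taylor
   radii. *)
exists (Num.min ri (Num.min rb rs / (2 * al + 1))) => [|e w ep].
  by rewrite lt_min ri0 divr_gt0// lt_min rb0.
rewrite lt_min => /andP[eri er] e1' Sal.
have e01 : 0 <= e <= 1 by rewrite e1' ltW.
have [z1 z2 z3] := perturbed_size e01 jN Sal.
have zd1 := zst_dom c x0 w (adm e01) jN; have zd2 := zst_dom c x0 w adm0 jN.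
have zv := zst_expand (hi e w ep eri e1' Sal).
set z := zst u j w in z1 z3 zd2 zv; set z' := zst (perturbed e) j w in z2 z3 zd1 zv.
set v := col_mx _ _ in zv.
have : n1 (z' - z) < Num.min rb rs.
  rewrite (le_lt_trans z3)//; apply: (@le_lt_trans _ _ (e * (2 * al + 1))).
    by rewrite ler_pM2l// lerDl.
  by rewrite -ltr_pdivlMr.
rewrite lt_min => /andP[zrb zrs].
pose L := e1 * (2 * al) + C * e2.
have L0 : 0 <= L by rewrite addr_ge0// mulr_ge0 ?(ltW e10) ?(ltW e20) ?(ltW C0).
have [_ _ _ Wal] := size_bound_term w jN.
apply: (@le_trans _ _ (n%:R * ((1 + al) * (e * L)))); last first.
  apply: (@le_trans _ _ (e * (M * L))); last by rewrite ler_pM2l// small_split.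
  rewrite [leLHS]mulrA [leRHS]mulrCA /M; rewrite ler_wpM2r ?mulr_ge0 ?(ltW ep)//.
  by rewrite ler_wpM2r ?(ltW a1)// lerDl.
apply: n1_le_entries => i.
have sub3 (a b g : 'cV[R]_n) : (a - b - e *: g) i 0 = a i 0 - b i 0 - e * g i 0.
  by rewrite !mxE.
have -> : state_variation j.+1 w = zDb D j z w *m v + \sum_l W j.+1 w l 0 *: (zDs D l j z w *m v).
  by [].
rewrite sub3 !state_step -/z -/z' [(_ + _ : 'cV[R]_n) i 0]mxE summxE.
have -> : zb c j z' w i 0 + \sum_l W j.+1 w l 0 * zs c l j z' w i 0 -
    (zb c j z w i 0 + \sum_l W j.+1 w l 0 * zs c l j z w i 0) -
    e * ((zDb D j z w *m v) i 0 +
      \sum_l (W j.+1 w l 0 *: (zDs D l j z w *m v)) i 0) =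
  (zb c j z' w i 0 - zb c j z w i 0 - e * (zDb D j z w *m v) i 0) +
  \sum_l W j.+1 w l 0 * (zs c l j z' w i 0 - zs c l j z w i 0 - e * (zDs D l j z w *m v) i 0).
  have -> : \sum_l W j.+1 w l 0 * (zs c l j z' w i 0 - zs c l j z w i 0 -
      e * (zDs D l j z w *m v) i 0) = \sum_l W j.+1 w l 0 * zs c l j z' w i 0 -
    \sum_l W j.+1 w l 0 * zs c l j z w i 0 -
    e * \sum_l (W j.+1 w l 0 *: (zDs D l j z w *m v)) i 0.
    rewrite mulr_sumr -!sumrB; apply: eq_bigr => l _.
    have -> : (W j.+1 w l 0 *: (zDs D l j z w *m v)) i 0 =
      W j.+1 w l 0 * (zDs D l j z w *m v) i 0 by rewrite mxE.
    by ring.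
  ring.
rewrite (le_trans (ler_normD _ _))// mulrDl mul1r; apply: lerD; first exact: hb.
apply: (@le_trans _ _ ((\sum_l `|W j.+1 w l 0|) * (e * L))); last first.
  by rewrite ler_wpM2r ?mulr_ge0 ?(ltW ep)// (le_trans Wal).
rewrite mulr_suml; apply: le_trans (ler_norm_sum _ _ _) _; apply: ler_sum => l _.
by rewrite normrM ler_wpM2l// hs.
Qed.

Lemma cost_expand al (e0 : R) : 0 <= al -> 0 < e0 ->
  exists2 r : R, 0 < r & forall (e : R) w, 0 < e -> e < r -> e <= 1 -> size_bound w <= al ->
    `|total_cost W N c x0 (perturbed e) w - total_cost W N c x0 u w - e * cost_variation w|
      <= e * e0.
Proof.
move=> al0 e00; pose M : R := N.+1%:R; have M0 : 0 < M by rewrite ltr0n.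
have a2 : 0 <= 2 * al by rewrite mulr_ge0.
have a21 : 0 < 2 * al + 1 by rewrite ltr_wpDl.
have al3 : 0 <= 3 * al by rewrite mulr_ge0.
pose B := affine_bound C (3 * al); have B0 : 0 < B by rewrite mulr_gt0// ltr_pwDl.
pose e1 := e0 / (2 * M * (2 * al + 1)); pose e2 := e0 / (2 * M * B).
have e10 : 0 < e1 by rewrite divr_gt0// !mulr_gt0.
have e20 : 0 < e2 by apply: divr_gt0 => //; apply: mulr_gt0 => //; exact: mulr_gt0.
have [rp rp0 hp] := nice_expand nphi al3 e10.
have [rf rf0 hf] := unif (fun k : 'I_N => nf (ltn_ord k)) al3 e10.
have [rx rx0 hx] : exists2 r : R, 0 < r & forall (k : 'I_N.+1) (e : R) w, 0 < e -> e < r ->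
    e <= 1 -> size_bound w <= al ->
    n1 (X (perturbed e) k w - X u k w - e *: state_variation k w) <= e * e2.
  apply: (finite_radius (Q := fun (k : 'I_N.+1) r => forall (e : R) w, 0 < e -> e < r ->
    e <= 1 -> size_bound w <= al ->
    n1 (X (perturbed e) k w - X u k w - e *: state_variation k w) <= e * e2)).
    by move=> k r s sr h e w ep es; apply: h => //; exact: lt_le_trans sr.
  by move=> k; apply: state_expand => //; rewrite -ltnS.
exists (Num.min rx (Num.min rf rp / (2 * al + 1))) => [|e w ep].
  by rewrite lt_min rx0 divr_gt0// lt_min rf0.
rewrite lt_min => /andP[erx er] e1' Sal.
have e01 : 0 <= e <= 1 by rewrite e1' ltW.
have eal : e * (2 * al) < Num.min rf rp.
  apply: (@le_lt_trans _ _ (e * (2 * al + 1))); last by rewrite -ltr_pdivlMr.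
  by rewrite ler_pM2l// lerDl.
move: eal; rewrite lt_min => /andP[ef eph].
pose L := e1 * (2 * al) + B * e2.
apply: (@le_trans _ _ (e * (M * L))); last by rewrite ler_pM2l// small_split.
rewrite !total_costE /cost_variation.
have -> : \sum_(k < N) zf c k (zst (perturbed e) k w) w 0 0 + zphi c (X (perturbed e) N w) w 0 0 -
   (\sum_(k < N) zf c k (zst u k w) w 0 0 + zphi c (X u N w) w 0 0) -
   e * (\sum_(k < N) (zDf D k (zst u k w) w *m col_mx (state_variation k w) (xi k w)) 0 0 +
     (phi_x D (X u N w) w *m state_variation N w) 0 0) =
  \sum_(k < N) (zf c k (zst (perturbed e) k w) w 0 0 - zf c k (zst u k w) w 0 0 -
     e * (zDf D k (zst u k w) w *m col_mx (state_variation k w) (xi k w)) 0 0) +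
  (zphi c (X (perturbed e) N w) w 0 0 - zphi c (X u N w) w 0 0 -
     e * (phi_x D (X u N w) w *m state_variation N w) 0 0).
  by rewrite !sumrB -mulr_sumr; ring.
rewrite (le_trans (ler_normD _ _))//.
have -> : e * (M * L) = \sum_(k < N) (e * L) + e * L.
  by rewrite sumr_const card_ord -mulrSr /M mulrCA mulr_natl.
apply: lerD.
  apply: le_trans (ler_norm_sum _ _ _) _; apply: ler_sum => k _.
  have kN := ltn_ord k; have [z1 z2 z3] := perturbed_size e01 kN Sal.
  have kN' : (k < N.+1)%N by rewrite ltnS ltnW.
  apply: hf => //; [exact: zst_dom adm0 kN|exact: zst_dom (adm e01) kN| |].
    exact: le_lt_trans z3 _.
  by apply: zst_expand; exact: (hx (Ordinal kN')).
have [s1 s2] := size_bound_terminal w.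
have hd : n1 (X (perturbed e) N w - X u N w) <= e * (2 * al).
  rewrite (le_trans (state_dist w e01 (leqnn N)))// ler_pM2l//.
  by rewrite (le_trans s2)// (le_trans Sal)// ler_peMl// ler1n.
have s1' : n1 (X u N w) <= al := le_trans s1 Sal.
apply: hp => //.
- by rewrite (le_trans s1')// ler_peMl// ler1n.
- rewrite -[X _ N w](subrK (X u N w)) (le_trans (le_n1D _ _))//.
  by apply: le_add3 hd _ s1'; rewrite ler_piMl.
- exact: le_lt_trans hd _.
- exact: (hx ord_max).
Qed.

(** Write S for [size_bound w]. A derivative of at most C (1 + 3 S) along an increment of at most 2
    S e costs at most 6 C (1 + S)^2 e in each of the N + 1 terms. The added 1 makes the bound exceed
    S as well. *)
Definition cost_bound w : R := (N.+1%:R * (6 * C) + 1) * ((1 + size_bound w) * (1 + size_bound w)).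

Lemma size_le_cost_bound w : size_bound w <= cost_bound w.
Proof.
have S0 := size_bound_ge0 w; rewrite /cost_bound mulrDl mul1r.
apply: (@le_trans _ _ ((1 + size_bound w) * (1 + size_bound w))).
  by rewrite mulrDl mul1r mulrDr mulr1; have := mulr_ge0 S0 S0; lra.
by rewrite lerDr !mulr_ge0 ?(ltW C0)// addr_ge0.
Qed.

Lemma cost_bound_ge0 w : 0 <= cost_bound w.
Proof. by rewrite (le_trans (size_bound_ge0 w))// size_le_cost_bound. Qed.

Lemma size_bound_UI2 : UI2 PP size_bound.
Proof.
have uX k : (k <= N)%N -> UI2 PP (fun w => n1 (X u k w)).
  by move=> kN; case: (DD_n1 kN (state_DD A3 hTheta hW h1 nb ns x0 adm0 kN)).
apply: UI2D; last by have [_] := dominator_DD (leqnn N).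
apply: UI2D; last exact: uX.
apply: UI2_sum => k; have kN := ltn_ord k; have kN' := ltnW kN.
apply: UI2D; last first.
  by apply: UI2_sum => l; apply: UI2_norm; have [_] := DD_W hW l kN.
apply: UI2D; last by have [_] := DD_n1 kN' (xiD kN).
apply: UI2D; last by have [_] := dominator_DD kN'.
by have [_] := DD_n1 kN' (zst_DD A3 hTheta hW h1 nb ns x0 adm0 kN).
Qed.

Lemma cost_bound_UI : UI PP cost_bound.
Proof.
have u1 := UI2D (UI2_cst PP 1) size_bound_UI2.
exact: UIZ (UI2M u1 u1).
Qed.

Let affine_sq (s t e : R) : 0 <= s -> 0 <= e -> 0 <= t -> t <= e * (2 * s) ->
  affine_bound C (3 * s) * t <= e * (6 * C * ((1 + s) * (1 + s))).
Proof.
move=> s0 e0 t0 h; rewrite /affine_bound.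
apply: (@le_trans _ _ (C * (1 + 3 * s) * (e * (2 * s)))).
  by rewrite ler_wpM2l// mulr_ge0 ?(ltW C0)// addr_ge0// mulr_ge0.
have -> : C * (1 + 3 * s) * (e * (2 * s)) = e * (C * (2 * s * (1 + 3 * s))) by ring.
rewrite ler_wpM2l//.
have -> : 6 * C * ((1 + s) * (1 + s)) = C * (6 * ((1 + s) * (1 + s))) by ring.
by rewrite ler_pM2l// sqr_arith.
Qed.

Let sum_le_cost_bound w (e a : R) (f : 'I_N -> R) : 0 <= e ->
  (forall k, `|f k| <= e * (6 * C * ((1 + size_bound w) * (1 + size_bound w)))) ->
  `|a| <= e * (6 * C * ((1 + size_bound w) * (1 + size_bound w))) ->
  `|\sum_(k < N) f k + a| <= e * cost_bound w.
Proof.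
move=> e0 hf ha; rewrite (le_trans (ler_normD _ _))//.
set B := _ * (6 * C * _) in ha hf.
apply: (@le_trans _ _ (\sum_(k < N) B + B)).
  apply: lerD => //; apply: le_trans (ler_norm_sum _ _ _) _; exact: ler_sum.
rewrite sumr_const card_ord -mulrSr -mulr_natl /B /cost_bound mulrCA ler_wpM2l//.
have : 0 <= (1 + size_bound w) * (1 + size_bound w).
  by rewrite mulr_ge0// addr_ge0// size_bound_ge0.
move: (_ * (1 + size_bound w)) => T T0.
have -> : N.+1%:R * (6 * C * T) = N.+1%:R * (6 * C) * T by ring.
by rewrite ler_wpM2r// lerDl.
Qed.

Lemma cost_dist (e : R) w : 0 <= e <= 1 ->
  `|total_cost W N c x0 (perturbed e) w - total_cost W N c x0 u w| <= e * cost_bound w.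
Proof.
move=> e01; have [e0 e1] := andP e01; rewrite !total_costE opprD addrACA -sumrB.
have S0 := size_bound_ge0 w.
apply: sum_le_cost_bound => // [k|].
  have kN := ltn_ord k; have [z1 z2 z3] := perturbed_size e01 kN (lexx (size_bound w)).
  apply: le_trans (nice_lip (nf kN) w 0 _ _ z1 z2) _; [|exact: zst_dom (adm e01) kN|].
    exact: zst_dom adm0 kN.
  by apply: affine_sq => //; exact: n1_ge0.
have [s1 s2] := size_bound_terminal w.
have hd : n1 (X (perturbed e) N w - X u N w) <= e * (2 * size_bound w).
  rewrite (le_trans (state_dist w e01 (leqnn N)))// ler_wpM2l//.
  by rewrite (le_trans s2)// ler_peMl// ler1n.
apply: le_trans (nice_lip nphi w 0 (z := X u N w) (z' := X (perturbed e) N w)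
  (al := 3 * size_bound w) _ _ _ _) _ => //.
- by rewrite (le_trans s1)// ler_peMl// ler1n.
- rewrite -[X _ N w](subrK (X u N w)) (le_trans (le_n1D _ _))//.
  by apply: le_add3 hd _ s1; rewrite ler_piMl// mulr_ge0.
- by apply: affine_sq => //; exact: n1_ge0.
Qed.

Lemma cost_variation_le w : `|cost_variation w| <= cost_bound w.
Proof.
rewrite -[leRHS]mul1r; have S0 := size_bound_ge0 w.
have hJ p q (A : set 'cV[R]_q) G (J : 'cV[R]_q -> Omega -> 'M[R]_(p, q)) z v i :
    nice A G J (affine_bound C) -> A z -> n1 z <= size_bound w -> n1 v <= 2 * size_bound w ->
    `|(J z w *m v) i 0| <= 1 * (6 * C * ((1 + size_bound w) * (1 + size_bound w))).
  move=> hG Az hz hv; rewrite (le_trans (le_entry_n1 _ _ _))// (le_trans (n1_mulmx _ _))//.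
  apply: (@le_trans _ _ (affine_bound C (3 * size_bound w) * n1 v)).
    rewrite ler_wpM2r ?n1_ge0// (le_trans (nice_bound hG w Az))//.
    have h : n1 z <= 3 * size_bound w by rewrite (le_trans hz)// ler_peMl// ler1n.
    by have /andP[] := nice_mono hG (n1_ge0 z) h.
  by apply: affine_sq => //; [exact: n1_ge0|rewrite mul1r].
apply: sum_le_cost_bound => // [k|].
  have kN := ltn_ord k; have [s1 s2 s3 _] := size_bound_term w kN.
  apply: hJ (nf kN) _ s1 _; first exact: zst_dom adm0 kN.
  rewrite n1_col_mx mulr2n mulrDl mul1r lerD//.
  exact: le_trans (variation_le w (ltnW kN)) s2.
have [s1 s2] := size_bound_terminal w.
apply: hJ nphi _ s1 _ => //.
by rewrite (le_trans (variation_le w (leqnn N)))// (le_trans s2)// ler_peMl// ler1n.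
Qed.

Lemma variation_dom k w : (k < N)%N ->
  zdom U k (zst u k w + col_mx (state_variation k w) (xi k w)).
Proof.
move=> kN; have := (adm (e := 1) _ kN).1 w; rewrite lexx ler01 => /(_ isT).
by rewrite /zdom/= /zst add_col_mx col_mxKd /perturbed scale1r.
Qed.

(** Quasi-continuity comes from directional derivatives step by step, and square-uniform
    integrability from [dominator]. *)
Lemma variation_DD k : (k <= N)%N -> forall i, DD k (fun w => state_variation k w i 0).
Proof.
move=> kN; suff qv : forall i, QC PP k (fun w => state_variation k w i 0).
  move=> i; split=> //; have [mv _] := qv i.
  apply: UI2_le mv _ (proj2 (dominator_DD kN)) => w.
  rewrite (le_trans (le_entry_n1 _ _ _))// (le_trans (variation_le w kN))//.
  exact: ler_norm.
elim: k kN => [_ i|j ih jN i].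
  by under eq_fun do rewrite mxE; exact: QC_cst.
have jN' := ltnW jN.
have qz i' : QC PP j (fun w => zst u j w i' 0).
  by case: (zst_DD A3 hTheta hW h1 nb ns x0 adm0 jN i').
have zd w : zdom U j (zst u j w) by exact: zst_dom adm0 jN.
have qV i' : QC PP j (fun w => col_mx (state_variation j w) (xi j w) i' 0).
  case: (split_ordP i') => a ->.
    by under eq_fun do rewrite col_mxEu; exact: ih.
  by under eq_fun do rewrite col_mxEd; case: (xiD jN a).
have qb : QC PP j (fun w => (zDb D j (zst u j w) w *m col_mx (state_variation j w) (xi j w)) i 0).
  apply: (nice_direction_QC (nb jN)) => // [z Az a|w].
    by case: (zb_DD h1 jN Az a).
  exact: variation_dom.
have qs l : QC PP j (fun w => (zDs D l j (zst u j w) w *m col_mx (state_variation j w) (xi j w)) i 0).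
  apply: (nice_direction_QC (ns l jN)) => // [z Az a|w].
    by case: (zs_DD h1 l jN Az a).
  exact: variation_dom.
rewrite /=; under eq_fun do rewrite mxE summxE.
apply: QCD => //; first exact: QC_le qb.
apply: QC_sum => // l; under eq_fun do rewrite mxE.
by apply: QCM => //; [case: (DD_W hW l jN)|exact: QC_le (qs l)].
Qed.

Lemma cost_variation_mF : mF W N cost_variation.
Proof.
have hf (k : 'I_N) : QC PP k (fun w =>
    (zDf D k (zst u k w) w *m col_mx (state_variation k w) (xi k w)) 0 0).
  have kN := ltn_ord k; have kN' := ltnW kN.
  apply: (nice_direction_QC (nf kN)) => // [z Az a|w|a|w|a].
  - by case: (zf_QC h1 kN Az a).
  - exact: zst_dom adm0 kN.
  - by case: (zst_DD A3 hTheta hW h1 nb ns x0 adm0 kN a).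
  - exact: variation_dom.
  - case: (split_ordP a) => b ->.
      by under eq_fun do rewrite col_mxEu; case: (variation_DD kN' b).
    by under eq_fun do rewrite col_mxEd; case: (xiD kN b).
apply: measurable_funD.
  by apply: measurable_sum => k; case: (hf k).
have [] // : QC PP N (fun w => (phi_x D (X u N w) w *m state_variation N w) 0 0).
apply: (nice_direction_QC nphi) => // [z _ a|a|a].
- by case: (zphi_QC h1 z a).
- by case: (state_DD A3 hTheta hW h1 nb ns x0 adm0 (leqnn N) a).
- by case: (variation_DD (leqnn N) a).
Qed.

Lemma cost_variation_UI : UI PP cost_variation.
Proof.
apply: UI_le cost_variation_mF _ cost_bound_UI => w.
by rewrite (ger0_norm (cost_bound_ge0 w)) cost_variation_le.
Qed.

(** Where [cost_bound] is at most M, the expansion is uniform. Elsewhere the error is at most 2 e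
    times [cost_bound], whose integral there is small uniformly over calP. *)
Lemma cost_derivative (e0 : R) : 0 < e0 -> exists2 r : R, 0 < r &
  forall e : R, 0 < e -> e < r -> e <= 1 -> forall P, PP P ->
    \int[P]_w `|total_cost W N c x0 (perturbed e) w - total_cost W N c x0 u w -
      e * cost_variation w| <= e * e0.
Proof.
move=> e00; have e02 : 0 < e0 / 2 by rewrite divr_gt0.
have e04 : 0 < e0 / 2 / 2 by rewrite !divr_gt0.
have uT := cost_bound_UI; have [mT iT _] := uT.
have [|M M0 hM] := UI_truncated uT uT cost_bound_ge0 _ e04.
  by move=> w; rewrite ger0_norm ?cost_bound_ge0.
have [r r0 hr] := cost_expand M0 e02; exists r => // e ep er e1 P PPP.
have e01 : 0 <= e <= 1 by rewrite e1 ltW.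
have [_ [_ iZe _]] := total_cost_QC A3 hTheta hW h1 nb ns nf nphi x0 (adm e01).
have [_ [_ iZ _]] := total_cost_QC A3 hTheta hW h1 nb ns nf nphi x0 adm0.
have [_ iY _] := cost_variation_UI.
have iD : intble P (fun w => `|total_cost W N c x0 (perturbed e) w -
    total_cost W N c x0 u w - e * cost_variation w|).
  apply: intble_norm; apply: intbleB; last by apply: intbleZ; exact: iY.
  by apply: intbleB; [exact: iZe|exact: iZ].
have iI : intble P (fun w => \1_[set w | M < cost_bound w] w * `|cost_bound w|).
  apply: (@intbleM_bounded _ _ _ P 1).
  - apply: measurable_indic; rewrite -[X in measurable X]setTI.
    rewrite -[X in _ `&` X]/((fun w => M < cost_bound w) @^-1` [set true]).
    by apply: measurable_fun_ltr => //; exact: measurable_cst.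
  - by move=> w; rewrite indicE; case: (_ \in _); rewrite ?normr1 ?normr0.
  - by apply: intble_norm; exact: iT.
apply: (@le_trans _ _ (\int[P]_w (e * (e0 / 2) +
    (2 * e) * (\1_[set w | M < cost_bound w] w * `|cost_bound w|)))).
  apply: Rint_le => // [|w].
    by apply: intbleD; [exact: intble_cst|exact: intbleZ].
  have T0 := cost_bound_ge0 w; rewrite (ger0_norm T0) indicE.
  have [/set_mem/= h|/negP h] := boolP (w \in _).
    rewrite mul1r (le_trans (ler_normB _ _))//.
    have h1' := cost_dist w e01.
    have h2 : `|e * cost_variation w| <= e * cost_bound w.
      by rewrite normrM gtr0_norm// ler_pM2l// cost_variation_le.
    rewrite (le_trans (lerD h1' h2))// -mulrA mulr2n mulrDl mul1r lerDr.
    by rewrite mulr_ge0// ltW.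
  rewrite mul0r mulr0 addr0; apply: hr => //.
  rewrite (le_trans (size_le_cost_bound w))// leNgt; apply/negP => h'.
  by apply: h; exact: mem_set.
rewrite RintegralD//; [|exact: intble_cst|exact: intbleZ].
rewrite Rint_cst RintegralZl//.
rewrite [e0 in leRHS]splitr mulrDr lerD2l (_ : 2 * e = e * 2); last exact: mulrC.
by rewrite -mulrA ler_pM2l// mulrC -ler_pdivlMr// hM.
Qed.

End variation.

(** * The worst-case measure of the optimal control *)

Lemma le_of_dist {R : realType} (a x y e e0 : R) :
  `|a - e * x| <= e * (e0 / 2) -> `|a - e * y| <= e * (e0 / 2) -> e * x <= e * y + e * e0.
Proof. by rewrite !ler_norml => /andP[h1 _] /andP[_ h2]; lra. Qed.

Section sup_expectation.
Context {R : realType} {d N : nat} {Omega : pointedType} {W : nat -> Omega -> 'cV[R]_d}.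
Context (PP : set (probability (Fspace W N) R)).
Hypothesis PP0 : PP !=set0.
Implicit Types X Y Z : Omega -> R.

(** The uniform bound on E|X| keeps [supE] finite, and [R^o] supplies the module structure used by
    [mazur_orlicz]. *)
Definition supV : set (Omega -> R^o) := [set X | mF W N X /\
  exists2 C : R, 0 <= C & forall P, PP P -> intble P X /\ \int[P]_w `|X w| <= C].

Definition supE X : R := sup [set \int[P]_w X w | P in PP].

Lemma UI_supV X : UI PP X -> supV X.
Proof.
move=> uX; have [mX iX _] := uX; have [C C0 hC] := UI_bound uX.
by split=> //; exists C => // P PPP; split; [exact: iX|exact: hC].
Qed.

Lemma supV_UI_cst (a : R) : supV (fun=> a).
Proof. exact/UI_supV/UI_cst. Qed.

Lemma supV_add X Y : supV X -> supV Y -> supV (fun w => X w + Y w).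
Proof.
move=> [mX [A A0 hA]] [mY [B B0 hB]]; split; first exact: measurable_funD.
exists (A + B) => [|P PPP]; first exact: addr_ge0.
have [iX XA] := hA P PPP; have [iY YB] := hB P PPP; split; first exact: intbleD.
apply: le_trans (lerD XA YB); rewrite -RintegralD//; [|exact: intble_norm..].
apply: Rint_le => [||w]; last exact: ler_normD.
  by apply: intble_norm; exact: intbleD.
by apply: intbleD; exact: intble_norm.
Qed.

Lemma supV_scale (a : R) X : supV X -> supV (fun w => a * X w).
Proof.
move=> [mX [A A0 hA]]; split.
  by apply: measurable_funM => //; exact: measurable_cst.
exists (`|a| * A) => [|P PPP]; first exact: mulr_ge0.
have [iX XA] := hA P PPP; split; first exact: intbleZ.
under eq_Rintegral do rewrite normrM.
by rewrite RintegralZl ?ler_wpM2l//; exact: intble_norm.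
Qed.

Lemma supV_intble X P : supV X -> PP P -> intble P X.
Proof. by move=> [_ [C _ hC]] /hC[]. Qed.

Lemma supE_ub X P : supV X -> PP P -> \int[P]_w X w <= supE X.
Proof.
move=> [mX [C C0 hC]] PPP; apply: ub_le_sup; last by exists P.
exists C => _ [Q PPQ <-]; have [iX XC] := hC Q PPQ; apply: le_trans XC.
by apply: Rint_le => // [|w]; [exact: intble_norm|exact: ler_norm].
Qed.

Lemma supE_le X (a : R) : (forall P, PP P -> \int[P]_w X w <= a) -> supE X <= a.
Proof.
move=> h; apply: ge_sup; last by move=> _ [P PPP <-]; exact: h.
by case: PP0 => P PPP; exists (\int[P]_w X w), P.
Qed.

Lemma supE_add X Y : supV X -> supV Y ->
  supE (fun w => X w + Y w) <= supE X + supE Y.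
Proof.
move=> VX VY; apply: supE_le => P PPP.
by rewrite RintegralD ?lerD ?supE_ub//; exact: supV_intble.
Qed.

Lemma supE_scale_le (a : R) X : 0 <= a -> supV X -> supE (fun w => a * X w) <= a * supE X.
Proof.
move=> a0 VX; apply: supE_le => P PPP.
by rewrite RintegralZl ?ler_wpM2l ?supE_ub//; exact: supV_intble VX PPP.
Qed.

Lemma supE_scale (a : R) X : 0 <= a -> supV X -> supE (fun w => a * X w) = a * supE X.
Proof.
move=> a0 VX; apply/eqP; rewrite eq_le supE_scale_le//=.
have [->|an0] := eqVneq a 0.
  rewrite mul0r; case: PP0 => P PPP.
  rewrite (le_trans _ (supE_ub _ PPP))//; last exact: supV_scale.
  by under eq_Rintegral do rewrite mul0r; rewrite Rint_cst.
have {}a0 : 0 < a by rewrite lt0r an0.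
have h := supE_scale_le (a := a^-1) (X := fun w => a * X w) _ (supV_scale _ VX).
rewrite mulrC -ler_pdivlMr// mulrC; apply: le_trans (h _); last by rewrite invr_ge0 ltW.
rewrite le_eqVlt; apply/orP; left; apply/eqP; congr supE; apply/funext => w.
by rewrite mulKf// gt_eqF.
Qed.

Lemma supE_sublinear : @sublinear_on R (Omega -> R^o) supV supE.
Proof. by split=> [X Y|a X]; [exact: supE_add|exact: supE_scale]. Qed.

Lemma supE_cst (a : R) : supE (fun=> a) = a.
Proof.
apply/eqP; rewrite eq_le; apply/andP; split.
  by apply: supE_le => P _; rewrite Rint_cst.
case: PP0 => P PPP; rewrite -[leLHS](Rint_cst P a).
by apply: supE_ub => //; exact: supV_UI_cst.
Qed.

(* A cone generated by Z - sup E[Z] and the derivatives Y of the cost in the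
   admissible directions; optimality makes sup_P E_P nonnegative on it. *)
Lemma cone_ge0 Z (Y : Omega -> R) (a s : R) : UI PP Z -> UI PP Y -> 0 <= a -> 0 <= s ->
  (forall e0 : R, 0 < e0 -> exists2 r : R, 0 < r & forall e : R, 0 < e -> e < r -> e <= 1 ->
    exists Ze, [/\ QC PP N Ze, UI PP Ze, supE Z <= supE Ze & forall P, PP P ->
      \int[P]_w `|Ze w - Z w - e * Y w| <= e * e0]) ->
  0 <= supE (fun w => a * (Z w - supE Z) + s * Y w).
Proof.
move=> uZ uY a0 s0 hY; set q := supE Z; set x := fun w => _.
have VZ := UI_supV uZ; have VY := UI_supV uY.
have Vx : supV x.
  apply: supV_add; last exact: supV_scale.
  by apply: supV_scale; apply: supV_add => //; exact: supV_UI_cst.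
have key (e0 : R) : 0 < e0 -> exists2 r : R, 0 < r & forall e : R, 0 <= e -> e < r -> e <= 1 ->
    q - e * e0 <= supE (fun w => Z w + e * Y w).
  move=> e00; have [r r0 hr] := hY _ e00; exists r => // e.
  rewrite le_eqVlt => /predU1P[<- _ _|ep er e1].
    rewrite mul0r subr0; have -> // : (fun w => Z w + 0 * Y w) = Z.
    by apply/funext => w; rewrite mul0r addr0.
  have [Ze [_ uZe qe hZe]] := hr e ep er e1.
  have VZY : supV (fun w => Z w + e * Y w) by apply: supV_add => //; exact: supV_scale.
  rewrite lerBlDr (le_trans qe)//; apply: supE_le => P PPP.
  have iZe := supV_intble (UI_supV uZe) PPP; have iZY := supV_intble VZY PPP.
  have -> : \int[P]_w Ze w = \int[P]_w (Z w + e * Y w) + \int[P]_w (Ze w - Z w - e * Y w).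
    rewrite -RintegralD//.
      by apply: eq_Rintegral => w _; ring.
    by apply: intble_eq (intbleB iZe iZY) => w; ring.
  apply: lerD; first exact: supE_ub.
  apply: le_trans (hZe P PPP); apply: Rint_le => [||w]; last exact: ler_norm.
    by apply: intble_eq (intbleB iZe iZY) => w; ring.
  by apply: intble_norm; apply: intble_eq (intbleB iZe iZY) => w; ring.
apply/ler_addgt0Pr => e1 e10; rewrite -lerBlDr sub0r.
have s1 : 0 < s + 1 by rewrite ltr_wpDl.
have [|r r0 hr] := key (e1 / (s + 1)); first exact: divr_gt0.
(* Chosen so that de s, and with it the step e below, is less than 1 and r. *)
pose de : R := Num.min 1 r / (2 * (s + 1)).
have m0 : 0 < Num.min 1 r by rewrite lt_min ltr01.
have de0 : 0 < de by rewrite divr_gt0// mulr_gt0.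
have da : 1 <= 1 + de * a by rewrite lerDl mulr_ge0// ltW.
have da0 : 0 < 1 + de * a by rewrite (lt_le_trans ltr01).
(* With q = [supE Z] one has Z + de x + de a q = (1 + de a) (Z + e Y): a small multiple of the cone
   element x added to Z is, up to scaling and a constant, an admissible perturbation of Z. *)
pose e : R := de * s / (1 + de * a).
have e0 : 0 <= e by apply: divr_ge0; [apply: mulr_ge0 => //|]; exact: ltW.
have em : e < Num.min 1 r.
  rewrite (@le_lt_trans _ _ (de * s))//.
    by rewrite ler_pdivrMr// ler_peMr// mulr_ge0// ltW.
  rewrite /de mulrAC ltr_pdivrMr ?mulr_gt0// ltr_pM2l//; lra.
have {em}[e_1 e_r] : e < 1 /\ e < r by move: em; rewrite lt_min => /andP[].
have h1 := hr e e0 e_r (ltW e_1).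
have VZY : supV (fun w => Z w + e * Y w) by apply: supV_add => //; exact: supV_scale.
have h2 : (1 + de * a) * supE (fun w => Z w + e * Y w) <= q + de * supE x + de * a * q.
  rewrite -supE_scale//; last exact: ltW.
  have -> : (fun w => (1 + de * a) * (Z w + e * Y w)) =
      (fun w => (Z w + de * x w) + de * a * q).
    apply/funext => w; rewrite /x /e; field; by rewrite gt_eqF.
  apply: le_trans (supE_add _ _) _; [|exact: supV_UI_cst|].
    by apply: supV_add => //; exact: supV_scale.
  rewrite supE_cst lerD2r (le_trans (supE_add _ _))//; first exact: supV_scale.
  by rewrite supE_scale// ltW.
have h3 : (1 + de * a) * (q - e * (e1 / (s + 1))) <= q + de * supE x + de * a * q.
  by apply: le_trans h2; rewrite ler_pM2l.
have h4 : (1 + de * a) * e * (e1 / (s + 1)) <= de * e1.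
  have -> : (1 + de * a) * e = de * s by rewrite /e mulrC divfK// gt_eqF.
  rewrite -mulrA ler_pM2l// mulrCA ger_pMr// ler_pdivrMr// mul1r lerDl//.
have h5 : de * - e1 <= de * supE x.
  move: h3 h4; rewrite mulrBr [(1 + de * a) * (e * _)]mulrA mulrN.
  move: (_ * e * _) (supE x) => T S; rewrite mulrDl mul1r; lra.
by move: h5; rewrite ler_pM2l.
Qed.

End sup_expectation.

Section worst_case_measure.
Context {R : realType} {d N : nat} {Theta : Type}.
Context {F : Theta -> probability (borel 'cV[R]_d) R}.
Context {Omega : pointedType} {W : nat -> Omega -> 'cV[R]_d}.
Hypothesis A3 : forall Q : probability (borel 'M[R]_(d, N)) R, calA F Q ->
  exists P : probability (Fspace W N) R,
    forall B : set (borel 'M[R]_(d, N)), measurable B ->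
      Q B = P (Wmat W N @^-1` B).
Hypothesis hTheta : inhabited Theta.
Hypothesis hW : forall k, (0 < k <= N)%N -> mxLc F W N 2 k (W k).
Implicit Types X Y Z : Omega -> R.

Notation PP := (@calP _ _ _ F _ W N).
Notation supE := (supE PP).
Notation supV := (supV PP).

Lemma calP_neq0 : PP !=set0.
Proof. by case: hTheta => th; have [P PPP _] := ex_calP_law A3 th; exists P. Qed.

Lemma Ehat_supE X : UI PP X -> Ehat F W N X = (supE X)%:E.
Proof.
move=> uX; have VX := UI_supV uX; apply/eqP; rewrite eq_le; apply/andP; split.
  apply: ge_ereal_sup => _ [P PPP <-]; rewrite -Rint_fineK ?lee_fin ?supE_ub//.
  exact: supV_intble VX PPP.
have [C _ hC] := UI_bound uX; have [P0 PP0] := calP_neq0.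
have hub P : PP P -> ((\int[P]_w X w)%:E <= Ehat F W N X)%E.
  by move=> PPP; rewrite Rint_fineK; [exact: Ehat_le|exact: supV_intble VX PPP].
case: (Ehat F W N X) hub => [r hub|_|/(_ _ PP0)]; last by rewrite leNgt ltNyr.
  by rewrite lee_fin; apply: supE_le; [exact: calP_neq0|move=> P /hub; rewrite lee_fin].
exact: leey.
Qed.

Lemma UI_n1_Wmat : UI PP (fun w => n1 (Wmat W N w)).
Proof.
apply: UI_sum => i; apply: UI_sum => j; apply: UI_norm.
under eq_fun do rewrite mxE.
by have [_ /UI2_UI] := DD_W hW i (ltn_ord j).
Qed.

Theorem ex_worst_case_measure Z (K : set (Omega -> R)) : QC PP N Z -> UI PP Z -> K !=set0 ->
  (forall Y1 Y2 (t : R), K Y1 -> K Y2 -> 0 <= t <= 1 -> K (fun w => t * Y1 w + (1 - t) * Y2 w)) ->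
  (forall Y, K Y -> UI PP Y /\ forall e0 : R, 0 < e0 -> exists2 r : R, 0 < r &
    forall e : R, 0 < e -> e < r -> e <= 1 ->
    exists Ze, [/\ QC PP N Ze, UI PP Ze, supE Z <= supE Ze & forall P, PP P ->
      \int[P]_w `|Ze w - Z w - e * Y w| <= e * e0]) ->
  exists2 P, PP P & \int[P]_w Z w = supE Z /\ forall Y, K Y -> 0 <= \int[P]_w Y w.
Proof.
move=> qZ uZ [Y0 KY0] Kcvx hK; have PP0 := calP_neq0; have VZ := UI_supV uZ.
pose q := supE Z.
pose cone : set (Omega -> R^o) := [set x | exists a s Y, [/\ 0 <= a, 0 <= s, K Y &
  x = fun w => a * (Z w - q) + s * Y w]].
have [l [[lD lZ] lp lK]] : exists l, [/\ @linear_on R (Omega -> R^o) supV l,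
    forall x, supV x -> l x <= supE x & forall x, cone x -> 0 <= l x].
  apply: mazur_orlicz.
  - exact: supV_UI_cst.
  - by move=> X Y; exact: supV_add.
  - by move=> a X; exact: supV_scale.
  - exact: supE_sublinear.
  - move=> _ [a [s [Y [_ _ KY ->]]]]; have [uY _] := hK _ KY.
    apply: supV_add; last by apply: supV_scale; exact: UI_supV.
    by apply: supV_scale; apply: supV_add => //; exact: supV_UI_cst.
  - exists 0, 0, Y0; split=> //; apply/funext => w; by rewrite !mul0r addr0.
  - move=> _ _ [a [s [Y [a0 s0 KY ->]]]] [b [t [Y' [b0 t0 KY' ->]]]].
    (* Two directions merge into their convex combination of weight s / (s + t); if s + t = 0
       neither occurs and any element of K will do. *)
    have [st|st] := eqVneq (s + t) 0.
      have s_0 : s = 0 by lra.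
      have t_0 : t = 0 by lra.
      exists (a + b), 0, Y; split=> //; first exact: addr_ge0.
      by apply/funext => w; rewrite s_0 t_0 -[LHS]/(_ + _ + (_ + _)); ring.
    have st0 : 0 < s + t by rewrite lt0r st addr_ge0.
    exists (a + b), (s + t), (fun w => s / (s + t) * Y w + (1 - s / (s + t)) * Y' w).
    split; [exact: addr_ge0|exact: addr_ge0| |].
      by apply: Kcvx => //; rewrite divr_ge0 ?(ltW st0)//= ler_pdivrMr// mul1r lerDl.
    by apply/funext => w; rewrite -[LHS]/(_ + _ + (_ + _)); field.
  - move=> b _ b0 [a [s [Y [a0 s0 KY ->]]]].
    exists (b * a), (b * s), Y; split=> //; [exact: mulr_ge0|exact: mulr_ge0|].
    by apply/funext => w; rewrite -[LHS]/(b * (_ + _)); ring.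
  - move=> _ [a [s [Y [a0 s0 KY ->]]]]; have [uY hY] := hK _ KY.
    exact: (cone_ge0 PP0).
have {}lD X Y : supV X -> supV Y -> l (fun w => X w + Y w) = l X + l Y by exact: lD.
have {}lZ (a : R) X : supV X -> l (fun w => a * X w) = a * l X by exact: lZ.
have lN X : supV X -> l (fun w => -1 * X w) = - l X by move=> VX; rewrite lZ// mulN1r.
have lB X Y : supV X -> supV Y -> l (fun w => X w + -1 * Y w) = l X - l Y.
  by move=> VX VY; rewrite lD ?lN//; exact: supV_scale.
(* Positivity is not imposed on l: it follows because a nonpositive variable has nonpositive
   [supE]. *)
have lmono X Y : supV X -> supV Y -> (forall w, X w <= Y w) -> l X <= l Y.
  move=> VX VY XY; rewrite -subr_le0 -lB//.
  have V' : supV (fun w => X w + -1 * Y w) by apply: supV_add => //; exact: supV_scale.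
  apply: le_trans (lp _ V') _; apply: supE_le => // P PPP.
  rewrite -(Rint_cst P 0); apply: Rint_le => [||w]; [exact: supV_intble V' PPP|exact: intble_cst|].
  by rewrite mulN1r subr_le0.
(* On constants [supE] is the identity, so domination at a and at - a forces equality. *)
have l1 (a : R) : l (fun=> a) = a.
  have h (b : R) : l (fun=> b) <= b.
    by rewrite -[leRHS](supE_cst PP0 b); apply: lp; exact: supV_UI_cst.
  have := lN _ (supV_UI_cst PP a); have := h (-1 * a); have := h a.
  by move=> ? + E; rewrite E; lra.
have ldist X Y (e : R) : supV X -> supV Y -> (forall P, PP P -> \int[P]_w `|X w - Y w| <= e) ->
    `|l X - l Y| <= e.
  have aux X' Y' : supV X' -> supV Y' -> (forall P, PP P -> \int[P]_w `|X' w - Y' w| <= e) ->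
      l X' - l Y' <= e.
    move=> VX VY h; rewrite -lB//.
    have V' : supV (fun w => X' w + -1 * Y' w) by apply: supV_add => //; exact: supV_scale.
    apply: le_trans (lp _ V') _; apply: supE_le => // P PPP; apply: le_trans (h P PPP).
    apply: Rint_le => [||w]; first exact: supV_intble V' PPP.
      apply: intble_norm; apply: intble_eq (supV_intble V' PPP) => w.
      by rewrite mulN1r.
    by rewrite mulN1r ler_norm.
  move=> VX VY h; rewrite ler_norml; apply/andP; split; last exact: aux.
  rewrite lerNl opprB; apply: aux => // P PPP; under eq_Rintegral do rewrite distrC.
  exact: h.
have Vlip g : bLip g -> supV (g \o Wmat W N).
  move=> gL; have /bLipP[B B0 [gB _]] := gL; split; first exact: mF_bLip.
  exists B => // P PPP; split; first exact: intble_bLip.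
  rewrite -[leRHS](Rint_cst P B); apply: Rint_le => [||w]; last exact: gB.
    by apply: intble_norm; exact: intble_bLip.
  exact: intble_cst.
have [P PPP hP] : exists2 P : probability (Fspace W N) R, PP P &
    forall g, bLip g -> \int[P]_w g (Wmat W N w) = l (g \o Wmat W N).
  apply: (calP_of_functional A3 (l := fun g => l (g \o Wmat W N))).
  - by move=> f g fL gL; rewrite -lD//; exact: Vlip.
  - by move=> a f fL; rewrite -lZ//; exact: Vlip.
  - move=> f fL f0; rewrite -[leLHS](l1 0); apply: lmono; [exact: supV_UI_cst|exact: Vlip|].
    by move=> w; exact: f0.
  - exact: l1.
  - apply: (@dini_tight _ _ _ (fun g => l (g \o Wmat W N))).
      move=> f fL a b a0 b0 r r0 fab.
      have Vm := Vlip _ (bLip_n1 _ _ r0).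
      have V' : supV (fun w => a + b * Num.min 1 (r^-1 * n1 (Wmat W N w))).
        by apply: supV_add; [exact: supV_UI_cst|exact: supV_scale].
      apply: (@le_trans _ _ (l (fun w => a + b * Num.min 1 (r^-1 * n1 (Wmat W N w))))).
        by apply: lmono => // [|w]; [exact: Vlip|exact: fab].
      rewrite (lD (fun=> a))//; [|exact: supV_UI_cst|exact: supV_scale].
      by rewrite l1 (lZ b)//.
    (* Tightness by Markov's inequality: the expected norm of the path is at most B uniformly over
       calP. *)
    move=> e e0; have [B B0 hB] := UI_bound UI_n1_Wmat.
    have r0 : 0 < (B + 1) / e by rewrite divr_gt0// ltr_wpDl.
    exists ((B + 1) / e) => //; apply: le_trans (lp _ (Vlip _ (bLip_n1 _ _ r0))) _.
    apply: supE_le => // P PPP; have [mW iW _] := UI_n1_Wmat.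
    apply: (@le_trans _ _ (\int[P]_w (((B + 1) / e)^-1 * n1 (Wmat W N w)))).
      apply: Rint_le => [||w]; first exact: intble_bLip (bLip_n1 _ _ r0).
        by apply: intbleZ; exact: iW.
      by rewrite /= ge_min lexx orbT.
    rewrite RintegralZl//; last exact: iW.
    rewrite -ler_pdivlMl ?invr_gt0// invrK divfK ?gt_eqF//.
    apply: (@le_trans _ _ B); last by rewrite lerDl.
    apply: le_trans (hB _ PPP); apply: Rint_le => [||w]; last exact: ler_norm.
      exact: iW.
    by apply: intble_norm; exact: iW.
  - move=> f fL; apply: le_trans (lp _ (Vlip _ fL)) _; apply: supE_le => // P PPP.
    exact: PPP.
(* Both sides are continuous for the supremum of E|.| and agree on bounded Lipschitz functions of W,
   which are dense among such X. *)
have PE X : QC PP N X -> UI PP X -> \int[P]_w X w = l X.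
  move=> qX uX; apply/eqP; rewrite -subr_eq0 -normr_le0; apply/ler_addgt0Pr => e e0.
  have e2 : 0 < e / 2 by rewrite divr_gt0.
  have [_ [g gL <-] hY] := QC_UI_dense (leqnn N) qX uX e2.
  have iX := supV_intble (UI_supV uX) PPP; have ig := intble_bLip P (leqnn N) gL.
  have -> : \int[P]_w X w - l X = (\int[P]_w X w - \int[P]_w (g \o Wmat W N) w) -
      (l X - l (g \o Wmat W N)).
    by rewrite [\int[P]_w (g \o Wmat W N) w]hP//; ring.
  rewrite add0r (le_trans (ler_normB _ _))// [leRHS]splitr; apply: lerD.
    rewrite -RintegralB// (le_trans _ (hY P PPP))//.
    by apply: le_normr_Rintegral => //; exact: intbleB.
  by apply: ldist; [exact: UI_supV|exact: Vlip|exact: hY].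
exists P => //; split.
  apply/eqP; rewrite eq_le supE_ub//= PE//.
  have : 0 <= l (fun w => Z w + - q).
    apply: lK; exists 1, 0, Y0; split=> //; apply/funext => w.
    by rewrite mul1r mul0r addr0.
  by rewrite (lD Z (fun=> - q))// ?l1 ?subr_ge0//; exact: supV_UI_cst.
(* [PE] requires quasi-continuity, which is known for [Ze] and [Z]. Since e Y is close to [Ze - Z]
   both under l and under P, the sign of l Y carries over. *)
move=> Y KY; have [uY hY] := hK _ KY; have VY := UI_supV uY.
have lY : 0 <= l Y.
  apply: lK; exists 0, 1, Y; split=> //; apply/funext => w.
  by rewrite mul1r mul0r add0r.
apply: le_trans lY _; apply/ler_addgt0Pr => e0 e00.
have e02 : 0 < e0 / 2 by rewrite divr_gt0.
have [r r0 hr] := hY _ e02; pose e : R := Num.min 1 r / 2.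
have m0 : 0 < Num.min 1 r by rewrite lt_min ltr01.
have ep : 0 < e by rewrite divr_gt0.
have em : e < Num.min 1 r by rewrite ltr_pdivrMr// ltr_pMr// ltr1n.
have {em}[e_1 e_r] : e < 1 /\ e < r by move: em; rewrite lt_min => /andP[].
have [Ze [qZe uZe _ hZe]] := hr e ep e_r (ltW e_1).
have VZe := UI_supV uZe.
have V' : supV (fun w => Ze w + -1 * Z w) by apply: supV_add => //; exact: supV_scale.
have VeY : supV (fun w => e * Y w) by exact: supV_scale.
have h1 : `|l (fun w => Ze w + -1 * Z w) - l (fun w => e * Y w)| <= e * (e0 / 2).
  apply: ldist => // P' PP'; apply: le_trans (hZe P' PP'); rewrite le_eqVlt; apply/orP; left.
  by apply/eqP; apply: eq_Rintegral => w _; rewrite mulN1r.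
have h2 : `|\int[P]_w (Ze w + -1 * Z w) - \int[P]_w (e * Y w)| <= e * (e0 / 2).
  have iA := supV_intble V' PPP; have iB := supV_intble VeY PPP.
  rewrite -RintegralB//; apply: le_trans (hZe P PPP).
  have -> : \int[P]_w `|Ze w - Z w - e * Y w| = \int[P]_w `|Ze w + -1 * Z w - e * Y w|.
    by apply: eq_Rintegral => w _; rewrite mulN1r.
  by apply: le_normr_Rintegral => //; exact: intbleB.
have iZe := supV_intble VZe PPP; have iZ := supV_intble VZ PPP.
have iY := supV_intble VY PPP.
rewrite lB// lZ// in h1.
rewrite RintegralD ?RintegralZl// in h2; last exact: intbleZ.
have {}h2 : `|l Ze - l Z - e * \int[P]_w Y w| <= e * (e0 / 2).
  apply: le_trans h2; rewrite le_eqVlt; apply/orP; left; apply/eqP; congr `|_|.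
  by rewrite -(PE Ze)// -(PE Z)//; ring.
by rewrite -(ler_pM2l ep) mulrDr; exact: le_of_dist h1 h2.
Qed.

End worst_case_measure.

(** * Admissible directions and the optimality condition *)

Section optimality.
Context {R : realType} {Omega : pointedType} {n m d N : nat} {Theta : Type}.
Context {F : Theta -> probability (borel 'cV[R]_d) R} {W : nat -> Omega -> 'cV[R]_d}.
Hypothesis A3 : forall Q : probability (borel 'M[R]_(d, N)) R, calA F Q ->
  exists P : probability (Fspace W N) R,
    forall B : set (borel 'M[R]_(d, N)), measurable B ->
      Q B = P (Wmat W N @^-1` B).
Hypothesis hTheta : inhabited Theta.
Hypothesis hW : forall k, (0 < k <= N)%N -> mxLc F W N 2 k (W k).
Context (U : nat -> set 'cV[R]_m).
Hypothesis U_convex : forall k, (k < N)%N ->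
  convex_set (U k : set (convex_lmodType 'cV[R]_m)).
Context (c : coefficients R Omega n m d) (D : derivatives R Omega n m d).
Hypothesis h1 : H1 F W N U c.
Context (C : R).
Hypothesis C0 : 0 < C.
Hypothesis nb : forall k, (k < N)%N -> nice (zdom U k) (zb c k) (zDb D k) (fun=> C).
Hypothesis ns : forall k l, (k < N)%N -> nice (zdom U k) (zs c l k) (zDs D l k) (fun=> C).
Hypothesis nf : forall k, (k < N)%N ->
  nice (zdom U k) (zf c k) (zDf D k) (affine_bound C).
Hypothesis nphi : nice setT (zphi c) (phi_x D) (affine_bound C).
Context (x0 : 'cV[R]_n) (u : nat -> Omega -> 'cV[R]_m).

Notation PP := (@calP _ _ _ F _ W N).
Notation DD := (@DD _ _ _ F _ W N).
Notation state_variation := (state_variation (W := W) c D x0 u).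
Notation cost_variation := (cost_variation (W := W) (N := N) c D x0 u).

(* The directions psi_k(W) - phi_k(W) u_k: the perturbed controls are then
   Lipschitz combinations of u and constants, hence stay in L_c^2. *)
Definition direction (xi : nat -> Omega -> 'cV[R]_m) := forall k, (k < N)%N ->
  exists psi : 'M[R]_(d, k) -> 'cV[R]_m, exists phi : 'M[R]_(d, k) -> R,
  [/\ forall i, bLip (fun x => psi x i 0), bLip phi &
      forall w, xi k w = psi (Wmat W k w) - phi (Wmat W k w) *: u k w /\
        U k (u k w + xi k w)].

Lemma variation_lin (xi1 xi2 : nat -> Omega -> 'cV[R]_m) (t s : R) k w :
  state_variation (fun k w => t *: xi1 k w + s *: xi2 k w) k w =
  t *: state_variation xi1 k w + s *: state_variation xi2 k w.
Proof.
elim: k => [|j ih] /=; first by rewrite !scaler0 addr0.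
have -> : col_mx (state_variation (fun k w => t *: xi1 k w + s *: xi2 k w) j w)
    (t *: xi1 j w + s *: xi2 j w) =
  t *: col_mx (state_variation xi1 j w) (xi1 j w) + s *: col_mx (state_variation xi2 j w) (xi2 j w).
  by rewrite ih !scale_col_mx add_col_mx.
set v1 := col_mx _ (xi1 j w); set v2 := col_mx _ (xi2 j w).
rewrite mulmxDr -!scalemxAr !scalerDr addrACA; congr (_ + _).
rewrite !scaler_sumr -big_split/=; apply: eq_bigr => l _.
rewrite mulmxDr -!scalemxAr scalerDr; congr (_ + _); by rewrite !scalerA mulrC.
Qed.

Lemma cost_variation_lin (xi1 xi2 : nat -> Omega -> 'cV[R]_m) (t s : R) w :
  cost_variation (fun k w => t *: xi1 k w + s *: xi2 k w) w =
  t * cost_variation xi1 w + s * cost_variation xi2 w.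
Proof.
rewrite /cost_variation !mulrDr addrACA; congr (_ + _).
  rewrite !mulr_sumr -big_split/=; apply: eq_bigr => k _.
  rewrite variation_lin.
  have -> : col_mx (t *: state_variation xi1 k w + s *: state_variation xi2 k w)
      (t *: xi1 k w + s *: xi2 k w) =
    t *: col_mx (state_variation xi1 k w) (xi1 k w) + s *: col_mx (state_variation xi2 k w) (xi2 k w).
    by rewrite !scale_col_mx add_col_mx.
  by rewrite mulmxDr -!scalemxAr !mxE.
by rewrite variation_lin mulmxDr -!scalemxAr !mxE.
Qed.

Hypothesis opt : optimal F W N U c x0 u.

Lemma direction_adm xi : direction xi -> forall e : R, 0 <= e <= 1 ->
  admissible F W N U (perturbed u xi e).
Proof.
move=> hxi e e01 k kN; have [psi [phi [psiL phiL hw]]] := hxi k kN.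
have [Uu Lu] := opt.1 k kN; have [P0 PP0] := calP_neq0 A3 hTheta.
split=> [w|i j].
  have [_ Ux] := hw w; have := U_segment U_convex kN (Uu w) Ux e01.
  by rewrite addrAC subrr add0r.
rewrite (ord1 j).
have -> : (fun w => perturbed u xi e k w i 0) = fun w =>
    (e * psi (Wmat W k w) i 0) + (1 - e * phi (Wmat W k w)) * u k w i 0.
  by apply/funext => w; rewrite /perturbed (hw w).1 !mxE; ring.
apply: (Lc2_affine (f := fun x => e * psi x i 0) (g := fun x => 1 - e * phi x) PP0 (ltnW kN)).
- exact: bLipZ.
- by apply: bLipB; [exact: bLip_cst|exact: bLipZ].
- exact: Lu.
Qed.

(** A direction is the difference of the admissible controls at e = 1 and e = 0. *)
Lemma direction_DD xi : direction xi -> forall k, (k < N)%N ->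
  forall i, DD k (fun w => xi k w i 0).
Proof.
move=> hxi k kN i; have kN' := ltnW kN.
have a1 : admissible F W N U (perturbed u xi 1).
  by apply: direction_adm => //; rewrite ler01 lexx.
have -> : (fun w => xi k w i 0) = fun w => perturbed u xi 1 k w i 0 + -1 * u k w i 0.
  by apply/funext => w; rewrite /perturbed !mxE; ring.
apply: (DDD kN'); first exact: control_DD a1 kN i.
by apply: (DDZ _ kN'); exact: control_DD opt.1 kN i.
Qed.

Lemma direction_convex xi1 xi2 (t : R) : direction xi1 -> direction xi2 -> 0 <= t <= 1 ->
  direction (fun k w => t *: xi1 k w + (1 - t) *: xi2 k w).
Proof.
move=> d1 d2 t01 k kN; have [p1 [f1 [p1L f1L hw1]]] := d1 k kN.
have [p2 [f2 [p2L f2L hw2]]] := d2 k kN.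
exists (fun x => t *: p1 x + (1 - t) *: p2 x), (fun x => t * f1 x + (1 - t) * f2 x).
split=> [i||w].
- under eq_fun do rewrite !mxE.
  by apply: bLipD; exact: bLipZ.
- by apply: bLipD; exact: bLipZ.
have [e1 U1] := hw1 w; have [e2 U2] := hw2 w; split.
  rewrite e1 e2 !scalerBr addrACA -opprD; congr (_ - _).
  by rewrite !scalerA scalerDl.
have := U_segment U_convex kN U2 U1 t01.
by have -> : u k w + xi2 k w + t *: (u k w + xi1 k w - (u k w + xi2 k w)) =
  u k w + (t *: xi1 k w + (1 - t) *: xi2 k w)
  by apply/matrixP => i j; rewrite !mxE; ring.
Qed.

Theorem ex_optimal_measure : exists2 P : probability (Fspace W N) R, calPstar F c x0 u P &
  forall xi, direction xi -> 0 <= \int[P]_w cost_variation xi w.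
Proof.
have adm_u := opt.1; pose Z := total_cost W N c x0 u.
have [qZ uZ] := total_cost_QC A3 hTheta hW h1 nb ns nf nphi x0 adm_u.
have [P PPP [PZ PY]] : exists2 P, PP P & \int[P]_w Z w = supE PP Z /\
    forall Y, [set cost_variation xi | xi in direction] Y -> 0 <= \int[P]_w Y w.
  apply: (ex_worst_case_measure A3 hTheta hW qZ uZ).
  - exists (cost_variation (fun k w => 0)), (fun k w => 0) => // k kN.
    exists (fun=> 0), (fun=> 0); split=> [i||w]; [|exact: bLip_cst|].
      by under eq_fun do rewrite mxE; exact: bLip_cst.
    by rewrite scale0r subr0 addr0; split=> //; case: (adm_u k kN).
  - move=> _ _ t [xi1 d1 <-] [xi2 d2 <-] t01.
    exists (fun k w => t *: xi1 k w + (1 - t) *: xi2 k w); first exact: direction_convex.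
    by apply/funext => w; exact: cost_variation_lin.
  - move=> _ [xi dxi <-]; have ad := direction_adm dxi; have xD := direction_DD dxi.
    split; first exact: (cost_variation_UI A3 hTheta hW h1 C0 nb ns nf nphi x0 ad xD).
    move=> e0 e00.
    have [r r0 hr] := cost_derivative A3 hTheta hW h1 C0 nb ns nf nphi x0 ad xD e00.
    exists r => // e ep er e1; exists (total_cost W N c x0 (perturbed u xi e)).
    have ade : admissible F W N U (perturbed u xi e) by apply: ad; rewrite e1 ltW.
    have [qe ue] := total_cost_QC A3 hTheta hW h1 nb ns nf nphi x0 ade.
    split=> //; last by move=> P PPP; exact: hr.
    by have := opt.2 _ ade; rewrite /cost (Ehat_supE A3 hTheta ue) (Ehat_supE A3 hTheta uZ).
exists P; last by move=> xi dxi; apply: PY; exists xi.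
split=> //; rewrite /cost (Ehat_supE A3 hTheta)// -PZ Rint_fineK//.
by have [_ iZ _] := uZ; exact: iZ.
Qed.

End optimality.

(** * Adjoint processes and duality *)

Section square_integrable.
Context {R : realType} {d N : nat} {Omega : pointedType} {W : nat -> Omega -> 'cV[R]_d}.
Variable P : probability (Fspace W N) R.
Implicit Types X Y : Omega -> R.

Definition L2 X := mF W N X /\ intble P (fun w => X w ^+ 2).

Lemma L2D X Y : L2 X -> L2 Y -> L2 (fun w => X w + Y w).
Proof.
by move=> [mX iX] [mY iY]; split; [exact: measurable_funD|exact: intble_sqrD].
Qed.

Lemma L2_le X Y : mF W N X -> (forall w, `|X w| <= `|Y w|) -> L2 Y -> L2 X.
Proof.
move=> mX XY [mY iY]; split=> //; apply: (intble_le _ iY).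
  exact: measurable_funX.
by move=> w; rewrite !normrX lerXn2r ?nnegrE.
Qed.

Lemma L2_cst (a : R) : L2 (fun=> a).
Proof. by split; [exact: measurable_cst|exact: intble_cst]. Qed.

Lemma L2_sum (I : Type) (s : seq I) (G : I -> Omega -> R) :
  (forall i, L2 (G i)) -> L2 (fun w => \sum_(i <- s) G i w).
Proof.
move=> hG; elim: s => [|i s ih].
  by under eq_fun do rewrite big_nil; exact: L2_cst.
by under eq_fun do rewrite big_cons; apply: L2D.
Qed.

Lemma L2M_bounded (M : R) X Y : mF W N X -> (forall w, `|X w| <= M) -> L2 Y ->
  L2 (fun w => X w * Y w).
Proof.
move=> mX XM [mY iY]; apply: (@L2_le _ (fun w => M * Y w)).
- exact: measurable_funM.
- move=> w; rewrite !normrM ler_wpM2r// (le_trans (XM w))// ler_norm//.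
split; first by apply: measurable_funM => //; exact: measurable_cst.
by apply: intble_eq (intbleZ (M ^+ 2) iY) => w; rewrite exprMn.
Qed.

Lemma L2M X Y : L2 X -> L2 Y -> intble P (fun w => X w * Y w).
Proof. by move=> [mX iX] [mY iY]; exact: intbleM_sqr. Qed.

Lemma L2_intble X : L2 X -> intble P X.
Proof. by move=> [mX iX]; exact: intble_of_sqr. Qed.

(** Jensen's inequality, as the case V = 1 and C = 1 of [cond_exp_sqr]. *)
Lemma L2_cond_exp k X Y : (k <= N)%N -> L2 X -> cond_exp P k X Y -> L2 Y.
Proof.
move=> kN [mX iX] XY; have [_ mY _ _] := XY; split; first exact: mF_le kN mY.
apply: (@cond_exp_sqr _ _ _ _ _ P 1 k X (fun=> 1)) => //; last 2 first.
- exact: measurable_cst.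
- move=> r M mr rM; have mrN := mF_le kN mr.
  have ir : intble P (fun w => r w ^+ 2).
    apply: (@bounded_integrable _ _ _ P _ (M ^+ 2)); first exact: measurable_funX.
    by move=> w; rewrite normrX lerXn2r ?nnegrE// (le_trans _ (rM w)).
  have -> : (fun w => (1 * r w) ^+ 2) = fun w => r w ^+ 2.
    by apply/funext => w; rewrite mul1r.
  by rewrite mul1r.
by have -> : (fun w => X w * 1) = X by apply/funext => w; rewrite mulr1.
Qed.

Definition dotp q (a b : 'cV[R]_q) : R := \sum_i a i 0 * b i 0.

Lemma dotpE q (a b : 'cV[R]_q) : dotp a b = (b^T *m a) 0 0.
Proof. by rewrite mxE; apply: eq_bigr => i _; rewrite mxE mulrC. Qed.

Lemma dotp_intble q (a b : Omega -> 'cV[R]_q) : (forall i, L2 (fun w => a w i 0)) ->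
  (forall i, L2 (fun w => b w i 0)) -> intble P (fun w => dotp (a w) (b w)).
Proof. by move=> ha hb; apply: intble_sum => i; exact: L2M. Qed.

End square_integrable.

Lemma mulmx_lrsubmx {R : realType} p q r (J : 'M[R]_(p, q + r)) (x : 'cV[R]_q) (y : 'cV[R]_r) :
  J *m col_mx x y = lsubmx J *m x + rsubmx J *m y.
Proof. by rewrite -{1}(hsubmxK J) mul_row_col. Qed.

(** The telescoping behind summation by parts in time. *)
Lemma sum_of_steps {R : realType} (a f h : nat -> R) N : a 0%N = 0 ->
  (forall k, (k < N)%N -> a k.+1 + f k = a k + h k) ->
  a N + \sum_(k < N) f k = \sum_(k < N) h k.
Proof.
move=> a0; elim: N => [_|N ih step]; first by rewrite !big_ord0 addr0.
rewrite !big_ord_recr/= addrCA step// -ih; last by move=> k kN; apply: step; exact: ltnW.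
by ring.
Qed.

Section duality.
Context {R : realType} {Omega : pointedType} {n m d N : nat} {Theta : Type}.
Context {F : Theta -> probability (borel 'cV[R]_d) R} {W : nat -> Omega -> 'cV[R]_d}.
Hypothesis A3 : forall Q : probability (borel 'M[R]_(d, N)) R, calA F Q ->
  exists P : probability (Fspace W N) R,
    forall B : set (borel 'M[R]_(d, N)), measurable B ->
      Q B = P (Wmat W N @^-1` B).
Hypothesis hTheta : inhabited Theta.
Hypothesis hW : forall k, (0 < k <= N)%N -> mxLc F W N 2 k (W k).
Hypothesis hN : (0 < N)%N.
Context (U : nat -> set 'cV[R]_m).
Context (c : coefficients R Omega n m d) (D : derivatives R Omega n m d).
Hypothesis h1 : H1 F W N U c.
Context (C : R).
Hypothesis C0 : 0 < C.
Hypothesis nb : forall k, (k < N)%N -> nice (zdom U k) (zb c k) (zDb D k) (fun=> C).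
Hypothesis ns : forall k l, (k < N)%N -> nice (zdom U k) (zs c l k) (zDs D l k) (fun=> C).
Hypothesis nf : forall k, (k < N)%N ->
  nice (zdom U k) (zf c k) (zDf D k) (affine_bound C).
Hypothesis nphi : nice setT (zphi c) (phi_x D) (affine_bound C).
Context (x0 : 'cV[R]_n) (u : nat -> Omega -> 'cV[R]_m).
Hypothesis adm_u : admissible F W N U u.

Notation PP := (@calP _ _ _ F _ W N).
Notation DD := (@DD _ _ _ F _ W N).
Notation X := (state W c x0 u).
Notation z := (zst (W := W) c x0 u).
Context (P : probability (Fspace W N) R) (PPP : PP P).
Notation L2 := (L2 P).
Implicit Types (p : nat -> Omega -> 'cV[R]_n) (q : nat -> Omega -> 'M[R]_(n, d)).

Lemma DD_L2 k (Y : Omega -> R) : DD k Y -> L2 Y.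
Proof. by move=> DY; split; [exact: DD_mF DY|exact: DD_intble2 DY PPP]. Qed.

Lemma zst_dsubmx k w : dsubmx (z k w) = u k w. Proof. exact: col_mxKd. Qed.
Lemma zst_usubmx k w : usubmx (z k w) = X k w. Proof. exact: col_mxKu. Qed.

Lemma zDbE k w : zDb D k (z k w) w = Db D k (X k w) (u k w) w.
Proof. by rewrite /zDb zst_usubmx zst_dsubmx. Qed.

Lemma zDsE l k w : zDs D l k (z k w) w = Dsigma D l k (X k w) (u k w) w.
Proof. by rewrite /zDs zst_usubmx zst_dsubmx. Qed.

Lemma zDfE k w : zDf D k (z k w) w = Df D k (X k w) (u k w) w.
Proof. by rewrite /zDf zst_usubmx zst_dsubmx. Qed.

(** Entries of the x-block are derivatives along basis vectors of the state space. These directions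
    are always admissible because U_k constrains only the control. *)
Lemma jac_x_QC r (G : 'cV[R]_(n + m) -> Omega -> 'cV[R]_r)
    (J : 'cV[R]_(n + m) -> Omega -> 'M[R]_(r, n + m)) g k i (j : 'I_n) : (k < N)%N ->
  nice (zdom U k) G J g ->
  (forall y, zdom U k y -> forall i, QC PP k (fun w => G y w i 0)) ->
  QC PP k (fun w => lsubmx (J (z k w) w) i j).
Proof.
move=> kN hG qG; have kN' := ltnW kN.
have -> : (fun w => lsubmx (J (z k w) w) i j) =
    fun w => (J (z k w) w *m (delta_mx (lshift m j) 0 : 'cV[R]_(n + m))) i 0.
  by apply/funext => w; rewrite -colE !mxE.
apply: (nice_direction_QC hG kN' qG) => [w|a|w|a].
- exact: zst_dom adm_u kN.
- by case: (zst_DD A3 hTheta hW h1 nb ns x0 adm_u kN a).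
- rewrite /zdom/= linearD/=.
  have -> : dsubmx (delta_mx (lshift m j) 0) = 0 :> 'cV[R]_m.
    by apply/matrixP => a b; rewrite !mxE eq_rlshift.
  by rewrite addr0 zst_dsubmx; exact: (adm_u kN).1.
- exact: QC_cst.
Qed.

Let driver p q k w : 'cV[R]_n :=
  (b_x D k (X k w) (u k w) w)^T *m p k w +
  \sum_l (sigma_x D l k (X k w) (u k w) w)^T *m col l (q k w) +
  (f_x D k (X k w) (u k w) w)^T.

(* the right-hand side of the adjoint equation at time k - 1 *)
Definition adjoint_rhs p (q : nat -> Omega -> 'M[R]_(n, d)) k w :=
  if k == N then (phi_x D (X N w) w)^T else driver p q k w.

Definition adjoint_at (p : nat -> Omega -> 'cV[R]_n) q k :=
  mxcond_exp P k (adjoint_rhs p q k.+1) (p k) /\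
  mxcond_exp P k (fun w => adjoint_rhs p q k.+1 w *m (W k.+1 w)^T) (q k).

(** Treats the terminal condition as the step k = N - 1, so that all later arguments follow one
    recursion. *)
Lemma adjointP p q : adjoint_solution c D x0 u P p q <->
  forall k, (k < N)%N -> adjoint_at p q k.
Proof.
split=> [[hp hq hk] k kN|h].
  have [kN1|kN1] := eqVneq k.+1 N.
    have -> : k = N.-1 by rewrite -kN1.
    by rewrite /adjoint_at /adjoint_rhs prednK// eqxx.
  have kN2 : (k.+1 < N)%N by rewrite ltn_neqAle kN1.
  have [a b] := hk k kN2.
  by rewrite /adjoint_at /adjoint_rhs (negbTE kN1).
have [] := h N.-1 _; first by rewrite prednK.
rewrite /adjoint_rhs prednK// eqxx => hp hq; split=> // k kN.
have [] := h k (ltnW kN).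
by rewrite /adjoint_rhs ltn_eqF.
Qed.

Lemma terminal_L2 i : L2 (fun w => (phi_x D (X N w) w)^T i 0).
Proof.
have DX := state_DD A3 hTheta hW h1 nb ns x0 adm_u (leqnn N).
have [mphi _] : QC PP N (fun w => (phi_x D (X N w) w)^T i 0).
  have -> : (fun w => (phi_x D (X N w) w)^T i 0) =
      fun w => (phi_x D (X N w) w *m (delta_mx i 0 : 'cV[R]_n)) 0 0.
    by apply/funext => w; rewrite -colE !mxE.
  apply: (nice_direction_QC nphi (leqnn N)) => // [y _ a|a|a].
  - by case: (zphi_QC h1 y a).
  - by case: (DX a).
  - exact: QC_cst.
apply: (L2_le mphi (Y := fun w => C * (1 + n1 (X N w)))).
  move=> w; rewrite mxE [leRHS]ger0_norm; last first.
    by rewrite mulr_ge0 ?(ltW C0)// addr_ge0// n1_ge0.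
  by rewrite (le_trans (le_entry_n1 _ _ _))//; exact: (nice_bound nphi).
apply: (@DD_L2 N); apply: DDZ => //; apply: DDD => //; first exact: DD_cst.
exact: DD_n1.
Qed.

Lemma zb_QC k : (k < N)%N -> forall y, zdom U k y -> forall i, QC PP k (fun w => zb c k y w i 0).
Proof. by move=> kN y Uy i; case: (zb_DD h1 kN Uy i). Qed.

Lemma zs_QC k l : (k < N)%N -> forall y, zdom U k y -> forall i, QC PP k (fun w => zs c l k y w i 0).
Proof. by move=> kN y Uy i; case: (zs_DD h1 l kN Uy i). Qed.

Lemma zf_QC1 k : (k < N)%N -> forall y, zdom U k y -> forall i, QC PP k (fun w => zf c k y w i 0).
Proof. by move=> kN y Uy i; case: (zf_QC h1 kN Uy i). Qed.

Lemma driver_L2 p q k i : (k < N)%N -> (forall i, L2 (fun w => p k w i 0)) ->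
  (forall i l, L2 (fun w => q k w i l)) -> L2 (fun w => driver p q k w i 0).
Proof.
move=> kN hp hq; have zd w := zst_dom c x0 w adm_u kN.
have bnd r (G : 'cV[R]_(n + m) -> Omega -> 'cV[R]_r) (J : 'cV[R]_(n + m) -> Omega -> 'M[R]_(r, n + m)) a b w :
    nice (zdom U k) G J (fun=> C) -> `|lsubmx (J (z k w) w) a b| <= C.
  move=> hG; rewrite mxE (le_trans (le_entry_n1 _ _ _))//.
  exact: (nice_bound hG).
rewrite /driver; under eq_fun do rewrite !mxE summxE.
apply: L2D; first apply: L2D.
- apply: L2_sum => j; under eq_fun do rewrite mxE /b_x -zDbE.
  apply: (L2M_bounded (M := C)) => // [|w]; last exact: bnd (nb kN).
  by case: (jac_x_QC j i kN (nb kN) (zb_QC kN)).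
- apply: L2_sum => l; under eq_fun do rewrite mxE.
  apply: L2_sum => j; under eq_fun do rewrite mxE /sigma_x -zDsE.
  apply: (L2M_bounded (M := C)) => [|w|]; last by under eq_fun do rewrite mxE; exact: hq.
    by case: (jac_x_QC j i kN (ns l kN) (zs_QC l kN)).
  exact: bnd (ns l kN).
have -> : (fun w => Df D k (X k w) (u k w) w 0 (lshift m i)) =
    fun w => lsubmx (zDf D k (z k w) w) 0 i.
  by apply/funext => w; rewrite zDfE mxE.
have [mf _] := jac_x_QC 0 i kN (nf kN) (zf_QC1 kN).
apply: (L2_le mf (Y := fun w => C * (1 + n1 (z k w)))).
  move=> w; rewrite mxE [leRHS]ger0_norm; last first.
    by rewrite mulr_ge0 ?(ltW C0)// addr_ge0// n1_ge0.
  by rewrite (le_trans (le_entry_n1 _ _ _))//; exact: (nice_bound (nf kN)).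
have kN' := ltnW kN.
apply: (@DD_L2 k); apply: DDZ => //; apply: DDD => //; first exact: DD_cst.
exact: DD_n1 kN' (zst_DD A3 hTheta hW h1 nb ns x0 adm_u kN).
Qed.

(** For q the conditioned variable is a product with W_{k+1} and may fail to be square integrable;
    [W_cond_sqr] supplies the conditional bound that [cond_exp_sqr] asks for. *)
Lemma adjoint_at_L2 p q k : (k < N)%N -> adjoint_at p q k ->
  (forall i, L2 (fun w => adjoint_rhs p q k.+1 w i 0)) ->
  (forall i, L2 (fun w => p k w i 0)) /\ (forall i l, L2 (fun w => q k w i l)).
Proof.
move=> kN [hp hq] hL; have kN' := ltnW kN; split=> [i|i l].
  exact: L2_cond_exp kN' (hL i) (hp i 0).
have [mY iY] := hL i; have hqil := hq i l; have [_ mq _ _] := hqil.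
split; first exact: mF_le kN' mq.
have [A A0 hA] := W_cond_sqr A3 hTheta hW l kN.
apply: (@cond_exp_sqr _ _ _ _ _ P A k (fun w => adjoint_rhs p q k.+1 w i 0)
  (fun w => W k.+1 w l 0)) => //.
- have <- : (fun w => (adjoint_rhs p q k.+1 w *m (W k.+1 w)^T) i l) =
    (fun w => adjoint_rhs p q k.+1 w i 0 * W k.+1 w l 0).
    by apply/funext => w; rewrite mxE big_ord1 mxE.
  exact: hqil.
- exact: mF_Wentry.
- move=> r M mr rM; have mrN := mF_le kN' mr.
  have mr2 : mF W k (fun w => r w ^+ 2) by exact: measurable_funX.
  have ir : intble P (fun w => r w ^+ 2).
    apply: (@bounded_integrable _ _ _ P _ (M ^+ 2)); first exact: measurable_funX.
    by move=> w; rewrite normrX lerXn2r ?nnegrE// (le_trans _ (rM w)).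
  have -> : (fun w => (W k.+1 w l 0 * r w) ^+ 2) = fun w => r w ^+ 2 * W k.+1 w l 0 ^+ 2.
    by apply/funext => w; rewrite exprMn mulrC.
  apply: hA => //.
  - exact: mF_le kN' mr2.
  - exact: mF_aeF.
  - by move=> w; exact: sqr_ge0.
Qed.

(** Runs backward from N down to k0. It allows solutions defined only from k0 on, as they occur
    during the construction of the adjoint processes. *)
Lemma adjoint_L2 p q k0 : (forall k, (k0 <= k < N)%N -> adjoint_at p q k) -> (k0 <= N)%N ->
  forall j, (j <= N - k0)%N -> forall i, L2 (fun w => adjoint_rhs p q (N - j)%N w i 0).
Proof.
move=> h k0N; elim=> [_ i|j ih jN i].
  by rewrite subn0 /adjoint_rhs eqxx; exact: terminal_L2.
have jN' : (j < N)%N by rewrite (leq_trans jN)// leq_subr.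
set k := (N - j.+1)%N; have kE : k.+1 = (N - j)%N by rewrite /k subnSK.
have kN : (k < N)%N by rewrite kE leq_subr.
have k0k : (k0 <= k)%N by rewrite /k leq_subRL// addnC -leq_subRL.
have hk : adjoint_at p q k by apply: h; rewrite k0k.
have [] := adjoint_at_L2 kN hk; first by rewrite kE; apply: ih; exact: ltnW.
by rewrite /adjoint_rhs ltn_eqF//; exact: driver_L2.
Qed.

Lemma adjoint_pq_L2 p q : (forall k, (k < N)%N -> adjoint_at p q k) -> forall k, (k < N)%N ->
  [/\ forall i, L2 (fun w => adjoint_rhs p q k.+1 w i 0),
      forall i, L2 (fun w => p k w i 0) & forall i l, L2 (fun w => q k w i l)].
Proof.
move=> h k kN; have hL i : L2 (fun w => adjoint_rhs p q k.+1 w i 0).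
  have := @adjoint_L2 p q 0 (fun j => h j) (leq0n _) (N - k.+1) _ i.
  by rewrite subn0 leq_subr subKn//; apply.
by have [] := adjoint_at_L2 kN (h k kN) hL; split.
Qed.

Lemma ex_mxcond_exp k a b (Y : Omega -> 'M[R]_(a, b)) : (k <= N)%N ->
  (forall i j, intble P (fun w => Y w i j)) -> exists E, mxcond_exp P k Y E.
Proof.
move=> kN iY.
have /choice[E hE] : forall ij : 'I_a * 'I_b, exists E, cond_exp P k (fun w => Y w ij.1 ij.2) E.
  by move=> ij; exact: ex_cond_exp.
exists (fun w => \matrix_(i, j) E (i, j) w) => i j.
have -> : (fun w => (\matrix_(i, j) E (i, j) w) i j) = E (i, j).
  by apply/funext => w; rewrite mxE.
exact: (hE (i, j)).
Qed.

Lemma ex_adjoint : exists p q, adjoint_solution c D x0 u P p q.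
Proof.
suff h : forall j, (j <= N)%N -> exists p q, forall k, (N - j <= k < N)%N -> adjoint_at p q k.
  have [p [q hpq]] := h N (leqnn N); exists p, q; apply/adjointP => k kN.
  by apply: hpq; rewrite subnn.
elim=> [_|j ih jN].
  by exists (fun _ _ => 0), (fun _ _ => 0) => k; rewrite subn0 => /andP[/leq_ltn_trans h /h]; rewrite ltnn.
have [p [q hpq]] := ih (ltnW jN).
set k := (N - j.+1)%N; have kE : k.+1 = (N - j)%N by rewrite /k subnSK.
have kN : (k < N)%N by rewrite kE leq_subr.
have kN' := ltnW kN.
have hL i : L2 (fun w => adjoint_rhs p q k.+1 w i 0).
  rewrite kE; apply: (adjoint_L2 (k0 := (N - j)%N)) => //; first exact: leq_subr.
  by rewrite subKn// ltnW.
have [p0 hp0] := ex_mxcond_exp (Y := adjoint_rhs p q k.+1) kN' (fun i j =>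
  eq_ind_r (fun j => intble P (fun w => adjoint_rhs p q k.+1 w i j)) (L2_intble (hL i)) (ord1 j)).
have [|q0 hq0] := ex_mxcond_exp (Y := fun w => adjoint_rhs p q k.+1 w *m (W k.+1 w)^T) kN'.
  move=> i l; have DW : L2 (fun w => W k.+1 w l 0) by exact: DD_L2 (DD_W hW l kN).
  by apply: intble_eq (L2M (hL i) DW) => w; rewrite mxE big_ord1 mxE.
(* Only the values at k change; the right-hand sides of the equations at k and later use values
   after k, so they are unaffected. *)
pose p' (k' : nat) := if k' == k then p0 else p k'.
pose q' (k' : nat) := if k' == k then q0 else q k'.
have rhsE k' w : (k <= k')%N -> adjoint_rhs p' q' k'.+1 w = adjoint_rhs p q k'.+1 w.
  move=> kk'; have e : (k'.+1 == k) = false by rewrite gtn_eqF.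
  by rewrite /adjoint_rhs /driver /p' /q' !e.
exists p', q' => k' /andP[kk' k'N].
rewrite /adjoint_at /p' /q'; move: kk'; rewrite leq_eqVlt => /orP[/eqP <-|kk'].
  have e : adjoint_rhs p' q' k.+1 = adjoint_rhs p q k.+1.
    by apply/funext => w; exact: rhsE.
  by rewrite -/p' -/q' e eqxx.
have e : adjoint_rhs p' q' k'.+1 = adjoint_rhs p q k'.+1.
  by apply/funext => w; apply: rhsE; exact: ltnW.
rewrite -/p' -/q' e gtn_eqF//; apply: hpq.
by rewrite k'N andbT -kE.
Qed.

(** Splits the Jacobians into blocks: the x-blocks reproduce the driver of the adjoint equation and
    the u-blocks give H_u. *)
Lemma hamiltonian_identity p q k w (x : 'cV[R]_n) (y : 'cV[R]_m) :
  dotp (zDb D k (z k w) w *m col_mx x y) (p k w) +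
  \sum_l dotp (zDs D l k (z k w) w *m col_mx x y) (col l (q k w)) +
  (zDf D k (z k w) w *m col_mx x y) 0 0 =
  dotp x (driver p q k w) + (H_u D k (X k w) (u k w) (p k w) (q k w) w *m y) 0 0.
Proof.
have hsum : \sum_l dotp (zDs D l k (z k w) w *m col_mx x y) (col l (q k w)) =
    (\sum_l (col l (q k w))^T *m (zDs D l k (z k w) w *m col_mx x y)) 0 0.
  by rewrite summxE; apply: eq_bigr => l _; rewrite dotpE.
rewrite hsum !dotpE -[LHS]/(_ + _ + _).
have mxD (a b : 'M[R]_1) : a 0 0 + b 0 0 = (a + b) 0 0 by rewrite mxE.
rewrite !mxD; congr (fun_of_matrix _ 0 0).
rewrite zDbE zDfE !mulmx_lrsubmx /H_u -/(b_x D k _ _ _) -/(b_u D k _ _ _).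
rewrite -/(f_x D k _ _ _) -/(f_u D k _ _ _).
have -> : (driver p q k w)^T = (p k w)^T *m b_x D k (X k w) (u k w) w +
    (\sum_l (col l (q k w))^T *m sigma_x D l k (X k w) (u k w) w) +
    f_x D k (X k w) (u k w) w.
  rewrite /driver !linearD/= linear_sum/= trmx_mul !trmxK; congr (_ + _ + _).
  by apply: eq_bigr => l _; rewrite trmx_mul trmxK.
rewrite mulmxDr !mulmxDl !mulmxA.
have -> : \sum_l (col l (q k w))^T *m (zDs D l k (z k w) w *m col_mx x y) =
  (\sum_l (col l (q k w))^T *m sigma_x D l k (X k w) (u k w) w) *m x +
  (\sum_l (col l (q k w))^T *m sigma_u D l k (X k w) (u k w) w) *m y.
  rewrite !mulmx_suml -big_split/=; apply: eq_bigr => l _.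
  by rewrite zDsE mulmx_lrsubmx mulmxDr !mulmxA.
set b1 := _ *m _ *m x; set b2 := _ *m _ *m y; set s1 := _ *m x; set s2 := _ *m y.
set f1 := f_x _ _ _ _ _ *m x; set f2 := f_u _ _ _ _ _ *m y.
by rewrite (addrACA b1) (addrACA (b1 + s1)).
Qed.

Section direction.
Context (xi : nat -> Omega -> 'cV[R]_m).
Hypothesis adm : forall e : R, 0 <= e <= 1 -> admissible F W N U (perturbed u xi e).
Hypothesis xiD : forall k, (k < N)%N -> forall i, DD k (fun w => xi k w i 0).
Notation Xh := (state_variation (W := W) c D x0 u xi).

Let v k w := col_mx (Xh k w) (xi k w).

Let Xh_DD k : (k <= N)%N -> forall i, DD k (fun w => Xh k w i 0).
Proof. exact: (variation_DD A3 hTheta hW h1 C0 nb ns x0 adm xiD). Qed.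

Let v_DD k : (k < N)%N -> forall i, DD k (fun w => v k w i 0).
Proof. by move=> kN; apply: col_mx_DD; [apply: Xh_DD; exact: ltnW|exact: xiD]. Qed.

Lemma jac_direction_QC r (G : 'cV[R]_(n + m) -> Omega -> 'cV[R]_r)
    (J : 'cV[R]_(n + m) -> Omega -> 'M[R]_(r, n + m)) g k i : (k < N)%N ->
  nice (zdom U k) G J g ->
  (forall y, zdom U k y -> forall i, QC PP k (fun w => G y w i 0)) ->
  QC PP k (fun w => (J (z k w) w *m v k w) i 0).
Proof.
move=> kN hG qG; apply: (nice_direction_QC hG (ltnW kN) qG) => [w|a|w|a].
- exact: zst_dom adm_u kN.
- by case: (zst_DD A3 hTheta hW h1 nb ns x0 adm_u kN a).
- exact: (variation_dom c D x0 adm).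
- by case: (v_DD kN a).
Qed.

Lemma jac_direction_DD r (G : 'cV[R]_(n + m) -> Omega -> 'cV[R]_r)
    (J : 'cV[R]_(n + m) -> Omega -> 'M[R]_(r, n + m)) k i : (k < N)%N ->
  nice (zdom U k) G J (fun=> C) ->
  (forall y, zdom U k y -> forall i, QC PP k (fun w => G y w i 0)) ->
  DD k (fun w => (J (z k w) w *m v k w) i 0).
Proof.
move=> kN hG qG; have qJ := jac_direction_QC i kN hG qG; split=> //.
have [mJ _] := qJ; have [_ uv] := DDZ C (ltnW kN) (DD_n1 (ltnW kN) (v_DD kN)).
apply: UI2_le mJ _ uv => w; rewrite [leRHS]ger0_norm; last first.
  by rewrite mulr_ge0 ?(ltW C0)// n1_ge0.
rewrite (le_trans (le_entry_n1 _ _ _))// (le_trans (n1_mulmx _ _))//.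
rewrite ler_wpM2r ?n1_ge0//; apply: (nice_bound hG).
exact: zst_dom adm_u kN.
Qed.

Lemma cost_direction_intble k : (k < N)%N ->
  intble P (fun w => (zDf D k (z k w) w *m v k w) 0 0).
Proof.
move=> kN; have kN' := ltnW kN.
have [mJ _] := jac_direction_QC 0 kN (nf kN) (zf_QC1 kN).
have L2z : L2 (fun w => C * (1 + n1 (z k w))).
  apply: (@DD_L2 k); apply: DDZ => //; apply: DDD => //; first exact: DD_cst.
  exact: DD_n1 kN' (zst_DD A3 hTheta hW h1 nb ns x0 adm_u kN).
have L2v : L2 (fun w => n1 (v k w)) by apply: (@DD_L2 k); exact: DD_n1 kN' (v_DD kN).
apply: intble_le mJ (L2M L2z L2v) _ => w.
rewrite [leRHS]ger0_norm; last first.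
  by rewrite mulr_ge0 ?n1_ge0// mulr_ge0 ?(ltW C0)// addr_ge0// n1_ge0.
rewrite (le_trans (le_entry_n1 _ _ _))// (le_trans (n1_mulmx _ _))//.
rewrite ler_wpM2r ?n1_ge0//; apply: (nice_bound (nf kN)).
exact: zst_dom adm_u kN.
Qed.

Section adjoint_along.
Variables (p : nat -> Omega -> 'cV[R]_n) (q : nat -> Omega -> 'M[R]_(n, d)).
Hypothesis adj : forall k, (k < N)%N -> adjoint_at p q k.

Notation rhs := (adjoint_rhs p q).
Notation A k w := (zDb D k (z k w) w *m v k w).
Notation B l k w := (zDs D l k (z k w) w *m v k w).

Let A_DD k i : (k < N)%N -> DD k (fun w => A k w i 0).
Proof. by move=> kN; exact: jac_direction_DD kN (nb kN) (zb_QC kN). Qed.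

Let B_DD k l i : (k < N)%N -> DD k (fun w => B l k w i 0).
Proof. by move=> kN; exact: jac_direction_DD kN (ns l kN) (zs_QC l kN). Qed.

Let col_L2 k l i : (k < N)%N -> L2 (fun w => col l (q k w) i 0).
Proof.
move=> kN; have [_ _ hq] := adjoint_pq_L2 adj kN.
by under eq_fun do rewrite mxE; exact: hq.
Qed.

(** The linearized state at k + 1 is A plus the sum of W^l B_l with factors of level k. These
    factors are pulled out of the conditional expectations that define p and q. *)
Lemma adjoint_step k : (k < N)%N ->
  \int[P]_w dotp (Xh k.+1 w) (rhs k.+1 w) =
  \int[P]_w (dotp (A k w) (p k w) + \sum_l dotp (B l k w) (col l (q k w))).
Proof.
move=> kN; have kN' := ltnW kN; have [hL hp hq] := adjoint_pq_L2 adj kN.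
have [cp cq] := adj kN.
have LA i : L2 (fun w => A k w i 0) := DD_L2 (A_DD i kN).
have LB l i : L2 (fun w => B l k w i 0) := DD_L2 (B_DD l i kN).
have LBW l i : L2 (fun w => B l k w i 0 * W k.+1 w l 0).
  by apply: (@DD_L2 k.+1); apply: (DDM_W A3 hTheta hW) => //; exact: B_DD.
have iBW i l : intble P (fun w => B l k w i 0 * (rhs k.+1 w i 0 * W k.+1 w l 0)).
  by apply: intble_eq (L2M (LBW l i) (hL i)) => w; rewrite mulrAC -mulrA.
have iAr i : intble P (fun w => A k w i 0 * rhs k.+1 w i 0) by exact: L2M.
have iAp i : intble P (fun w => A k w i 0 * p k w i 0) by exact: L2M.
have iBq i l : intble P (fun w => B l k w i 0 * q k w i l) by exact: L2M.
have eA i : \int[P]_w (A k w i 0 * rhs k.+1 w i 0) = \int[P]_w (A k w i 0 * p k w i 0).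
  have [qA _] := A_DD i kN; have [mA _] := qA.
  apply: (pull_out kN' (cp i 0)) => //; exact: QC_aeF qA.
have eB i l : \int[P]_w (B l k w i 0 * (rhs k.+1 w i 0 * W k.+1 w l 0)) =
    \int[P]_w (B l k w i 0 * q k w i l).
  have [qB _] := B_DD l i kN; have [mB _] := qB.
  have cqil := cq i l.
  have E : (fun w => (rhs k.+1 w *m (W k.+1 w)^T) i l) =
      (fun w => rhs k.+1 w i 0 * W k.+1 w l 0).
    by apply/funext => w; rewrite mxE big_ord1 mxE.
  rewrite E in cqil.
  apply: (pull_out kN' cqil) => //; exact: QC_aeF qB.
have -> : \int[P]_w dotp (Xh k.+1 w) (rhs k.+1 w) =
    \int[P]_w (\sum_i (A k w i 0 * rhs k.+1 w i 0 +
      \sum_l B l k w i 0 * (rhs k.+1 w i 0 * W k.+1 w l 0))).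
  apply: eq_Rintegral => w _; apply: eq_bigr => i _.
  have -> : Xh k.+1 w i 0 = A k w i 0 + \sum_l W k.+1 w l 0 * B l k w i 0.
    rewrite [Xh _ _]/= [LHS]mxE summxE; congr (_ + _); apply: eq_bigr => l _.
    by rewrite [LHS]mxE.
  rewrite mulrDl mulr_suml; congr (_ + _); apply: eq_bigr => l _; ring.
have -> : \int[P]_w (dotp (A k w) (p k w) + \sum_l dotp (B l k w) (col l (q k w))) =
    \int[P]_w (\sum_i (A k w i 0 * p k w i 0 + \sum_l B l k w i 0 * q k w i l)).
  apply: eq_Rintegral => w _; rewrite big_split/=; congr (_ + _).
  rewrite exchange_big/=; apply: eq_bigr => l _; apply: eq_bigr => i _.
  by rewrite [col _ _ _ _]mxE.
rewrite !Rint_sum; last 2 first.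
- by move=> i; apply: intbleD => //; apply: intble_sum.
- by move=> i; apply: intbleD => //; apply: intble_sum.
apply: eq_bigr => i _; rewrite !RintegralD ?Rint_sum//; last 2 first.
- exact: intble_sum.
- exact: intble_sum.
by rewrite eA; congr (_ + _); apply: eq_bigr => l _.
Qed.

(** Read off from [hamiltonian_identity], all of whose other terms are integrable; the u-block is
    never estimated alone. *)
Lemma hamiltonian_intble k : (k < N)%N ->
  intble P (fun w => (H_u D k (X k w) (u k w) (p k w) (q k w) w *m xi k w) 0 0).
Proof.
move=> kN; have [hL hp hq] := adjoint_pq_L2 adj kN.
have LX i : L2 (fun w => Xh k w i 0) by apply: DD_L2; exact: Xh_DD (ltnW kN) i.
apply: (@intble_eq _ _ _ P (fun w => (dotp (A k w) (p k w) +
   \sum_l dotp (B l k w) (col l (q k w)) + (zDf D k (z k w) w *m v k w) 0 0) -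
   dotp (Xh k w) (driver p q k w))).
  by move=> w; rewrite hamiltonian_identity addrAC subrr add0r.
apply: intbleB; last by apply: dotp_intble => // i; exact: driver_L2.
apply: intbleD; last exact: cost_direction_intble.
apply: intbleD; first by apply: dotp_intble => // i; exact: DD_L2 (A_DD i kN).
apply: intble_sum => l; apply: dotp_intble => i; last exact: col_L2.
exact: DD_L2 (B_DD l i kN).
Qed.

(** Duality: the pairing of the linearized state with the adjoint right-hand side vanishes at time
    0, equals the terminal cost term at N, and its increments exchange running cost for H_u. *)
Lemma cost_variation_hamiltonian : \int[P]_w cost_variation (W := W) (N := N) c D x0 u xi w =
  \sum_(k < N) \int[P]_w (H_u D k (X k w) (u k w) (p k w) (q k w) w *m xi k w) 0 0.
Proof.
have step k : (k < N)%N -> \int[P]_w dotp (Xh k.+1 w) (rhs k.+1 w) +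
    \int[P]_w (zDf D k (z k w) w *m v k w) 0 0 =
    \int[P]_w dotp (Xh k w) (rhs k w) +
    \int[P]_w (H_u D k (X k w) (u k w) (p k w) (q k w) w *m xi k w) 0 0.
  move=> kN; have [hL hp hq] := adjoint_pq_L2 adj kN.
  have LX i : L2 (fun w => Xh k w i 0) by apply: DD_L2; exact: Xh_DD (ltnW kN) i.
  rewrite adjoint_step// -RintegralD//; last 2 first.
  - apply: intbleD; first by apply: dotp_intble => // i; exact: DD_L2 (A_DD i kN).
    apply: intble_sum => l; apply: dotp_intble => i; last exact: col_L2.
    exact: DD_L2 (B_DD l i kN).
  - exact: cost_direction_intble.
  rewrite -RintegralD//; last 2 first.
  - apply: dotp_intble => // i; rewrite /adjoint_rhs ltn_eqF//; exact: driver_L2.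
  - exact: hamiltonian_intble.
  apply: eq_Rintegral => w _.
  by rewrite hamiltonian_identity /adjoint_rhs ltn_eqF.
have tele : \int[P]_w dotp (Xh N w) (rhs N w) +
    \sum_(k < N) \int[P]_w (zDf D k (z k w) w *m v k w) 0 0 =
    \sum_(k < N) \int[P]_w (H_u D k (X k w) (u k w) (p k w) (q k w) w *m xi k w) 0 0.
  apply: (sum_of_steps (a := fun k => \int[P]_w dotp (Xh k w) (rhs k w))
    (f := fun k => \int[P]_w (zDf D k (z k w) w *m v k w) 0 0)
    (h := fun k => \int[P]_w (H_u D k (X k w) (u k w) (p k w) (q k w) w *m xi k w) 0 0)) => //.
  have -> : \int[P]_w dotp (Xh 0 w) (rhs 0 w) = \int[P]_w 0.
    by apply: eq_Rintegral => w _; rewrite /dotp big1// => i _; rewrite mxE mul0r.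
  exact: Rint_cst.
have LX i : L2 (fun w => Xh N w i 0) by apply: (@DD_L2 N); exact: Xh_DD.
have LT i : L2 (fun w => rhs N w i 0) by rewrite /adjoint_rhs eqxx; exact: terminal_L2.
rewrite -tele /cost_variation RintegralD//; last 2 first.
- by apply: intble_sum => k; exact: cost_direction_intble.
- apply: intble_eq (dotp_intble LX LT) => w.
  rewrite /adjoint_rhs eqxx mxE; apply: eq_bigr => i _; by rewrite mxE mulrC.
rewrite Rint_sum; last by move=> k; exact: cost_direction_intble.
rewrite addrC; congr (_ + _); apply: eq_Rintegral => w _.
rewrite /adjoint_rhs eqxx mxE; apply: eq_bigr => i _; by rewrite mxE mulrC.
Qed.

End adjoint_along.

End direction.

End duality.

Lemma sum_single {R : realType} (N k : nat) (f : nat -> R) : (k < N)%N ->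
  (forall j, j != k -> f j = 0) -> \sum_(j < N) f j = f k.
Proof.
move=> kN f0; rewrite (bigD1 (Ordinal kN))//= big1 ?addr0// => j jk.
by apply: f0; apply: contra_neq jk => e; exact: val_inj.
Qed.

(** * Localization in time and along the noise *)

Section maximum_principle.
Context {R : realType} {Omega : pointedType} {n m d N : nat} {Theta : Type}.
Context {F : Theta -> probability (borel 'cV[R]_d) R} {W : nat -> Omega -> 'cV[R]_d}.
Hypothesis A3 : forall Q : probability (borel 'M[R]_(d, N)) R, calA F Q ->
  exists P : probability (Fspace W N) R,
    forall B : set (borel 'M[R]_(d, N)), measurable B ->
      Q B = P (Wmat W N @^-1` B).
Hypothesis hTheta : inhabited Theta.
Hypothesis hW : forall k, (0 < k <= N)%N -> mxLc F W N 2 k (W k).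
Hypothesis hN : (0 < N)%N.
Context (U : nat -> set 'cV[R]_m).
Hypothesis U_convex : forall k, (k < N)%N ->
  convex_set (U k : set (convex_lmodType 'cV[R]_m)).
Context (c : coefficients R Omega n m d) (D : derivatives R Omega n m d).
Hypothesis h1 : H1 F W N U c.
Context (C : R).
Hypothesis C0 : 0 < C.
Hypothesis nb : forall k, (k < N)%N -> nice (zdom U k) (zb c k) (zDb D k) (fun=> C).
Hypothesis ns : forall k l, (k < N)%N -> nice (zdom U k) (zs c l k) (zDs D l k) (fun=> C).
Hypothesis nf : forall k, (k < N)%N ->
  nice (zdom U k) (zf c k) (zDf D k) (affine_bound C).
Hypothesis nphi : nice setT (zphi c) (phi_x D) (affine_bound C).
Context (x0 : 'cV[R]_n) (u : nat -> Omega -> 'cV[R]_m).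
Hypothesis opt : optimal F W N U c x0 u.

Notation PP := (@calP _ _ _ F _ W N).
Notation X := (state W c x0 u).
Notation z := (zst (W := W) c x0 u).
Context (P : probability (Fspace W N) R) (PPP : PP P).
Hypothesis stationary : forall xi, direction (W := W) (N := N) U u xi ->
  0 <= \int[P]_w cost_variation (W := W) (N := N) c D x0 u xi w.

Let localized k (h : 'M[R]_(d, k) -> R) (v : 'cV[R]_m) (j : nat) (w : Omega) : 'cV[R]_m :=
  if j == k then h (Wmat W k w) *: (v - u k w) else 0.

Let localized_direction k (h : 'M[R]_(d, k) -> R) v : (k < N)%N -> U k v -> bLip h -> (forall x, 0 <= h x <= 1) ->
  direction (W := W) (N := N) U u (localized h v).
Proof.
move=> kN Uv hL h01 j jN; have [Uu _] := opt.1 j jN.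
rewrite /localized; have [jk|jk] := eqVneq j k.
  subst j; exists (fun x => h x *: v), h; split=> // [i|w].
    by under eq_fun do rewrite mxE mulrC; exact: bLipZ.
  by split; [exact: scalerBr|exact: (U_segment U_convex)].
exists (fun=> 0), (fun=> 0); split=> [i||w]; last by rewrite scale0r subr0 addr0.
  by under eq_fun do rewrite mxE; exact: bLip_cst.
exact: bLip_cst.
Qed.

(** Along the direction (0, v - u_k) the driver drops out of [hamiltonian_identity]. What remains
    consists of directional derivatives, which are quasi-continuous at level k, and of p and q,
    which are F_k-measurable. *)
Lemma hamiltonian_aeF p q k v : (k < N)%N -> U k v ->
  (forall k, (k < N)%N -> adjoint_at c D x0 u P p q k) ->
  aeF P k (fun w => (H_u D k (X k w) (u k w) (p k w) (q k w) w *m (v - u k w)) 0 0).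
Proof.
move=> kN Uv adj; have kN' := ltnW kN; have adm_u := opt.1.
pose V w : 'cV[R]_(n + m) := col_mx 0 (v - u k w).
have qV i : QC PP k (fun w => V w i 0).
  case: (split_ordP i) => j ->.
    by under eq_fun do rewrite col_mxEu mxE; exact: QC_cst.
  under eq_fun do rewrite col_mxEd !mxE; apply: QCB => //; first exact: QC_cst.
  by case: (control_DD adm_u kN j).
have VA w : zdom U k (z k w + V w).
  by rewrite /zdom/= /zst /V add_col_mx col_mxKd addrC subrK.
have qz i : QC PP k (fun w => z k w i 0).
  by case: (zst_DD A3 hTheta hW h1 nb ns x0 adm_u kN i).
have zd w : zdom U k (z k w) by exact: zst_dom adm_u kN.
have [cp cq] := adj k kN.
have mp i : aeF P k (fun w => p k w i 0) by apply: mF_aeF; case: (cp i 0).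
have mq i l : aeF P k (fun w => q k w i l) by apply: mF_aeF; case: (cq i l).
have jac r (G : 'cV[R]_(n + m) -> Omega -> 'cV[R]_r)
    (J : 'cV[R]_(n + m) -> Omega -> 'M[R]_(r, n + m)) g i : nice (zdom U k) G J g ->
    (forall y, zdom U k y -> forall i, QC PP k (fun w => G y w i 0)) ->
    aeF P k (fun w => (J (z k w) w *m V w) i 0).
  move=> hG qG; apply: (QC_aeF kN' PPP).
  exact: (nice_direction_QC hG kN' qG zd qz VA qV).
have -> : (fun w => (H_u D k (X k w) (u k w) (p k w) (q k w) w *m (v - u k w)) 0 0) =
  fun w => dotp (zDb D k (z k w) w *m V w) (p k w) +
    \sum_l dotp (zDs D l k (z k w) w *m V w) (col l (q k w)) +
    (zDf D k (z k w) w *m V w) 0 0.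
  apply/funext => w; rewrite /V hamiltonian_identity /dotp big1 ?add0r// => i _.
  by rewrite mxE mul0r.
apply: aeFD; last exact: jac (nf kN) (zf_QC1 h1 kN).
apply: aeFD.
  by apply: aeF_sum => i; apply: aeFM => //; exact: jac (nb kN) (zb_QC h1 kN).
apply: aeF_sum => l; apply: aeF_sum => i; apply: aeFM.
  exact: jac (ns l kN) (zs_QC h1 l kN).
by under eq_fun do rewrite mxE; exact: mq.
Qed.

(** For a localized direction only the term of time k survives in the duality formula. The test
    function 1 gives integrability, and arbitrary h give the sign. *)
Lemma hamiltonian_ge0 p q k v : (k < N)%N -> U k v ->
  adjoint_solution c D x0 u P p q ->
  {ae P, forall w, 0 <= (H_u D k (X k w) (u k w) (p k w) (q k w) w *m (v - u k w)) 0 0}.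
Proof.
move=> kN Uv /adjointP => /(_ hN) adj; have kN' := ltnW kN.
have key h : bLip h -> (forall x, 0 <= h x <= 1) ->
    let Y w := h (Wmat W k w) *
      (H_u D k (X k w) (u k w) (p k w) (q k w) w *m (v - u k w)) 0 0 in
    intble P Y /\ 0 <= \int[P]_w Y w.
  move=> hL h01 Y; have dh := localized_direction kN Uv hL h01.
  have ad := direction_adm A3 hTheta U_convex opt dh.
  have xD := direction_DD A3 hTheta U_convex opt dh.
  have YE w : (H_u D k (X k w) (u k w) (p k w) (q k w) w *m localized h v k w) 0 0 = Y w.
    by rewrite /localized eqxx -scalemxAr mxE.
  split.
    apply: (@intble_eq _ _ _ P _ _ YE).
    exact: (hamiltonian_intble A3 hTheta hW h1 C0 nb ns nf nphi opt.1 PPP ad xD adj kN).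
  have := stationary dh.
  rewrite (cost_variation_hamiltonian A3 hTheta hW h1 C0 nb ns nf nphi opt.1 PPP ad xD adj).
  rewrite (sum_single (f := fun j => \int[P]_w
    (H_u D j (X j w) (u j w) (p j w) (q j w) w *m localized h v j w) 0 0) kN).
    by under eq_Rintegral do rewrite YE.
  move=> j jk.
  have -> : \int[P]_w (H_u D j (X j w) (u j w) (p j w) (q j w) w *m localized h v j w) 0 0 =
      \int[P]_w 0.
    by apply: eq_Rintegral => w _; rewrite /localized (negbTE jk) mulmx0 mxE.
  exact: Rint_cst.
have iH : intble P (fun w =>
    (H_u D k (X k w) (u k w) (p k w) (q k w) w *m (v - u k w)) 0 0).
  have [|i1 _] := key (fun=> 1) (bLip_cst _ _ _); first by rewrite ler01 lexx.
  by apply: intble_eq i1 => w; rewrite mul1r.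
apply: (ae_ge0 kN' iH) => [|A mA]; first exact: hamiltonian_aeF.
apply: (indic_test_ge0 kN' iH) mA => h hL h01.
by have [] := key h hL h01.
Qed.

End maximum_principle.

Theorem theorem4p6 (R : realType) (Omega : pointedType) (n m d N : nat)
  (hN : (0 < N)%N) (hd : (0 < d)%N)
  (W : nat -> Omega -> 'cV[R]_d)
  (Theta : Type) (hTheta : inhabited Theta)
  (F : Theta -> probability (borel 'cV[R]_d) R)
  (A1 : range (Wmat W N) =
          [set x : 'M[R]_(d, N) | forall j : 'I_N, range (W j.+1) (col j x)] /\
        forall theta (j : 'I_N), F theta (closure (range (W j.+1))) = 1%E)
  (A2 : (ereal_sup [set \int[F theta]_y (enorm y)%:E
                   | theta in [set: Theta]] < +oo)%E)
  (A3 : forall Q : probability (borel 'M[R]_(d, N)) R, calA F Q ->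
        exists P : probability (Fspace W N) R,
          forall B : set (borel 'M[R]_(d, N)), measurable B ->
            Q B = P (Wmat W N @^-1` B))
  (hW : forall k, (0 < k <= N)%N -> mxLc F W N 2 k (W k))
  (U : nat -> set 'cV[R]_m)
  (U_nonempty : forall k, (k < N)%N -> U k !=set0)
  (U_convex : forall k, (k < N)%N ->
     convex_set (U k : set (convex_lmodType 'cV[R]_m)))
  (c : coefficients R Omega n m d) (D : derivatives R Omega n m d)
  (hD : differentiable_coefficients N U c D)
  (h1 : H1 F W N U c) (h2 : H2 N U D) (h3 : H3 N U D)
  (x0 : 'cV[R]_n) (ustar : nat -> Omega -> 'cV[R]_m)
  (hopt : optimal F W N U c x0 ustar) :
  exists2 P : probability (Fspace W N) R, calPstar F c x0 ustar P &
    (exists p q, adjoint_solution c D x0 ustar P p q) /\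
    (forall p q, adjoint_solution c D x0 ustar P p q ->
      forall k, (k < N)%N -> forall u, U k u ->
        {ae P, forall w,
          0 <= (H_u D k (state W c x0 ustar k w) (ustar k w) (p k w) (q k w) w
                  *m (u - ustar k w)) 0 0}).
Proof.
have [C C0 [nb ns nf nphi]] := ex_nice hN hd U_nonempty U_convex hD h2 h3.
have [P Pstar stat] := ex_optimal_measure A3 hTheta hW U_convex h1 C0 nb ns nf nphi hopt.
exists P => //; have [PPP _] := Pstar; split.
  exact: (ex_adjoint A3 hTheta hW hN h1 C0 nb ns nf nphi x0 hopt.1 PPP).
move=> p q adj k kN u Uu.
exact: (hamiltonian_ge0 A3 hTheta hW hN U_convex h1 C0 nb ns nf nphi hopt PPP stat kN Uu adj).
Qed.
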